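(* For $n=7$ and for $n=9$ there are infinitely many pairs of reverse $n$-congruent non-isogenous elliptic curves over $\mathbb{Q}$. That is, for each $n\in\{7,9\}$, the set of pairs $(j(E_1),j(E_2))$, where $(E_1,E_2)$ runs over all pairs of non-isogenous elliptic curves over $\mathbb{Q}$ that are reverse $n$-congruent, is infinite.
   Context: Elliptic curves $E_1,E_2$ over a field $K$ of characteristic $0$ are reverse $n$-congruent if there is an isomorphism of Galois modules $\phi:E_1[n]\cong E_2[n]$ with $e_n(\phi P,\phi Q)=e_n(P,Q)^{-1}$ for all $P,Q\in E_1[n]$, where $e_n$ denotes the Weil pairing. As is understood in the problem (since from one example infinitely many can be obtained by simultaneous quadratic twists), ''infinitely many'' refers to examples with distinct $j$-invariants. *)

(* Defs.v *)
From HB Require Import structures.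
From mathcomp Require Import all_boot all_order all_algebra all_field.
From mathcomp Require Import classical_sets cardinality.
From mathcomp Require Import mpoly.

Set Implicit Arguments.
Unset Strict Implicit.
Unset Printing Implicit Defensive.

Import Order.TTheory GRing.Theory Num.Theory.
Local Open Scope ring_scope.

(* y^2 + a1 x y + a3 y = x^3 + a2 x^2 + a4 x + a6 *)
Record weierstrass (K : Type) := Weierstrass {
  wa1 : K; wa2 : K; wa3 : K; wa4 : K; wa6 : K }.

Definition map_weierstrass (K L : Type) (f : K -> L) (W : weierstrass K) :=
  Weierstrass (f (wa1 W)) (f (wa2 W)) (f (wa3 W)) (f (wa4 W)) (f (wa6 W)).

Section Invariants.
Variables (K : fieldType) (W : weierstrass K).

Definition wb2 : K := wa1 W ^+ 2 + 4%:R * wa2 W.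
Definition wb4 : K := 2%:R * wa4 W + wa1 W * wa3 W.
Definition wb6 : K := wa3 W ^+ 2 + 4%:R * wa6 W.
Definition wb8 : K :=
  wa1 W ^+ 2 * wa6 W + 4%:R * wa2 W * wa6 W - wa1 W * wa3 W * wa4 W
  + wa2 W * wa3 W ^+ 2 - wa4 W ^+ 2.
Definition wc4 : K := wb2 ^+ 2 - 24%:R * wb4.
Definition wdisc : K :=
  - (wb2 ^+ 2 * wb8) - 8%:R * wb4 ^+ 3 - 27%:R * wb6 ^+ 2
  + 9%:R * wb2 * wb4 * wb6.
Definition wj : K := wc4 ^+ 3 / wdisc.

End Invariants.

(* [None] is the point at infinity O; membership in the curve is the
   separate predicate [on_curve], and the group operations below are only
   meaningful on points satisfying it. *)
Notation point K := (option (K * K)%type).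

Section GroupLaw.
Variables (K : fieldType) (W : weierstrass K).

Definition on_curve (P : point K) : bool :=
  if P is Some (x, y) then
    y ^+ 2 + wa1 W * x * y + wa3 W * y
      == x ^+ 3 + wa2 W * x ^+ 2 + wa4 W * x + wa6 W
  else true.

Definition add_pt (P Q : point K) : point K :=
  match P, Q with
  | None, _ => Q
  | _, None => P
  | Some (x1, y1), Some (x2, y2) =>
    if (x1 == x2) && (y1 + y2 + wa1 W * x2 + wa3 W == 0) then None else
    let lam :=
      if x1 == x2 then
        (3%:R * x1 ^+ 2 + 2%:R * wa2 W * x1 + wa4 W - wa1 W * y1)
          / (2%:R * y1 + wa1 W * x1 + wa3 W)
      else (y2 - y1) / (x2 - x1) in
    let x3 := lam ^+ 2 + wa1 W * lam - wa2 W - x1 - x2 in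
    Some (x3, lam * (x1 - x3) - y1 - wa1 W * x3 - wa3 W)
  end.

Definition muln_pt (n : nat) (P : point K) : point K :=
  iter n (add_pt P) None.

Definition torsion (n : nat) : pred (point K) :=
  [pred P | on_curve P && (muln_pt n P == None)].

(* Homogeneous coordinates (X : Y : Z) in the projective plane. *)
Definition coords (P : point K) : 3.-tuple K :=
  if P is Some (x, y) then [tuple x; y; 1] else [tuple 0; 1; 0].

(* The function field of the curve (meaningful for K algebraically closed):
   a rational function is a pair (F, G), read F / G, of forms of the same
   degree with G not identically zero on the curve, modulo [rf_eq]. *)
Notation form := {mpoly K[3]}.
Notation rfun := (form * form)%type.

Definition evalf (F : form) (P : point K) : K := F.@[tnth (coords P)].

Definition is_rfun (f : rfun) : Prop :=
  (exists d : nat, f.1 \is d.-homog /\ f.2 \is d.-homog)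
  /\ (exists P, on_curve P /\ evalf f.2 P != 0).

Definition rf_eq (f g : rfun) : Prop :=
  forall P, on_curve P -> evalf f.1 P * evalf g.2 P = evalf g.1 P * evalf f.2 P.

Definition rf_mul (f g : rfun) : rfun := (f.1 * g.1, f.2 * g.2).

Definition rf_exp (f : rfun) (d : int) : rfun :=
  match d with
  | Posz m => (f.1 ^+ m, f.2 ^+ m)
  | Negz m => (f.2 ^+ m.+1, f.1 ^+ m.+1)
  end.

(* f is regular at P and f(P) = z. *)
Definition rf_value (f : rfun) (P : point K) (z : K) : Prop :=
  exists g, [/\ is_rfun g, rf_eq f g, evalf g.2 P != 0
              & z = evalf g.1 P / evalf g.2 P].

Definition rf_regular (f : rfun) (P : point K) : Prop :=
  exists z, rf_value f P z.

(* t generates the maximal ideal of the local ring at P. *)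
Definition uniformizer (t : rfun) (P : point K) : Prop :=
  [/\ is_rfun t, rf_value t P 0
    & forall f, is_rfun f -> rf_value f P 0 ->
      exists g, [/\ is_rfun g, rf_regular g P & rf_eq f (rf_mul t g)]].

(* ord_P(f) = d *)
Definition rf_ord (f : rfun) (P : point K) (d : int) : Prop :=
  exists t u, [/\ uniformizer t P,
                  is_rfun u, exists2 z, z != 0 & rf_value u P z
                & rf_eq f (rf_mul (rf_exp t d) u)].

(* div(f) = n (A) - n (B) *)
Definition has_div (f : rfun) (n : nat) (A B : point K) : Prop :=
  is_rfun f /\
  forall X, on_curve X ->
    rf_ord f X (n%:Z * ((X == A)%:Z - (X == B)%:Z)).

(* e_n(P, Q) = z, for n-torsion points P and Q.  With
   D_P = (P + S) - (S) and D_Q = (Q + T) - (T) of disjoint supports,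
   div(f) = n D_P and div(g) = n D_Q, the pairing is f(D_Q) / g(D_P);
   by Weil reciprocity this does not depend on the choices.  The opposite
   sign convention for e_n replaces every value by its inverse. *)
Definition weil_pairing (n : nat) (P Q : point K) (z : K) : Prop :=
  exists S T f g,
  [/\ on_curve S, on_curve T,
      [&& add_pt P S != add_pt Q T, add_pt P S != T, S != add_pt Q T & S != T],
      has_div f n (add_pt P S) S /\ has_div g n (add_pt Q T) T
    & exists f1 f2 g1 g2,
      [/\ rf_value f (add_pt Q T) f1, rf_value f T f2,
          rf_value g (add_pt P S) g1, rf_value g S g2
        & z = (f1 / f2) / (g1 / g2)]].

End GroupLaw.

(* Elliptic curves over Q; their geometric points live over algC, which is
   an algebraic closure of Q. *)
Record ellcurve := EllCurve {
  ell_model :> weierstrass rat;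
  ell_nonsing : wdisc ell_model != 0 }.

Definition jinv (E : ellcurve) : rat := wj E.

Definition geom (E : ellcurve) : weierstrass algC :=
  map_weierstrass (ratr : rat -> algC) E.

(* Field endomorphisms of algC fix Q and are bijective, so
   {rmorphism algC -> algC} is the absolute Galois group of Q. *)
Definition galois_pt (s : {rmorphism algC -> algC}) (P : point algC) :
    point algC :=
  if P is Some (x, y) then Some (s x, s y) else None.

Definition galois_module_iso (n : nat) (E1 E2 : ellcurve)
    (phi : point algC -> point algC) : Prop :=
  let T1 := torsion (geom E1) n in
  let T2 := torsion (geom E2) n in
  [/\ forall P, P \in T1 -> phi P \in T2,
      {in T1 &, injective phi},
      forall Q, Q \in T2 -> exists2 P, P \in T1 & phi P = Q,
      {in T1 &, forall P Q,
         phi (add_pt (geom E1) P Q) = add_pt (geom E2) (phi P) (phi Q)}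
    & forall s : {rmorphism algC -> algC},
      {in T1, forall P, phi (galois_pt s P) = galois_pt s (phi P)}].

Definition reverse_congruent (n : nat) (E1 E2 : ellcurve) : Prop :=
  exists phi, galois_module_iso n E1 E2 phi /\
    {in torsion (geom E1) n &, forall P Q,
      exists z, weil_pairing (geom E1) n P Q z
             /\ weil_pairing (geom E2) n (phi P) (phi Q) z^-1}.

(* phi is a morphism of curves E1 -> E2 defined over Q: near every geometric
   point it is given by three forms of the same degree with rational
   coefficients. *)
Definition morphism_over_Q (E1 E2 : ellcurve)
    (phi : point algC -> point algC) : Prop :=
  let ev (F : {mpoly rat[3]}) (P : point algC) :=
    evalf (map_mpoly (ratr : rat -> algC) F) P in
  (forall P, on_curve (geom E1) P -> on_curve (geom E2) (phi P)) /\
  forall P, on_curve (geom E1) P ->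
    exists (d : nat) (F : 'I_3 -> {mpoly rat[3]}),
    [/\ forall i, F i \is d.-homog,
        exists i, ev (F i) P != 0
      & forall Q, on_curve (geom E1) Q -> (exists i, ev (F i) Q != 0) ->
        exists c : algC, forall i, ev (F i) Q = c * tnth (coords (phi Q)) i].

(* Isogenies are defined over Q: quadratic twists, although isomorphic over
   algC, need not be isogenous in this sense. *)
Definition isogenous (E1 E2 : ellcurve) : Prop :=
  exists phi, [/\ morphism_over_Q E1 E2 phi, phi None = None
    & exists2 P, on_curve (geom E1) P & phi P <> None].

(* Main.v *)
Require Import Defs.
From Stdlib Require Import ZArith.
From HB Require Import structures.
From mathcomp Require Import all_boot all_order all_algebra all_field.
From mathcomp Require Import mpoly.
From mathcomp Require Import ssrZ ring zify.
From mathcomp Require boolp classical_sets cardinality.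

(* The Weil pairing is computed from the functions h_{A,B} with divisor (A) + (B) - (A + B) - (O), which
   are slopes of lines: their cocycle relation and Weil reciprocity on lines give associativity of the group law
   and bilinearity.

   n = 7: if the image of Galois on E[7] normalises a split Cartan subgroup, then E[7] = C + C' over a
   quadratic field where conjugation swaps the lines C and C'; composing a P + b P' |-> a P - b P' with the
   quadratic twist by that field is Galois equivariant and has determinant -1. The family lives on a genus 0
   modular curve.

   n = 9: an anti-isometry E[3] -> E'[3] lifts to E[9] through theta(C) = h_{Q,-Q}(C) / h_{C,C}(Q), Q = -3C: one has
   theta(C)^3 = -2 y(3C) and theta(C + T) = theta(C) e_3(-3C, T) for T in E[3]. When 4 y(Q) y'(phi Q) is the cube of a
   Galois compatible function alpha(Q), the lift Phi with theta(C) theta'(Phi C) = alpha(3C) is unique up to a scalar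
   1 + 3c, which the pairing e_9 fixes; uniqueness makes Phi equivariant.

   Non-isogeny: a morphism fixing O is a homomorphism (the even part maps P^1 to the curve, hence is constant),
   and it is zero as soon as there is no nonzero Galois homomorphism E1[l] -> E2[l], for one prime l
   (l = 3 for the first family, l = 2 for the second). *)

Set Implicit Arguments.
Unset Strict Implicit.
Unset Printing Implicit Defensive.

Import Order.TTheory GRing.Theory Num.Theory.
Local Open Scope ring_scope.

(** Associativity and the cocycle relation are proved together, from ideals: the ideal of P times
    the ideal of Q is h_{P,Q} times the ideal of P + Q, and products of ideals associate. One prime
    l is enough against isogenies because a homomorphism that kills E1[l] factors through
    multiplication by l, and the quotient is again a Galois homomorphism, to which the same
    hypothesis applies. Hence all l-power torsion is killed, and a map of bounded degree is constant
    along arbitrarily many translates. For n = 9 no coordinate of a 9-torsion point is ever written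
    down. The input is a correspondence between the roots of the two 3-division polynomials, both
    expressed by a root u of one quartic, and identities over Z[m] with two roots u, v adjoined. The
    theta relation finds the lift to E[9] up to cube roots of unity, and complex conjugation removes
    most of this ambiguity, since a real cube root of unity is 1. *)

Module CurveRing.

(** * Short Weierstrass curves, the chord construction and the coordinate ring *)

Record ecurve (K : numClosedFieldType) := ECurve {
  ea : K; eb : K; e_ns : 4%:R * ea ^+ 3 + 27%:R * eb ^+ 2 != 0 }.

Section Curve.
Variables (K : numClosedFieldType) (E : ecurve K).
Local Notation a := (ea E).
Local Notation b := (eb E).
Implicit Types (A B C D P Q : option (K * K)).

Definition ew := Weierstrass 0 0 0 a b.
Definition ecub (x : K) := x ^+ 3 + a * x + b.
Definition onc (P : point K) := on_curve ew P.
Local Notation "P ++ Q" := (add_pt ew P Q).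

Lemma oncE x y : onc (Some (x, y)) = (y ^+ 2 == ecub x).
Proof.
rewrite /onc /on_curve /= /ecub; congr (_ == _); ring.
Qed.

Lemma onc_eq x y : onc (Some (x, y)) -> y ^+ 2 = ecub x.
Proof. by rewrite oncE => /eqP. Qed.

Definition eopp (P : point K) : point K := if P is Some (x, y) then Some (x, - y) else None.

Lemma onc_opp P : onc (eopp P) = onc P.
Proof. by case: P => [[x y]|] //; rewrite /eopp !oncE sqrrN. Qed.

Definition slope (x1 y1 x2 y2 : K) : K :=
  if x1 == x2 then (3%:R * x1 ^+ 2 + a) / (2%:R * y1) else (y2 - y1) / (x2 - x1).

Lemma add0p P : None ++ P = P. Proof. by []. Qed.
Lemma addp0 P : P ++ None = P. Proof. by case: P => [[]|]. Qed.

Lemma addpE x1 y1 x2 y2 : Some (x1, y1) ++ Some (x2, y2) =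
  if (x1 == x2) && (y1 + y2 == 0) then None else
  let l := slope x1 y1 x2 y2 in
  Some (l ^+ 2 - x1 - x2, l * (x1 - (l ^+ 2 - x1 - x2)) - y1).
Proof.
rewrite /add_pt /=.
have -> : y1 + y2 + 0 * x2 + 0 = y1 + y2 by ring.
case: ifP => // _; rewrite /slope.
set l := (if _ then _ else _); set l' := (if _ then _ else _).
have -> : l = l'.
  rewrite /l /l'; case: ifP => // _.
  by congr (_ / _); ring.
by congr (Some (_, _)); ring.
Qed.

Lemma two_neq0 : (2%:R : K) != 0. Proof. by rewrite pnatr_eq0. Qed.
Lemma three_neq0 : (3%:R : K) != 0. Proof. by rewrite pnatr_eq0. Qed.

(** A double root x would force a = -3 x^2 and b = 2 x^3, for which the discriminant vanishes. *)
Lemma ecub_simple x : ecub x = 0 -> 3%:R * x ^+ 2 + a != 0.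
Proof.
rewrite /ecub => fx; apply/eqP => dx.
have ea' : a = - (3%:R * x ^+ 2) by rewrite -[LHS](addKr (3%:R * x ^+ 2)) dx addr0.
have eb' : b = 2%:R * x ^+ 3.
  by move/eqP: fx; rewrite addrC addr_eq0 => /eqP ->; rewrite ea'; ring.
by case/eqP: (e_ns E); rewrite ea' eb'; ring.
Qed.

(* A uniform description of the chord and of the tangent: it makes the two cases of the group law one. *)
Lemma chordP x1 y1 x2 y2 : onc (Some (x1, y1)) -> onc (Some (x2, y2)) ->
  ~~ ((x1 == x2) && (y1 + y2 == 0)) ->
  let l := slope x1 y1 x2 y2 in
  [/\ y2 = y1 + l * (x2 - x1), a = l * (y1 + y2) - (x1 ^+ 2 + x1 * x2 + x2 ^+ 2),
      b = y1 ^+ 2 - x1 ^+ 3 - a * x1 & x1 = x2 -> y1 = y2 /\ y1 != 0].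
Proof.
move=> /onc_eq; rewrite /ecub => o1 /onc_eq; rewrite /ecub => o2 nopp /=.
have eb' : b = y1 ^+ 2 - x1 ^+ 3 - a * x1 by rewrite o1; ring.
have [e12|n12] := eqVneq x1 x2.
  rewrite /slope; subst x2; rewrite eqxx /= in nopp *.
  have e : y1 = y2.
    have : (y1 - y2) * (y1 + y2) = 0 by rewrite -subr_sqr o1 o2 subrr.
    by move/eqP; rewrite mulf_eq0 (negPf nopp) orbF subr_eq0 => /eqP.
  subst y2.
  have y0 : y1 != 0 by apply: contraNneq nopp => ->; rewrite addr0.
  split=> //; first by ring.
  by have := two_neq0; move: y0 => y0 t0; field; rewrite y0.
have d0 : x2 - x1 != 0 by rewrite subr_eq0 eq_sym.
have el : y2 = y1 + slope x1 y1 x2 y2 * (x2 - x1).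
  by rewrite /slope (negPf n12); field.
split=> //; last by move=> e; rewrite e eqxx in n12.
apply: (mulfI d0); set l := slope _ _ _ _ in el *.
have -> : (x2 - x1) * (l * (y1 + y2) - (x1 ^+ 2 + x1 * x2 + x2 ^+ 2))
        = (l * (x2 - x1)) * (y1 + y2) - (x2 ^+ 3 - x1 ^+ 3) by ring.
have -> : l * (x2 - x1) = y2 - y1 by rewrite el; ring.
have -> : (y2 - y1) * (y1 + y2) - (x2 ^+ 3 - x1 ^+ 3)
   = (y2 ^+ 2 - y1 ^+ 2) - (x2 ^+ 3 - x1 ^+ 3) by ring.
by rewrite o1 o2; ring.
Qed.

(** Vieta along the chord or tangent: the third abscissa is read off from the coefficient of x^2.
    Most later computations with lines start from this identity. *)
Lemma chord_cubic x1 y1 x2 y2 : onc (Some (x1, y1)) -> onc (Some (x2, y2)) ->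
  ~~ ((x1 == x2) && (y1 + y2 == 0)) ->
  let l := slope x1 y1 x2 y2 in
  forall x, ecub x - (y1 + l * (x - x1)) ^+ 2
    = (x - x1) * (x - x2) * (x - (l ^+ 2 - x1 - x2)).
Proof.
move=> o1 o2 nopp l x.
have [ey ea' eb' _] := chordP o1 o2 nopp; rewrite -/l in ey ea'.
by rewrite /ecub eb' ea' ey; ring.
Qed.

Lemma onc_add P Q : onc P -> onc Q -> onc (P ++ Q).
Proof.
case: P => [[x1 y1]|]; last by rewrite add0p.
case: Q => [[x2 y2]|]; last by rewrite addp0.
move=> o1 o2; rewrite addpE; case: ifP => // /negbT nopp.
rewrite oncE /=; have := chord_cubic o1 o2 nopp; set l := slope _ _ _ _ => /(_ (l ^+ 2 - x1 - x2)).
rewrite subrr mulr0 => /eqP; rewrite subr_eq0 => /eqP ->.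
by apply/eqP; ring.
Qed.

Lemma addpC P Q : onc P -> onc Q -> P ++ Q = Q ++ P.
Proof.
case: P => [[x1 y1]|]; last by rewrite add0p addp0.
case: Q => [[x2 y2]|]; last by rewrite add0p addp0.
move=> o1 o2; rewrite !addpE [x2 == x1]eq_sym [y2 + _]addrC; case: ifP => // /negbT nopp.
have [e1 _ _ h] := chordP o1 o2 nopp.
have es : slope x2 y2 x1 y1 = slope x1 y1 x2 y2.
  rewrite /slope [x2 == x1]eq_sym; case: eqP => [e|/eqP n]; first by case: (h e) => <- _; rewrite e.
  by rewrite -[y1 - y2]opprB -[x1 - x2]opprB invrN mulrNN.
rewrite /= es; move: e1; set l := slope _ _ _ _ => e1; congr (Some (_, _)); first by ring.
by rewrite e1; ring.
Qed.

Lemma addpN P : onc P -> P ++ eopp P = None.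
Proof. by case: P => [[x y]|] // _; rewrite addpE eqxx subrr eqxx. Qed.

(** * The coordinate ring *)

Definition rg := ({poly K} * {poly K})%type.
Definition ev (g : rg) (x y : K) := g.1.[x] + g.2.[x] * y.
Definition fpoly : {poly K} := 'X^3 + a *: 'X + b%:P.
(** Product of u + v y and u' + v' y with y^2 replaced by the cubic, so that a pair is a normal form
    of a regular function. *)
Definition rmul (g h : rg) : rg :=
  (g.1 * h.1 + g.2 * h.2 * fpoly, g.1 * h.2 + g.2 * h.1).
Definition radd (g h : rg) : rg := (g.1 + h.1, g.2 + h.2).
Definition rc (c : K) : rg := (c%:P, 0).
Definition rx : rg := ('X, 0).
Definition ry : rg := (0, 1).
Definition rsc (c : K) (g : rg) : rg := (c *: g.1, c *: g.2).

Definition hornE := (hornerD, hornerN, hornerZ, hornerM, hornerXn, hornerX, hornerC).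

Lemma fpolyE x : fpoly.[x] = ecub x. Proof. by rewrite /fpoly !hornE. Qed.

Lemma evM g h x y : y ^+ 2 = ecub x -> ev (rmul g h) x y = ev g x y * ev h x y.
Proof.
by rewrite /ecub => o; rewrite /ev /rmul /= !hornE; ring: o.
Qed.
Lemma evD g h x y : ev (radd g h) x y = ev g x y + ev h x y.
Proof. rewrite /ev /radd /= !hornE; ring. Qed.
Lemma evc c x y : ev (rc c) x y = c.
Proof. by rewrite /ev /rc /= !hornE; ring. Qed.
Lemma evx x y : ev rx x y = x.
Proof. by rewrite /ev /rx /= !hornE; ring. Qed.
Lemma evy x y : ev ry x y = y.
Proof. by rewrite /ev /ry /= !hornE; ring. Qed.
Lemma evsc c g x y : ev (rsc c g) x y = c * ev g x y.
Proof. by rewrite /ev /rsc /= !hornE; ring. Qed.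
Definition evE := (evD, evc, evx, evy, evsc).

Lemma onc_ex x : exists y, y ^+ 2 = ecub x.
Proof. by exists (sqrtC (ecub x)); rewrite sqrtCK. Qed.

Lemma poly_eq0_all (p : {poly K}) : (forall x, p.[x] = 0) -> p = 0.
Proof.
move=> p0; apply/eqP/negPn/negP => pn0.
have : (size [seq (i%:R : K) | i <- iota 0 (size p)] < size p)%N.
  apply: max_poly_roots => //; first by apply/allP => z /mapP[i _ ->]; rewrite /root p0.
  by rewrite map_inj_uniq ?iota_uniq // => i j /eqP; rewrite eqr_nat => /eqP.
by rewrite size_map size_iota ltnn.
Qed.

Lemma fpoly_neq0 : fpoly != 0.
Proof.
rewrite -lead_coef_eq0 /fpoly -addrA lead_coefDl ?lead_coefXn ?oner_eq0 //.
rewrite size_polyXn; apply: leq_ltn_trans (size_polyD _ _) _.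
by rewrite gtn_max (leq_ltn_trans (size_scale_leq _ _)) ?size_polyX // (leq_ltn_trans (size_polyC_leq1 _)).
Qed.

(** The values at (x, y) and (x, -y) separate the two components; the second one is then killed
    after multiplication by the cubic, which is a nonzero polynomial. *)
Lemma ev_eq0 (g : rg) : (forall x y, y ^+ 2 = ecub x -> ev g x y = 0) -> g = (0, 0).
Proof.
case: g => u v /= h.
have huv x : u.[x] = 0 /\ v.[x] * ecub x = 0.
  have [y oy] := onc_ex x.
  have h1 := h x y oy; have h2 : ev (u, v) x (- y) = 0 by apply: h; rewrite sqrrN.
  rewrite /ev /= in h1 h2.
  have e1 : 2%:R * u.[x] = 0.
    have -> : 2%:R * u.[x] = (u.[x] + v.[x] * y) + (u.[x] + v.[x] * - y) by ring.
    by rewrite h1 h2 addr0.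
  have e2 : u.[x] = 0 by apply: (mulfI two_neq0); rewrite mulr0.
  split=> //; rewrite -oy expr2 mulrA.
  by move: h1; rewrite e2 add0r => ->; rewrite mul0r.
have -> : u = 0 by apply: poly_eq0_all => x; case: (huv x).
have : v * fpoly = 0.
  by apply: poly_eq0_all => x; rewrite hornerM fpolyE; case: (huv x).
by move/eqP; rewrite mulf_eq0 (negPf fpoly_neq0) orbF => /eqP ->.
Qed.

Lemma ev_inj (g h : rg) : (forall x y, y ^+ 2 = ecub x -> ev g x y = ev h x y) -> g = h.
Proof.
move=> e; have : (radd g (rsc (-1) h)) = (0, 0).
  by apply: ev_eq0 => x y o; rewrite !evE e //; ring.
case: g h {e} => [u v] [u' v']; rewrite /radd /rsc /= !scaleN1r => -[/eqP h1 /eqP h2].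
by rewrite subr_eq0 in h1; rewrite subr_eq0 in h2; rewrite (eqP h1) (eqP h2).
Qed.

(* With [x] of degree 2 and [y] of degree 3, the degree and the leading coefficient of
   [rwt g] are the pole order of [g] at the point at infinity and its leading coefficient. *)
Definition rwt (g : rg) : {poly K} := g.1 \Po 'X^2 + 'X^3 * (g.2 \Po 'X^2).

Lemma rwt_even g i : (rwt g)`_(i.*2) = g.1`_i.
Proof.
rewrite /rwt coefD coefXnM coef_comp_poly_Xn // coef_comp_poly_Xn //.
rewrite dvdn2 odd_double /= divn2 doubleK.
case: ltnP => h; first by rewrite addr0.
by rewrite dvdn2 oddB // odd_double /= addr0.
Qed.

Lemma rwt_odd g i : (rwt g)`_(i.*2 + 3) = g.2`_i.
Proof.
rewrite /rwt coefD coefXnM coef_comp_poly_Xn // coef_comp_poly_Xn //.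
rewrite dvdn2 oddD odd_double /= add0r ltnNge leq_addl /= addnK dvdn2 odd_double /=.
by rewrite divn2 doubleK.
Qed.

(** The gap at 1: no regular function has just a simple pole at infinity. This is what separates an
    affine point from O in the proof of associativity. *)
Lemma rwt1 g : (rwt g)`_1 = 0.
Proof. by rewrite /rwt coefD coefXnM coef_comp_poly_Xn //= addr0. Qed.

Lemma rwt_eq0 g : rwt g = 0 -> g = (0, 0).
Proof.
case: g => u v e; congr (_, _); apply/polyP => i; rewrite coef0.
  by rewrite -(rwt_even (u, v)) e coef0.
by rewrite -(rwt_odd (u, v)) e coef0.
Qed.

(** The substitution x = T^2, y = T^3 is not multiplicative, because y^2 is not x^3; the correction
    a T^2 + b has lower weight, so leading terms still multiply. *)
Lemma rwtM_aux g h : rwt (rmul g h) =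
  rwt g * rwt h + ((g.2 * h.2) \Po 'X^2) * (a *: 'X^2 + b%:P).
Proof.
rewrite /rwt /rmul /fpoly /= !comp_polyD !comp_polyM !comp_polyD !comp_polyZ.
rewrite comp_polyX comp_polyC comp_Xn_poly -!mul_polyC.
by set u := _ \Po _; set v := _ \Po _; set u' := _ \Po _; set v' := _ \Po _; ring.
Qed.

Lemma size_rwt2 g : g.2 != 0 -> (size (g.2 \Po 'X^2) + 3 <= size (rwt g))%N.
Proof.
move=> v0; set v := g.2 in v0 *.
have sv : (0 < size v)%N by rewrite size_poly_gt0.
have -> : size (v \Po 'X^2) = ((size v).-1.*2).+1.
  by rewrite -[LHS]prednK ?size_comp_poly ?size_polyXn ?muln2 // size_poly_gt0 comp_poly_eq0 // size_polyXn.
rewrite addSn; apply/negbNE; rewrite -leqNgt; apply/negP => h.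
have : (rwt g)`_((size v).-1.*2 + 3) = 0 by rewrite nth_default.
by rewrite rwt_odd; apply/eqP; rewrite -/v -lead_coefE lead_coef_eq0.
Qed.

Lemma rwtM g h : rwt g != 0 -> rwt h != 0 ->
  size (rwt (rmul g h)) = (size (rwt g) + size (rwt h)).-1 /\
  lead_coef (rwt (rmul g h)) = lead_coef (rwt g) * lead_coef (rwt h).
Proof.
move=> g0 h0; rewrite -(size_mul g0 h0) -lead_coefM.
set r := ((g.2 * h.2) \Po 'X^2) * (a *: 'X^2 + b%:P).
have sr : (size r < size (rwt g * rwt h)%R)%N.
  have -> : size (rwt g * rwt h) = (size (rwt g) + size (rwt h)).-1 by exact: size_mul.
  have sg : (0 < size (rwt g))%N by rewrite size_poly_gt0.
  have sh : (0 < size (rwt h))%N by rewrite size_poly_gt0.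
  have [e|n] := eqVneq (g.2 * h.2) 0.
    have -> : r = 0 by rewrite /r e comp_poly0; apply: mul0r.
    rewrite size_poly0; have : (0 < (size (rwt g) + size (rwt h)).-1)%N by lia.
    exact.
  have [ng nh] : g.2 != 0 /\ h.2 != 0 by apply/andP; rewrite -negb_or -mulf_eq0.
  have s1 := size_rwt2 ng; have s2 := size_rwt2 nh.
  have s5 : (size r <= (size ((g.2 * h.2) \Po 'X^2)%R + size (a *: 'X^2 + b%:P)%R).-1)%N.
    exact: size_polyMleq.
  have s3 : (size (a *: 'X^2 + b%:P)%R <= 3)%N.
    apply: leq_trans (size_polyD _ _) _.
    rewrite geq_max (leq_trans (size_scale_leq _ _)) ?size_polyXn //.
    exact: leq_trans (size_polyC_leq1 _) _.
  have s4 : (size ((g.2 * h.2) \Po 'X^2) <= (size (g.2 \Po 'X^2) + size (h.2 \Po 'X^2)).-1)%N.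
    by rewrite comp_polyM size_polyMleq.
  have ar (A B C D q p c : nat) : (A + 3 <= C -> B + 3 <= D -> c <= 3 -> p <= (A + B).-1 ->
      q <= (p + c).-1 -> q < (C + D).-1)%N by lia.
  exact: (ar _ _ _ _ _ _ _ s1 s2 s3 s4 s5).
by rewrite rwtM_aux size_polyDl // lead_coefDl.
Qed.

End Curve.

End CurveRing.

(** * The product of the ideals of two points *)

Module PointIdeals.
Import CurveRing.

Section Associativity.
Variables (K : numClosedFieldType) (E : ecurve K).
Local Notation a := (ea E).
Local Notation b := (eb E).
Local Notation "P ++ Q" := (add_pt (ew E) P Q).
Local Notation onc := (onc E).
Local Notation ecub := (ecub E).
Local Notation rmul := (rmul E).
Local Notation slope := (slope E).
Implicit Types (A B C D P Q : point K) (g h : rg K).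

Lemma rwt0 : rwt (0, 0) = 0 :> {poly K}.
Proof. by rewrite /rwt /= !comp_poly0 mulr0 addr0. Qed.

Lemma rmul_neq0 g h : rwt g != 0 -> rwt h != 0 -> rwt (rmul g h) != 0.
Proof.
move=> g0 h0; rewrite -lead_coef_eq0; have [_ ->] := rwtM E g0 h0.
by rewrite mulf_neq0 // lead_coef_eq0.
Qed.

(** The coordinate ring is a domain, because leading coefficients at infinity multiply. *)
Lemma rmul_cancel w g h : rwt w != 0 ->
  (forall x y, y ^+ 2 = ecub x -> ev w x y * ev g x y = ev w x y * ev h x y) -> g = h.
Proof.
move=> w0 e; pose d := radd g (rsc (-1) h).
have dw : rmul w d = (0, 0).
  apply: (ev_eq0 (E := E)) => x y o; rewrite evM // /d !evE mulrDr e //; ring.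
have d0 : d = (0, 0).
  apply: rwt_eq0; apply/eqP/negPn/negP => d0.
  by have := rmul_neq0 w0 d0; rewrite dw rwt0 eqxx.
apply: (ev_inj (E := E)) => x y o; have : ev d x y = 0 by rewrite d0 /ev /= !hornE; ring.
by rewrite /d !evE mulN1r => /eqP; rewrite subr_eq0 => /eqP.
Qed.

Definition rxm (c : K) : rg K := ('X - c%:P, 0).
Definition rln (l x1 y1 : K) : rg K := ((l * x1 - y1)%:P - l *: 'X, 1).

Lemma ev_rxm c x y : ev (rxm c) x y = x - c.
Proof. by rewrite /ev /rxm /= !hornE; ring. Qed.
Lemma ev_rln l x1 y1 x y : ev (rln l x1 y1) x y = y - y1 - l * (x - x1).
Proof. by rewrite /ev /rln /= !hornE; ring. Qed.
Definition evX := (evE, ev_rxm, ev_rln).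

Definition opposite P Q :=
  if P is Some (x1, y1) then if Q is Some (x2, y2) then (x1 == x2) && (y1 + y2 == 0)
  else false else false.

(* [numr P Q / denr P Q] is the function with divisor (P) + (Q) - (P + Q) - (O), normalised at O. *)
Definition numr P Q : rg K :=
  if P is Some (x1, y1) then if Q is Some (x2, y2) then
    if opposite P Q then rxm x1 else rln (slope x1 y1 x2 y2) x1 y1
  else rc 1 else rc 1.
Definition denr P Q : rg K :=
  if P is Some (x1, y1) then if Q is Some (x2, y2) then
    if opposite P Q then rc 1 else rxm ((slope x1 y1 x2 y2) ^+ 2 - x1 - x2)
  else rc 1 else rc 1.

(** Membership in the ideal I_P of the affine ring; the ideal of O is the whole ring. *)
Definition vanish P g : Prop := if P is Some (x, y) then ev g x y = 0 else True.

Lemma poly_sub_root (p : {poly K}) c : exists q : {poly K}, forall x, p.[x] = q.[x] * (x - c) + p.[c].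
Proof.
have /factor_theorem[q e] : root (p - p.[c]%:P) c by rewrite /root !hornE subrr.
exists q => x; have := congr1 (horner^~ x) e; rewrite !hornE => <-; ring.
Qed.

Lemma vanish_gen x0 y0 g : vanish (Some (x0, y0)) g -> exists al be : rg K, forall x y,
  ev g x y = (x - x0) * ev al x y + (y - y0) * ev be x y.
Proof.
case: g => u v /=; rewrite /ev /= => h.
have [qu eu] := poly_sub_root u x0; have [qv ev'] := poly_sub_root v x0.
exists (qu, qv), (rc v.[x0]) => x y; rewrite /rc /= !hornE eu ev'.
have -> : u.[x0] = - (v.[x0] * y0) by apply/eqP; rewrite -addr_eq0 h.
ring.
Qed.

(** One inclusion of I_P I_Q = h_{P,Q} I_{P+Q}. In the generic case y - y_i is replaced by the
    chord, and the chord times its conjugate is the product of the three vertical lines. *)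
Lemma mul_vanish P Q g1 g2 : onc P -> onc Q -> vanish P g1 -> vanish Q g2 ->
  exists2 g, vanish (P ++ Q) g & forall x y, y ^+ 2 = ecub x ->
    ev (denr P Q) x y * (ev g1 x y * ev g2 x y) = ev (numr P Q) x y * ev g x y.
Proof.
case: P => [[x1 y1]|] oP oQ v1 v2; last first.
  exists (rmul g1 g2) => [|x y o]; last by rewrite evM.
  by case: Q v2 oQ => [[x y]|] //= v2 oQ; rewrite evM ?v2 ?mulr0 //; apply: onc_eq.
case: Q v2 oQ => [[x2 y2]|] v2 oQ; last first.
  exists (rmul g1 g2) => [|x y o]; last by rewrite evM.
  by rewrite addp0 /= evM ?v1 ?mul0r //; apply: onc_eq.
have [al1 [be1 e1]] := vanish_gen v1; have [al2 [be2 e2]] := vanish_gen v2.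
rewrite addpE /numr /denr /opposite.
case: ifP => [/andP[/eqP ex /eqP ey]|/negbT nopp].
  have {}ey : y2 = - y1 by apply/eqP; rewrite -addr_eq0 addrC ey.
  (* [k] is (f(x) - f(x1)) / (x - x1) for the cubic f. *)
  subst x2 y2; pose k : rg K := ('X^2 + x1 *: 'X + (x1 ^+ 2 + a)%:P, 0).
  exists (radd (rmul (rxm x1) (rmul al1 al2)) (radd (rmul (radd (rmul al1 be2) (rmul al2 be1)) (ry K))
     (radd (rsc y1 (radd (rmul al1 be2) (rsc (-1) (rmul al2 be1)))) (rmul k (rmul be1 be2))))) => // x y o.
  have ek : ev k x y * (x - x1) = y ^+ 2 - y1 ^+ 2.
    by rewrite o (onc_eq oP) /ev /k /= !hornE /CurveRing.ecub; ring.
  rewrite !(evX, evM) //.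
  transitivity ((x - x1) * ((x - x1) * (ev al1 x y * ev al2 x y) + (ev al1 x y * ev be2 x y + ev al2 x y * ev be1 x y) * y
      + y1 * (ev al1 x y * ev be2 x y - ev al2 x y * ev be1 x y)) + (y ^+ 2 - y1 ^+ 2) * (ev be1 x y * ev be2 x y)).
    by rewrite e1 e2; ring.
  by rewrite -ek; ring.
have := chord_cubic oP oQ nopp; have [ey _ _ _] := chordP oP oQ nopp.
move: ey; set l := slope _ _ _ _ => ey cub /=.
set x3 := l ^+ 2 - x1 - x2 in cub *.
(* Up to sign the chord reflected by y -> -y. *)
pose L' : rg K := ((y1 - l * x1)%:P + l *: 'X, 1).
have eL' x y : ev L' x y = y + (y1 + l * (x - x1)) by rewrite /ev /L' /= !hornE; ring.
pose al1' := radd al1 (rsc l be1); pose al2' := radd al2 (rsc l be2).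
exists (radd (rmul L' (rmul al1' al2')) (rmul (rxm x3) (radd (rmul (rxm x1) (rmul al1' be2))
   (radd (rmul (rxm x2) (rmul al2' be1)) (rmul (rln l x1 y1) (rmul be1 be2)))))) => [|x y o].
  have o3 : (l * (x1 - x3) - y1) ^+ 2 = ecub x3.
    by have /eqP := cub x3; rewrite subrr mulr0 subr_eq0 => /eqP ->; ring.
  by rewrite !(evX, evM, eL') // subrr; ring.
have cubx := cub x; rewrite -o in cubx.
rewrite !(evX, evM, eL') //.
transitivity (((x - x1) * (x - x2) * (x - x3)) * ((ev al1 x y + l * ev be1 x y) * (ev al2 x y + l * ev be2 x y))
  + (y - y1 - l * (x - x1)) * (x - x3) * ((x - x1) * ((ev al1 x y + l * ev be1 x y) * ev be2 x y)
  + (x - x2) * ((ev al2 x y + l * ev be2 x y) * ev be1 x y) + (y - y1 - l * (x - x1)) * (ev be1 x y * ev be2 x y))).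
  by rewrite e1 e2 ey; ring.
by rewrite -cubx; ring.
Qed.

(** The other inclusion of I_P I_Q = h_{P,Q} I_{P+Q}. Each case rests on inverting one number:
    f'(x1) or 2 y1 for opposite points, according to whether y1 = 0, then 2 y1 for a tangent and x2
    - x1 for a chord. *)
Lemma vanish_mul P Q g : onc P -> onc Q -> vanish (P ++ Q) g ->
  exists2 s : seq (rg K * rg K), (forall p, p \in s -> vanish P p.1 /\ vanish Q p.2) &
    forall x y, y ^+ 2 = ecub x ->
    ev (numr P Q) x y * ev g x y = ev (denr P Q) x y * \sum_(p <- s) ev p.1 x y * ev p.2 x y.
Proof.
case: P => [[x1 y1]|] oP oQ vg; last first.
  exists [:: (rc 1, g)] => [p|x y o]; last by rewrite big_seq1 !evX; ring.
  by rewrite inE => /eqP ->.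
case: Q vg oQ => [[x2 y2]|] vg oQ; last first.
  exists [:: (g, rc 1)] => [p|x y o]; last by rewrite big_seq1 !evX; ring.
  by rewrite inE => /eqP ->.
have o1 := onc_eq oP; have o2 := onc_eq oQ.
have t0 := two_neq0 K.
move: vg; rewrite addpE /numr /denr /opposite.
case: ifP => [/andP[/eqP ex /eqP ey] _|/negbT nopp].
  have {}ey : y2 = - y1 by apply/eqP; rewrite -addr_eq0 addrC ey.
  subst x2 y2; have [y0|y0] := eqVneq y1 0.
    pose c0 := 3%:R * x1 ^+ 2 + a.
    have c00 : c0 != 0 by apply: ecub_simple; rewrite -o1 y0 expr0n.
    pose k := radd (rc (- (2%:R * x1))) (rsc (-1) (rx K)).
    exists [:: (ry K, rmul (ry K) (rsc c0^-1 g));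
      (rxm x1, rmul (rmul k (rxm x1)) (rsc c0^-1 g))] => [p|x y o].
      rewrite !inE => /orP[] /eqP -> /=; rewrite y0 oppr0 !(evX, evM) ?expr0n /=;
        do ?split; try ring; by rewrite -o1 y0 expr0n.
    rewrite !big_cons big_nil /= !(evX, evM) //.
    have q : y ^+ 2 = (x - x1) * (c0 + (x - x1) * (x + 2%:R * x1)).
      have q0 : ecub x1 = 0 by rewrite -o1 y0 expr0n.
      by rewrite o -[LHS]subr0 -q0 /CurveRing.ecub /c0; ring.
    transitivity (c0^-1 * ev g x y * (y ^+ 2 - (x - x1) * (x - x1) * (x + 2%:R * x1))); last by ring.
    by rewrite q; field.
  exists [:: (rxm x1, rmul (radd (ry K) (rc y1)) (rsc (2%:R * y1)^-1 g));
      (rmul (radd (ry K) (rc (- y1))) (rsc (- (2%:R * y1)^-1) g), rxm x1)] => [p|x y o].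
    rewrite !inE => /orP[] /eqP -> /=; rewrite !(evX, evM) //; do ?split; try ring.
  by rewrite !big_cons big_nil /= !(evX, evM) //; field.
have := chord_cubic oP oQ nopp; have [ey _ _ hT] := chordP oP oQ nopp.
move: ey; move: (slope x1 y1 x2 y2) => l ey cub /=.
set x3 := l ^+ 2 - x1 - x2 in cub *; move=> vg.
have [al [be e]] := @vanish_gen x3 (l * (x1 - x3) - y1) g vg.
pose L := rln l x1 y1.
pose L' : rg K := ((y1 - l * x1)%:P + l *: 'X, 1).
have eL' x y : ev L' x y = y + (y1 + l * (x - x1)) by rewrite /ev /L' /= !hornE; ring.
have [al' eg] : exists al', forall x y, ev g x y = (x - x3) * ev al' x y + ev L' x y * ev be x y.
  by exists (radd al (rsc (- l) be)) => x y; rewrite e !evX eL'; ring.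
have [ex|nx] := eqVneq x1 x2.
  have [ey' y0] := hT ex; subst x2 y2.
  pose c := (2%:R * y1)^-1.
  exists [:: (rxm x1, rmul (rxm x1) (radd (rmul (rxm x3) (rsc c al')) be));
     (L, rmul (rsc (- c) al') L); (L, rmul (rsc (- (2%:R * l * c)) al') (rxm x1))] => [p|x y o].
    rewrite !inE => /or3P[] /eqP -> /=; rewrite !(evX, evM) //; do ?split; try ring.
  have cubx := cub x; rewrite -o in cubx.
  rewrite !big_cons big_nil /= !(evX, evM) // eg eL'.
  transitivity ((x - x3) * (c * (y ^+ 2 - (y1 + l * (x - x1)) ^+ 2 - (y - y1 - l * (x - x1)) ^+ 2 - 2%:R * l * (x - x1) * (y - y1 - l * (x - x1))) * ev al' x y)
    + (y ^+ 2 - (y1 + l * (x - x1)) ^+ 2) * ev be x y).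
    by rewrite /c; field.
  by rewrite cubx /x3; ring.
pose c := (x2 - x1)^-1.
have d0 : x2 - x1 != 0 by rewrite subr_eq0 eq_sym.
exists [:: (rmul (rxm x1) (rsc c al'), L); (rmul L (rsc (- c) al'), rxm x2);
   (rmul (rxm x1) be, rxm x2)] => [p|x y o].
  by rewrite !inE => /or3P[] /eqP -> /=; rewrite !(evX, evM) // ?ey; do ?split; ring.
have cubx := cub x; rewrite -o in cubx.
rewrite !big_cons big_nil /= !(evX, evM) // eg eL'.
transitivity ((x - x3) * ((y - y1 - l * (x - x1)) * ev al' x y)
    + (y ^+ 2 - (y1 + l * (x - x1)) ^+ 2) * ev be x y); first by ring.
by rewrite cubx /c /x3; field.
Qed.

End Associativity.

End PointIdeals.

(** * Associativity and the cocycle relation, by pole orders at infinity *)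

Module CocycleLaw.
Import CurveRing PointIdeals.

Section Assoc2.
Variables (K : numClosedFieldType) (E : ecurve K).
Local Notation a := (ea E).
Local Notation b := (eb E).
Local Notation "P ++ Q" := (add_pt (ew E) P Q).
Local Notation onc := (onc E).
Local Notation ecub := (ecub E).
Local Notation rmul := (rmul E).
Local Notation slope := (slope E).
Local Notation numr := (numr E).
Local Notation denr := (denr E).
Implicit Types (A B C D P Q : point K) (g h : rg K).

Definition mondeg g n := size (rwt g) = n.+1 /\ lead_coef (rwt g) = 1.

Lemma mondeg_neq0 g n : mondeg g n -> rwt g != 0.
Proof. by case=> s _; rewrite -size_poly_eq0 s. Qed.

Lemma mondegM g h m n : mondeg g m -> mondeg h n -> mondeg (rmul g h) (m + n).
Proof.
move=> mg mh; have [s l] := rwtM E (mondeg_neq0 mg) (mondeg_neq0 mh).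
case: mg mh => sg lg [sh lh]; split; last by rewrite l lg lh mulr1.
by rewrite s sg sh addnS.
Qed.

Lemma mondeg1 : mondeg (rc 1) 0.
Proof.
by rewrite /mondeg /rwt /rc /= comp_polyC comp_poly0 mulr0 addr0 size_poly1 lead_coefC.
Qed.

Lemma rwt_rxm c : rwt (rxm c) = 'X^2 - c%:P :> {poly K}.
Proof. by rewrite /rwt /rxm /= comp_polyB comp_polyX comp_polyC comp_poly0 mulr0 addr0. Qed.

Lemma mondeg_rxm c : mondeg (rxm c) 2.
Proof. by rewrite /mondeg rwt_rxm size_XnsubC // lead_coefXnsubC. Qed.

Lemma mondeg3 (p : {poly K}) : (size p <= 2)%N -> mondeg (p, 1) 3.
Proof.
move=> sp; rewrite /mondeg /rwt /= comp_polyC mulr1 addrC.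
have s : (size (p \Po 'X^2) < size ('X^3 : {poly K}))%N.
  rewrite size_polyXn; have [->|p0] := eqVneq p 0; first by rewrite comp_poly0 size_poly0.
  have : size (p \Po 'X^2) != 0%N by rewrite size_poly_eq0 comp_poly_eq0 // size_polyXn.
  rewrite -lt0n => /prednK <-; rewrite size_comp_poly size_polyXn /=.
  by move: sp; case: (size p) => [|[|[|]]].
by rewrite size_polyDl // lead_coefDl // size_polyXn lead_coefXn.
Qed.

Lemma mondeg_rln l x1 y1 : mondeg (rln l x1 y1) 3.
Proof.
apply: mondeg3; apply: leq_trans (size_polyD _ _) _.
rewrite geq_max (leq_trans (size_polyC_leq1 _)) // size_polyN.
by rewrite (leq_trans (size_scale_leq _ _)) // size_polyX.
Qed.

Definition affine P : nat := if P is Some _ then 1 else 0.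

Definition ndeg A B : nat := if A is Some (x1, y1) then if B is Some (x2, y2) then
  if opposite A B then 2 else 3 else 0 else 0.
Definition ddeg A B : nat := if A is Some (x1, y1) then if B is Some (x2, y2) then
  if opposite A B then 0 else 2 else 0 else 0.

Lemma mondeg_numr A B : mondeg (numr A B) (ndeg A B).
Proof.
rewrite /ndeg /PointIdeals.numr; case: A => [[x1 y1]|]; last exact: mondeg1.
case: B => [[x2 y2]|]; last exact: mondeg1.
by case: ifP => _; [apply: mondeg_rxm | apply: mondeg_rln].
Qed.

Lemma mondeg_denr A B : mondeg (denr A B) (ddeg A B).
Proof.
rewrite /ddeg /PointIdeals.denr; case: A => [[x1 y1]|]; last exact: mondeg1.
case: B => [[x2 y2]|]; last exact: mondeg1.
by case: ifP => _; [apply: mondeg1 | apply: mondeg_rxm].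
Qed.

(** The divisor of h_{A,B} has degree 0, so its pole order at infinity is the number of its affine
    zeros minus that of its affine poles. *)
Lemma ndeg_ddeg A B : (ndeg A B + affine (A ++ B) = ddeg A B + affine A + affine B)%N.
Proof.
rewrite /ndeg /ddeg; case: A => [[x1 y1]|]; last by case: B => [[x2 y2]|].
case: B => [[x2 y2]|]; last by rewrite addp0.
by rewrite addpE /opposite; case: ifP.
Qed.

Lemma rmul_deg g h w v m n k : mondeg g m -> mondeg h n -> mondeg w k ->
  (forall x y, y ^+ 2 = ecub x -> ev g x y * ev h x y = ev w x y * ev v x y) ->
  exists2 j, mondeg v j & (m + n = k + j)%N.
Proof.
move=> mg mh mw e.
have e' : rmul g h = rmul w v by apply: (ev_inj (E := E)) => x y o; rewrite !evM ?e.
have v0 : rwt v != 0.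
  apply/eqP => v0; have := mondeg_neq0 (mondegM mg mh); rewrite e'.
  by rewrite (rwt_eq0 v0) (_ : rmul w (0, 0) = (0, 0)) ?rwt0 ?eqxx // /CurveRing.rmul /= !mulr0 mul0r addr0.
have [s l] := rwtM E (mondeg_neq0 mw) v0.
have [s' l'] := mondegM mg mh; rewrite -e' s' in s; rewrite -e' l' in l.
case: mw s l => -> -> s l; rewrite mul1r in l.
have sv : (0 < size (rwt v))%N by rewrite size_poly_gt0.
by exists (size (rwt v)).-1; [split; [rewrite prednK|] | move: s sv; lia].
Qed.

Lemma mondeg_neq1 g : ~ mondeg g 1.
Proof.
by case=> s; rewrite lead_coefE s /= rwt1 => /eqP; rewrite eq_sym oner_eq0.
Qed.

Lemma mondeg_snd g n : mondeg g n -> (n < 3)%N -> g.2 = 0.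
Proof.
move=> [s _] n3; apply/eqP/negPn/negP => v0.
have h : (size (g.2 \Po 'X^2)%R + 3 <= n.+1)%N by rewrite -s size_rwt2.
have s0 : (0 < size (g.2 \Po 'X^2)%R)%N by rewrite size_poly_gt0 comp_poly_eq0 ?size_polyXn.
by lia.
Qed.

Lemma size_fst g n : size (rwt g) = n.+1 -> (size g.1 <= (n./2).+1)%N.
Proof.
move=> s; apply/leq_sizeP => j hj; rewrite -rwt_even nth_default // s.
by move: hj; rewrite -ltn_double => h; lia.
Qed.

Lemma mondeg0E g : mondeg g 0 -> forall x y, ev g x y = 1.
Proof.
move=> m x y; have g2 := mondeg_snd m isT; case: m => s l.
have := size_fst s => /size1_polyC e.
rewrite /ev g2 horner0 mul0r addr0 e hornerC.
by have := rwt_even g 0; rewrite -l lead_coefE s /= => <-.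
Qed.

Lemma mondeg2E g : mondeg g 2 -> exists c, forall x y, ev g x y = x - c.
Proof.
move=> m; have g2 := mondeg_snd m isT; case: m => s l.
have s1 := size_fst s; exists (- g.1`_0) => x y; rewrite /ev g2 horner0 mul0r addr0.
have e1 : g.1`_1 = 1 by rewrite -rwt_even -l lead_coefE s.
rewrite (horner_coef_wide _ s1) !big_ord_recl big_ord0 /= e1 expr0 expr1; ring.
Qed.

Lemma mondeg3E g : mondeg g 3 -> exists c d, forall x y, ev g x y = y + c * x + d.
Proof.
move=> m; case: m => s l.
have s1 := size_fst s.
have e1 : g.2`_0 = 1 by rewrite -rwt_odd -l lead_coefE s.
have s2 : (size g.2 <= 1)%N.
  by apply/leq_sizeP => j hj; rewrite -rwt_odd nth_default // s; lia.
exists g.1`_1, g.1`_0 => x y; rewrite /ev.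
rewrite (horner_coef_wide _ s1) (size1_polyC s2) hornerC e1 !big_ord_recl big_ord0 /= expr0 expr1; ring.
Qed.

(** Rebracketing of I_A I_B I_C: [vanish_mul] twice expands an element into sums of triple products,
    which [mul_vanish] contracts in the other order. *)
Lemma shift_ideal A B C s : onc A -> onc B -> onc C -> vanish ((A ++ B) ++ C) s ->
  exists2 s', vanish (A ++ (B ++ C)) s' & forall x y, y ^+ 2 = ecub x ->
  ev (numr A B) x y * ev (numr (A ++ B) C) x y * ev (denr B C) x y * ev (denr A (B ++ C)) x y * ev s x y
  = ev (denr A B) x y * ev (denr (A ++ B) C) x y * ev (numr B C) x y * ev (numr A (B ++ C)) x y * ev s' x y.
Proof.
move=> oA oB oC vs; have oAB := onc_add oA oB; have oBC := onc_add oB oC.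
have [L HL eL] := vanish_mul oAB oC vs.
have main de ga : vanish (A ++ B) de -> vanish C ga -> exists2 s', vanish (A ++ (B ++ C)) s' &
   forall x y, y ^+ 2 = ecub x ->
   ev (numr A B) x y * ev (denr B C) x y * ev (denr A (B ++ C)) x y * (ev de x y * ev ga x y)
   = ev (denr A B) x y * ev (numr B C) x y * ev (numr A (B ++ C)) x y * ev s' x y.
  move=> vd vg; have [M HM eM] := vanish_mul oA oB vd.
  have key : exists2 s', vanish (A ++ (B ++ C)) s' & forall x y, y ^+ 2 = ecub x ->
     ev (denr B C) x y * ev (denr A (B ++ C)) x y * ((\sum_(p <- M) ev p.1 x y * ev p.2 x y) * ev ga x y)
    = ev (numr B C) x y * ev (numr A (B ++ C)) x y * ev s' x y.
    elim: M HM {eM} => [|[al be] M IH] HM.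
      exists (rc 0) => [|x y o]; last by rewrite big_nil evc; ring.
      by case: (A ++ _) => [[x y]|] //=; rewrite evc.
    have [|s' vs' es'] := IH; first by move=> p pM; apply: HM; rewrite inE pM orbT.
    have [va vb] := HM _ (mem_head _ _).
    have [g' vg' eg'] := mul_vanish oB oC vb vg.
    have [g'' vg'' eg''] := mul_vanish oA oBC va vg'.
    exists (radd g'' s') => [|x y o].
      by move: vs' vg''; case: (A ++ _) => [[x y]|] //= e1 e2; rewrite evD e1 e2 addr0.
    have h0 := es' x y o; have h1 := eg' x y o; have h2 := eg'' x y o.
    rewrite big_cons /= evD.
    transitivity (ev (denr A (B ++ C)) x y * ev al x y * (ev (denr B C) x y * (ev be x y * ev ga x y)) +
       ev (denr B C) x y * ev (denr A (B ++ C)) x y * ((\sum_(j <- M) ev j.1 x y * ev j.2 x y) * ev ga x y)).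
      by ring.
    rewrite h1 h0.
    transitivity (ev (numr B C) x y * (ev (denr A (B ++ C)) x y * (ev al x y * ev g' x y))
      + ev (numr B C) x y * ev (numr A (B ++ C)) x y * ev s' x y); first by ring.
    by rewrite h2; ring.
  have [s' vs' es'] := key; exists s' => // x y o.
  transitivity (ev (denr B C) x y * ev (denr A (B ++ C)) x y * ((ev (numr A B) x y * ev de x y) * ev ga x y)); first by ring.
  rewrite eM //.
  transitivity (ev (denr A B) x y * (ev (denr B C) x y * ev (denr A (B ++ C)) x y * ((\sum_(p <- M) ev p.1 x y * ev p.2 x y) * ev ga x y))); first by ring.
  by rewrite es' //; ring.
have key : exists2 s', vanish (A ++ (B ++ C)) s' & forall x y, y ^+ 2 = ecub x ->
   ev (numr A B) x y * ev (denr B C) x y * ev (denr A (B ++ C)) x y * (\sum_(p <- L) ev p.1 x y * ev p.2 x y)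
   = ev (denr A B) x y * ev (numr B C) x y * ev (numr A (B ++ C)) x y * ev s' x y.
  elim: L HL {eL} => [|[de ga] L IH] HL.
    exists (rc 0) => [|x y o]; last by rewrite big_nil evc; ring.
    by case: (A ++ _) => [[x y]|] //=; rewrite evc.
  have [|s' vs' es'] := IH; first by move=> p pM; apply: HL; rewrite inE pM orbT.
  have [va vb] := HL _ (mem_head _ _).
  have [g vg eg] := main _ _ va vb.
  exists (radd g s') => [|x y o].
    by move: vs' vg; case: (A ++ _) => [[x y]|] //= e1 e2; rewrite evD e1 e2 addr0.
  by rewrite big_cons mulrDr /= eg // es' // evD; ring.
have [s' vs' es'] := key; exists s' => // x y o.
transitivity (ev (numr A B) x y * ev (denr B C) x y * ev (denr A (B ++ C)) x y * (ev (numr (A ++ B) C) x y * ev s x y)); first by ring.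
rewrite eL //.
transitivity (ev (denr (A ++ B) C) x y * (ev (numr A B) x y * ev (denr B C) x y * ev (denr A (B ++ C)) x y * (\sum_(p <- L) ev p.1 x y * ev p.2 x y))); first by ring.
by rewrite es' //; ring.
Qed.

(** By [shift_ideal], multiplication by u / w sends the ideal of (A + B) + C into that of A + (B +
    C). Both u and w are monic at infinity; the images of the functions of lowest pole order force
    the two points to agree and u = w. *)
Theorem addp_assoc_cocycle A B C : onc A -> onc B -> onc C ->
  (A ++ B) ++ C = A ++ (B ++ C) /\ forall x y, y ^+ 2 = ecub x ->
  ev (numr A B) x y * ev (numr (A ++ B) C) x y * ev (denr B C) x y * ev (denr A (B ++ C)) x y
  = ev (denr A B) x y * ev (denr (A ++ B) C) x y * ev (numr B C) x y * ev (numr A (B ++ C)) x y.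
Proof.
move=> oA oB oC.
have sh s := @shift_ideal A B C s oA oB oC.
pose u := rmul (rmul (rmul (numr A B) (numr (A ++ B) C)) (denr B C)) (denr A (B ++ C)).
pose w := rmul (rmul (rmul (denr A B) (denr (A ++ B) C)) (numr B C)) (numr A (B ++ C)).
have mu := mondegM (mondegM (mondegM (mondeg_numr A B) (mondeg_numr (A ++ B) C)) (mondeg_denr B C)) (mondeg_denr A (B ++ C)).
have mw := mondegM (mondegM (mondegM (mondeg_denr A B) (mondeg_denr (A ++ B) C)) (mondeg_numr B C)) (mondeg_numr A (B ++ C)).
rewrite -/u in mu; rewrite -/w in mw.
have eu x y : y ^+ 2 = ecub x -> ev (numr A B) x y * ev (numr (A ++ B) C) x y * ev (denr B C) x y * ev (denr A (B ++ C)) x y = ev u x y.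
  by move=> o; rewrite /u !evM.
have ew' x y : y ^+ 2 = ecub x -> ev (denr A B) x y * ev (denr (A ++ B) C) x y * ev (numr B C) x y * ev (numr A (B ++ C)) x y = ev w x y.
  by move=> o; rewrite /w !evM.
have d1 := ndeg_ddeg A B; have d2 := ndeg_ddeg (A ++ B) C; have d3 := ndeg_ddeg B C.
have d4 := ndeg_ddeg A (B ++ C).
set du := (_ + _ + _ + _)%N in mu; set dw := (_ + _ + _ + _)%N in mw.
have duw : (du + affine ((A ++ B) ++ C) = dw + affine (A ++ (B ++ C)))%N by rewrite /du /dw; lia.
clear d1 d2 d3 d4; clearbody du dw u w.
have {}sh s : vanish ((A ++ B) ++ C) s -> exists2 s', vanish (A ++ (B ++ C)) s' &
    forall x y, y ^+ 2 = ecub x -> ev u x y * ev s x y = ev w x y * ev s' x y.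
  by move=> /sh[s' v e]; exists s' => // x y o; rewrite -eu // -ew' // e.
suff H : (A ++ B) ++ C = A ++ (B ++ C) /\ u = w.
  by case: H => -> e; split=> // x y o; rewrite eu // ew' // e.
clear eu ew'; move: sh duw; move: ((A ++ B) ++ C) (A ++ (B ++ C)) => S1 S2.
case: S1 => [[x1 y1]|] sh duw; last first.
  have [|s' vs' e] := sh (rc 1); first by [].
  have [j mj ej] := rmul_deg mu mondeg1 mw e.
  case: S2 vs' duw {sh} => [[x2 y2]|] vs' /= duw.
    (* A function of pole order 1 would have to exist. *)
    have j1 : j = 1%N by lia.
    by rewrite j1 in mj; case: (mondeg_neq1 mj).
  have j0 : j = 0%N by lia.
  rewrite j0 in mj; split=> //; apply: (ev_inj (E := E)) => x y o.
  by have := e x y o; rewrite evc !mulr1 (mondeg0E mj) mulr1.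
(* The test functions are x - x1 and y - y1 ([rln 0] is a horizontal line); their images have pole
   orders 2 and 3, hence the shapes x - c and y + p x + q. *)
have [|s' vs' e] := sh (rxm x1); first by rewrite /= ev_rxm subrr.
have [|s2 vs2 e2] := sh (rln 0 x1 y1); first by rewrite /= ev_rln; ring.
have [j mj ej] := rmul_deg mu (mondeg_rxm _) mw e.
have [j' mj' ej'] := rmul_deg mu (mondeg_rln _ _ _) mw e2.
case: S2 vs' vs2 duw {sh} => [[x2 y2]|] vs' vs2 /= duw; last first.
  have j1 : j = 1%N by lia.
  by rewrite j1 in mj; case: (mondeg_neq1 mj).
have jE : j = 2%N by lia.
have jE' : j' = 3%N by lia.
rewrite jE in mj; rewrite jE' in mj'.
have [c hc] := mondeg2E mj; have [p [q hp]] := mondeg3E mj'.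
have ec : c = x2 by move: vs'; rewrite /= hc => /eqP; rewrite subr_eq0 => /eqP.
have vy : y2 + p * x2 + q = 0 by move: vs2; rewrite /= hp.
have w0 := mondeg_neq0 mw.
have e3 : rmul (rxm x2) (rln 0 x1 y1) = rmul (rxm x1) s2.
  apply: (rmul_cancel (E := E) w0) => x y o; rewrite !evM // !ev_rxm.
  transitivity ((ev w x y * ev s' x y) * ev (rln 0 x1 y1) x y); first by rewrite hc ec; ring.
  rewrite -e // ev_rxm.
  transitivity ((ev u x y * ev (rln 0 x1 y1) x y) * (x - x1)); first by ring.
  by rewrite e2 //; ring.
have e4 x y : y ^+ 2 = ecub x -> (x - x2) * (y - y1) = (x - x1) * (y + p * x + q).
  move=> o; have := congr1 (fun g => ev g x y) e3; rewrite !evM // !ev_rxm ev_rln hp => h.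
  by rewrite -h; ring.
pose t : rg K := (((y1 * x2 + x1 * q)%:P + (x1 * p - y1 - q) *: 'X) - p *: 'X^2, (x1 - x2)%:P).
have t0 : t = (0, 0).
  apply: (ev_eq0 (E := E)) => x y o; rewrite /ev /t /= !hornE.
  transitivity ((x - x2) * (y - y1) - (x - x1) * (y + p * x + q)); first by ring.
  by rewrite e4 // subrr.
move: (congr1 fst t0) (congr1 snd t0) => /= t1 /eqP; rewrite polyC_eq0 subr_eq0 => /eqP ex.
have cf i : ((y1 * x2 + x1 * q)%:P + (x1 * p - y1 - q) *: 'X - p *: 'X^2)`_i = 0 by rewrite t1 coef0.
have p0 : p = 0.
  have := cf 2; rewrite !coefD coefN !coefZ coefC coefX coefXn /= => h.
  by rewrite -[LHS]opprK -[RHS]oppr0 -h; ring.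
have q1 : q = - y1.
  have := cf 1%N; rewrite !coefD coefN !coefZ coefC coefX coefXn /= p0 => h.
  by rewrite -[LHS]addr0 -h; ring.
split.
  by rewrite ex; congr (Some (_, _)); apply/eqP; rewrite -subr_eq0 -oppr_eq0 -vy p0 q1; apply/eqP; ring.
have x0 := mondeg_neq0 (mondeg_rxm x1).
apply: (rmul_cancel (E := E) x0) => x y o; rewrite mulrC e // hc ec -ex ev_rxm; ring.
Qed.

End Assoc2.

End CocycleLaw.

(** * The group of points and the values of the functions h *)

Module CurveGroup.
Import CurveRing PointIdeals CocycleLaw.

Section Group.
Variables (K : numClosedFieldType) (E : ecurve K).

Definition ept := {P : point K | onc E P}.
HB.instance Definition _ := Choice.on ept.

Definition ept0 : ept := exist _ None isT.
Definition eptN (A : ept) : ept := exist _ (eopp (val A)) (etrans (onc_opp E (val A)) (valP A)).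
Definition eptD (A B : ept) : ept := exist _ (add_pt (ew E) (val A) (val B)) (onc_add (valP A) (valP B)).

Lemma eptDA : associative eptD.
Proof.
move=> A B C; apply: val_inj => /=.
by case: (addp_assoc_cocycle (valP A) (valP B) (valP C)) => ->.
Qed.
Lemma eptDC : commutative eptD.
Proof. by move=> A B; apply: val_inj; apply: (addpC (valP A) (valP B)). Qed.
Lemma ept0D : left_id ept0 eptD.
Proof. by move=> A; apply: val_inj. Qed.
Lemma eptND : left_inverse ept0 eptN eptD.
Proof. by move=> A; rewrite eptDC; apply: val_inj; apply: (addpN (valP A)). Qed.

HB.instance Definition _ := GRing.isZmodule.Build ept eptDA eptDC ept0D eptND.

Lemma valD (A B : ept) : val (A + B) = add_pt (ew E) (val A) (val B).
Proof. by []. Qed.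
Lemma valN (A : ept) : val (- A) = eopp (val A).
Proof. by []. Qed.
Lemma val0 : val (0 : ept) = None.
Proof. by []. Qed.

Lemma val_muln (A : ept) n : val (A *+ n) = muln_pt (ew E) n (val A).
Proof.
elim: n => [|n IH]; first by rewrite mulr0n.
by rewrite mulrS valD IH.
Qed.

Lemma valSomeP (A : ept) x y : val A = Some (x, y) -> y ^+ 2 = ecub E x.
Proof. by move=> e; have := valP A; rewrite e => /onc_eq. Qed.

Lemma val_None (A : ept) : val A = None -> A = 0.
Proof. by move=> e; apply: val_inj. Qed.

Lemma same_x (A B : ept) x y y' : val A = Some (x, y) -> val B = Some (x, y') -> A = B \/ A = - B.
Proof.
move=> eA eB; have : (y - y') * (y + y') = 0.
  by rewrite -subr_sqr (valSomeP eA) (valSomeP eB) subrr.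
move/eqP; rewrite mulf_eq0 subr_eq0 addr_eq0 => /orP[] /eqP e; [left|right]; apply: val_inj.
  by rewrite eA eB e.
by rewrite eA valN eB e.
Qed.

(** The default -1 at O is not a value of the function. It is the convention under which [hv_rec]
    and the telescoping products keep one form when an argument reaches O. *)
Definition hv (A B X : ept) : K :=
  if val X is Some (x, y) then
    ev (numr E (val A) (val B)) x y / ev (denr E (val A) (val B)) x y
  else -1.

Lemma hv0l B X : X != 0 -> hv 0 B X = 1.
Proof.
rewrite /hv; case e: (val X) => [[x y]|]; last by rewrite (val_None e) eqxx.
by rewrite /= evc divr1.
Qed.
Lemma hv0r A X : X != 0 -> hv A 0 X = 1.
Proof.
rewrite /hv; case e: (val X) => [[x y]|]; last by rewrite (val_None e) eqxx.
by case: (val A) => [[x1 y1]|] /= _; rewrite evc divr1.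
Qed.

Lemma oppositeP (A B : ept) : opposite (val A) (val B) -> A = - B.
Proof.
case eA: (val A) => [[x1 y1]|] //; case eB: (val B) => [[x2 y2]|] //= /andP[/eqP ex /eqP ey].
apply: val_inj; rewrite eA valN eB /= ex; congr (Some (_, _)).
by apply/eqP; rewrite -addr_eq0 ey.
Qed.

Lemma opposite_add (A B : ept) x1 y1 x2 y2 : val A = Some (x1, y1) -> val B = Some (x2, y2) ->
  ~~ opposite (val A) (val B) -> let l := slope E x1 y1 x2 y2 in
  val (A + B) = Some (l ^+ 2 - x1 - x2, l * (x1 - (l ^+ 2 - x1 - x2)) - y1).
Proof. by move=> eA eB; rewrite valD eA eB addpE /opposite => /negPf ->. Qed.

Lemma den_neq0 (A B X : ept) x y : val X = Some (x, y) -> X != A + B -> X != - (A + B) ->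
  ev (denr E (val A) (val B)) x y != 0.
Proof.
move=> eX n1 n2; rewrite /denr; case eA: (val A) => [[x1 y1]|]; last by rewrite evc oner_eq0.
case eB: (val B) => [[x2 y2]|]; last by rewrite evc oner_eq0.
rewrite -eA -eB; case: ifP => [_|/negbT no]; first by rewrite evc oner_eq0.
have eS := opposite_add eA eB no; rewrite ev_rxm subr_eq0; apply/eqP => ex.
by rewrite ex in eX; case: (same_x eX eS) => e; rewrite e eqxx in n1 n2.
Qed.

Lemma num_neq0 (A B X : ept) x y : val X = Some (x, y) -> X != A -> X != B -> X != - (A + B) ->
  ev (numr E (val A) (val B)) x y != 0.
Proof.
move=> eX n1 n2 n3; rewrite /numr; case eA: (val A) => [[x1 y1]|]; last by rewrite evc oner_eq0.
case eB: (val B) => [[x2 y2]|]; last by rewrite evc oner_eq0.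
rewrite -eA -eB; case: ifP => [op|/negbT no].
  have eAB := oppositeP op; rewrite ev_rxm subr_eq0; apply/eqP => ex.
  rewrite ex in eX; case: (same_x eX eA) => e; first by rewrite e eqxx in n1.
  by rewrite e eAB opprK eqxx in n2.
have eS := opposite_add eA eB no; rewrite ev_rln.
have no' : ~~ ((x1 == x2) && (y1 + y2 == 0)) by move: no; rewrite eA eB.
have oA : onc E (Some (x1, y1)) by rewrite -eA (valP A).
have oB : onc E (Some (x2, y2)) by rewrite -eB (valP B).
have cub := chord_cubic oA oB no'; have [ey _ _ _] := chordP oA oB no'.
rewrite subr_eq0 subr_eq; apply/eqP => e.
have {}e : y = y1 + slope E x1 y1 x2 y2 * (x - x1) by rewrite e addrC.
have := cub x; rewrite -(valSomeP eX) -e subrr => /esym/eqP.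
rewrite !mulf_eq0 !subr_eq0 => /orP[/orP[]|] /eqP ex.
- by case/eqP: n1; apply: val_inj; rewrite eX eA e ex subrr mulr0 addr0.
- by case/eqP: n2; apply: val_inj; rewrite eX eB e ex [in RHS]ey.
- case/eqP: n3; apply: val_inj; rewrite eX valN eS /= e ex; congr (Some (_, _)); ring.
Qed.

Lemma hv_neq0 (A B X : ept) : X != A -> X != B -> X != A + B -> X != - (A + B) -> hv A B X != 0.
Proof.
move=> n1 n2 n3 n4; rewrite /hv; case e: (val X) => [[x y]|]; last by rewrite oppr_eq0 oner_eq0.
by rewrite mulf_neq0 ?invr_eq0 ?(den_neq0 e) // (num_neq0 e).
Qed.

Lemma hv_coc (A B C X : ept) : X != 0 -> X != A + B -> X != - (A + B) -> X != B + C -> X != - (B + C) ->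
  X != A + B + C -> X != - (A + B + C) ->
  hv A B X * hv (A + B) C X = hv A (B + C) X * hv B C X.
Proof.
move=> n0 n1 n2 n3 n4 n5 n6; rewrite /hv; case e: (val X) => [[x y]|]; last by rewrite (val_None e) eqxx in n0.
have [_ /(_ x y (valSomeP e))] := addp_assoc_cocycle (valP A) (valP B) (valP C).
rewrite -!valD.
have d1 := den_neq0 e n1 n2; have d2 := den_neq0 e n3 n4.
have d3 := den_neq0 e n5 n6.
have d4 : ev (denr E (val A) (val (B + C))) x y != 0 by apply: (den_neq0 e); rewrite addrA.
move: (ev (numr E (val A) (val B)) x y) d1; move: (ev (denr E (val A) (val B)) x y) => d n d1.
move: (ev (numr E (val B) (val C)) x y) d2; move: (ev (denr E (val B) (val C)) x y) => d' n' d2.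
move: (ev (numr E (val (A + B)) (val C)) x y) d3; move: (ev (denr E (val (A + B)) (val C)) x y) => d'' n'' d3.
move: (ev (numr E (val A) (val (B + C))) x y) d4; move: (ev (denr E (val A) (val (B + C))) x y) => k m d4 h.
apply: (mulfI d1); apply: (mulfI d2); apply: (mulfI d3); apply: (mulfI d4).
transitivity (n * n'' * d' * k); first by field; rewrite ?d1 ?d2 ?d3 ?d4.
by rewrite h; field; rewrite ?d1 ?d2 ?d3 ?d4.
Qed.

Lemma hvC A B X : X != 0 -> hv A B X = hv B A X.
Proof.
move=> X0; rewrite /hv; case e: (val X) => [[x y]|] //.
case eA: (val A) => [[x1 y1]|]; case eB: (val B) => [[x2 y2]|] //.
have oA : onc E (Some (x1, y1)) by rewrite -eA (valP A).
have oB : onc E (Some (x2, y2)) by rewrite -eB (valP B).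
rewrite /numr /denr /opposite [x2 == x1]eq_sym [y2 + y1]addrC.
case: ifP => [/andP[/eqP -> _]//|/negbT no].
have [ey _ _ h] := chordP oA oB no.
have es : slope E x2 y2 x1 y1 = slope E x1 y1 x2 y2.
  rewrite /slope [x2 == x1]eq_sym; case: eqP => [e'|/eqP n]; first by case: (h e') => <- _; rewrite e'.
  by rewrite -[y1 - y2]opprB -[x1 - x2]opprB invrN mulrNN.
rewrite es; move: (slope E x1 y1 x2 y2) ey => l ey.
rewrite !ev_rln !ev_rxm; congr (_ / _); [rewrite ey|]; ring.
Qed.

End Group.

End CurveGroup.

(** * Weil reciprocity for the functions h *)

Module Reciprocity.
Import CurveRing PointIdeals CocycleLaw CurveGroup.

Section Reciprocity.
Variables (K : numClosedFieldType) (E : ecurve K).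
Implicit Types (A B C D P Q S T U X Y Z : ept E).

Lemma affineP A : A != 0 -> exists x y, val A = Some (x, y).
Proof.
by case e: (val A) => [[x y]|]; [exists x, y | rewrite (val_None e) eqxx].
Qed.

Lemma neq_x A B x y x' y' : val A = Some (x, y) -> val B = Some (x', y') ->
  A != B -> A != - B -> x - x' != 0.
Proof.
move=> eA eB n1 n2; rewrite subr_eq0; apply/eqP => e; rewrite e in eA.
by case: (same_x eA eB) => h; rewrite h eqxx in n1 n2.
Qed.

Lemma lineP C D : C != 0 -> D != 0 -> C + D != 0 -> exists l m xC xD xU,
  [/\ val C = Some (xC, l * xC + m), val D = Some (xD, l * xD + m),
      val (C + D) = Some (xU, - (l * xU + m)),
      forall x, ecub E x - (l * x + m) ^+ 2 = (x - xC) * (x - xD) * (x - xU) &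
      forall X x y, val X = Some (x, y) -> hv C D X = (y - (l * x + m)) / (x - xU)].
Proof.
move=> /affineP[x1 [y1 eC]] /affineP[x2 [y2 eD]] nU.
have no : ~~ opposite (val C) (val D) by apply: contra nU => /oppositeP ->; rewrite addNr.
have eU := opposite_add eC eD no.
have no' : ~~ ((x1 == x2) && (y1 + y2 == 0)) by move: no; rewrite eC eD.
have oC : onc E (Some (x1, y1)) by rewrite -eC (valP C).
have oD : onc E (Some (x2, y2)) by rewrite -eD (valP D).
have cub := chord_cubic oC oD no'; have [ey _ _ _] := chordP oC oD no'.
have hV X x y : val X = Some (x, y) -> hv C D X = (y - y1 - slope E x1 y1 x2 y2 * (x - x1)) /
    (x - (slope E x1 y1 x2 y2 ^+ 2 - x1 - x2)).
  move=> eX; rewrite /hv eX eC eD /numr /denr -{1 2}eC -{1 2}eD.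
  by rewrite /opposite eC eD (negPf no') ev_rln ev_rxm.
move: eU hV cub ey; move: (slope E x1 y1 x2 y2) => l eU hV cub ey.
exists l, (y1 - l * x1), x1, x2, (l ^+ 2 - x1 - x2); split.
- by rewrite eC; congr (Some (_, _)); ring.
- by rewrite eD ey; congr (Some (_, _)); ring.
- by rewrite eU; congr (Some (_, _)); ring.
- by move=> x; rewrite -cub; congr (_ - _ ^+ 2); ring.
- by move=> X x y /hV ->; congr (_ / _); ring.
Qed.

(* The two triples of abscissae are the roots of [f - l^2] and [f - m^2]; both products are,
   up to the same factor, the value of these cubics at the common abscissa of the two lines. *)
Lemma line_reciprocity (l m l' m' xA xB xS xC xD xU : K) :
  (forall x, ecub E x - (l * x + m) ^+ 2 = (x - xA) * (x - xB) * (x - xS)) ->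
  (forall x, ecub E x - (l' * x + m') ^+ 2 = (x - xC) * (x - xD) * (x - xU)) ->
  let d x := (l' - l) * x + (m' - m) in
  d xA * d xB * d xS = d xC * d xD * d xU.
Proof.
move=> h1 h2 d; rewrite /d; have [e|n] := eqVneq (l' - l) 0; first by rewrite e !mul0r.
pose x0 := - (m' - m) / (l' - l).
have e0 : l * x0 + m = l' * x0 + m'.
  by apply/eqP; rewrite -subr_eq0 /x0; apply/eqP; field.
have := h1 x0; rewrite e0 h2 => h.
have dE x : (l' - l) * x + (m' - m) = (l' - l) * (x - x0) by rewrite /x0; field.
rewrite !dE.
transitivity (- (l' - l) ^+ 3 * ((x0 - xA) * (x0 - xB) * (x0 - xS))); first by ring.
by rewrite -h; ring.
Qed.

Definition separated A B C D := forall Y Z, Y \in [:: A; B; A + B] -> Z \in [:: C; D; C + D] ->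
  Y != Z /\ Y != - Z.

(** A + B and C + D are the reflections of the third intersection points. The equation of the cubic
    along each line turns the values there into products of differences of abscissae, after which
    [line_reciprocity] compares the two sides. *)
Lemma hv_rec A B C D : C != 0 -> D != 0 -> C + D != 0 -> separated A B C D ->
  hv A B C * hv A B D * hv C D (A + B) = - (hv C D A * hv C D B * hv A B (C + D)).
Proof.
move=> C0 D0 U0 sep.
have h0 Z W : hv Z W 0 = -1 by [].
have [->|A0] := eqVneq A 0; first by rewrite !hv0l // add0r h0; ring.
have [->|B0] := eqVneq B 0; first by rewrite !hv0r // addr0 h0; ring.
have [l [m [xC [xD [xU [eC eD eU cub hV]]]]]] := lineP C0 D0 U0.
have sA Z (hZ : Z \in [:: C; D; C + D]) := sep A Z (mem_head _ _) hZ.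
have sS Z (hZ : Z \in [:: C; D; C + D]) : A + B != Z /\ A + B != - Z.
  by apply: sep => //; rewrite !inE eqxx !orbT.
have sB Z (hZ : Z \in [:: C; D; C + D]) : B != Z /\ B != - Z.
  by apply: sep => //; rewrite !inE eqxx orbT.
have iC : C \in [:: C; D; C + D] by rewrite inE eqxx.
have iD : D \in [:: C; D; C + D] by rewrite !inE eqxx orbT.
have iU : C + D \in [:: C; D; C + D] by rewrite !inE eqxx !orbT.
have [S0|S0] := eqVneq (A + B) 0.
  have eB : B = - A by apply/eqP; rewrite -addr_eq0 addrC S0.
  have [xA [yA eA]] := affineP A0.
  have vA X x y : val X = Some (x, y) -> hv A B X = x - xA.
    by move=> eX; rewrite /hv eX eB valN eA /numr /denr /= eqxx subrr eqxx /= evc ev_rxm divr1.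
  rewrite S0 h0 (vA _ _ _ eC) (vA _ _ _ eD) (vA _ _ _ eU) (hV _ _ _ eA).
  rewrite eB (hV (- A) xA (- yA)) ?valN ?eA //.
  have n : xA - xU != 0 by case: (sA _ iU) => ? ?; apply: (neq_x eA eU).
  have c := cub xA; rewrite -(valSomeP eA) in c.
  have -> : (yA - (l * xA + m)) / (xA - xU) * ((- yA - (l * xA + m)) / (xA - xU)) =
    - (yA ^+ 2 - (l * xA + m) ^+ 2) / (xA - xU) ^+ 2 by field.
  by rewrite c; field.
have [l' [m' [xA [xB [xS [eA eB eS cub' hV']]]]]] := lineP A0 B0 S0.
rewrite (hV _ _ _ eA) (hV _ _ _ eB) (hV _ _ _ eS) (hV' _ _ _ eC) (hV' _ _ _ eD) (hV' _ _ _ eU).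
have nAU : xA - xU != 0 by case: (sA _ iU) => ? ?; apply: (neq_x eA eU).
have nBU : xB - xU != 0 by case: (sB _ iU) => ? ?; apply: (neq_x eB eU).
have nSU : xS - xU != 0 by case: (sS _ iU) => ? ?; apply: (neq_x eS eU).
have nSC : xS - xC != 0 by case: (sS _ iC) => ? ?; apply: (neq_x eS eC).
have nSD : xS - xD != 0 by case: (sS _ iD) => ? ?; apply: (neq_x eS eD).
have rec := line_reciprocity cub' cub.
have c1 := cub xS; have c2 := cub' xU.
have f1 : ecub E xS = (l' * xS + m') ^+ 2 by rewrite -(valSomeP eS) sqrrN.
have f2 : ecub E xU = (l * xU + m) ^+ 2 by rewrite -(valSomeP eU) sqrrN.
rewrite f1 in c1; rewrite f2 in c2.
have n1 : (l' * xS + m') - (l * xS + m) != 0.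
  have : (xS - xC) * (xS - xD) * (xS - xU) != 0 by rewrite !mulf_neq0.
  by rewrite -c1 subr_sqr; rewrite mulf_eq0 negb_or => /andP[].
have n2 : (l * xU + m) - (l' * xU + m') != 0.
  have : (xU - xA) * (xU - xB) * (xU - xS) != 0.
    by rewrite !mulf_neq0 // -opprB oppr_eq0.
  by rewrite -c2 subr_sqr; rewrite mulf_eq0 negb_or => /andP[].
have nCS : xC - xS != 0 by rewrite -opprB oppr_eq0.
have nDS : xD - xS != 0 by rewrite -opprB oppr_eq0.
have nUS : xU - xS != 0 by rewrite -opprB oppr_eq0.
set MS := (l' * xS + m') - (l * xS + m) in n1.
set LU := (l * xU + m) - (l' * xU + m') in n2.
(* The product of [MS] with the value of the other line at the reflected point is a difference of
   squares, known from [cub]; likewise for [LU] and [cub']. *)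
apply: (mulfI n1); apply: (mulfI n2).
pose LC := l * xC + m - (l' * xC + m'); pose LD := l * xD + m - (l' * xD + m').
pose MA := l' * xA + m' - (l * xA + m); pose MB := l' * xB + m' - (l * xB + m).
have r : LC * LD * LU = - (MA * MB * MS).
  rewrite /LC /LD /LU /MA /MB /MS /= in rec *.
  transitivity (((l - l') * xC + (m - m')) * ((l - l') * xD + (m - m')) * ((l - l') * xU + (m - m'))); first by ring.
  by rewrite -rec; ring.
have e1 : MS * (- (l' * xS + m') - (l * xS + m)) = - ((xS - xC) * (xS - xD) * (xS - xU)).
  by rewrite -c1 /MS; ring.
have e2 : LU * (- (l * xU + m) - (l' * xU + m')) = - ((xU - xA) * (xU - xB) * (xU - xS)).
  by rewrite -c2 /LU; ring.
rewrite -/LC -/LD -/MA -/MB.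
set p := - (l' * xS + m') - (l * xS + m) in e1 *.
set q := - (l * xU + m) - (l' * xU + m') in e2 *.
transitivity ((LC * LD * LU) * (MS * p) / ((xC - xS) * (xD - xS) * (xS - xU))).
  by field; rewrite ?nCS ?nDS ?nSU.
transitivity (- (MA * MB * MS) * (LU * q) / ((xA - xU) * (xB - xU) * (xU - xS))).
  by rewrite r e1 e2; field; rewrite ?nCS ?nDS ?nSU ?nUS ?nAU ?nBU.
by field; rewrite ?nUS ?nAU ?nBU.
Qed.

End Reciprocity.

End Reciprocity.

(** * Miller functions and additivity of the Weil pairing *)

Module MillerFunctions.
Import CurveRing PointIdeals CocycleLaw CurveGroup Reciprocity.

Section Pairing.
Variables (K : numClosedFieldType) (E : ecurve K) (n : nat).
Hypothesis odd_n : odd n.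
Implicit Types (A B C D P Q S T U X Y Z : ept E).

Local Notation tor P := (P *+ n = 0).
Local Notation ntor P := (is_true (P *+ n != 0)).

Lemma ntor_neq X Y : ntor (X - Y) -> X != Y.
Proof. by apply: contraNneq => ->; rewrite subrr mul0rn. Qed.
Lemma ntor_neqN X Y : ntor (X + Y) -> X != - Y.
Proof. by apply: contraNneq => ->; rewrite addNr mul0rn. Qed.
Lemma ntorD X P : tor P -> ntor X -> ntor (X + P).
Proof. by move=> tP; rewrite mulrnDl tP addr0. Qed.
Lemma ntorDl X P : tor P -> ntor X -> ntor (P + X).
Proof. by move=> tP; rewrite mulrnDl tP add0r. Qed.
Lemma ntorN X : ntor X -> ntor (- X).
Proof. by rewrite mulNrn oppr_eq0. Qed.
Lemma torD P Q : tor P -> tor Q -> tor (P + Q).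
Proof. by move=> tP tQ; rewrite mulrnDl tP tQ addr0. Qed.
Lemma torN P : tor P -> tor (- P).
Proof. by move=> tP; rewrite mulNrn tP oppr0. Qed.
Lemma torM P k : tor P -> tor (P *+ k).
Proof. by move=> tP; rewrite mulrnAC tP mul0rn. Qed.
Lemma ntor_neq0 X : ntor X -> X != 0.
Proof. by apply: contraNneq => ->; rewrite mul0rn. Qed.
Lemma tor_ntor_neq P X : tor P -> ntor X -> P != X /\ P != - X.
Proof.
move=> tP nX; split; first by rewrite eq_sym; apply: ntor_neq; apply: ntorD => //; apply: torN.
by apply: ntor_neqN; apply: ntorDl.
Qed.

(* [ff P] has divisor n (P) - n (O) when P has order dividing n. *)
Definition ff P X : K := \prod_(k < n) hv P (P *+ k) X.

Lemma hv_tor_neq0 P Q X : tor P -> tor Q -> ntor X -> hv P Q X != 0.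
Proof.
move=> tP tQ nX; have tS := torD tP tQ.
case: (tor_ntor_neq tP nX) => ? _; case: (tor_ntor_neq tQ nX) => ? _.
case: (tor_ntor_neq tS nX) => ? h.
apply: hv_neq0; rewrite 1?eq_sym //.
by apply: contra h => /eqP <-; rewrite opprK.
Qed.

Lemma hv_at_tor_neq0 P Z W : tor P -> ntor Z -> ntor W -> ntor (Z + W) -> hv Z W P != 0.
Proof.
move=> tP nZ nW nS.
case: (tor_ntor_neq tP nZ) => ? _; case: (tor_ntor_neq tP nW) => ? _.
by case: (tor_ntor_neq tP nS) => ? h; apply: hv_neq0.
Qed.

Lemma hv_mixed_neq0 P S Z : tor P -> ntor Z -> ntor (Z - S) -> ntor (Z + S) -> hv P S Z != 0.
Proof.
move=> tP nZ n1 n2; case: (tor_ntor_neq tP nZ) => h _.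
apply: hv_neq0; first by rewrite eq_sym.
- exact: ntor_neq.
- apply: ntor_neq; rewrite opprD addrCA addrC; apply: ntorD => //; exact: torN.
- by apply: ntor_neqN; rewrite addrCA; apply: ntorDl.
Qed.

Lemma ff_neq0 P X : tor P -> ntor X -> ff P X != 0.
Proof.
by move=> tP nX; apply/prodf_neq0 => k _; apply: hv_tor_neq0 => //; apply: torM.
Qed.

(** Reciprocity between h_{P,kP} and h_{C,D}, multiplied over k: the values h_{C,D}(kP) telescope,
    and the oddness of n settles the sign. *)
Lemma ff_eval P C D : tor P -> ntor C -> ntor D -> ntor (C + D) ->
  ff P C * ff P D = - (hv C D P ^+ n * ff P (C + D)).
Proof.
move=> tP nC nD nS.
have key m : (\prod_(k < m) hv P (P *+ k) C) * (\prod_(k < m) hv P (P *+ k) D) * hv C D (P *+ m)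
   = - ((-1) ^+ m * (hv C D P ^+ m * \prod_(k < m) hv P (P *+ k) (C + D))).
  elim: m => [|m IH]; first by rewrite !big_ord0 mulr0n !expr0 !mulr1 mul1r.
  rewrite !big_ord_recr /= mulrS.
  have sep : separated P (P *+ m) C D.
    move=> Y Z hY hZ; apply: tor_ntor_neq.
      move: hY; rewrite !inE => /or3P[] /eqP -> //; [exact: torM | apply: torD => //; exact: torM].
    by move: hZ; rewrite !inE => /or3P[] /eqP ->.
  have r := hv_rec (ntor_neq0 nC) (ntor_neq0 nD) (ntor_neq0 nS) sep.
  set a := \prod_(_ < _) _ in IH *; set b := \prod_(_ < _) _ in IH *; set c := \prod_(_ < _) _ in IH *.
  transitivity (a * b * (hv P (P *+ m) C * hv P (P *+ m) D * hv C D (P + P *+ m))); first by ring.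
  rewrite r.
  transitivity (- (a * b * hv C D (P *+ m)) * hv C D P * hv P (P *+ m) (C + D)); first by ring.
  by rewrite IH !exprS; ring.
have := key n; rewrite tP /ff -/(ff P C) -signr_odd odd_n expr1 => h.
have h0 : hv C D 0 = -1 by [].
rewrite h0 in h; apply: oppr_inj; rewrite opprK -mulrN1 h; ring.
Qed.

Lemma hv_coc_tor A B C X : tor A -> tor B -> tor C -> ntor X ->
  hv A B X * hv (A + B) C X = hv A (B + C) X * hv B C X.
Proof.
move=> tA tB tC nX; have t1 := torD tA tB; have t2 := torD tB tC; have t3 := torD t1 tC.
have ne Y : tor Y -> X != Y /\ X != - Y.
  move=> tY; case: (tor_ntor_neq tY nX) => h1 h2; rewrite eq_sym; split=> //.
  by apply: contra h2 => /eqP ->; rewrite opprK.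
have [] := ne _ t1; have [] := ne _ t2; have [] := ne _ t3 => *.
by apply: hv_coc => //; apply: ntor_neq0.
Qed.

(** Both sides have the same divisor. The induction on the number of factors uses the cocycle
    relation four times at each step. *)
Lemma ff_add Q R X : tor Q -> tor R -> ntor X -> ff Q X * ff R X = ff (Q + R) X * hv Q R X ^+ n.
Proof.
move=> tQ tR nX.
have key m : (\prod_(k < m) hv Q (Q *+ k) X) * (\prod_(k < m) hv R (R *+ k) X) * hv (Q *+ m) (R *+ m) X
   = (\prod_(k < m) hv (Q + R) ((Q + R) *+ k) X) * hv Q R X ^+ m.
  elim: m => [|m IH]; first by rewrite !big_ord0 expr0 !mul1r !mulr0n hv0l // ntor_neq0.
  rewrite !big_ord_recr /= !mulrS mulrnDl exprS.
  set a := \prod_(_ < _) _ in IH *; set b := \prod_(_ < _) _ in IH *; set c := \prod_(_ < _) _ in IH *.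
  have q : hv Q (Q *+ m) X * hv R (R *+ m) X * hv (Q + Q *+ m) (R + R *+ m) X
      = hv (Q + R) (Q *+ m + R *+ m) X * hv Q R X * hv (Q *+ m) (R *+ m) X.
    pose W := {Y : ept E | Y *+ n == 0}.
    have tm := torM m tQ; have tm' := torM m tR.
    have h1 := hv_coc_tor (torD tQ tm) tR tm' nX.
    have h2 := hv_coc_tor tQ tm tR nX.
    have h3 := hv_coc_tor tQ tR tm nX.
    have h4 := hv_coc_tor (torD tQ tR) tm tm' nX.
    have e1 : Q + R + Q *+ m = Q + Q *+ m + R by rewrite addrAC.
    have X0 := ntor_neq0 nX.
    rewrite e1 in h4; rewrite [R + Q *+ m]addrC [hv R (Q *+ m) X](hvC _ _ X0) in h3.
    transitivity (hv Q (Q *+ m) X * (hv (Q + Q *+ m) (R + R *+ m) X * hv R (R *+ m) X)); first by ring.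
    rewrite -h1.
    transitivity (hv Q (Q *+ m) X * hv (Q + Q *+ m) R X * hv (Q + Q *+ m + R) (R *+ m) X); first by ring.
    rewrite h2 -h3.
    transitivity (hv Q R X * (hv (Q + R) (Q *+ m) X * hv (Q + Q *+ m + R) (R *+ m) X)); first by ring.
    by rewrite h4; ring.
  transitivity (a * b * (hv Q (Q *+ m) X * hv R (R *+ m) X * hv (Q + Q *+ m) (R + R *+ m) X)); first by ring.
  rewrite q.
  transitivity ((a * b * hv (Q *+ m) (R *+ m) X) * (hv (Q + R) (Q *+ m + R *+ m) X * hv Q R X)); first by ring.
  by rewrite IH; ring.
have := key n; rewrite tQ tR /ff hv0l ?mulr1 //; exact: ntor_neq0.
Qed.

(** The function [ff P] / h_{P,S}^n has divisor n (P + S) - n (S). Its value on (Q + T) - (T) is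
    divided by the value obtained by exchanging (P, S) and (Q, T). *)
Definition wpv P Q S T : K :=
  (ff P (Q + T) / ff P T * (hv P S T / hv P S (Q + T)) ^+ n) /
  (ff Q (P + S) / ff Q S * (hv Q T S / hv Q T (P + S)) ^+ n).

(** Stronger than disjoint supports: the condition is stable under n-torsion translations of T, and
    it keeps the evaluation points off the zeros and poles of all functions involved. *)
Definition generic S T := [/\ ntor S, ntor T, ntor (T + S) & ntor (T - S)].

Lemma generic_sym S T : generic S T -> generic T S.
Proof.
case=> nS nT h1 h2; split=> //; first by rewrite addrC.
by rewrite -opprB mulNrn oppr_eq0.
Qed.

Lemma wpv_sym P Q S T : wpv Q P T S = (wpv P Q S T)^-1.
Proof. by rewrite /wpv invf_div. Qed.

Lemma genericD S T Q : tor Q -> generic S T -> generic S (T + Q).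
Proof.
move=> tQ [nS nT h1 h2]; split=> //; first exact: ntorD.
  by rewrite addrAC; apply: ntorD.
by rewrite addrAC; apply: ntorD.
Qed.

Lemma hv_PS_neq0 P Q S T : tor P -> tor Q -> generic S T -> hv P S (Q + T) != 0.
Proof.
move=> tP tQ g; have [_ nT h1 h2] := genericD tQ g; rewrite addrC.
exact: hv_mixed_neq0.
Qed.

Lemma wpv_neq0 P Q S T : tor P -> tor Q -> generic S T -> wpv P Q S T != 0.
Proof.
move=> tP tQ g; have [nS nT h1 h2] := g; have t0 : (0 : ept E) *+ n = 0 by rewrite mul0rn.
have g' := generic_sym g.
have ge0 A B S' T' : tor A -> generic S' T' -> hv A S' T' != 0.
  by move=> tA g0; have := hv_PS_neq0 tA t0 g0; rewrite add0r.
rewrite /wpv !mulf_neq0 ?invr_eq0 ?mulf_neq0 ?expf_neq0 ?mulf_neq0 ?invr_eq0 ?ff_neq0 //;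
  try exact: ntorDl; try exact: hv_PS_neq0; exact: ge0.
Qed.

(** Additivity at the price of moving one base point to T + R; the price is refunded once the value
    is known not to depend on T. *)
Lemma wpv_addr P Q R S T : tor P -> tor Q -> tor R -> generic S T ->
  wpv P (Q + R) S T = wpv P Q S (T + R) * wpv P R S T.
Proof.
move=> tP tQ tR g; have [nS nT h1 h2] := g.
have t0 : (0 : ept E) *+ n = 0 by rewrite mul0rn.
have g' := generic_sym g; have tQR := torD tQ tR.
have eT : Q + (T + R) = Q + R + T by rewrite [T + R]addrC addrA.
have eT' : R + T = T + R by rewrite addrC.
have key X : X = S \/ X = P + S -> [/\ ff Q X * ff R X / (hv Q (T + R) X * hv R T X) ^+ n = ff (Q + R) X / hv (Q + R) T X ^+ n,
    [/\ ff Q X != 0, ff R X != 0 & ff (Q + R) X != 0] &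
    [/\ hv Q (T + R) X != 0, hv R T X != 0 & hv (Q + R) T X != 0]].
  move=> hX.
  have [nX nXT nXT'] : [/\ ntor X, ntor (X + T) & ntor (X - T)].
    case: hX => ->; first by case: g'.
    by rewrite addrC; case: (genericD tP g').
  have mx A T' : tor A -> tor T' -> hv A (T' + T) X != 0.
    move=> tA tT'; apply: hv_mixed_neq0 => //.
      rewrite opprD addrCA; apply: ntorDl => //; exact: torN.
    by rewrite addrCA; apply: ntorDl.
  have m1 := mx Q R tQ tR; have m2 := mx R 0 tR t0; have m3 := mx _ 0 tQR t0.
  rewrite add0r in m2 m3.
  split; [|by split; apply: ff_neq0|by split=> //; rewrite addrC].
  rewrite ff_add //.
  have X0 := ntor_neq0 nX.
  have c : hv Q R X * hv (Q + R) T X = hv Q (R + T) X * hv R T X.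
    have ne A : tor A -> X != A + T /\ X != - (A + T).
      move=> tA; split; first by apply: ntor_neq; rewrite opprD addrCA; apply: ntorDl => //; exact: torN.
      by apply: ntor_neqN; rewrite addrCA; apply: ntorDl.
    have [? ?] := ne _ tR; have [? ?] := ne _ tQR.
    case: (tor_ntor_neq tQR nX) => d1 d2.
    apply: hv_coc => //; first by rewrite eq_sym.
    by apply: contra d2 => /eqP ->; rewrite opprK.
  rewrite [T + R]addrC -c exprMn.
  have q : hv Q R X ^+ n != 0 by apply: expf_neq0; apply: hv_tor_neq0.
  have q' : hv (Q + R) T X ^+ n != 0 by apply: expf_neq0.
  move: (hv Q R X ^+ n) (hv (Q + R) T X ^+ n) q q' => a b q q'; field; by rewrite q q'.
have [k1 [a1 a2 a3] [b1 b2 b3]] := key S (or_introl erefl).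
have [k2 [c1 c2 c3] [d1 d2 d3]] := key (P + S) (or_intror erefl).
rewrite /wpv eT eT'.
have w1 : ff P (T + R) != 0 by apply: ff_neq0 => //; apply: ntorD.
have w2 : ff P T != 0 by exact: ff_neq0.
have w3 : ff P (Q + R + T) != 0 by apply: ff_neq0 => //; apply: ntorDl.
have w4 := hv_PS_neq0 tP tR g; have w5 := hv_PS_neq0 tP tQR g.
have w6 := hv_PS_neq0 tP t0 g; rewrite add0r in w6; rewrite eT' in w4.
transitivity (ff P (Q + R + T) / ff P T * (hv P S T / hv P S (Q + R + T)) ^+ n *
  ((ff (Q + R) S / hv (Q + R) T S ^+ n) / (ff (Q + R) (P + S) / hv (Q + R) T (P + S) ^+ n))).
  rewrite !expr_div_n.
  have := expf_neq0 n b3; have := expf_neq0 n d3; have := expf_neq0 n w5.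
  move: (hv (Q + R) T S ^+ n) (hv (Q + R) T (P + S) ^+ n) (hv P S (Q + R + T) ^+ n) (hv P S T ^+ n) => x1 x2 x3 x4 ? ? ?.
  by field; rewrite ?a3 ?c3 ?w2; do ?(apply/andP; split).
rewrite -k1 -k2 !expr_div_n !exprMn.
have := expf_neq0 n b1; have := expf_neq0 n b2; have := expf_neq0 n d1; have := expf_neq0 n d2.
have := expf_neq0 n w4; have := expf_neq0 n w5.
move: (hv Q (T + R) S ^+ n) (hv R T S ^+ n) (hv Q (T + R) (P + S) ^+ n) (hv R T (P + S) ^+ n) (hv P S (T + R) ^+ n)
  (hv P S (Q + R + T) ^+ n) (hv P S T ^+ n) => x1 x2 x3 x4 x5 x6 x7 ? ? ? ? ? ?.
by field; rewrite ?a1 ?a2 ?c1 ?c2 ?w1 ?w2; do ?(apply/andP; split).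
Qed.

End Pairing.

End MillerFunctions.

(** * Independence of the base points and the pairing on torsion *)

Module TorsionPairing.
Import CurveRing PointIdeals CocycleLaw CurveGroup Reciprocity MillerFunctions.

Section PairingInd.
Variables (K : numClosedFieldType) (E : ecurve K) (n : nat).
Hypothesis odd_n : odd n.
Implicit Types (A B C D P Q R S T U X Y Z : ept E).

Local Notation tor P := (P *+ n = 0).
Local Notation ntor P := (is_true (P *+ n != 0)).
Local Notation wpv := (wpv n).
Local Notation ff := (ff n).
Local Notation generic := (generic n).

Lemma ntor_opp X Y : ntor (X - Y) -> ntor (Y - X).
Proof. by rewrite -opprB mulNrn oppr_eq0. Qed.

(** By [ff_eval] the move from T to T + U changes the Miller part by an n-th power of h_{T,U}(P) /
    h_{Q+T,U}(P). Two reciprocities and two cocycle relations show that the correction factors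
    change by the inverse ([base]). *)
Lemma wpv_shift P Q S T U : tor P -> tor Q -> generic S T -> generic S U -> generic S (T + U) ->
  wpv P Q S (T + U) = wpv P Q S T.
Proof.
move=> tP tQ gT gU gTU; have [nS nT a1 a2] := gT; have [_ nU b1 b2] := gU; have [_ nTU c1 c2] := gTU.
have t0 : (0 : ept E) *+ n = 0 by rewrite mul0rn.
have nQT : ntor (Q + T) by exact: ntorDl.
have nQTU : ntor (Q + T + U) by rewrite -addrA; exact: ntorDl.
pose f1 := ff_eval odd_n tP nQT nU nQTU; pose f2 := ff_eval odd_n tP nT nU nTU.
have gQT : generic S (Q + T) by rewrite addrC; exact: genericD.
have gQTU : generic S (Q + T + U) by rewrite -addrA addrC; exact: genericD.
have sepP Y Z : Y \in [:: P; S; P + S] -> (generic S Z) -> Y != Z /\ Y != - Z.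
  move=> hY [_ nZ z1 z2]; move: hY; rewrite !inE => /or3P[] /eqP ->.
  - exact: (tor_ntor_neq tP nZ).
  - by split; [rewrite eq_sym; apply: (@ntor_neq _ _ n) | apply: (@ntor_neqN _ _ n); rewrite addrC].
  - split.
      by rewrite eq_sym; apply: (@ntor_neq _ _ n); rewrite opprD addrCA; apply: ntorDl => //; exact: torN.
    by apply: (@ntor_neqN _ _ n); rewrite -addrA; apply: ntorDl => //; rewrite addrC.
have rec1 : hv P S T * hv P S U * hv T U (P + S) = - (hv T U P * hv T U S * hv P S (T + U)).
  apply: hv_rec; try exact: (@ntor_neq0 _ _ n).
  by move=> Y Z hY hZ; apply: sepP => //; move: hZ; rewrite !inE => /or3P[] /eqP ->.
have rec2 : hv P S (Q + T) * hv P S U * hv (Q + T) U (P + S)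
     = - (hv (Q + T) U P * hv (Q + T) U S * hv P S (Q + T + U)).
  apply: hv_rec; try exact: (@ntor_neq0 _ _ n).
  by move=> Y Z hY hZ; apply: sepP => //; move: hZ; rewrite !inE => /or3P[] /eqP ->.
have mixS Z : generic S Z -> hv P S Z != 0.
  by case=> _ nZ z1 z2; apply: (hv_mixed_neq0 (n := n)).
have key X : X = S \/ X = P + S -> [/\ hv Q T X * hv (Q + T) U X = hv Q (T + U) X * hv T U X,
   [/\ hv Q T X != 0 & hv (Q + T) U X != 0] & [/\ hv Q (T + U) X != 0 & hv T U X != 0]].
  move=> hX.
  have gX Z : generic S Z -> [/\ ntor X, ntor Z, ntor (X - Z) & ntor (X + Z)].
    move=> [_ nZ z1 z2]; case: hX => ->; split=> //; rewrite -?addrA.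
    - exact: ntor_opp.
    - by rewrite addrC.
    - exact: ntorDl.
    - by apply: ntorDl => //; exact: ntor_opp.
    - by apply: ntorDl => //; rewrite addrC.
  have neX Z : generic S Z -> X != Z /\ X != - Z.
    by case/gX => _ _ h1 h2; split; [apply: (@ntor_neq _ _ n)|apply: (@ntor_neqN _ _ n)].
  have [nX _ _ _] := gX _ gT.
  have [x1 x2] := neX _ gT; have [x3 x4] := neX _ gU; have [x5 x6] := neX _ gTU.
  have [x7 x8] := neX _ gQT; have [x9 x10] := neX _ gQTU.
  case: (tor_ntor_neq tQ nX) => x11 _; rewrite eq_sym in x11.
  split.
  - by apply: hv_coc => //; apply: (@ntor_neq0 _ _ n).
  - by split; apply: hv_neq0.
  - by split; apply: hv_neq0 => //; rewrite addrA.
have [k1 [p1 p2] [p3 p4]] := key S (or_introl erefl).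
have [k2 [q1 q2] [q3 q4]] := key (P + S) (or_intror erefl).
have m1 := mixS _ gT; have m2 := mixS _ gU; have m3 := mixS _ gTU; have m4 := mixS _ gQT; have m5 := mixS _ gQTU.
have v1 : hv T U P != 0 by apply: (hv_at_tor_neq0 (n := n)).
have v2 : hv (Q + T) U P != 0 by apply: (hv_at_tor_neq0 (n := n)).
have base : hv T U P / hv (Q + T) U P * (hv P S (T + U) / hv P S (Q + T + U)) * (hv Q (T + U) (P + S) / hv Q (T + U) S)
   = hv P S T / hv P S (Q + T) * (hv Q T (P + S) / hv Q T S).
  have e1 : hv P S T = - (hv T U P * hv T U S * hv P S (T + U)) / (hv P S U * hv T U (P + S)).
    by rewrite -rec1; field; rewrite q4 m2.
  have e2 : hv P S (Q + T) = - (hv (Q + T) U P * hv (Q + T) U S * hv P S (Q + T + U)) / (hv P S U * hv (Q + T) U (P + S)).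
    by rewrite -rec2; field; rewrite q2 m2.
  have e3 : hv Q T S = hv Q (T + U) S * hv T U S / hv (Q + T) U S by rewrite -k1; field.
  have e4 : hv Q T (P + S) = hv Q (T + U) (P + S) * hv T U (P + S) / hv (Q + T) U (P + S) by rewrite -k2; field.
  by rewrite e1 e2 e3 e4; field; rewrite ?p2 ?p3 ?p4 ?q2 ?q3 ?q4 ?m2 ?m5 ?v2; do ?(apply/andP; split).
have w1 : ff P T != 0 by exact: ff_neq0.
have w2 : ff P (T + U) != 0 by exact: ff_neq0.
have w3 : ff P U != 0 by exact: ff_neq0.
have w5 := ff_neq0 tP nQTU.
have e : ff P (Q + T + U) / ff P (T + U) = ff P (Q + T) / ff P T * (hv T U P / hv (Q + T) U P) ^+ n.
  rewrite expr_div_n; have := expf_neq0 n v1; have := expf_neq0 n v2; move: f1 f2.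
  move: (hv T U P ^+ n) (hv (Q + T) U P ^+ n) => a b g1 g2 b0 a0.
  have h1 : ff P (Q + T + U) = - (ff P (Q + T) * ff P U) / b by rewrite g1; field.
  have h2 : ff P (T + U) = - (ff P T * ff P U) / a by rewrite g2; field.
  by rewrite h1 h2; field; rewrite ?w1 ?w3 ?a0 ?b0.
rewrite /wpv addrA e.
have -> : ff P (Q + T) / ff P T * (hv T U P / hv (Q + T) U P) ^+ n * (hv P S (T + U) / hv P S (Q + T + U)) ^+ n
   / (ff Q (P + S) / ff Q S * (hv Q (T + U) S / hv Q (T + U) (P + S)) ^+ n)
  = ff P (Q + T) / ff P T / (ff Q (P + S) / ff Q S) * (hv T U P / hv (Q + T) U P * (hv P S (T + U) / hv P S (Q + T + U))
     * (hv Q (T + U) (P + S) / hv Q (T + U) S)) ^+ n.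
  by rewrite !exprMn !exprVn !invfM !invrK; ring.
by rewrite base !exprMn !exprVn !invfM !invrK; ring.
Qed.

(* n-torsion is finite; generic points exist because the curve is infinite *)
Variable G : seq (ept E).
Hypothesis tor_fin : forall P, P *+ n = 0 -> P \in G.

Lemma ex_notin (L : seq (ept E)) : exists X : ept E, X \notin L.
Proof.
pose xs := pmap (fun X : ept E => omap fst (val X)) L.
have [N hN] : exists N : nat, N%:R \notin xs.
  have : ~~ all (mem xs) [seq (i%:R : K) | i <- iota 0 (size xs).+1].
    apply/negP => /allP sub.
    have : (size [seq (i%:R : K) | i <- iota 0 (size xs).+1] <= size xs)%N.
      apply: uniq_leq_size => //; rewrite map_inj_uniq ?iota_uniq // => i j /eqP.
      by rewrite eqr_nat => /eqP.
    by rewrite size_map size_iota ltnn.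
  by case/allPn => z /mapP[N _ ->] hz; exists N.
have [y ey] := onc_ex E N%:R.
have o : onc E (Some (N%:R, y)) by rewrite oncE; apply/eqP.
pose X0 : ept E := exist (fun P : point K => onc E P) _ o.
exists X0; apply: contra hN => hX; rewrite mem_pmap.
exact: (map_f (fun X : ept E => omap fst (val X)) hX).
Qed.

Lemma ex_gen (L : seq (ept E)) : exists X : ept E, forall Y, Y \in L -> ntor (X - Y).
Proof.
have [X hX] := ex_notin [seq Y + Z | Y <- L, Z <- G].
exists X => Y hY; apply: contra hX => /eqP /tor_fin hZ.
by apply/allpairsP; exists (Y, X - Y); split=> //=; rewrite addrC subrK.
Qed.

(** T and T' are joined through T + V = T' + (V + T - T') with V generic. *)
Lemma wpv_indepT P Q S T T' : tor P -> tor Q -> generic S T -> generic S T' ->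
  wpv P Q S T = wpv P Q S T'.
Proof.
move=> tP tQ g g'.
have [nS nT a1 a2] := g; have [_ nT' b1 b2] := g'.
have [V hV] := ex_gen [seq Z - Y | Z <- [:: 0; S; - S], Y <- [:: 0; T; T - T']].
have gY Y : Y \in [:: 0; T; T - T'] -> generic S (V + Y).
  move=> hY; have h Z : Z \in [:: 0; S; - S] -> ntor (V + Y - Z).
    move=> hZ; have -> : V + Y - Z = V - (Z - Y) by rewrite opprB addrA.
    by apply: hV; apply/allpairsP; exists (Z, Y).
  split=> //; first by have := h 0; rewrite subr0; apply; rewrite inE eqxx.
    by have := h (- S); rewrite opprK; apply; rewrite !inE eqxx !orbT.
  by apply: h; rewrite !inE eqxx orbT.
have g1 : generic S V by have := gY 0; rewrite addr0; apply; rewrite inE eqxx.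
have g2 : generic S (T + V) by rewrite addrC; apply: gY; rewrite !inE eqxx orbT.
have g3 : generic S (V + (T - T')) by apply: gY; rewrite !inE eqxx !orbT.
have e : T + V = T' + (V + (T - T')) by rewrite [in RHS]addrCA [T' + _]addrC subrK addrC.
rewrite -(wpv_shift tP tQ g g1 g2) e.
by apply: wpv_shift => //; rewrite -e.
Qed.

(** Pass to a V generic for both S and S'; the symmetry of [wpv] then turns independence of T into
    independence of S. *)
Lemma wpv_indep P Q S T S' T' : tor P -> tor Q -> generic S T -> generic S' T' ->
  wpv P Q S T = wpv P Q S' T'.
Proof.
move=> tP tQ g g'.
have [V hV] := ex_gen [:: 0; S; - S; S'; - S'].
have gV Z : Z *+ n != 0 -> Z \in [:: 0; S; - S; S'; - S'] -> - Z \in [:: 0; S; - S; S'; - S'] -> generic Z V.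
  move=> nZ h1 h2; split=> //; first by have := hV 0; rewrite subr0; apply; rewrite inE eqxx.
    by have := hV _ h2; rewrite opprK.
  exact: hV.
have [nS _ _ _] := g; have [nS' _ _ _] := g'.
have g1 : generic S V by apply: gV => //; rewrite !inE eqxx !orbT.
have g2 : generic S' V by apply: gV => //; rewrite !inE eqxx !orbT.
rewrite (wpv_indepT tP tQ g g1) (wpv_indepT tP tQ g' g2).
apply: invr_inj; rewrite -(wpv_sym n P Q S V) -(wpv_sym n P Q S' V).
by apply: wpv_indepT => //; apply: generic_sym.
Qed.

Lemma ex_generic : exists S T, generic S T.
Proof.
have [S hS] := ex_gen [:: 0]; have nS : ntor S by have := hS 0; rewrite subr0; apply; rewrite inE eqxx.
have [T hT] := ex_gen [:: 0; S; - S]; exists S, T; split=> //.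
- by have := hT 0; rewrite subr0; apply; rewrite inE eqxx.
- by have := hT (- S); rewrite opprK; apply; rewrite !inE eqxx !orbT.
- by apply: hT; rewrite !inE eqxx orbT.
Qed.

(** A predicate rather than a chosen value: each later argument evaluates the pairing at whichever
    base points suit it. *)
Definition is_pairing (e : ept E -> ept E -> K) :=
  forall P Q S T, tor P -> tor Q -> generic S T -> e P Q = wpv P Q S T.

Lemma ex_pairing : exists e, is_pairing e.
Proof.
have [S [T g]] := ex_generic; exists (fun P Q => wpv P Q S T) => P Q S' T' tP tQ g'.
exact: wpv_indep.
Qed.

Section Props.
Variable e : ept E -> ept E -> K.
Hypothesis he : is_pairing e.

Lemma pair_neq0 P Q : tor P -> tor Q -> e P Q != 0.
Proof.
move=> tP tQ; have [S [T g]] := ex_generic.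
by rewrite (he tP tQ g); apply: wpv_neq0.
Qed.

Lemma pair_sym P Q : tor P -> tor Q -> e Q P = (e P Q)^-1.
Proof.
move=> tP tQ; have [S [T g]] := ex_generic.
by rewrite (he tP tQ g) (he tQ tP (generic_sym g)) wpv_sym.
Qed.

Lemma pairDr P Q R : tor P -> tor Q -> tor R -> e P (Q + R) = e P Q * e P R.
Proof.
move=> tP tQ tR; have [S [T g]] := ex_generic.
by rewrite (he tP (torD tQ tR) g) wpv_addr // -(he tP tQ (genericD tR g)) -(he tP tR g).
Qed.

Lemma pairDl P Q R : tor P -> tor Q -> tor R -> e (P + Q) R = e P R * e Q R.
Proof.
move=> tP tQ tR; rewrite pair_sym //; last exact: torD.
by rewrite pairDr // invfM -!pair_sym.
Qed.

Lemma tor0 : tor (0 : ept E). Proof. exact: mul0rn. Qed.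

Lemma pair0r P : tor P -> e P 0 = 1.
Proof.
move=> tP; have := pairDr tP tor0 tor0; rewrite addr0 => h.
by apply: (mulfI (pair_neq0 tP tor0)); rewrite -h mulr1.
Qed.

Lemma pairMr P Q k : tor P -> tor Q -> e P (Q *+ k) = e P Q ^+ k.
Proof.
move=> tP tQ; elim: k => [|k IH]; first by rewrite mulr0n pair0r.
by rewrite mulrS pairDr ?IH ?exprS //; apply: torM.
Qed.

Lemma pairMl P Q k : tor P -> tor Q -> e (P *+ k) Q = e P Q ^+ k.
Proof.
move=> tP tQ; rewrite pair_sym ?pairMr //; last exact: torM.
by rewrite pair_sym // exprVn invrK.
Qed.

Lemma pair_unity P Q : tor P -> tor Q -> e P Q ^+ n = 1.
Proof. by move=> tP tQ; rewrite -pairMr // tQ pair0r. Qed.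

(** Antisymmetry makes the value a square root of 1, and it is an n-th root of 1 with n odd. *)
Lemma pairxx P : tor P -> e P P = 1.
Proof.
move=> tP; have h := pair_sym tP tP; have p0 := pair_neq0 tP tP.
have h2 : e P P ^+ 2 = 1 by rewrite expr2 {1}h mulVf.
have := pair_unity tP tP; rewrite -(odd_double_half n) odd_n add1n -muln2 mulnC exprS exprM h2.
by rewrite expr1n mulr1.
Qed.

Lemma pairNr P Q : tor P -> tor Q -> e P (- Q) = (e P Q)^-1.
Proof.
move=> tP tQ; apply: (mulfI (pair_neq0 tP tQ)).
by rewrite mulfV ?pair_neq0 // -pairDr ?subrr ?pair0r //; apply: torN.
Qed.

End Props.

End PairingInd.

End TorsionPairing.

(** * Homogeneous forms and the coordinate ring *)

Module HomogeneousForms.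
Import CurveRing PointIdeals CocycleLaw CurveGroup Reciprocity MillerFunctions TorsionPairing.

Definition i0 : 'I_3 := @Ordinal 3 0 isT.
Definition i1 : 'I_3 := @Ordinal 3 1 isT.
Definition i2 : 'I_3 := @Ordinal 3 2 isT.

Lemma I3P (P : 'I_3 -> Prop) : P i0 -> P i1 -> P i2 -> forall i, P i.
Proof.
move=> h0 h1 h2 [[|[|[|//]]] hi].
- by rewrite (_ : Ordinal hi = i0) //; apply: val_inj.
- by rewrite (_ : Ordinal hi = i1) //; apply: val_inj.
- by rewrite (_ : Ordinal hi = i2) //; apply: val_inj.
Qed.

Section Forms.
Variables (K : numClosedFieldType) (E : ecurve K).
Local Notation a := (ea E).
Local Notation b := (eb E).
Local Notation onc := (onc E).
Local Notation form := {mpoly K[3]}.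
Implicit Types (F G H : form) (P : point K).

Lemma evfD F G P : evalf (F + G) P = evalf F P + evalf G P.
Proof. exact: mevalD. Qed.
Lemma evfN F P : evalf (- F) P = - evalf F P.
Proof. exact: mevalN. Qed.
Lemma evfM F G P : evalf (F * G) P = evalf F P * evalf G P.
Proof. exact: mevalM. Qed.
Lemma evfZ c F P : evalf (c *: F) P = c * evalf F P.
Proof. exact: mevalZ. Qed.
Lemma evf1 P : evalf 1 P = 1.
Proof. exact: meval1. Qed.
Lemma evf0 P : evalf 0 P = 0.
Proof. exact: meval0. Qed.
Lemma evfX i P : evalf 'X_i P = tnth (coords P) i.
Proof. exact: mevalXU. Qed.
Lemma evfXn F n P : evalf (F ^+ n) P = evalf F P ^+ n.
Proof. exact: rmorphXn. Qed.
Lemma evf_prod (I : Type) (r : seq I) (p : pred I) (F : I -> form) P :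
  evalf (\prod_(i <- r | p i) F i) P = \prod_(i <- r | p i) evalf (F i) P.
Proof. exact: rmorph_prod. Qed.
Definition evfE := (evfD, evfN, evfM, evfZ, evf1, evf0, evfX, evfXn).

Lemma crd_aff x y : [/\ tnth (coords (Some (x, y))) i0 = x, tnth (coords (Some (x, y))) i1 = y
  & tnth (coords (Some (x, y) : point K)) i2 = 1].
Proof. by []. Qed.
Lemma crd_inf : [/\ tnth (coords (None : point K)) i0 = 0, tnth (coords (None : point K)) i1 = 1
  & tnth (coords (None : point K)) i2 = 0].
Proof. by []. Qed.

Lemma crd_eq P : onc P -> tnth (coords P) i1 ^+ 2 * tnth (coords P) i2
  = tnth (coords P) i0 ^+ 3 + a * tnth (coords P) i0 * tnth (coords P) i2 ^+ 2 + b * tnth (coords P) i2 ^+ 3.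
Proof.
case: P => [[x y]|] /=; last by move=> _; rewrite !(tnth_nth 0) /=; ring.
by move=> /onc_eq; rewrite /ecub !(tnth_nth 0) /= => e; rewrite e; ring.
Qed.

Lemma form_ind (d : nat) (Q : form -> Prop) :
  Q 0 -> (forall c m F, mdeg m = d -> Q F -> Q (c *: 'X_[m] + F)) ->
  forall F, F \is d.-homog -> Q F.
Proof.
move=> Q0 QD F hF; rewrite (mpolyE F).
have h m : m \in msupp F -> mdeg m = d.
  by move=> hm; move/dhomogP: hF => /(_ m hm).
elim: (msupp F : seq _) h => [|m s IH] h; first by rewrite big_nil.
rewrite big_cons; apply: QD; first by apply: h; rewrite inE eqxx.
by apply: IH => m' hm'; apply: h; rewrite inE hm' orbT.
Qed.

Lemma mon_split (d : nat) (m : 'X_{1..3}) : mdeg m = d.+1 -> exists i m',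
  mdeg m' = d /\ 'X_[m] = 'X_i * 'X_[m'] :> form.
Proof.
move=> hm; have [i hi] : exists i, m i != 0%N.
  apply/existsP; rewrite -negb_forall; apply/negP => /forallP h.
  by move: hm; rewrite mdegE big1 // => i _; apply/eqP; apply: h.
have le : (U_(i) <= m)%MM.
  by apply/mnm_lepP => j; rewrite mnm1E; case: eqP => // <-; rewrite lt0n.
exists i, (m - U_(i))%MM; split; last by rewrite -mpolyXD addmC submK.
by move: hm; rewrite -{1}(submK le) mdegD mdeg1 addn1 => -[].
Qed.

(** The forms X_j - v_j X_k generate the homogeneous ideal of the point v, and X_k^(d+1) takes the
    value 1 there; induction on monomials. *)
Lemma split_form (v : 'I_3 -> K) k d F : v k = 1 -> F \is d.+1.-homog ->
  exists A : 'I_3 -> form, (forall j, A j \is d.-homog) /\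
    F = \sum_j ('X_j - v j *: 'X_k) * A j + F.@[v] *: 'X_k ^+ d.+1.
Proof.
move=> vk.
have hX i : ('X_i : form) \is 1.-homog by rewrite dhomogX; apply/eqP; exact: mdeg1.
have hXk e : ('X_k ^+ e : form) \is e.-homog by have := dhomogMn e (hX k); rewrite mul1n.
have sumD (c : 'I_3 -> form) A1 A2 : \sum_j c j * (A1 j + A2 j) = \sum_j c j * A1 j + \sum_j c j * A2 j.
  by rewrite -big_split; apply: eq_bigr => j _; rewrite mulrDr.
have sum1 (c : 'I_3 -> form) (i : 'I_3) f : \sum_j c j * (if j == i then f else 0) = c i * f.
  rewrite (bigD1 i) //= eqxx big1 ?addr0 // => j /negPf ->; exact: mulr0.
have mon e (m : 'X_{1..3}) : mdeg m = e.+1 -> exists A : 'I_3 -> form, (forall j, A j \is e.-homog) /\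
    'X_[m] = \sum_j ('X_j - v j *: 'X_k) * A j + ('X_[m] : form).@[v] *: 'X_k ^+ e.+1.
  elim: e m => [|e IH] m /mon_split[i [m' [dm' em]]].
    move: dm' => /eqP; rewrite mdeg_eq0 => /eqP em'; rewrite em' mpolyX0 mulr1 in em.
    exists (fun j => if j == i then 1 else 0); split=> [j|].
      by case: ifP => _; rewrite ?dhomog1 ?dhomog0.
    by rewrite sum1 mulr1 em mevalXU expr1; ring.
  have [A [hA eA]] := IH _ dm'.
  exists (fun j => (v i *: ('X_k * A j)) + (if j == i then 'X_[m'] else 0)); split=> [j|].
    apply: dhomogD; first by apply: dhomogZ; have := dhomogM (hX k) (hA j); rewrite add1n.
    by case: ifP => _; rewrite ?dhomog0 // dhomogX; apply/eqP.
  rewrite sumD sum1 em mevalM mevalXU.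
  have -> : \sum_j ('X_j - v j *: 'X_k) * (v i *: ('X_k * A j))
     = v i *: ('X_k * \sum_j ('X_j - v j *: 'X_k) * A j).
    by rewrite mulr_sumr scaler_sumr; apply: eq_bigr => j _; rewrite -!mul_mpolyC; ring.
  move: eA; set S := \sum_j _; set c := (_.@[v]) => eA.
  have -> : S = 'X_[m'] - c *: 'X_k ^+ e.+1 by rewrite {1}eA; ring.
  by rewrite -!mul_mpolyC mpolyCM ['X_k ^+ e.+2]exprS; ring.
elim/form_ind=> [|c m {}F dm [A [hA eA]]].
  exists (fun=> 0); split=> [j|]; first exact: dhomog0.
  by rewrite meval0 scale0r addr0 big1 // => j _; rewrite mulr0.
have [B [hB eB]] := mon _ _ dm.
exists (fun j => c *: B j + A j); split=> [j|]; first by apply: dhomogD => //; apply: dhomogZ.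
rewrite sumD mevalD mevalZ {1}eB {1}eA.
have -> : \sum_j ('X_j - v j *: 'X_k) * (c *: B j) = c *: \sum_j ('X_j - v j *: 'X_k) * B j.
  by rewrite scaler_sumr; apply: eq_bigr => j _; rewrite scalerAr.
by rewrite scalerDr scalerDl scalerA; ring.
Qed.

(** [g] is the dehomogenisation of F. A monomial of degree d has pole order at most 3 d at infinity,
    with equality only for Y^d, so the coefficient of index 3 d is the value at (0 : 1 : 0). *)
Definition form_rg d F (g : rg K) := [/\ forall x y, y ^+ 2 = ecub E x -> evalf F (Some (x, y)) = ev g x y,
  (size (rwt g) <= (3 * d).+1)%N & (rwt g)`_(3 * d) = evalf F None].

Lemma form_rg_ex d F : F \is d.-homog -> exists g, form_rg d F g.
Proof.
elim/form_ind=> [|c m {}F dm [g [e1 e2 e3]]].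
  exists (0, 0); split=> [x y o||]; first by rewrite evf0 /ev /= !hornE; ring.
    by rewrite rwt0 size_poly0.
  by rewrite rwt0 coef0 evf0.
have mx : mondeg ('X^(m i0) : {poly K}, 0 : {poly K}) (2 * m i0).
  have e : rwt ('X^(m i0) : {poly K}, 0 : {poly K}) = 'X^(2 * m i0).
    by rewrite /rwt comp_poly0 mulr0 addr0 comp_Xn_poly -exprM.
  by rewrite /mondeg e size_polyXn lead_coefXn.
have my k : exists g : rg K, mondeg g (3 * k) /\ forall x y, y ^+ 2 = ecub E x -> ev g x y = y ^+ k.
  elim: k => [|k [h [mh eh]]]; first by exists (rc 1); split=> [|x y o]; [exact: mondeg1|rewrite evc].
  exists (rmul E (0, 1) h); split=> [|x y o]; last by rewrite evM // eh // /ev /= !hornE exprS; ring.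
  rewrite mulnS; apply: mondegM => //; apply: mondeg3; by rewrite size_poly0.
have [h [mh eh]] := my (m i1).
have mg := mondegM E mx mh; set g1 := rmul E _ h in mg.
have dm3 : (m i0 + m i1 + m i2 = d)%N.
  by rewrite -dm mdegE big_ord_recl big_ord_recl big_ord_recl big_ord0 addn0 addnA; congr (m _ + m _ + m _)%N; apply: val_inj.
have rD (u w : rg K) : rwt (radd u w) = rwt u + rwt w.
  by rewrite /rwt /radd /= !comp_polyD; ring.
have rS (u : rg K) : rwt (rsc c u) = c *: rwt u.
  by rewrite /rwt /rsc /= !comp_polyZ -!mul_polyC; ring.
exists (radd (rsc c g1) g); split=> [x y o||].
- rewrite !evE evfD evfZ e1 //; congr (c * _ + _).
  rewrite /g1 evM // eh // /evalf mevalX big_ord_recl big_ord_recl big_ord_recl big_ord0 mulr1.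
  have [c0 c1 c2] := crd_aff x y.
  rewrite (_ : lift ord0 (lift ord0 ord0) = i2) ?c2 ?expr1n ?mulr1; last exact: val_inj.
  rewrite (_ : lift ord0 ord0 = i1) ?c1; last exact: val_inj.
  rewrite (_ : ord0 = i0) ?c0; last exact: val_inj.
  by rewrite /ev /= !hornE; ring.
- rewrite rD rS; apply: leq_trans (size_polyD _ _) _; rewrite geq_max e2 andbT.
  apply: leq_trans (size_scale_leq _ _) _; case: mg => -> _; lia.
- rewrite rD rS coefD coefZ e3 evfD evfZ; congr (c * _ + _).
  rewrite /evalf mevalX big_ord_recl big_ord_recl big_ord_recl big_ord0 mulr1.
  have [c0 c1 c2] := crd_inf.
  rewrite (_ : lift ord0 (lift ord0 ord0) = i2) ?c2; last exact: val_inj.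
  rewrite (_ : lift ord0 ord0 = i1) ?c1 ?expr1n ?mul1r; last exact: val_inj.
  rewrite (_ : ord0 = i0) ?c0; last exact: val_inj.
  rewrite !expr0n; case: mg => sg lg.
  have [/andP[/eqP z0 /eqP z2]|] := boolP ((m i0 == 0%N) && (m i2 == 0%N)).
    rewrite z0 z2 mulr1; move: lg; rewrite lead_coefE sg /=.
    by rewrite (_ : 2 * m i0 + 3 * m i1 = 3 * d)%N //; lia.
  move=> nz; rewrite nth_default; first by move: nz; case: eqP; case: eqP => //= _ _ _; rewrite ?mul0r ?mulr0.
  by rewrite sg; lia.
Qed.

Lemma form_affine d F : F \is d.-homog ->
  (forall x y, y ^+ 2 = ecub E x -> evalf F (Some (x, y)) = 0) -> forall P, onc P -> evalf F P = 0.
Proof.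
move=> /form_rg_ex[g [e1 _ e3]] h [[x y] /onc_eq|_]; first exact: h.
rewrite -e3; have -> : g = (0, 0) by apply: (ev_eq0 (E := E)) => x y o; rewrite -e1 // h.
by rewrite rwt0 coef0.
Qed.

(** Cancellation in the coordinate ring; it also yields the vanishing of F at the zeros of G. *)
Lemma form_mul_eq0 d e F G x y : F \is d.-homog -> G \is e.-homog -> y ^+ 2 = ecub E x ->
  evalf G (Some (x, y)) != 0 -> (forall P, onc P -> evalf G P * evalf F P = 0) ->
  forall P, onc P -> evalf F P = 0.
Proof.
move=> hF hG o nG h; apply: (form_affine hF).
have [f [e1 _ _]] := form_rg_ex hF; have [g [g1 _ _]] := form_rg_ex hG.
have g0 : rwt g != 0.
  apply: contra nG => /eqP /rwt_eq0 eg; rewrite g1 // eg /ev /= !hornE; apply/eqP; ring.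
have : f = (0, 0).
  apply: (rmul_cancel (E := E) g0) => x' y' o'; rewrite -e1 // -g1 //.
  rewrite h /ev ?oncE /= ?o' // !hornE; ring.
by move=> f0 x' y' o'; rewrite e1 // f0 /ev /= !hornE; ring.
Qed.

End Forms.

End HomogeneousForms.

(** * Uniformisers and orders of vanishing *)

Module LocalOrders.
Import CurveRing PointIdeals CocycleLaw CurveGroup Reciprocity MillerFunctions TorsionPairing HomogeneousForms.

Section Orders.
Variables (K : numClosedFieldType) (E : ecurve K).
Local Notation a := (ea E).
Local Notation b := (eb E).
Local Notation onc := (onc E).
Local Notation form := {mpoly K[3]}.
Implicit Types (F G H : form) (P : point K).

Lemma dhC F d e : F \is d.-homog -> d = e -> F \is e.-homog.
Proof. by move=> h <-. Qed.
Lemma dhX (i : 'I_3) : ('X_i : form) \is 1.-homog.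
Proof. by rewrite dhomogX; apply/eqP; exact: mdeg1. Qed.
Lemma dhXn F d n : F \is d.-homog -> F ^+ n \is (n * d).-homog.
Proof. by move=> h; apply: dhC (dhomogMn n h) _; rewrite mulnC. Qed.
Lemma dhM d e F G : F \is d.-homog -> G \is e.-homog -> F * G \is (d + e).-homog.
Proof. exact: dhomogM. Qed.
Lemma dhM' d e n F G : (d + e = n)%N -> F \is d.-homog -> G \is e.-homog -> F * G \is n.-homog.
Proof. by move=> <-; exact: dhomogM. Qed.
Lemma dhB F G d : F \is d.-homog -> G \is d.-homog -> F - G \is d.-homog.
Proof. by move=> hF hG; rewrite rpredB. Qed.

(** [kk] is a coordinate with value 1 at P. Together with [jj] it gives the local parameter: a shift
    of X/Z in general, Y/Z at points of order two, X/Y at O. *)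
Definition kk P : 'I_3 := if P is Some _ then i2 else i1.
Definition jj P : 'I_3 := if P is Some (x, y) then if y == 0 then i1 else i0 else i0.
Definition tt P : form := 'X_(jj P) - tnth (coords P) (jj P) *: 'X_(kk P).
Definition unif P := (tt P, 'X_(kk P) : form).

Lemma tt_two x : tt (Some (x, 0)) = 'X_i1.
Proof. by rewrite /tt /jj eqxx (_ : tnth _ _ = 0) ?scale0r ?subr0. Qed.
Lemma tt_gen x y : y != 0 -> tt (Some (x, y)) = 'X_i0 - x *: 'X_i2.
Proof. by move=> /negPf y0; rewrite /tt /jj y0. Qed.
Lemma tt_inf : tt None = 'X_i0.
Proof. by rewrite /tt (_ : tnth _ _ = 0) ?scale0r ?subr0. Qed.

Lemma kkP P : tnth (coords P) (kk P) = 1.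
Proof. by case: P => [[x y]|]. Qed.
Lemma ttP P : evalf (tt P) P = 0.
Proof. by rewrite !evfE kkP mulr1 subrr. Qed.
Lemma dh_tt P : tt P \is 1.-homog.
Proof. by rewrite dhB ?dhomogZ ?dhX. Qed.

(** Smoothness at P: the equation of the curve, factored around P, makes every coordinate difference
    a multiple of [tt P] up to a factor q that is a unit at P. *)
Lemma tangent_coord P j : onc P -> exists q p, [/\ q \is 2.-homog, p \is 2.-homog, evalf q P != 0 &
  forall Q, onc Q -> evalf ('X_j - tnth (coords P) j *: 'X_(kk P)) Q * evalf q Q = evalf (tt P) Q * evalf p Q].
Proof.
move=> oP.
have h2 i i' : ('X_i * 'X_i' : form) \is 2.-homog by exact: dhC (dhomogM (dhX i) (dhX i')) _.
have hk : j = kk P -> exists q p, [/\ q \is 2.-homog, p \is 2.-homog, evalf q P != 0 &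
  forall Q, onc Q -> evalf ('X_j - tnth (coords P) j *: 'X_(kk P)) Q * evalf q Q = evalf (tt P) Q * evalf p Q].
  move=> ->; exists ('X_(kk P) * 'X_(kk P)), 0; split=> //; first exact: dhomog0.
    by rewrite !evfE kkP mulr1 oner_eq0.
  by move=> Q _; rewrite !evfE kkP; ring.
have hj : j = jj P -> exists q p, [/\ q \is 2.-homog, p \is 2.-homog, evalf q P != 0 &
  forall Q, onc Q -> evalf ('X_j - tnth (coords P) j *: 'X_(kk P)) Q * evalf q Q = evalf (tt P) Q * evalf p Q].
  move=> ->; exists ('X_(kk P) * 'X_(kk P)), ('X_(kk P) * 'X_(kk P)); split=> //.
  by rewrite !evfE kkP mulr1 oner_eq0.
have hZ c F d : F \is d.-homog -> c *: F \is d.-homog by exact: dhomogZ.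
case: P oP hk hj => [[x0 y0]|] oP hk hj; last first.
  elim/I3P: j hk hj => hk hj; [exact: hj | exact: hk | ].
  exists ('X_i1 * 'X_i1 - a *: ('X_i0 * 'X_i2) - b *: ('X_i2 * 'X_i2)), ('X_i0 * 'X_i0).
  have [c0 c1 c2] := crd_inf K.
  split=> //; first by rewrite !dhB ?hZ.
    by rewrite !evfE c0 c1 c2 !mulr0 mulr1 !subr0 oner_eq0.
  move=> Q /crd_eq; rewrite tt_inf c2 !evfE => e.
  move: e; set u := tnth _ i0; set v := tnth _ i1; set w := tnth _ i2 => e; ring: e.
have o := onc_eq oP; have [c0 c1 c2] := crd_aff x0 y0.
elim/I3P: j hk hj => hk hj; last exact: hk.
- have [ey|ny] := eqVneq y0 0; last by apply: hj; rewrite /jj (negPf ny).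
  exists ('X_i0 * 'X_i0 + x0 *: ('X_i0 * 'X_i2) + x0 ^+ 2 *: ('X_i2 * 'X_i2) + a *: ('X_i2 * 'X_i2)), ('X_i1 * 'X_i2).
  split=> //; first by rewrite !dhomogD ?hZ.
    have f0 : ecub E x0 = 0 by rewrite -o ey expr0n.
    have := ecub_simple f0; rewrite !evfE c0 c2 => h; apply: contra h => /eqP h; apply/eqP; rewrite -h; ring.
  move=> Q /crd_eq; rewrite c0 ey tt_two !evfE.
  move: o; rewrite ey expr0n /= /ecub => o.
  have eb' : b = - (x0 ^+ 3 + a * x0) by apply/eqP; rewrite -addr_eq0 addrC -o.
  rewrite eb'; set u := tnth _ i0; set v := tnth _ i1; set w := tnth _ i2 => e.
  by ring: e.
have [ey|ny] := eqVneq y0 0; first by apply: hj; rewrite /jj ey eqxx.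
exists (('X_i1 + y0 *: 'X_i2) * 'X_i2),
  ('X_i0 * 'X_i0 + x0 *: ('X_i0 * 'X_i2) + x0 ^+ 2 *: ('X_i2 * 'X_i2) + a *: ('X_i2 * 'X_i2)).
split=> //; [|by rewrite !dhomogD ?hZ| |].
- by apply: (@dhM' 1 1 _ _ _ erefl); rewrite ?dhomogD ?hZ ?dhX.
- by rewrite !evfE c1 c2 !mulr1 -mulr2n -mulr_natl mulf_neq0 ?two_neq0.
move=> Q /crd_eq; rewrite tt_gen // c1 !evfE.
set u := tnth _ i0; set v := tnth _ i1; set w := tnth _ i2 => e.
have eb' : b = y0 ^+ 2 - x0 ^+ 3 - a * x0 by rewrite o /ecub; ring.
by move: e; rewrite eb' => e; ring: e.
Qed.

(** A numerator that vanishes at P lies in the ideal of P by [split_form], and each generator of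
    that ideal is a multiple of [tt P] by [tangent_coord]. *)
Lemma unifP P : onc P -> uniformizer (ew E) (unif P) P.
Proof.
move=> oP; have vk := kkP P.
have ru : is_rfun (ew E) (unif P).
  split; first by exists 1%N; rewrite /= dh_tt dhX.
  by exists P; split=> //; rewrite /= evfE vk oner_eq0.
split=> //.
  by exists (unif P); split=> //=; rewrite ?ttP ?mul0r // evfE vk oner_eq0.
move=> f _ [[F G] /= [[[d [/= hF hG]] _] efg nG]].
move=> /esym/eqP; rewrite mulf_eq0 invr_eq0 (negPf nG) orbF => /eqP zF.
have hFk : F * 'X_(kk P) \is d.+1.-homog by exact: dhC (dhomogM hF (dhX _)) (addn1 d).
have [A [hA eA]] := split_form vk hFk.
have z : (F * 'X_(kk P)).@[tnth (coords P)] = 0 by have := evfM F 'X_(kk P) P; rewrite zF mul0r.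
rewrite z scale0r addr0 in eA.
have [q0 [p0 [hq0 hp0 nq0 e0]]] := tangent_coord i0 oP.
have [q1 [p1 [hq1 hp1 nq1 e1]]] := tangent_coord i1 oP.
have [q2 [p2 [hq2 hp2 nq2 e2]]] := tangent_coord i2 oP.
pose N := A i0 * (p0 * (q1 * q2)) + A i1 * (p1 * (q0 * q2)) + A i2 * (p2 * (q0 * q1)).
pose D := G * 'X_(kk P) * (q0 * (q1 * q2)).
have nD : evalf D P != 0 by rewrite /D !evfM evfX vk mulr1 !mulf_neq0.
have hN : 'X_(kk P) * N \is (d + 7).-homog.
  have -> : (d + 7 = 1 + (d + 6))%N by rewrite addnCA.
  apply: dhM; first exact: dhX.
  by rewrite /N !dhomogD //; apply: dhM => //; apply: (@dhM' 2 4 _ _ _ erefl) => //; apply: (@dhM' 2 2 _ _ _ erefl).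
have hD : D \is (d + 7).-homog.
  have -> : (d + 7 = (d + 1) + 6)%N by rewrite -addnA.
  apply: dhM; first by apply: dhM => //; exact: dhX.
  by apply: (@dhM' 2 4 _ _ _ erefl) => //; apply: (@dhM' 2 2 _ _ _ erefl).
have rg' : is_rfun (ew E) ('X_(kk P) * N, D).
  by split; [exists (d + 7)%N | exists P].
exists ('X_(kk P) * N, D); split=> //.
  by exists (evalf ('X_(kk P) * N) P / evalf D P), ('X_(kk P) * N, D); split.
move=> Q oQ; have := efg Q oQ; rewrite /= => eQ.
have eF : evalf F Q * evalf 'X_(kk P) Q = evalf ('X_i0 - tnth (coords P) i0 *: 'X_(kk P)) Q * evalf (A i0) Q
   + evalf ('X_i1 - tnth (coords P) i1 *: 'X_(kk P)) Q * evalf (A i1) Q + evalf ('X_i2 - tnth (coords P) i2 *: 'X_(kk P)) Q * evalf (A i2) Q.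
  rewrite -!evfM -!evfD eA; congr (evalf _ Q).
  rewrite big_ord_recl big_ord_recl big_ord_recl big_ord0 addr0 addrA.
  rewrite (_ : lift ord0 (lift ord0 ord0) = i2); last exact: val_inj.
  rewrite (_ : lift ord0 ord0 = i1); last exact: val_inj.
  by rewrite (_ : ord0 = i0); last exact: val_inj.
have := e0 Q oQ; have := e1 Q oQ; have := e2 Q oQ; move: eF.
move: (evalf ('X_i0 - _) Q) (evalf ('X_i1 - _) Q) (evalf ('X_i2 - _) Q) => l0 l1 l2.
rewrite /D /N !evfM.
set t := evalf (tt P) Q; rewrite !evfD !evfM.
set f1 := evalf f.1 Q in eQ *; set f2 := evalf f.2 Q in eQ *; move: eQ.
move: (evalf F Q) (evalf G Q) (evalf 'X_(kk P) Q) (evalf (A i0) Q) (evalf (A i1) Q) (evalf (A i2) Q).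
move: (evalf q0 Q) (evalf q1 Q) (evalf q2 Q) (evalf p0 Q) (evalf p1 Q) (evalf p2 Q).
move=> r0 r1 r2 s0 s1 s2 F' G' x A0 A1 A2 eQ eF E2 E1 E0.
transitivity ((f1 * G') * (x * x * (r0 * (r1 * r2)))); first by ring.
rewrite eQ; transitivity (f2 * x * (F' * x) * (r0 * (r1 * r2))); first by ring.
rewrite eF; transitivity (f2 * x * ((l0 * r0) * A0 * (r1 * r2) + (l1 * r1) * A1 * (r0 * r2) + (l2 * r2) * A2 * (r0 * r1))); first by ring.
by rewrite E0 E1 E2; ring.
Qed.

(** Order m at P: F / X_k^d is (t / X_k)^m times the unit X_k-normalised fraction p / q,
    cross-multiplied so as to hold on the whole curve. *)
Definition ford P d F m := F \is d.-homog /\ exists e p q,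
  [/\ q \is e.-homog, p \is (d + e).-homog, evalf q P != 0, evalf p P != 0
    & forall Q, onc Q -> evalf F Q * evalf 'X_(kk P) Q ^+ m * evalf q Q = evalf (tt P) Q ^+ m * evalf p Q].

Lemma ford_unit P d F : F \is d.-homog -> evalf F P != 0 -> ford P d F 0.
Proof.
move=> hF nF; split=> //; exists 0%N, F, 1; split=> //; rewrite ?addn0 ?dhomog1 ?evf1 ?oner_eq0 //.
by move=> Q _; rewrite evf1 !expr0; ring.
Qed.

Lemma fordM P d F m d' F' m' : ford P d F m -> ford P d' F' m' -> ford P (d + d') (F * F') (m + m').
Proof.
move=> [hF [e [p [q [hq hp nq np h]]]]] [hF' [e' [p' [q' [hq' hp' nq' np' h']]]]].
split; first exact: dhomogM.
exists (e + e')%N, (p * p'), (q * q'); rewrite !evfM !mulf_neq0 //; split=> //.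
- exact: dhomogM.
- by rewrite addnACA; apply: dhM.
move=> Q oQ; rewrite !evfM !exprD.
transitivity ((evalf F Q * evalf 'X_(kk P) Q ^+ m * evalf q Q) * (evalf F' Q * evalf 'X_(kk P) Q ^+ m' * evalf q' Q)); first ring.
by rewrite h // h' //; ring.
Qed.

Lemma ford_div P d e F G H m : F \is d.-homog -> H \is e.-homog -> evalf H P != 0 ->
  (forall Q, onc Q -> evalf F Q * evalf H Q = evalf G Q) -> ford P (d + e) G m -> ford P d F m.
Proof.
move=> hF hH nH eFH [hG [e' [p [q [hq hp nq np h]]]]]; split=> //.
exists (e + e')%N, p, (H * q); split=> //; first exact: dhomogM.
- by rewrite addnA.
- by rewrite evfM mulf_neq0.
by move=> Q oQ; rewrite -h // -eFH // evfM; ring.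
Qed.

Definition dord P (f : form * form) (k : int) := exists d m1 m2,
  [/\ ford P d f.1 m1, ford P d f.2 m2 & k = m1%:Z - m2%:Z].

Lemma dordM P f g k l : dord P f k -> dord P g l -> dord P (rf_mul f g) (k + l).
Proof.
move=> [d [m1 [m2 [h1 h2 ->]]]] [d' [n1 [n2 [h1' h2' ->]]]].
exists (d + d')%N, (m1 + n1)%N, (m2 + n2)%N; split; [exact: fordM | exact: fordM |].
by rewrite !PoszD; ring.
Qed.

Lemma dordV P f k : dord P f k -> dord P (f.2, f.1) (- k).
Proof. by move=> [d [m1 [m2 [h1 h2 ->]]]]; exists d, m2, m1; split=> //; rewrite opprB. Qed.

Lemma dord1 P : dord P (1, 1) 0.
Proof. by exists 0%N, 0%N, 0%N; split; rewrite ?subrr //; apply: ford_unit; rewrite ?dhomog1 // evf1 oner_eq0. Qed.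

Lemma dord_exp P f k n : dord P f k -> dord P (f.1 ^+ n, f.2 ^+ n) (k *+ n).
Proof.
move=> h; elim: n => [|n IH]; first by rewrite !expr0 mulr0n; apply: dord1.
by rewrite !exprS mulrS; apply: (dordM h IH).
Qed.

Lemma dord_prod P n (f : nat -> form * form) (k : nat -> int) :
  (forall i, (i < n)%N -> dord P (f i) (k i)) ->
  dord P (\prod_(i < n) (f i).1, \prod_(i < n) (f i).2) (\sum_(i < n) k i).
Proof.
elim: n => [|n IH] h; first by rewrite !big_ord0; apply: dord1.
rewrite !big_ord_recr; apply: (@dordM P (_, _) (_, _)); first by apply: IH => i hi; apply: h; rewrite ltnS ltnW.
rewrite -surjective_pairing; exact: h.
Qed.

(** Provides a point at which the factors to be cancelled by [form_mul_eq0] do not vanish. *)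
Lemma ex_nontangent P : exists x y, y ^+ 2 = ecub E x /\ evalf (tt P) (Some (x, y)) != 0 /\ evalf 'X_(kk P) (Some (x, y)) != 0.
Proof.
pose x0 := if P is Some (x, y) then x else 0.
pose p := fpoly E * ('X * ('X - x0%:P)).
have np : p != 0 by rewrite /p !mulf_neq0 ?fpoly_neq0 ?polyX_eq0 ?polyXsubC_eq0.
have [x hx] : exists x, p.[x] != 0.
  have [/existsP[i hi]|] := boolP [exists i : 'I_(size p), p.[i%:R] != 0]; first by exists i%:R.
  rewrite negb_exists => /forallP h; case/negP: np.
  have : (size [seq (i%:R : K) | i <- iota 0 (size p)] < size p)%N -> p == 0 by rewrite size_map size_iota ltnn.
  have [//|pn0] := eqVneq p 0; apply.
  apply: max_poly_roots => //.
    apply/allP => z /mapP[i]; rewrite mem_iota add0n /= => hi ->; rewrite /root.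
    by have := h (Ordinal hi); rewrite negbK.
  by rewrite map_inj_uniq ?iota_uniq // => i j /eqP; rewrite eqr_nat => /eqP.
have [y oy] := onc_ex E x; exists x, y; split=> //.
move: hx; rewrite /p hornerM fpolyE hornerM hornerX hornerD hornerN hornerC -oy !mulf_eq0 orbb !negb_or subr_eq0 => /and3P[ny nx nx0].
have [c0 c1 c2] := crd_aff x y.
move: nx0; rewrite /x0; clear -c0 c1 c2 ny nx; case: P => [[x1 y1]|] nx0; last by rewrite tt_inf /kk !evfE c0 c1.
have -> : evalf ('X_(kk (Some (x1, y1))) : form) (Some (x, y)) = 1 by rewrite evfX.
rewrite oner_eq0; have [->|n1] := eqVneq y1 0; first by rewrite tt_two evfX c1.
by rewrite tt_gen // !evfE c0 c2 mulr1 subr_eq0; rewrite hornerX in nx0.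
Qed.

Lemma int_subE (k m1 m2 : nat) :
  (Posz k = m1%:Z - m2%:Z -> (m1 + 0 = m2 + k)%N) /\ (Negz k = m1%:Z - m2%:Z -> (m1 + k.+1 = m2 + 0)%N).
Proof. lia. Qed.

Lemma rf_ordP P f k : onc P -> dord P f k -> rf_ord (ew E) f P k.
Proof.
move=> oP [d [m1 [m2 [[h1 [e1 [p1 [q1 [hq1 hp1 nq1 np1 E1]]]]] [h2 [e2 [p2 [q2 [hq2 hp2 nq2 np2 E2]]]]] ek]]]].
exists (unif P), (p1 * q2, q1 * p2).
have nu : evalf (q1 * p2) P != 0 by rewrite evfM mulf_neq0.
have hu1 : p1 * q2 \is (d + (e1 + e2)).-homog by rewrite addnA; apply: dhM.
have hu2 : q1 * p2 \is (d + (e1 + e2)).-homog by rewrite addnCA; apply: dhM.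
have ru : is_rfun (ew E) (p1 * q2, q1 * p2).
  by split; [exists (d + (e1 + e2))%N | exists P].
split=> //; first exact: unifP.
  exists (evalf (p1 * q2) P / evalf (q1 * p2) P); first by rewrite mulf_neq0 ?invr_eq0 // evfM mulf_neq0.
  by exists (p1 * q2, q1 * p2); split.
(* One statement for both signs of the order: j1 is its positive part and j2 its negative part. *)
have key j1 j2 : (m1 + j2 = m2 + j1)%N -> rf_eq (ew E) f
   (rf_mul ((tt P) ^+ j1 * 'X_(kk P) ^+ j2, 'X_(kk P) ^+ j1 * (tt P) ^+ j2) (p1 * q2, q1 * p2)).
  move=> ej Q oQ; rewrite /=.
  apply/eqP; rewrite -subr_eq0; apply/eqP; rewrite -!evfM -evfN -evfD; move: Q oQ.
  have [x [y [o [n1 n2]]]] := ex_nontangent P.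
  have hXn i : ('X_(kk P) : form) ^+ i \is i.-homog by have := dhXn i (dhX (kk P)); rewrite muln1.
  have htn i : (tt P) ^+ i \is i.-homog by have := dhXn i (dh_tt P); rewrite muln1.
  apply: (@form_mul_eq0 K E (d + (j1 + j2 + (d + (e1 + e2)))) (m2 + m1) _ (tt P ^+ m2 * 'X_(kk P) ^+ m1) x y) => //.
  - apply: dhB; first by do 3!apply: dhomogM => //.
    by rewrite addnC; apply: dhM => //; apply: dhM => //; apply: dhM.
  - exact: dhomogM.
  - by rewrite evfM !evfXn mulf_neq0 ?expf_neq0.
  move=> Q oQ; rewrite !evfD !evfN !evfM !evfXn mulrBr; apply/eqP; rewrite subr_eq0; apply/eqP.
  have:= E1 Q oQ; have := E2 Q oQ.
  move: (evalf _ Q) (evalf 'X_(kk P) Q) (evalf q2 Q) (evalf (tt P) Q) (evalf p2 Q) (evalf f.1 Q) (evalf q1 Q) (evalf p1 Q).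
  move=> F2 X Q2 T P2 F1 Q1 P1 eq2 eq1.
  transitivity ((F1 * X ^+ m1 * Q1) * (T ^+ m2 * P2) * (X ^+ j1 * T ^+ j2)); first by ring.
  rewrite eq1 -eq2; transitivity (P1 * Q2 * F2 * T ^+ (m1 + j2) * X ^+ (m2 + j1)); first by rewrite !exprD; ring.
  by rewrite -ej [X in T ^+ X]ej !exprD; ring.
have := @int_subE; case: k ek => k ek /(_ k m1 m2) [c1 c2].
  by have := key k 0%N (c1 ek); rewrite !expr0 !mulr1.
by have := key 0%N k.+1 (c2 ek); rewrite !expr0 !mul1r.
Qed.

End Orders.

End LocalOrders.

(** * Divisors of lines, and the pairing in the sense of the definition *)

Module WeilPairing.
Import CurveRing PointIdeals CocycleLaw CurveGroup Reciprocity MillerFunctions TorsionPairing HomogeneousForms LocalOrders.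

Section Lines.
Variables (K : numClosedFieldType) (E : ecurve K).
Local Notation a := (ea E).
Local Notation b := (eb E).
Local Notation onc := (onc E).
Local Notation form := {mpoly K[3]}.
Local Notation slope := (slope E).
Local Notation ford := (ford E).
Local Notation dord := (dord E).
Implicit Types (F G H : form) (P : point K) (A B X : ept E).

Definition vertf (c : K) : form := 'X_i0 - c *: 'X_i2.
Definition linef (l x1 y1 : K) : form := 'X_i1 - y1 *: 'X_i2 - l *: ('X_i0 - x1 *: 'X_i2).

Lemma dh_vertf c : vertf c \is 1.-homog.
Proof. by rewrite dhB ?dhomogZ ?dhX. Qed.
Lemma dh_linef l x1 y1 : linef l x1 y1 \is 1.-homog.
Proof. by rewrite !dhB ?dhomogZ ?dhB ?dhomogZ ?dhX. Qed.

Lemma vertf_aff c x y : evalf (vertf c) (Some (x, y)) = x - c.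
Proof. by have [c0 c1 c2] := crd_aff x y; rewrite !evfE c0 c2 mulr1. Qed.
Lemma linef_aff l x1 y1 x y : evalf (linef l x1 y1) (Some (x, y)) = y - y1 - l * (x - x1).
Proof. by have [c0 c1 c2] := crd_aff x y; rewrite !evfE c0 c1 c2 !mulr1. Qed.

(** O is a flex with tangent Z = 0: the equation reads Z (Y^2 - a X Z - b Z^2) = X^3. *)
Lemma ford_X2_inf : ford None 1 'X_i2 3.
Proof.
split; first exact: dhX.
have [c0 c1 c2] := crd_inf K.
exists 2%N, ('X_i1 ^+ 3), ('X_i1 ^+ 2 - a *: ('X_i0 * 'X_i2) - b *: ('X_i2 ^+ 2)).
split.
- have h2 i : ('X_i ^+ 2 : form) \is 2.-homog by exact: (dhXn 2 (dhX K i)).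
  have h2' i j : ('X_i * 'X_j : form) \is 2.-homog by apply: (@dhM' _ 1 1 _ _ _ erefl); apply: dhX.
  by rewrite !dhB ?dhomogZ.
- exact: (dhXn 3 (dhX K i1)).
- by rewrite !evfE c0 c1 c2; apply/eqP => h; case/eqP: (oner_neq0 K); rewrite -h; ring.
- by rewrite !evfE c1 !mulr1 oner_eq0.
move=> Q /crd_eq; rewrite tt_inf /kk !evfE => e; set u := tnth _ i0 in e *; set v := tnth _ i1 in e *; set w := tnth _ i2 in e *.
by ring: e.
Qed.

Lemma ford_vertf_inf c : ford None 1 (vertf c) 1.
Proof.
split; first exact: dh_vertf.
have [c0 c1 c2] := crd_inf K.
pose q : form := 'X_i1 ^+ 2 - a *: ('X_i0 * 'X_i2) - b *: ('X_i2 ^+ 2).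
have h2 i : ('X_i ^+ 2 : form) \is 2.-homog by exact: (dhXn 2 (dhX K i)).
have h2' i j : ('X_i * 'X_j : form) \is 2.-homog by apply: (@dhM' _ 1 1 _ _ _ erefl); apply: dhX.
exists 2%N, ('X_i1 * (q - c *: 'X_i0 ^+ 2)), q.
split.
- by rewrite /q !dhB ?dhomogZ.
- by apply: (@dhM' _ 1 2 _ _ _ erefl); rewrite ?dhX // !dhB ?dhomogZ // /q !dhB ?dhomogZ.
- by rewrite !evfE c0 c1 c2; apply/eqP => h; case/eqP: (oner_neq0 K); rewrite -h; ring.
- by rewrite !evfE c0 c1 c2; apply/eqP => h; case/eqP: (oner_neq0 K); rewrite -h; ring.
move=> Q /crd_eq; rewrite tt_inf /kk !evfE => e; set u := tnth _ i0 in e *; set v := tnth _ i1 in e *; set w := tnth _ i2 in e *.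
by ring: e.
Qed.

Lemma ford_X2_aff x y : ford (Some (x, y)) 1 'X_i2 0.
Proof. by apply: ford_unit; rewrite ?dhX // evfX (_ : tnth _ _ = 1) ?oner_eq0. Qed.

Lemma ford_linef_inf l x1 y1 : ford None 1 (linef l x1 y1) 0.
Proof.
apply: ford_unit; first exact: dh_linef.
have [c0 c1 c2] := crd_inf K; rewrite !evfE c0 c1 c2.
by apply/eqP => h; case/eqP: (oner_neq0 K); rewrite -h; ring.
Qed.

Lemma ford_vertf c x y : onc (Some (x, y)) -> ford (Some (x, y)) 1 (vertf c)
  (if x == c then (if y == 0 then 2 else 1) else 0).
Proof.
move=> o; have [ex|nx] := eqVneq x c; last by apply: ford_unit; rewrite ?dh_vertf // vertf_aff subr_eq0.
subst c; split; first exact: dh_vertf.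
have h2 i : ('X_i ^+ 2 : form) \is 2.-homog by exact: (dhXn 2 (dhX K i)).
have h2' i j : ('X_i * 'X_j : form) \is 2.-homog by apply: (@dhM' _ 1 1 _ _ _ erefl); apply: dhX.
have [c0 c1 c2] := crd_aff x y.
have [ey|ny] := eqVneq y 0.
  have ox := onc_eq o; rewrite ey expr0n /= in ox.
  exists 2%N, ('X_i2 ^+ 3), ('X_i0 ^+ 2 + x *: ('X_i0 * 'X_i2) + x ^+ 2 *: ('X_i2 ^+ 2) + a *: ('X_i2 ^+ 2)).
  split; first by rewrite !dhomogD ?dhomogZ.
  - exact: (dhXn 3 (dhX K i2)).
  - have := ecub_simple (esym ox); rewrite !evfE c0 c2 => h; apply: contra h => /eqP h; apply/eqP; rewrite -h; ring.
  - by rewrite !evfE c2 !mulr1 oner_eq0.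
  move=> Q /crd_eq; rewrite ey tt_two /kk !evfE => e; set u := tnth _ i0 in e *; set v := tnth _ i1 in e *; set w := tnth _ i2 in e *.
  have eb' : b = - (x ^+ 3 + a * x) by apply/eqP; rewrite -addr_eq0; apply/eqP; apply: etrans (esym ox); rewrite /ecub; ring.
  by rewrite eb' in e; ring: e.
exists 0%N, 'X_i2, 1; split; rewrite ?dhomog1 ?dhX ?evf1 ?oner_eq0 //.
  by rewrite evfX c2 oner_eq0.
by move=> Q _; rewrite tt_gen // /kk /vertf !evfE !expr1; ring.
Qed.

(** At a point of order two A and -A coincide and the vertical line is tangent, so both counts are
    2. *)
Lemma cnt_vertf A X x y x0 y0 : val A = Some (x, y) -> val X = Some (x0, y0) ->
  (if x0 == x then (if y0 == 0 then 2%N else 1%N) else 0%N) = ((X == A) + (X == - A))%N.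
Proof.
move=> eA eX; have eN : val (- A) = Some (x, - y) by rewrite valN eA.
have eq1 : (X == A) = (x0 == x) && (y0 == y) by rewrite -val_eqE /= eA eX.
have eq2 : (X == - A) = (x0 == x) && (y0 == - y) by rewrite -(inj_eq val_inj) eN eX.
rewrite eq1 eq2; have [ex|//] := eqVneq x0 x; rewrite /=; subst x0.
have [e|e] := same_x eX eA.
  have ey : y0 = y by move: eX; rewrite e eA => -[].
  rewrite ey eqxx -addr_eq0.
  have -> : (y + y == 0) = (y == 0) by rewrite -mulr2n mulrn_eq0.
  by case: eqP.
have ey : y0 = - y by move: eX; rewrite e eN => -[].
rewrite ey eqxx oppr_eq0 eqr_oppLR -addr_eq0.
have -> : (y + y == 0) = (y == 0) by rewrite -mulr2n mulrn_eq0.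
by case: eqP.
Qed.

Definition numf P Q : form :=
  if P is Some (x1, y1) then if Q is Some (x2, y2) then
    if opposite P Q then vertf x1 else linef (slope x1 y1 x2 y2) x1 y1
  else 1 else 1.
Definition denf P Q : form :=
  if P is Some (x1, y1) then if Q is Some (x2, y2) then
    if opposite P Q then 'X_i2 else vertf ((slope x1 y1 x2 y2) ^+ 2 - x1 - x2)
  else 1 else 1.

Lemma numf_aff P Q x y : evalf (numf P Q) (Some (x, y)) = ev (numr E P Q) x y.
Proof.
rewrite /numf /numr; case: P => [[x1 y1]|]; last by rewrite evf1 evc.
case: Q => [[x2 y2]|]; last by rewrite evf1 evc.
by case: ifP => _; rewrite ?vertf_aff ?linef_aff !evX.
Qed.
Lemma denf_aff P Q x y : evalf (denf P Q) (Some (x, y)) = ev (denr E P Q) x y.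
Proof.
rewrite /denf /denr; case: P => [[x1 y1]|]; last by rewrite evf1 evc.
case: Q => [[x2 y2]|]; last by rewrite evf1 evc.
case: ifP => _; rewrite ?vertf_aff ?linef_aff !evX //.
by have [c0 c1 c2] := crd_aff x y; rewrite evfX c2.
Qed.

(** The line times its conjugate times Z is the product of three vertical lines, and the conjugate
    is a unit at X when y0 is nonzero. If y0 = 0, only one of A, B, -(A + B) can be X, since
    otherwise A, B or A + B would be O, and the order is computed directly. *)
Lemma ford_linef A B X x1 y1 x2 y2 x0 y0 : val A = Some (x1, y1) -> val B = Some (x2, y2) ->
  val X = Some (x0, y0) -> ~~ opposite (val A) (val B) ->
  ford (Some (x0, y0)) 1 (linef (slope x1 y1 x2 y2) x1 y1) ((X == A) + (X == B) + (X == - (A + B))%R)%N.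
Proof.
move=> eA eB eX nop; have eC := opposite_add eA eB nop.
have oA : onc (Some (x1, y1)) by rewrite -eA; apply: valP.
have oB : onc (Some (x2, y2)) by rewrite -eB; apply: valP.
have oX : onc (Some (x0, y0)) by rewrite -eX; apply: valP.
rewrite eA eB in nop; have cub := chord_cubic oA oB nop; have [ey _ _ _] := chordP oA oB nop.
have C0 : A + B != 0 by apply/eqP => h; move: eC; rewrite h val0.
have A0 : A != 0 by apply/eqP => h; move: eA; rewrite h val0.
have B0 : B != 0 by apply/eqP => h; move: eB; rewrite h val0.
move: ey eC cub; set l := slope _ _ _ _ => ey eC cub.
set x3 := l ^+ 2 - x1 - x2 in eC cub.
have eN : val (- (A + B)) = Some (x3, y1 + l * (x3 - x1)).
  by rewrite valN eC /=; congr (Some (_, _)); rewrite /x3 /l; ring.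
set y3 := y1 + _ in eN.
have veq Y y z : val Y = Some (y, z) -> (X == Y) = (x0 == y) && (y0 == z).
  by move=> eY; rewrite -(inj_eq val_inj) eY eX.
have eqA : (X == A) = (x0 == x1) && (y0 == y1) by exact: veq.
have eqB : (X == B) = (x0 == x2) && (y0 == y2) by exact: veq.
have eqC : (X == - (A + B)) = (x0 == x3) && (y0 == y3) by exact: veq.
have [zl|nl] := eqVneq (y0 - y1 - l * (x0 - x1)) 0; last first.
  rewrite (_ : (_ + _ + _)%N = 0%N); first by apply: ford_unit; rewrite ?dh_linef // linef_aff.
  rewrite eqA eqB eqC; have [/andP[/eqP e1 /eqP e2]|_] := boolP ((x0 == x1) && _).
    by case/eqP: nl; rewrite e1 e2; ring.
  have [/andP[/eqP e1 /eqP e2]|_] := boolP ((x0 == x2) && _).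
    by case/eqP: nl; rewrite e1 e2 ey; ring.
  have [/andP[/eqP e1 /eqP e2]|//] := boolP ((x0 == x3) && _).
  by case/eqP: nl; rewrite e1 e2 /y3; ring.
have ly : y0 = y1 + l * (x0 - x1).
  by apply/eqP; rewrite -subr_eq0; apply/eqP; rewrite -zl; ring.
have eqA' : (X == A) = (x0 == x1).
  by rewrite eqA; have [e|//] := eqVneq; rewrite ly e subrr mulr0 addr0 eqxx.
have eqB' : (X == B) = (x0 == x2).
  by rewrite eqB; have [e|//] := eqVneq; rewrite ly ey e eqxx.
have eqC' : (X == - (A + B)) = (x0 == x3).
  by rewrite eqC; have [e|//] := eqVneq; rewrite ly /y3 e eqxx.
have onl : x0 \in [:: x1; x2; x3].
  have := cub x0; rewrite -ly (onc_eq oX) subrr => /esym/eqP; rewrite !mulf_eq0 !subr_eq0 !inE.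
  by rewrite orbA.
have h2 i : ('X_i ^+ 2 : form) \is 2.-homog by exact: (dhXn 2 (dhX K i)).
have h2' i j : ('X_i * 'X_j : form) \is 2.-homog by apply: (@dhM' _ 1 1 _ _ _ erefl); apply: dhX.
have [c0 c1 c2] := crd_aff x0 y0.
have [ey0|ny0] := eqVneq y0 0.
  have ox := onc_eq oX; rewrite ey0 expr0n /= in ox.
  have eXX : - X = X by apply: val_inj; rewrite valN eX /= ey0 oppr0.
  have -> : ((X == A) + (X == B) + (X == - (A + B)) = 1)%N.
    have nAB : ~~ ((X == A) && (X == B)).
      by apply/andP => -[/eqP e1 /eqP e2]; case/eqP: C0; rewrite -e1 -e2 -[X in X + _]eXX addNr.
    have nAC : ~~ ((X == A) && (X == - (A + B))).
      apply/andP => -[/eqP e1 /eqP e2]; case/eqP: B0.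
      have : X = X + B by rewrite -[LHS]eXX [X in - X]e2 opprK -e1.
      by rewrite -{1}[X]addr0 => /addrI.
    have nBC : ~~ ((X == B) && (X == - (A + B))).
      apply/andP => -[/eqP e1 /eqP e2]; case/eqP: A0.
      have : X = X + A by rewrite -[LHS]eXX [X in - X]e2 opprK -e1 addrC.
      by rewrite -{1}[X]addr0 => /addrI.
    move: onl nAB nAC nBC; rewrite !inE -eqA' -eqB' -eqC'.
    by case: (X == A); case: (X == B); case: (X == - (A + B)).
  split; first exact: dh_linef.
  pose Q0 : form := 'X_i0 ^+ 2 + x0 *: ('X_i0 * 'X_i2) + x0 ^+ 2 *: ('X_i2 ^+ 2) + a *: ('X_i2 ^+ 2).
  have hQ : Q0 \is 2.-homog by rewrite !dhomogD ?dhomogZ.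
  have nQ : evalf Q0 (Some (x0, y0)) != 0.
    have := ecub_simple (esym ox); rewrite !evfE c0 c2 => h; apply: contra h => /eqP h; apply/eqP; rewrite -h; ring.
  exists 2%N, ('X_i2 * (Q0 - l *: ('X_i1 * 'X_i2))), Q0; split=> //.
  - by apply: (@dhM' _ 1 2 _ _ _ erefl); rewrite ?dhX // dhB ?dhomogZ.
  - by move: nQ; rewrite evfM evfD evfN evfZ evfM !evfX c1 c2 ey0 !(mul0r, mulr0) subr0 mul1r.
  have el : y1 = - (l * (x0 - x1)) by apply/eqP; rewrite -addr_eq0 -ly ey0.
  have eb' : b = - (x0 ^+ 3 + a * x0) by apply/eqP; rewrite -addr_eq0; apply/eqP; apply: etrans (esym ox); rewrite /ecub; ring.
  move=> Q /crd_eq; rewrite ey0 tt_two /kk /Q0 /linef !evfE => e; set u := tnth _ i0 in e *; set v := tnth _ i1 in e *; set w := tnth _ i2 in e *.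
  rewrite eb' in e; rewrite el; by ring: e.
have dh' : 'X_i1 + (y1 *: 'X_i2 + l *: vertf x1) \is 1.-homog.
  by rewrite dhomogD ?dhX // dhomogD ?dhomogZ ?dh_vertf ?dhX.
apply: (@ford_div _ _ _ 1 2 _ (vertf x1 * vertf x2 * vertf x3) (('X_i1 + (y1 *: 'X_i2 + l *: vertf x1)) * 'X_i2)).
- exact: dh_linef.
- by apply: (@dhM' _ 1 1 _ _ _ erefl) => //; apply: dhX.
- rewrite evfM !evfD !evfZ !evfX vertf_aff c1 c2 !mulr1 -ly -mulr2n -mulr_natl.
  by rewrite mulf_neq0 ?two_neq0.
- move=> Q /crd_eq; rewrite /linef /vertf !evfE => e.
  set u := tnth _ i0 in e *; set v := tnth _ i1 in e *; set w := tnth _ i2 in e *.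
  have [ea1 eb1] : a = x1 * x2 + x1 * x3 + x2 * x3 + 2%:R * l * (y1 - l * x1)
      /\ b = (y1 - l * x1) ^+ 2 - x1 * x2 * x3.
    have k0 := cub 0; have k1 := cub 1; rewrite /ecub in k0 k1.
    have kb : b = (y1 - l * x1) ^+ 2 - x1 * x2 * x3.
      apply/eqP; rewrite -subr_eq0; apply/eqP.
      transitivity (0 ^+ 3 + a * 0 + b - (y1 + l * (0 - x1)) ^+ 2 - (0 - x1) * (0 - x2) * (0 - x3)); first by ring.
      by rewrite k0 subrr.
    split=> //; apply/eqP; rewrite -subr_eq0; apply/eqP.
    transitivity (1 ^+ 3 + a * 1 + b - (y1 + l * (1 - x1)) ^+ 2 - (1 - x1) * (1 - x2) * (1 - x3)); last by rewrite k1 subrr.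
    by rewrite kb /x3; ring.
  rewrite ea1 eb1 in e; rewrite /x3 in e *.
  transitivity (v ^+ 2 * w - (y1 * w + l * (u - x1 * w)) ^+ 2 * w); first by ring.
  by rewrite e; ring.
have hv c : ford (Some (x0, y0)) 1 (vertf c) (x0 == c).
  by have := ford_vertf c oX; rewrite (negPf ny0); case: eqP.
by rewrite eqA' eqB' eqC'; apply: (fordM (fordM (hv x1) (hv x2)) (hv x3)).
Qed.

Lemma dord_chord A B X : dord (val X) (numf (val A) (val B), denf (val A) (val B))
  ((X == A)%:Z + (X == B)%:Z - (X == A + B)%:Z - (X == 0)%:Z).
Proof.
have [->|A0] := eqVneq A 0.
  rewrite add0r [X in dord _ _ X](_ : _ = 0); first exact: dord1.
  by ring.
have [->|B0] := eqVneq B 0.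
  rewrite addr0 [X in dord _ _ X](_ : _ = 0); last by ring.
  by rewrite val0 /numf /denf; case: (val A) => [[x y]|]; exact: dord1.
have [x1 [y1 eA]] := affineP A0; have [x2 [y2 eB]] := affineP B0.
have op := @oppositeP _ _ A B; rewrite /numf /denf eA eB; rewrite eA eB in op.
case: ifP op => [_ /(_ isT) eAB|nop _].
  have -> : A + B = 0 by rewrite eAB addNr.
  have {}eAB : B = - A by rewrite eAB opprK.
  have [->|X0] := eqVneq X 0.
    rewrite eq_sym (negPf A0) [0 == B]eq_sym (negPf B0) val0.
    by exists 1%N, 1%N, 3%N; split; [exact: ford_vertf_inf | exact: ford_X2_inf |].
  have [x0 [y0 eX]] := affineP X0; rewrite eX.
  have oX : onc (Some (x0, y0)) by rewrite -eX; apply: valP.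
  exists 1%N, ((X == A) + (X == - A))%N, 0%N; split; last by rewrite eAB PoszD; lia.
    by rewrite -(cnt_vertf eA eX); apply: ford_vertf.
  exact: ford_X2_aff.
have nop' : ~~ opposite (val A) (val B) by rewrite eA eB nop.
have eC := opposite_add eA eB nop'.
have [->|X0] := eqVneq X 0.
  have C0 : A + B != 0 by apply/eqP => h; move: eC; rewrite h val0.
  rewrite eq_sym (negPf A0) [0 == B]eq_sym (negPf B0) [0 == A + B]eq_sym (negPf C0) val0.
  by exists 1%N, 0%N, 1%N; split; [exact: ford_linef_inf | exact: ford_vertf_inf |].
have [x0 [y0 eX]] := affineP X0; rewrite eX.
have oX : onc (Some (x0, y0)) by rewrite -eX; apply: valP.
exists 1%N, ((X == A) + (X == B) + (X == - (A + B))%R)%N, ((X == A + B)%R + (X == - (A + B))%R)%N; split.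
- exact: ford_linef.
- by rewrite -(cnt_vertf eC eX); apply: ford_vertf.
- by rewrite !PoszD (_ : Posz (nat_of_bool false) = 0) //; ring.
Qed.

Lemma dh_numf P Q : exists d, numf P Q \is d.-homog /\ denf P Q \is d.-homog.
Proof.
rewrite /numf /denf; case: P => [[x1 y1]|]; last by exists 0%N; rewrite !dhomog1.
case: Q => [[x2 y2]|]; last by exists 0%N; rewrite !dhomog1.
by case: ifP => _; exists 1%N; rewrite ?dh_vertf ?dh_linef ?dhX.
Qed.

End Lines.

Section Weil.
Variables (K : numClosedFieldType) (E : ecurve K) (n : nat).
Hypothesis odd_n : odd n.
Implicit Types (P Q S T X : ept E).
Local Notation tor P := (P *+ n = 0).
Local Notation ntor P := (is_true (P *+ n != 0)).

Definition wfun P S : {mpoly K[3]} * {mpoly K[3]} :=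
  rf_mul (\prod_(k < n) numf E (val P) (val (P *+ k)), \prod_(k < n) denf E (val P) (val (P *+ k)))
    (denf E (val P) (val S) ^+ n, numf E (val P) (val S) ^+ n).

Lemma hv_aff (A B X : ept E) x y : val X = Some (x, y) -> hv A B X != 0 ->
  [/\ evalf (numf E (val A) (val B)) (val X) != 0, evalf (denf E (val A) (val B)) (val X) != 0
    & evalf (numf E (val A) (val B)) (val X) / evalf (denf E (val A) (val B)) (val X) = hv A B X].
Proof.
move=> eX; rewrite /hv eX numf_aff denf_aff => h; split=> //.
  by apply: contraNneq h => ->; rewrite mul0r.
by apply: contraNneq h => ->; rewrite invr0 mulr0.
Qed.

(** The divisors (P) + (kP) - ((k+1)P) - (O) add up to n (P) - n (O) because nP = O; the factor
    h_{P,S}^-n moves this to n (P + S) - n (S). *)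
Lemma wfun_dord P S X : tor P -> dord E (val X) (wfun P S) (n%:Z * ((X == P + S)%:Z - (X == S)%:Z)).
Proof.
move=> tP.
have d1 := @dord_prod _ E (val X) n (fun k => (numf E (val P) (val (P *+ k)), denf E (val P) (val (P *+ k))))
  _ (fun k _ => dord_chord P (P *+ k) X).
have d2 := dord_exp n (dordV (dord_chord P S X)).
have := dordM d1 d2; rewrite /wfun /=; set k := (_ + _).
have -> // : k = n%:Z * ((X == P + S)%:Z - (X == S)%:Z).
have tele m : \sum_(i < m) ((X == P)%:Z + (X == P *+ i)%:Z - (X == P + P *+ i)%:Z - (X == 0)%:Z)
  = m%:Z * ((X == P)%:Z - (X == 0)%:Z) + (X == 0)%:Z - (X == P *+ m)%:Z.
  elim: m => [|m IH]; first by rewrite big_ord0 mulr0n; ring.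
  by rewrite big_ord_recr IH /= -mulrS -addn1 PoszD; ring.
rewrite /k tele tP -mulr_natl; ring.
Qed.

Lemma wfun_value P S X : tor P -> ntor X -> ntor (X - S) -> ntor (X + S) ->
  evalf (wfun P S).2 (val X) != 0 /\
  evalf (wfun P S).1 (val X) / evalf (wfun P S).2 (val X) = ff n P X / hv P S X ^+ n.
Proof.
move=> tP nX n1 n2; have [x [y eX]] := affineP (ntor_neq0 nX).
have [u1 u2 u3] := hv_aff eX (hv_mixed_neq0 tP nX n1 n2).
have w k := hv_aff eX (hv_tor_neq0 tP (torM k tP) nX).
rewrite /wfun /= !evfM !evfXn !evf_prod; split.
  rewrite mulf_neq0 ?expf_neq0 //; apply/prodf_neq0 => k _; by case: (w k).
rewrite -u3 expr_div_n /ff.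
have -> : \prod_(k < n) hv P (P *+ k) X =
  (\prod_(k < n) evalf (numf E (val P) (val (P *+ k))) (val X)) / \prod_(k < n) evalf (denf E (val P) (val (P *+ k))) (val X).
  by rewrite -prodfV -big_split; apply: eq_bigr => k _; case: (w k) => _ _ <-.
by rewrite !invfM invrK; ring.
Qed.

Lemma wfun_div P S X : tor P -> ntor X -> ntor (X - S) -> ntor (X + S) ->
  has_div (ew E) (wfun P S) n (add_pt (ew E) (val P) (val S)) (val S).
Proof.
move=> tP nX n1 n2; split.
  split; last by exists (val X); split; [exact: valP | case: (wfun_value tP nX n1 n2)].
  have hd m : exists d, \prod_(k < m) numf E (val P) (val (P *+ k)) \is d.-homog /\
      \prod_(k < m) denf E (val P) (val (P *+ k)) \is d.-homog.
    elim: m => [|m [d [h1 h2]]]; first by exists 0%N; rewrite !big_ord0 !dhomog1.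
    have [e [h3 h4]] := dh_numf E (val P) (val (P *+ m)).
    by exists (d + e)%N; rewrite !big_ord_recr; split; apply: dhM.
  have [d [h1 h2]] := hd n; have [e [h3 h4]] := dh_numf E (val P) (val S).
  by exists (d + n * e)%N; split; apply: dhM => //; apply: dhXn.
move=> P' oP'; apply: rf_ordP => //.
exact: (wfun_dord S (exist _ P' oP' : ept E) tP).
Qed.

(** Genericity gives the disjoint supports, and it makes the denominators of [wfun] nonzero at the
    four points, so the fractions can be evaluated as they stand. *)
Lemma weil_wpv P Q S T : tor P -> tor Q -> generic n S T ->
  weil_pairing (ew E) n (val P) (val Q) (wpv n P Q S T).
Proof.
move=> tP tQ g; have [nS nT a1 a2] := g; have [_ nQT b1 b2] := genericD tQ g.
have [nT' nPS c1 c2] := genericD tP (generic_sym g).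
rewrite addrC in nQT b1 b2; rewrite addrC in nPS c1 c2.
rewrite addrC [S + P]addrC in c1; have [nS' _ c3 c4] := generic_sym g.
exists (val S), (val T), (wfun P S), (wfun Q T); split; try exact: valP.
- rewrite -!valD !(inj_eq val_inj).
  have neqP (X Y : ept E) : ntor (X - Y) -> X != Y by exact: ntor_neq.
  have d1 : ntor (P + S - (Q + T)).
    have -> : P + S - (Q + T) = - (T - S) + (P - Q) by rewrite !opprB !opprD; rewrite addrACA [LHS]addrC addrC; congr (_ + _); rewrite addrC.
    by apply: ntorD; [apply: torD => //; apply: torN | apply: ntorN].
  rewrite (neqP _ _ d1) (neqP _ _ c2) /=; apply/andP; split.
    by rewrite eq_sym; apply: neqP.
  by apply: neqP.
- split; first exact: (wfun_div tP nT a2 a1).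
  exact: (wfun_div tQ nS c4 c3).
have own (f : {mpoly K[3]} * {mpoly K[3]}) (A B P' : point K) : has_div (ew E) f n A B -> evalf f.2 P' != 0 ->
    rf_value (ew E) f P' (evalf f.1 P' / evalf f.2 P').
  by case=> rf _ nz; exists f; split.
have [v1 w1] := wfun_value tP nQT b2 b1; have [v2 w2] := wfun_value tP nT a2 a1.
have [v3 w3] := wfun_value tQ nPS c2 c1; have [v4 w4] := wfun_value tQ nS c4 c3.
exists (ff n P (Q + T) / hv P S (Q + T) ^+ n), (ff n P T / hv P S T ^+ n),
  (ff n Q (P + S) / hv Q T (P + S) ^+ n), (ff n Q S / hv Q T S ^+ n); split.
- rewrite -w1 -valD; exact: (own _ _ _ _ (wfun_div tP nT a2 a1)).
- rewrite -w2; exact: (own _ _ _ _ (wfun_div tP nT a2 a1)).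
- rewrite -w3 -valD; exact: (own _ _ _ _ (wfun_div tQ nS c4 c3)).
- rewrite -w4; exact: (own _ _ _ _ (wfun_div tQ nS c4 c3)).
by rewrite /wpv !expr_div_n !invfM !invrK; ring.
Qed.

End Weil.

End WeilPairing.

(** * A formula for the pairing without base points; geometry at a flex *)

Module ExplicitPairing.
Import CurveRing PointIdeals CocycleLaw CurveGroup Reciprocity MillerFunctions TorsionPairing.

Section Explicit.
Variables (K : numClosedFieldType) (E : ecurve K) (n : nat).
Hypothesis odd_n : odd n.
Implicit Types (A B C D P Q S T U X Y Z : ept E).
Local Notation tor P := (P *+ n = 0).
Local Notation ntor P := (is_true (P *+ n != 0)).
Local Notation ff := (ff n).

(** Enough to keep X away from the zeros and poles of the factors of [ff P]; unlike non-torsion, it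
    allows evaluation at torsion points. *)
Definition off P X := forall k, X != P *+ k.

Lemma tor_opp P k : tor P -> - (P *+ k) = P *+ (k * n.-1).
Proof.
move=> tP; have n0 : (0 < n)%N by case: n odd_n.
have e : P *+ (k * n.-1) + P *+ k = 0.
  by rewrite -mulrnDr -mulnSr prednK // mulnC mulrnA tP mul0rn.
by rewrite -[RHS]subr0 -e opprD addrA subrr add0r.
Qed.

Lemma off_neq0 P X : off P X -> X != 0.
Proof. by move=> h; have := h 0%N; rewrite mulr0n. Qed.

Lemma offN P X k : tor P -> off P X -> P *+ k != X /\ P *+ k != - X.
Proof.
move=> tP h; rewrite eq_sym h; split=> //.
by rewrite eq_sym eqr_oppLR tor_opp.
Qed.

Lemma off_ntor P X : tor P -> ntor X -> off P X.
Proof. by move=> tP nX k; apply: contraNneq nX => ->; rewrite mulrnAC tP mul0rn. Qed.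

Lemma ff_eval_off P C D : tor P -> off P C -> off P D -> off P (C + D) ->
  ff P C * ff P D = - (hv C D P ^+ n * ff P (C + D)).
Proof.
move=> tP nC nD nS.
have key m : (\prod_(k < m) hv P (P *+ k) C) * (\prod_(k < m) hv P (P *+ k) D) * hv C D (P *+ m)
   = - ((-1) ^+ m * (hv C D P ^+ m * \prod_(k < m) hv P (P *+ k) (C + D))).
  elim: m => [|m IH]; first by rewrite !big_ord0 mulr0n !expr0 !mulr1 mul1r.
  rewrite !big_ord_recr /= mulrS.
  have sep : separated P (P *+ m) C D.
    have hk k Z : Z \in [:: C; D; C + D] -> P *+ k != Z /\ P *+ k != - Z.
      by rewrite !inE => /or3P[] /eqP ->; apply: offN.
    by move=> Y Z; rewrite !inE -mulrS -{1}[P]mulr1n => /or3P[] /eqP -> hZ; apply: hk; rewrite !inE.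
  have r := hv_rec (off_neq0 nC) (off_neq0 nD) (off_neq0 nS) sep.
  set a := \prod_(_ < _) _ in IH *; set b := \prod_(_ < _) _ in IH *; set c := \prod_(_ < _) _ in IH *.
  transitivity (a * b * (hv P (P *+ m) C * hv P (P *+ m) D * hv C D (P + P *+ m))); first by ring.
  rewrite r.
  transitivity (- (a * b * hv C D (P *+ m)) * hv C D P * hv P (P *+ m) (C + D)); first by ring.
  by rewrite IH !exprS; ring.
have := key n; rewrite tP /ff -/(ff P C) -signr_odd odd_n expr1 => h.
have h0 : hv C D 0 = -1 by [].
rewrite h0 in h; apply: oppr_inj; rewrite opprK -mulrN1 h; ring.
Qed.

Lemma ff_off_neq0 P X : tor P -> off P X -> ff P X != 0.
Proof.
move=> tP h; apply/prodf_neq0 => k _.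
have hk j : X != P *+ j /\ X != - (P *+ j).
  by have [h1 h2] := offN j tP h; rewrite eq_sym h1 -eqr_oppLR eq_sym h2.
by apply: hv_neq0; rewrite -?mulrS; [have [] := hk 1%N | have [] := hk k | have [] := hk k.+1 | have [] := hk k.+1].
Qed.

Variable G : seq (ept E).
Hypothesis tor_fin : forall P, P *+ n = 0 -> P \in G.
Variable e : ept E -> ept E -> K.
Hypothesis he : is_pairing n e.

(** The classical formula e(P, Q) = (-1)^n f_P(Q) / f_Q(P). [ff_eval_off] at (Q, T) and at (P, S),
    with one reciprocity, eliminates the base points. *)
Lemma pair_explicit P Q : tor P -> tor Q -> off P Q -> off Q P -> e P Q = - ff P Q / ff Q P.
Proof.
move=> tP tQ oPQ oQP; have [S [T g]] := ex_generic tor_fin.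
rewrite (he tP tQ g); have [nS nT g1 g2] := g; have g' := generic_sym g.
have [_ nTQ h1 h2] := genericD tQ g; have [_ nSP h3 h4] := genericD tP g'.
have t0 : (0 : ept E) *+ n = 0 by rewrite mul0rn.
have ge0 A B S' T' : tor A -> generic n S' T' -> hv A S' T' != 0.
  by move=> tA g0; have := hv_PS_neq0 tA t0 g0; rewrite add0r.
rewrite [T + Q]addrC in nTQ h1 h2; rewrite [S + P]addrC in nSP h3 h4.
have E1 := ff_eval_off tP oPQ (off_ntor tP nT) (off_ntor tP nTQ).
have E2 := ff_eval_off tQ oQP (off_ntor tQ nS) (off_ntor tQ nSP).
have nf1 := ff_off_neq0 tP oPQ; have nf2 := ff_off_neq0 tQ oQP.
have nf3 := ff_off_neq0 tP (off_ntor tP nT); have nf4 := ff_off_neq0 tQ (off_ntor tQ nS).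
have nh1 : hv Q T P != 0.
  apply: contraNneq (mulf_neq0 nf1 nf3) => h; rewrite E1 h expr0n.
  by case: n odd_n => //= k _; rewrite mul0r oppr0.
have nh2 : hv P S Q != 0.
  apply: contraNneq (mulf_neq0 nf2 nf4) => h; rewrite E2 h expr0n.
  by case: n odd_n => //= k _; rewrite mul0r oppr0.
have nh3 : hv P S T != 0 by exact: (ge0 P P S T tP g).
have nh4 : hv P S (Q + T) != 0 by exact: (hv_PS_neq0 tP tQ g).
have nh5 : hv Q T S != 0 by exact: (ge0 Q Q T S tQ g').
have nh6 : hv Q T (P + S) != 0 by exact: (hv_PS_neq0 tQ tP g').
have sep : separated P S Q T.
  have tn Y X : tor X -> ntor Y -> X != Y /\ X != - Y by move=> a b; exact: (tor_ntor_neq a b).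
  have nt Y X : ntor Y -> tor X -> Y != X /\ Y != - X.
    by move=> a b; have [c d] := tor_ntor_neq b a; rewrite eq_sym c -eqr_oppLR eq_sym d.
  have dd X Y : ntor (X - Y) -> ntor (X + Y) -> X != Y /\ X != - Y.
    by move=> a b; split; [exact: (ntor_neq a) | exact: (ntor_neqN b)].
  have sd X Y : ntor (X - Y) -> ntor (X + Y) -> Y != X /\ Y != - X.
    by move=> a b; have [c d] := dd _ _ a b; rewrite eq_sym c -eqr_oppLR eq_sym d.
  move=> Y Z; rewrite !inE => /or3P[] /eqP -> /or3P[] /eqP ->.
  - by have := offN 1 tP oPQ; rewrite mulr1n.
  - exact: (tn _ _ tP nT).
  - exact: (tn _ _ tP nTQ).
  - exact: (nt _ _ nS tQ).
  - exact: (sd _ _ g2 g1).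
  - exact: (sd _ _ h2 h1).
  - exact: (nt _ _ nSP tQ).
  - exact: (dd _ _ h4 h3).
  - have k1 := ntorD (torN tQ) h4; have k2 := ntorD tQ h3.
    by apply: dd; rewrite [Q + T]addrC ?opprD addrA.
have R := hv_rec (off_neq0 oPQ) (ntor_neq0 nT) (ntor_neq0 nTQ) sep.
have nX (x y : K) : x = - y -> x ^+ n = - y ^+ n by move=> ->; rewrite exprNn -signr_odd odd_n expr1 mulN1r.
have Rn := nX _ _ R; rewrite /wpv !expr_div_n; rewrite !exprMn in Rn.
have := expf_neq0 n nh1; have := expf_neq0 n nh2; have := expf_neq0 n nh3; have := expf_neq0 n nh4; have := expf_neq0 n nh5; have := expf_neq0 n nh6.
have nf5 : ff Q (P + S) != 0 by apply: ff_off_neq0 => //; apply: off_ntor.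
move: E1 E2 Rn nf1 nf2 nf3 nf4 nf5.
move: (hv Q T P ^+ n) (hv P S Q ^+ n) (hv P S T ^+ n) (hv P S (Q + T) ^+ n) (hv Q T S ^+ n) (hv Q T (P + S) ^+ n).
move: (ff P Q) (ff Q P) (ff P T) (ff Q S) (ff P (Q + T)) (ff Q (P + S)) => u v u' v' u2 v2 a b c d x y E1 E2 Rn n1 n2 n3 n4 n5 p1 p2 p3 p4 p5 p6.
have -> : u2 = - (u * u' / a) by rewrite E1; field.
have ev2 : v2 = - (v * v' / b) by rewrite E2; field.
rewrite ev2; have ey : y = - (a * x * d) / (b * c) by rewrite -Rn; field; rewrite p5 p4.
by rewrite ey; field; rewrite n2 n4 n3 p6 p5 p4 p3 p2.
Qed.

End Explicit.

Section Flex.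
Variables (K : numClosedFieldType) (E : ecurve K).
Implicit Types (A B C D P Q S T U X Y Z G : ept E).

Lemma cub_sum (l m u v w : K) : (forall x, ecub E x - (l * x + m) ^+ 2 = (x - u) * (x - v) * (x - w)) ->
  l ^+ 2 = u + v + w.
Proof.
move=> h; have h1 := h 1; have h2 := h (-1); have h0 := h 0.
apply: (mulfI (two_neq0 K)); rewrite /ecub in h0 h1 h2.
transitivity (- ((1 ^+ 3 + ea E * 1 + eb E - (l * 1 + m) ^+ 2) + ((-1) ^+ 3 + ea E * (-1) + eb E - (l * (-1) + m) ^+ 2)
   - 2%:R * (0 ^+ 3 + ea E * 0 + eb E - (l * 0 + m) ^+ 2))); first by ring.
by rewrite h1 h2 h0; ring.
Qed.

Lemma hv_opp A X x y x' y' : val A = Some (x, y) -> val X = Some (x', y') -> hv A (- A) X = x' - x.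
Proof.
move=> eA eX; rewrite /hv eX valN eA /numr /denr /= eqxx subrr eqxx /=.
by rewrite ev_rxm evc divr1.
Qed.

Section AtQ.
Variable Q : ept E.
Hypothesis tQ : Q *+ 3 = 0.
Hypothesis Q0 : Q != 0.

Lemma flexD : Q + Q = - Q.
Proof. by apply/eqP; rewrite -addr_eq0 -addrA -[X in X == _]/(Q *+ 3) tQ. Qed.

(** [m] is the slope of the flex tangent at Q and [l] that of the line through Q, X and W; the
    product formula compares the cubic along these two lines. *)
Lemma flex_line X W : X != 0 -> W != 0 -> X + W + Q = 0 -> X != Q -> X != - Q -> W != Q -> W != - Q ->
  exists l m xQ yQ xX xW yX yW, [/\ val Q = Some (xQ, yQ), val X = Some (xX, yX), val W = Some (xW, yW) &
   [/\ yX = yQ + l * (xX - xQ), yW = yQ + l * (xW - xQ), hv Q Q X = l - m /\ hv Q Q W = l - m,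
      (xX - xQ) * (xW - xQ) = - 2%:R * yQ * (l - m) & l ^+ 2 = xX + xQ + xW]].
Proof.
move=> X0 W0 s n1 n2 n3 n4.
have QQ0 : Q + Q != 0 by rewrite flexD oppr_eq0.
have [m [k [xQ [xQ' [xU [eQ eQ' eU cQ hQ]]]]]] := lineP Q0 Q0 QQ0.
have XQ0 : X + Q != 0 by rewrite addr_eq0.
have [l [k' [xX [xQ'' [xW [eX eQ'' eW cX hX]]]]]] := lineP X0 Q0 XQ0.
have e1 : xQ' = xQ by move: eQ'; rewrite eQ => -[].
have e2 : xU = xQ by move: eU; rewrite flexD valN eQ /= => -[].
have e3 : xQ'' = xQ by move: eQ''; rewrite eQ => -[].
subst xQ' xU xQ''.
have ek : l * xQ + k' = m * xQ + k by move: eQ''; rewrite eQ => -[].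
have eWv : val W = Some (xW, l * xW + k').
  have -> : W = - (X + Q) by apply/eqP; rewrite -addr_eq0 addrA [W + X]addrC s.
  by rewrite valN eW /= opprK.
have dX := neq_x eX eQ n1 n2; have dW := neq_x eWv eQ n3 n4.
exists l, m, xQ, (m * xQ + k), xX, xW, (l * xX + k'), (l * xW + k'); split=> //.
have ek' : k' = m * xQ + k - l * xQ by rewrite -ek; ring.
split.
- by rewrite ek'; ring.
- by rewrite ek'; ring.
- by rewrite (hQ _ _ _ eX) (hQ _ _ _ eWv) ek'; split; field.
2: exact: cub_sum cX.
(* [L] is affine in x and vanishes at xQ + 1 and xQ - 1, hence also at xQ, where it is the identity
   sought. *)
pose L x := (l - m) * ((l * x + k') + (m * x + k)) - ((x - xQ) ^+ 2 - (x - xX) * (x - xW)).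
have hL x : (x - xQ) * L x = 0.
  transitivity ((ecub E x - (m * x + k) ^+ 2) - (x - xQ) * (x - xQ) * (x - xQ)
     - ((ecub E x - (l * x + k') ^+ 2) - (x - xX) * (x - xQ) * (x - xW))); first by rewrite /L ek'; ring.
  by rewrite cQ cX !subrr.
have h1 := hL (xQ + 1); have h2 := hL (xQ - 1).
apply: (mulfI (two_neq0 K)); apply/eqP; rewrite -subr_eq0; apply/eqP.
transitivity (((xQ + 1) - xQ) * L (xQ + 1) - ((xQ - 1) - xQ) * L (xQ - 1)); last by rewrite h1 h2 subrr.
by rewrite /L ek'; ring.
Qed.

(* The points A, B, G, Q are the finite intersections of the cubic with a parabola y = r + s x + t x^2. *)
Lemma flex_conic A B G : A + B + G + Q = 0 -> A != 0 -> B != 0 -> G != 0 -> A + B != 0 -> G + B != 0 ->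
  A != Q -> A != - Q -> B != Q -> B != - Q -> G != Q -> G != - Q -> G != B -> G != - B ->
  A + B != Q -> A + B != - Q -> G + B != Q -> G + B != - Q ->
  hv A B Q * hv Q Q G = hv G B Q * hv Q Q A.
Proof.
move=> s A0 B0 G0 V0 S0 a1 a2 b1 b2 g1 g2 gb1 gb2 v1 v2 s1 s2.
have sG : G + (A + B) + Q = 0 by rewrite -s; congr (_ + _); rewrite addrC.
have sA : A + (G + B) + Q = 0 by rewrite -s -!addrA; congr (_ + _); rewrite addrCA.
have [l1 [m [xQ [yQ [xG [xV [yG [yV [eQ eG eV [hyG hyV [hG _] pG sumG]]]]]]]]]] := flex_line G0 V0 sG g1 g2 v1 v2.
have [l2 [m' [xQ' [yQ' [xA [xS [yA [yS [eQ' eA eS [hyA hyS [hA _] pA _]]]]]]]]]] := flex_line A0 S0 sA a1 a2 s1 s2.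
have [e1 e2] : xQ' = xQ /\ yQ' = yQ by move: eQ'; rewrite eQ => -[-> ->].
subst xQ' yQ'.
have [l [k [xA' [xB [xV' [eA' eB eV' cAB hAB]]]]]] := lineP A0 B0 V0.
have [j [q [xG' [xB' [xS' [eG' eB' eS' cGB hGB]]]]]] := lineP G0 B0 S0.
have [e1 e2] : xA' = xA /\ yA = l * xA + k by move: eA'; rewrite eA => -[-> ->].
have [e3 e4] : xV' = xV /\ yV = - (l * xV + k) by move: eV'; rewrite eV => -[-> ->].
have [e5 e6] : xG' = xG /\ yG = j * xG + q by move: eG'; rewrite eG => -[-> ->].
have [e7 e8] : xB' = xB /\ j * xB + q = l * xB + k by move: eB'; rewrite eB => -[-> ->].
have e9 : xS' = xS by move: eS'; rewrite eS => -[->].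
subst xA' xV' xG' xB' xS'.
have dA := neq_x eA eQ a1 a2; have dB := neq_x eB eQ b1 b2; have dG := neq_x eG eQ g1 g2.
have dV := neq_x eV eQ v1 v2; have dS := neq_x eS eQ s1 s2; have dGB := neq_x eG eB gb1 gb2.
rewrite (hAB _ _ _ eQ) (hGB _ _ _ eQ) hG hA.
have yQ0 : yQ != 0.
  apply/eqP => y0; have := pG; rewrite y0 !mulr0 mul0r => /eqP; rewrite mulf_eq0 (negPf dG) (negPf dV) //.
have c0 : - 2%:R * yQ != 0 by rewrite mulNr oppr_eq0 mulf_neq0 ?two_neq0.
have dV' : xQ - xV != 0 by rewrite -opprB oppr_eq0.
have dS' : xQ - xS != 0 by rewrite -opprB oppr_eq0.
apply: (mulfI c0).
set e := yQ - (l * xQ + k); set f := yQ - (j * xQ + q).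
suff con : e * (xG - xQ) = f * (xA - xQ).
  transitivity (- (e * (xG - xQ))); last rewrite con.
    transitivity (e / (xQ - xV) * (- 2%:R * yQ * (l1 - m))); first by ring.
    by rewrite -pG; field.
  transitivity (f / (xQ - xS) * (- 2%:R * yQ * (l2 - m'))); last by ring.
  by rewrite -pA; field.
have ed : (l1 + l) * (xQ - xV) = yQ + (l * xQ + k).
  have -> : (l1 + l) * (xQ - xV) = yQ - (yQ + l1 * (xV - xQ)) + l * (xQ - xV) by ring.
  by rewrite -hyV e4; ring.
have edd : e * (l1 + l) = (xQ - xA) * (xQ - xB).
  apply: (mulIf dV'); rewrite -mulrA ed -cAB -(valSomeP eQ) /e; ring.
have dA' : xQ - xA != 0 by rewrite -opprB oppr_eq0.
have dB' : xQ - xB != 0 by rewrite -opprB oppr_eq0.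
have d0 : l1 + l != 0.
  by apply: contraNneq (mulf_neq0 dA' dB') => h; rewrite -edd h mulr0.
have sA' := cub_sum cAB.
have exG : xG = (l1 + l) ^+ 2 - 2%:R * l * (l1 + l) + xA + xB - xQ.
  have -> : xA = l ^+ 2 - xB - xV by rewrite sA'; ring.
  have -> : xV = l1 ^+ 2 - xG - xQ by rewrite sumG; ring.
  by ring.
have hf : f * (xG - xB) = (xG - xQ) * (e + (l - l1) * (xQ - xB)).
  have ej : j * (xG - xB) = yQ + l1 * (xG - xQ) - (l * xB + k) by rewrite -hyG e6 -e8; ring.
  transitivity ((yQ - (l * xB + k)) * (xG - xB) - (j * (xG - xB)) * (xQ - xB)).
    by rewrite /f -e8; ring.
  by rewrite ej /e; ring.
apply: (mulIf dGB); rewrite [f * _ * _]mulrAC hf.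
apply: (mulIf d0).
transitivity ((xG - xQ) * (e * (l1 + l)) * (xG - xB)); first by ring.
transitivity ((xG - xQ) * (e * (l1 + l) + (l - l1) * (l1 + l) * (xQ - xB)) * (xA - xQ)); last by ring.
rewrite edd; rewrite {2}exG; ring.
Qed.

End AtQ.
End Flex.

End ExplicitPairing.

(** * The function theta: its translates, its cube, and the pairing on E[9] *)

Module ThetaFunction.
Import CurveRing PointIdeals CocycleLaw CurveGroup Reciprocity MillerFunctions TorsionPairing ExplicitPairing.

Section Theta.
Variables (K : numClosedFieldType) (E : ecurve K).
Implicit Types (A B P Q S T U X Y Z G : ept E).

Definition theta (C : ept E) : K := hv (- (C *+ 3)) (C *+ 3) C / hv C C (- (C *+ 3)).

Variables (C T : ept E).
Hypotheses (C9 : C *+ 9 = 0) (C3 : C *+ 3 != 0) (T3 : T *+ 3 = 0).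
Hypothesis indep : forall k, T != C *+ k.

Definition pt (i j : int) : ept E := C *~ i + T *~ j.
(** A decidable criterion for i C + j T to be nonzero. With it the side conditions of cocycle and
    reciprocity relations at such points become closed boolean computations. *)
Definition nz (i j : int) : bool := ~~ ((absz i %% 9 == 0) && (absz j %% 3 == 0))%N.

Lemma ptD i j k l : pt i j + pt k l = pt (i + k) (j + l).
Proof. by rewrite /pt !mulrzDr addrACA. Qed.
Lemma ptN i j : - pt i j = pt (- i) (- j).
Proof. by rewrite /pt opprD !mulrNz. Qed.

Lemma mulrn_mod (V : zmodType) (x : V) m k : x *+ m = 0 -> x *+ k = x *+ (k %% m).
Proof. by move=> h; rewrite {1}(divn_eq k m) mulrnDr mulnC mulrnA h mul0rn add0r. Qed.

Lemma nat_pt_neq0 i j : ~~ ((i %% 9 == 0) && (j %% 3 == 0))%N -> C *+ i + T *+ j != 0 /\ C *+ i - T *+ j != 0.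
Proof.
move=> h.
have no k l : (l = 1 \/ l = 2)%N -> C *+ k + T *+ l <> 0.
  move=> hl; have oppC m : - (C *+ m) = C *+ (m * 8) by exact: (@tor_opp _ _ 9 isT).
  case: hl => -> e0.
    case/eqP: (indep (k * 8)); rewrite -oppC; apply/eqP; rewrite -addr_eq0 addrC.
    by apply/eqP; exact: e0.
  case/eqP: (indep k); rewrite -[RHS]addr0 -T3 -[T *+ 3]/(T + (T + T)) -[X in C *+ k + (T + X)]/(T *+ 2).
  by rewrite addrCA e0 addr0.
have {}no k l : (l %% 3 != 0)%N -> C *+ k + T *+ l <> 0.
  rewrite (mulrn_mod l T3); have : (l %% 3 < 3)%N by rewrite ltn_mod.
  by case: (l %% 3)%N => [|[|[|]]] // _ _; apply: no; [left | right].
have nC : (j %% 3 == 0)%N -> C *+ i <> 0.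
  move=> j0; move: h; rewrite j0 andbT (mulrn_mod i C9).
  have : (i %% 9 < 9)%N by rewrite ltn_mod.
  have key m u : (u * m = 3 %[mod 9])%N -> C *+ m <> 0.
    by move=> e e0; case/eqP: C3; rewrite (mulrn_mod 3 C9) -e -(mulrn_mod _ C9) mulnC mulrnA e0 mul0rn.
  case: (i %% 9)%N => [|[|[|[|[|[|[|[|[|]]]]]]]]] // _ _;
   [exact: (key 1%N 3%N)|exact: (key 2%N 6%N)|exact: (key 3%N 1%N)|exact: (key 4%N 3%N)|exact: (key 5%N 6%N)|exact: (key 6%N 2%N)|exact: (key 7%N 3%N)|exact: (key 8%N 6%N)].
have oppT : - (T *+ j) = T *+ (j * 2) by exact: (@tor_opp _ _ 3 isT).
have [j0|j0] := boolP (j %% 3 == 0)%N.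
  by rewrite !(mulrn_mod j T3) (eqP j0) mulr0n addr0 subr0; split; apply/eqP; apply: nC.
split; apply/eqP; first exact: no.
rewrite oppT; apply: no; apply: contra j0 => /eqP e; rewrite -[X in X == _]modn_mod.
by move: e; clear; lia.
Qed.

Lemma pt_neq0 i j : nz i j -> pt i j != 0.
Proof.
rewrite /nz /pt; move=> /nat_pt_neq0 [h1 h2].
have ab (V : zmodType) (x : V) (k : int) : x *~ k = x *+ absz k \/ x *~ k = - (x *+ absz k).
  by case: k => k; [left; rewrite -pmulrn | right; rewrite NegzE mulrNz -pmulrn].
case: (ab _ C i) => ->; case: (ab _ T j) => -> //.
  by rewrite addrC -opprB oppr_eq0.
by rewrite -opprD oppr_eq0.
Qed.

Lemma pt_neq i j k l : nz (i - k) (j - l) -> pt i j != pt k l.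
Proof. by move=> h; rewrite -subr_eq0 ptN ptD; apply: pt_neq0. Qed.

Definition nzz i j k l := nz (i - k) (j - l) && nz (i + k) (j + l).
Lemma pt_neqs i j k l : nzz i j k l -> pt i j != pt k l /\ pt i j != - pt k l.
Proof. by case/andP=> h1 h2; rewrite pt_neq // ptN pt_neq // !opprK. Qed.

Lemma pt_coc (i j k l p q x y : int) :
  [&& nz x y, nzz x y (i + k) (j + l), nzz x y (k + p) (l + q) & nzz x y (i + k + p) (j + l + q)] ->
  hv (pt i j) (pt k l) (pt x y) * hv (pt (i + k) (j + l)) (pt p q) (pt x y)
  = hv (pt i j) (pt (k + p) (l + q)) (pt x y) * hv (pt k l) (pt p q) (pt x y).
Proof.
case/and4P=> /pt_neq0 h0 /pt_neqs[h1 h2] /pt_neqs[h3 h4] /pt_neqs[h5 h6].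
by have := @hv_coc _ _ (pt i j) (pt k l) (pt p q) (pt x y); rewrite !ptD; apply.
Qed.

Lemma pt_rec (i j k l p q r s : int) :
  [&& nz p q, nz r s, nz (p + r) (q + s), [&& nzz i j p q, nzz i j r s & nzz i j (p + r) (q + s)],
    [&& nzz k l p q, nzz k l r s & nzz k l (p + r) (q + s)] &
    [&& nzz (i + k) (j + l) p q, nzz (i + k) (j + l) r s & nzz (i + k) (j + l) (p + r) (q + s)]] ->
  hv (pt i j) (pt k l) (pt p q) * hv (pt i j) (pt k l) (pt r s) * hv (pt p q) (pt r s) (pt (i + k) (j + l))
  = - (hv (pt p q) (pt r s) (pt i j) * hv (pt p q) (pt r s) (pt k l) * hv (pt i j) (pt k l) (pt (p + r) (q + s))).
Proof.
case/and5P=> /pt_neq0 h1 /pt_neq0 h2 /pt_neq0 h3 /and3P[/pt_neqs a1 /pt_neqs a2 /pt_neqs a3].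
case/andP=> /and3P[/pt_neqs b1 /pt_neqs b2 /pt_neqs b3] /and3P[/pt_neqs c1 /pt_neqs c2 /pt_neqs c3].
rewrite -!ptD in h3 a3 b3 c1 c2 c3 *; apply: hv_rec => //.
by move=> Y Z; rewrite !inE => /or3P[] /eqP -> /or3P[] /eqP ->.
Qed.

Lemma pt_hv_neq0 (i j k l x y : int) : [&& nz (x - i) (y - j), nz (x - k) (y - l) & nzz x y (i + k) (j + l)] ->
  hv (pt i j) (pt k l) (pt x y) != 0.
Proof.
case/and3P=> /pt_neq h1 /pt_neq h2 /pt_neqs[h3 h4]; rewrite -ptD in h3 h4; exact: hv_neq0.
Qed.

Lemma pt_off3 (i j k l : int) : [&& nz (k - 0) (l - 0), nz (k - i) (l - j) & nz (k - (i + i)) (l - (j + j))] -> pt i j *+ 3 = 0 ->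
  off (pt i j) (pt k l).
Proof.
case/and3P=> h0 h1 h2 t3 m; rewrite (mulrn_mod m t3); have : (m %% 3 < 3)%N by rewrite ltn_mod.
case: (m %% 3)%N => [|[|[|]]] // _.
- by have := pt_neq h0; rewrite mulr0n /pt !mulr0z addr0.
- by rewrite mulr1n; apply: pt_neq.
- by rewrite mulr2n ptD; apply: pt_neq.
Qed.

Lemma pt00 : pt 0 0 = 0. Proof. by rewrite /pt !mulr0z addr0. Qed.
Lemma ptC : pt 1 0 = C. Proof. by rewrite /pt mulr0z addr0. Qed.
Lemma ptT : pt 0 1 = T. Proof. by rewrite /pt mulr0z add0r. Qed.
Lemma pt3 : pt 3 0 = C *+ 3. Proof. by rewrite /pt mulr0z addr0 -pmulrn. Qed.
Lemma ptQ : pt (- 3) 0 = - (C *+ 3). Proof. by rewrite -pt3 ptN oppr0. Qed.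
Lemma pt_shiftC i j : pt (i + 9) j = pt i j.
Proof. by rewrite /pt mulrzDr -[C *~ 9]/(C *+ 9) C9 addr0. Qed.
Lemma pt_shiftT i j : pt i (j + 3) = pt i j.
Proof. by rewrite /pt mulrzDr -[T *~ 3]/(T *+ 3) T3 addr0. Qed.
Lemma pt_tor3 (i j : int) : (absz i %% 3 == 0)%N -> pt i j *+ 3 = 0.
Proof.
move=> h; have e (x : ept E) (m : int) : x *~ m *+ 3 = x *+ 3 *~ m by rewrite !pmulrn -!mulrzA mulrC.
rewrite /pt mulrnDl !e T3 mul0rz addr0.
have [q ->] : exists q : int, i = 3 * q by exists (i %/ 3)%Z; lia.
by rewrite mulrzA -[C *+ 3 *~ 3]/(C *+ 3 *+ 3) -mulrnA C9 mul0rz.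
Qed.

Ltac ptgoal := lazymatch goal with
  | |- is_true (_ != 0) => exact: pt_neq0
  | |- is_true (_ != - _) => rewrite ptN; exact: pt_neq
  | |- is_true (_ != _) => exact: pt_neq
  | |- _ = 0 => exact: pt00 end.

Local Notation Q := (pt (- 3) 0).
Local Notation Qm := (pt 3 0).

Lemma ff3 X Y : X *+ 3 = 0 -> Y != 0 -> ff 3 X Y = hv X X Y * hv X (- X) Y.
Proof.
move=> X3 Y0; rewrite /ff !big_ord_recr big_ord0 /= mul1r mulr0n mulr1n hv0r // mul1r.
congr (_ * hv X _ Y); apply/eqP; rewrite -addr_eq0 -mulrSr; exact/eqP.
Qed.

Lemma theta_pt : theta C = hv Q Qm (pt 1 0) / hv (pt 1 0) (pt 1 0) Q.
Proof. by rewrite /theta -ptQ -pt3 -ptC. Qed.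

Lemma theta_ptT : theta (C + T) = hv Q Qm (pt 1 1) / hv (pt 1 1) (pt 1 1) Q.
Proof.
have e : C + T = pt 1 1 by rewrite /pt.
have e3 : pt 1 1 *+ 3 = Qm by rewrite -e mulrnDl T3 addr0 pt3.
by rewrite /theta e e3 ptN oppr0.
Qed.

(** The factor of translation is -f_Q(T) / f_T(Q), that is e_3(Q, T). Two reciprocities, four
    cocycle relations at Q and [flex_conic] suffice to eliminate all values of h. *)
Lemma theta_trans : theta (C + T) * ff 3 T Q = - ff 3 Q T * theta C.
Proof.
have tQ : Q *+ 3 = 0 by exact: pt_tor3.
have nT : T != 0 by have := indep 0; rewrite mulr0n.
have nQ : Q != 0 by exact: pt_neq0.
have eQm : - Q = Qm by rewrite ptN.
have eTm : - T = pt 0 (-1) by rewrite -ptT ptN.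
rewrite ff3 // ff3 // theta_pt theta_ptT eQm eTm -ptT.
have e1 : hv Q Qm (pt 1 0) * hv Q Qm (pt 0 1) * hv (pt 1 0) (pt 0 1) 0
  = - (hv (pt 1 0) (pt 0 1) Q * hv (pt 1 0) (pt 0 1) Qm * hv Q Qm (pt 1 1)).
  by rewrite -pt00; apply: (pt_rec (i := -3) (k := 3) (p := 1) (q := 0) (r := 0) (s := 1)).
have e2 : hv Q Q (pt 1 0) * hv Q Q (pt 0 1) * hv (pt 1 0) (pt 0 1) Qm
  = - (hv (pt 1 0) (pt 0 1) Q * hv (pt 1 0) (pt 0 1) Q * hv Q Q (pt 1 1)).
  have -> : Qm = pt (- 3 + - 3) (0 + 0) by rewrite -(pt_shiftC (-3 + -3)).
  exact: (pt_rec (i := -3) (k := -3) (p := 1) (q := 0) (r := 0) (s := 1)).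
have c1 : hv (pt 1 1) (pt 1 0) Q * hv (pt 2 1) (pt 0 1) Q = hv (pt 1 1) (pt 1 1) Q * hv (pt 1 0) (pt 0 1) Q := @pt_coc 1 1 1 0 0 1 (-3) 0 isT.
have c3 : hv (pt 1 0) (pt 1 0) Q * hv (pt 2 0) (pt 0 1) Q = hv (pt 1 0) (pt 1 1) Q * hv (pt 1 0) (pt 0 1) Q := @pt_coc 1 0 1 0 0 1 (-3) 0 isT.
have c4 : hv (pt 2 0) (pt 0 1) Q * hv (pt 2 1) (pt 0 1) Q = hv (pt 2 0) (pt (0 + 0) (1 + 1)) Q * hv (pt 0 1) (pt 0 1) Q := @pt_coc 2 0 0 1 0 1 (-3) 0 isT.
have c5 : hv (pt 1 0) (pt 0 1) Q * hv (pt 1 1) (pt 0 (-1)) Q = hv (pt 1 0) (pt (0 + 0) (1 + -1)) Q * hv (pt 0 1) (pt 0 (-1)) Q := @pt_coc 1 0 0 1 0 (-1) (-3) 0 isT.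
have key : hv (pt 2 0) (pt 0 (-1)) Q * hv Q Q (pt 1 1) = hv (pt 1 1) (pt 0 (-1)) Q * hv Q Q (pt 2 0).
  apply: flex_conic; rewrite ?ptD //; ptgoal.
have fl : hv Q Q (pt 2 0) = hv Q Q (pt 1 0).
  have [] := @flex_line _ E Q tQ nQ (pt 2 0) (pt 1 0); rewrite ?ptD ?pt00 //; try ptgoal.
  by move=> ? [? [? [? [? [? [? [? [_ _ _ [_ _ [-> ->]]]]]]]]]].
rewrite fl in key.
have e0 : hv (pt 1 0) (pt 0 1) 0 = -1 by [].
rewrite e0 in e1.
have h0 : hv (pt 1 0) (pt (0 + 0) (1 + -1)) Q = 1 by rewrite [pt (0 + 0) _]pt00 hv0r.
rewrite h0 mul1r in c5.
have m1 : pt (0 + 0) (1 + 1) = pt 0 (-1) by rewrite -(pt_shiftT 0 (-1)).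
rewrite m1 in c4.
have [n1 n2 n3 n4] : [/\ hv (pt 1 0) (pt 0 1) Q != 0, hv (pt 1 0) (pt 0 1) Qm != 0, hv (pt 1 0) (pt 1 0) Q != 0 & hv (pt 1 1) (pt 1 1) Q != 0].
  by split; apply: pt_hv_neq0.
have [n5 n6 n7 n8] : [/\ hv (pt 2 0) (pt 0 1) Q != 0, hv Q Q (pt 1 0) != 0, hv Q Q (pt 1 1) != 0 & hv (pt 2 1) (pt 0 1) Q != 0].
  by split; apply: pt_hv_neq0.
have sy (X Y : ept E) : hv X Y Q = hv Y X Q by exact: hvC.
move: e1 e2 c1 c3 c4 c5 key.
rewrite (sy (pt 1 1) (pt 1 0)).
move: n1 n2 n3 n4 n5 n6 n7 n8.
move: (hv (pt 1 0) (pt 0 1) Q) (hv (pt 1 0) (pt 0 1) Qm) (hv (pt 1 0) (pt 1 0) Q) (hv (pt 1 1) (pt 1 1) Q)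
 (hv (pt 2 0) (pt 0 1) Q) (hv Q Q (pt 1 0)) (hv Q Q (pt 1 1)) (hv (pt 2 1) (pt 0 1) Q)
 (hv Q Qm (pt 1 0)) (hv Q Qm (pt 0 1)) (hv Q Qm (pt 1 1)) (hv Q Q (pt 0 1)) (hv (pt 0 1) (pt 0 1) Q)
 (hv (pt 0 1) (pt 0 (-1)) Q) (hv (pt 1 1) (pt 0 (-1)) Q) (hv (pt 2 0) (pt 0 (-1)) Q) (hv (pt 1 0) (pt 1 1) Q).
move=> ct cm cc c11 c2t mc m11 c21 hC hT h11 mT tt tm k1 k2 c111 n1 n2 n3 n4 n5 n6 n7 n8 e1 e2 c1 c3 c4 c5 key.
have E1 : h11 = hC * hT / (ct * cm) by apply: (mulfI (mulf_neq0 n1 n2)); apply: oppr_inj; rewrite -e1; field; rewrite n2.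
have E3 : c111 = cc * c2t / ct by apply: (mulIf n1); rewrite -c3; field.
have E11 : c11 = cc * k2 * tt / ct ^+ 2.
  apply: (mulIf n1); apply: (mulIf n5); rewrite -c1 E3.
  transitivity (cc * c2t / ct * (c2t * c21)); first by ring.
  by rewrite c4; field.
have Em : mT = - (ct ^+ 2 * m11) / (mc * cm).
  by apply: (mulfI (mulf_neq0 n6 n2)); transitivity (mc * mT * cm); [ring | rewrite e2; field; rewrite n6 n2].
have Etm : tm = ct * k1 by rewrite c5.
have n9 : k2 != 0 by apply: contraNneq n4 => h; rewrite E11 h mulr0 !mul0r.
have n10 : tt != 0 by apply: contraNneq n4 => h; rewrite E11 h mulr0 !mul0r.
have Ek : k1 = k2 * m11 / mc by apply: (mulIf n6); rewrite -key; field.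
by rewrite E11 E1 Etm Em Ek; field; rewrite n1 n2 n3 n6 n9 n10.
Qed.

(** From f_Q(C)^2 = - h_{C,C}(Q)^3 f_Q(2C): C, 2C and Q are collinear, so h_{Q,Q} takes the same
    value at C and 2C, and [flex_line] evaluates the rest. *)
Lemma theta_cube x y : val Q = Some (x, y) -> theta C ^+ 3 = 2%:R * y.
Proof.
move=> eQ; have tQ : Q *+ 3 = 0 by exact: pt_tor3.
have nQ : Q != 0 by exact: pt_neq0.
have s : pt 1 0 + pt 2 0 + Q = 0 by rewrite !ptD pt00.
have [l [m [xQ [yQ [xX [xW [yX [yW [eQ' eX eW [_ _ [h1 h2] p _]]]]]]]]]] := @flex_line _ E Q tQ nQ (pt 1 0) (pt 2 0)
  ltac:(exact: pt_neq0) ltac:(exact: pt_neq0) s ltac:(exact: pt_neq) ltac:(rewrite ptN; exact: pt_neq) ltac:(exact: pt_neq) ltac:(rewrite ptN; exact: pt_neq).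
have [ex ey] : xQ = x /\ yQ = y by move: eQ'; rewrite eQ => -[-> ->].
subst xQ yQ.
have eQm : Qm = - Q by rewrite ptN.
have g1 : hv Q Qm (pt 1 0) = xX - x by rewrite eQm (hv_opp eQ eX).
have g2 : hv Q Qm (pt 2 0) = xW - x by rewrite eQm (hv_opp eQ eW).
have F := @ff_eval_off _ E 3 isT Q (pt 1 0) (pt 1 0) tQ ltac:(exact: pt_off3) ltac:(exact: pt_off3) ltac:(rewrite ptD; exact: pt_off3).
rewrite ptD [pt (1 + 1) _]/(pt 2 0) ff3 ?(@pt_neq0 1 0 isT) // ff3 ?(@pt_neq0 2 0 isT) // -eQm g1 g2 h1 h2 in F.
have n1 : hv (pt 1 0) (pt 1 0) Q != 0 by exact: pt_hv_neq0.
have n2 : l - m != 0 by rewrite -h1; exact: pt_hv_neq0.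
have n3 : xX - x != 0 by rewrite -g1; exact: pt_hv_neq0.
rewrite theta_pt g1; move: n1 F; move: (hv (pt 1 0) (pt 1 0) Q) => c n1 F.
rewrite expr_div_n; apply: (mulIf (expf_neq0 3 n1)); rewrite divfK ?expf_neq0 //.
apply: (mulIf (expf_neq0 2 n2)).
transitivity (((l - m) * (xX - x)) * ((l - m) * (xX - x)) * (xX - x)); first by ring.
rewrite F; transitivity (- (c ^+ 3 * (l - m)) * ((xX - x) * (xW - x))); first by ring.
by rewrite p; ring.
Qed.

Variable G9 : seq (ept E).
Hypothesis tor_fin : forall P, P *+ 9 = 0 -> P \in G9.
Variable e : ept E -> ept E -> K.
Hypothesis he : is_pairing 9 e.

(** With Q = -3C the right side is e_3(Q, T). At level 9 the Miller function of T is the cube of the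
    one at level 3, and that of -C is f_Q times a cube; by [ff_eval_off] the cubes cancel. *)
Lemma pair9 : e (- C) T = - ff 3 Q T / ff 3 T Q.
Proof.
have tC : pt (-1) 0 *+ 9 = 0 by rewrite -[pt _ _]opprK ptN oppr0 opprK ptC mulNrn C9 oppr0.
have tT : T *+ 9 = 0 by rewrite (mulrnA T 3 3) T3 mul0rn.
have eC : - C = pt (-1) 0 by rewrite -ptC ptN oppr0.
have tT3 : pt 0 1 *+ 3 = 0 by rewrite ptT.
have tQ : Q *+ 3 = 0 by exact: pt_tor3.
have nT : T != 0 by have := indep 0; rewrite mulr0n.
have mk k : pt (-1) 0 *+ k = pt (- k%:Z) 0 by rewrite -eC mulNrn -[C *+ k]addr0 /pt mulr0z addr0 mulrNz -pmulrn addr0.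
have oPT : off (pt (-1) 0) T.
  by move=> k; rewrite (mulrn_mod k tC) mk -ptT; apply: pt_neq; rewrite /nz (_ : (absz (1 - 0 : int) %% 3 == 0)%N = false) ?andbF.
have oTP : off T (pt (-1) 0) by rewrite -ptT; exact: pt_off3.
rewrite eC (pair_explicit (isT : odd 9) tor_fin he tC tT oPT oTP).
have -> : ff 9 T (pt (-1) 0) = ff 3 T (pt (-1) 0) ^+ 3.
  rewrite /ff !big_ord_recr !big_ord0 /=.
  rewrite (mulrn_mod 3 T3) (mulrn_mod 4 T3) (mulrn_mod 5 T3) (mulrn_mod 6 T3) (mulrn_mod 7 T3) (mulrn_mod 8 T3) /=; ring.
have co := @pt_coc; pose X := pt 0 1.
have cA k : (k <= 7)%N -> hv (pt (-1) 0) (pt (-1) 0) X * hv (pt (-2) 0) (pt (- k%:Z) 0) X = hv (pt (-1) 0) (pt (-1 + - k%:Z) (0 + 0)) X * hv (pt (-1) 0) (pt (- k%:Z) 0) X.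
  move=> hk; apply: (pt_coc (i := -1) (j := 0) (k := -1) (l := 0) (p := - k%:Z) (q := 0)).
  by move: hk; case: k => [|[|[|[|[|[|[|[|]]]]]]]].
have cB k : (k <= 6)%N -> hv (pt (-2) 0) (pt (-1) 0) X * hv Q (pt (- k%:Z) 0) X = hv (pt (-2) 0) (pt (-1 + - k%:Z) (0 + 0)) X * hv (pt (-1) 0) (pt (- k%:Z) 0) X.
  move=> hk; apply: (pt_coc (i := -2) (j := 0) (k := -1) (l := 0) (p := - k%:Z) (q := 0)).
  by move: hk; case: k => [|[|[|[|[|[|[|]]]]]]].
(* Three consecutive factors of the Miller function of -C make one factor of that of Q, up to a
   constant independent of k. *)
have tri k : (k <= 6)%N -> hv (pt (-1) 0) (pt (- k%:Z) 0) X * hv (pt (-1) 0) (pt (- k.+1%:Z) 0) X * hv (pt (-1) 0) (pt (- k.+2%:Z) 0) X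
   = (hv (pt (-1) 0) (pt (-1) 0) X * hv (pt (-2) 0) (pt (-1) 0) X) * hv Q (pt (- k%:Z) 0) X.
  move=> hk; have a1 := cA k.+1 hk; have b1 := cB k hk.
  have m1 : pt (-1 + - k%:Z) (0 + 0) = pt (- k.+1%:Z) 0 by congr (pt _ _); lia.
  have m2 : pt (-1 + - k.+1%:Z) (0 + 0) = pt (- k.+2%:Z) 0 by congr (pt _ _); lia.
  rewrite m2 in a1; rewrite m1 in b1.
  transitivity (hv (pt (-1) 0) (pt (- k%:Z) 0) X * (hv (pt (-1) 0) (pt (- k.+2%:Z) 0) X * hv (pt (-1) 0) (pt (- k.+1%:Z) 0) X)); first by ring.
  by rewrite -a1; transitivity (hv (pt (-1) 0) (pt (-1) 0) X * (hv (pt (-2) 0) (pt (- k.+1%:Z) 0) X * hv (pt (-1) 0) (pt (- k%:Z) 0) X)); [ring | rewrite -b1; ring].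
have -> : ff 9 (pt (-1) 0) T = ff 3 Q T * (hv (pt (-1) 0) (pt (-1) 0) X * hv (pt (-2) 0) (pt (-1) 0) X) ^+ 3.
  have mQ k : Q *+ k = pt (- (3 * k)%:Z) 0.
    by rewrite ptQ -mulNrn -mulrnA eC mk.
  have := tri 0%N isT; have := tri 3%N isT; have := tri 6%N isT; rewrite /ff !big_ord_recr !big_ord0 /= !mk !mQ -ptT -/X.
  rewrite [(3 * 0)%N]/= [(3 * 1)%N]/= [(3 * 2)%N]/= => t1 t2 t3.
  rewrite !mul1r; set u := (_ * hv (pt (-2) 0) _ X) in t1 t2 t3 *.
  rewrite -[LHS]mulrA -[LHS]mulrA; rewrite [X in _ * X]mulrA t1.
  rewrite -[LHS]mulrA.
  transitivity ((hv (pt (-1) 0) (pt (- 0%:Z) 0) X * hv (pt (-1) 0) (pt (- 1%:Z) 0) X * hv (pt (-1) 0) (pt (- 2%:Z) 0) X)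
   * (hv (pt (-1) 0) (pt (- 3%:Z) 0) X * hv (pt (-1) 0) (pt (- 4%:Z) 0) X * hv (pt (-1) 0) (pt (- 5%:Z) 0) X) * (u * hv Q (pt (- 6%:Z) 0) X)); first by ring.
  by rewrite t3 t2; ring.
have F1 := @ff_eval_off _ E 3 isT T (pt (-1) 0) (pt (-1) 0) T3 oTP oTP ltac:(rewrite ptD -ptT; exact: pt_off3).
have F2 := @ff_eval_off _ E 3 isT T (pt (-2) 0) (pt (-1) 0) T3 ltac:(rewrite -ptT; exact: pt_off3) oTP ltac:(rewrite ptD -ptT; exact: pt_off3).
rewrite ptD in F1; rewrite ptD in F2.
have nf : ff 3 T (pt (-1) 0) != 0 by apply: ff_off_neq0.
have oQ : off T Q by rewrite -ptT; exact: pt_off3.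
have nfQ : ff 3 T Q != 0 by apply: ff_off_neq0.
have : ff 3 T (pt (-1) 0) ^+ 3 = (hv (pt (-1) 0) (pt (-1) 0) X * hv (pt (-2) 0) (pt (-1) 0) X) ^+ 3 * ff 3 T Q.
  rewrite /X ptT; transitivity (ff 3 T (pt (-1) 0) * ff 3 T (pt (-1) 0) * ff 3 T (pt (-1) 0)); first by ring.
  rewrite F1; transitivity (- (hv (pt (-1) 0) (pt (-1) 0) T ^+ 3) * (ff 3 T (pt (-2) 0) * ff 3 T (pt (-1) 0))); first by ring.
  by rewrite F2; ring.
move: nf nfQ; move: (ff 3 T _) (ff 3 T Q) (ff 3 Q T) (hv _ _ X * _) => f g h u nf ng ef.
have u0 : u != 0.
  by apply: contraNneq nf => u0; have /eqP := ef; rewrite u0 expr0n mul0r expf_eq0.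
by rewrite ef; field; rewrite ng u0.
Qed.

End Theta.

End ThetaFunction.

(** * Division polynomials, divisibility, and bases of E[3], E[7], E[9] *)

Module TorsionStructure.
Import CurveRing PointIdeals CocycleLaw CurveGroup Reciprocity.

Section Top.
Variable R : comNzRingType.
Implicit Types (p q : {poly R}).
(** A bound on the degree together with one coefficient; unlike the exact degree this passes through
    sums, and a nonzero c recovers the degree. *)
Definition top p n c := (size p <= n.+1)%N /\ p`_n = c.

Lemma topM p q m n c d : top p m c -> top q n d -> top (p * q) (m + n) (c * d).
Proof.
move=> [sp cp] [sq cq]; split.
  apply: leq_trans (size_polyMleq _ _) _.
  by move: sp sq; move: (size p) (size q) => u v; lia.
have hm : (m < (m + n).+1)%N by rewrite ltnS leq_addr.
rewrite coefM (bigD1 (Ordinal hm)) //= addKn cp cq big1 ?addr0 // => i ni.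
have [lt|ge] := ltnP i m.
  rewrite [q`_ _]nth_default ?mulr0 //; apply: leq_trans sq _; lia.
have {}ge : (m < i)%N by rewrite ltn_neqAle ge andbT; apply: contra ni => /eqP e; apply/eqP/val_inj.
by rewrite nth_default ?mul0r //; apply: leq_trans sp _.
Qed.
Lemma topD p q n c d : top p n c -> top q n d -> top (p + q) n (c + d).
Proof.
move=> [sp cp] [sq cq]; split; last by rewrite coefD cp cq.
by apply: leq_trans (size_polyD _ _) _; rewrite geq_max sp sq.
Qed.
Lemma topZ k p n c : top p n c -> top (k *: p) n (k * c).
Proof. by move=> [sp cp]; split; [apply: leq_trans (size_scale_leq _ _) sp | rewrite coefZ cp]. Qed.
Lemma topN p n c : top p n c -> top (- p) n (- c).
Proof. by move=> [sp cp]; rewrite /top size_polyN coefN cp. Qed.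
Lemma top_neq0 p n c : top p n c -> c != 0 -> p != 0.
Proof. by move=> [_ <-]; apply: contraNneq => ->; rewrite coef0. Qed.
End Top.

Section Torsion.
Variables (K : numClosedFieldType) (E : ecurve K).
Local Notation a := (ea E).
Local Notation b := (eb E).
Implicit Types (A B P Q S T U V X Y Z : ept E).

Lemma ex_pt x : exists P y, val P = Some (x, y) /\ y ^+ 2 = ecub E x.
Proof.
have [y oy] := onc_ex E x.
have o : onc E (Some (x, y)) by rewrite oncE oy.
pose P : ept E := exist _ (Some (x, y)) o; by exists P, y.
Qed.

Lemma dbl_val A x y l : val A = Some (x, y) -> y != 0 -> l = (3%:R * x ^+ 2 + a) / (2%:R * y) ->
  val (A + A) = Some (l ^+ 2 - x - x, l * (x - (l ^+ 2 - x - x)) - y).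
Proof.
move=> eA y0 ->; have no : ~~ opposite (val A) (val A).
  by rewrite eA /= eqxx /= -mulr2n mulrn_eq0.
by have := opposite_add eA eA no; rewrite /slope eqxx.
Qed.

Lemma add_val A B x y x' y' l : val A = Some (x, y) -> val B = Some (x', y') -> x != x' ->
  l = (y' - y) / (x' - x) -> val (A + B) = Some (l ^+ 2 - x - x', l * (x - (l ^+ 2 - x - x')) - y).
Proof.
move=> eA eB n ->; have no : ~~ opposite (val A) (val B) by rewrite eA eB /= (negPf n).
by have := opposite_add eA eB no; rewrite /slope (negPf n).
Qed.

Lemma two_tor A x : val A = Some (x, 0) -> A + A = 0.
Proof. by move=> eA; apply: val_inj; rewrite valD eA addpE eqxx addr0 eqxx. Qed.

(** The abscissa of B is a root of the monic quartic obtained from x(2B) = X by clearing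
    denominators. Such a root with y = 0 would be a multiple root of the cubic. *)
Lemma halving A : exists B, B *+ 2 = A.
Proof.
have [->|/affineP[X [Y eA]]] := eqVneq A 0; first by exists 0; rewrite mul0rn.
pose c := [:: - a ^+ 2 + 4%:R * b * X; 8%:R * b + 4%:R * a * X; 2%:R * a; 4%:R * X].
have [x hx] := @solve_monicpoly K 4%N (fun i => c`_i) isT.
rewrite !big_ord_recr big_ord0 /= add0r in hx.
have [P [y [eP oy]]] := ex_pt x.
have y0 : y != 0.
  apply/eqP => y0; have f0 : ecub E x = 0 by rewrite -oy y0 expr0n.
  case/eqP: (ecub_simple f0); apply/eqP; rewrite -sqrf_eq0; apply/eqP.
  transitivity (x ^+ 4 - 2%:R * a * x ^+ 2 - 8%:R * b * x + a ^+ 2 + 8%:R * x * ecub E x).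
    by rewrite /ecub; ring.
  rewrite f0 mulr0 addr0 hx; transitivity (4%:R * X * ecub E x); first by rewrite /ecub; ring.
  by rewrite f0 mulr0.
have := dbl_val eP y0 (erefl _); set l := _ / _ => e2.
have ex : l ^+ 2 - x - x = X.
  have F0 : y ^+ 2 != 0 by rewrite expf_neq0.
  have -> : l ^+ 2 - x - x = ((3%:R * x ^+ 2 + a) ^+ 2 - 8%:R * x * y ^+ 2) / (4%:R * y ^+ 2) by rewrite /l; field.
  apply: (mulIf (mulf_neq0 (_ : 4%:R != 0) F0)); first by rewrite pnatr_eq0.
  rewrite divfK ?mulf_neq0 ?pnatr_eq0 // oy /ecub.
  transitivity (x ^+ 4 - 2%:R * a * x ^+ 2 - 8%:R * b * x + a ^+ 2); first by ring.
  by rewrite hx; ring.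
rewrite ex in e2; case: (same_x eA e2) => ->; first by exists P; rewrite mulr2n.
by exists (- P); rewrite mulNrn mulr2n.
Qed.

(** The classical division polynomials with powers of y^2 eliminated: psi_2 = 2 y and psi_4 = 4 y
    [psi4], while [p_m] is the numerator of the tangent slope. *)
Definition p_m : {poly K} := 3%:R *: 'X^2 + a%:P.
Definition psi3 : {poly K} := 12%:R *: ('X * fpoly E) - p_m * p_m.
Definition psi4 : {poly K} := p_m * psi3 - 8%:R *: (fpoly E * fpoly E).
Definition psi5 : {poly K} := 32%:R *: (fpoly E * fpoly E * psi4) - psi3 * psi3 * psi3.
Definition psi7 : {poly K} := psi5 * (psi3 * psi3 * psi3) - 128%:R *: (fpoly E * fpoly E * (psi4 * psi4 * psi4)).

Lemma p_mE x : p_m.[x] = 3%:R * x ^+ 2 + a. Proof. by rewrite /p_m !hornE. Qed.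
Lemma psi3E x : psi3.[x] = 12%:R * x * ecub E x - (3%:R * x ^+ 2 + a) ^+ 2.
Proof. by rewrite /psi3 hornerD hornerN hornerZ !hornerM fpolyE p_mE hornerX; ring. Qed.
Lemma psi3E' x : psi3.[x] = 3%:R * x ^+ 4 + 6%:R * a * x ^+ 2 + 12%:R * b * x - a ^+ 2.
Proof. by rewrite psi3E /ecub; ring. Qed.
Lemma psi4E x : psi4.[x] = (3%:R * x ^+ 2 + a) * psi3.[x] - 8%:R * ecub E x ^+ 2.
Proof. by rewrite /psi4 hornerD hornerN hornerZ !hornerM fpolyE p_mE; ring. Qed.
Lemma psi7E x : psi7.[x] = (32%:R * ecub E x ^+ 2 * psi4.[x] - psi3.[x] ^+ 3) * psi3.[x] ^+ 3
   - 128%:R * ecub E x ^+ 2 * psi4.[x] ^+ 3.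
Proof.
rewrite /psi7 /psi5 -fpolyE; move: (fpoly E) psi4 psi3 => F p q.
by rewrite !(hornerD, hornerN, hornerZ, hornerM); ring.
Qed.

Lemma top_fpoly : top (fpoly E) 3 1.
Proof.
rewrite /fpoly -addrA; split; last by rewrite coefD coefXn coefD coefZ coefX coefC /= mulr0 !addr0.
apply: leq_trans (size_polyD _ _) _; rewrite size_polyXn geq_max /=.
apply: leq_trans (size_polyD _ _) _; rewrite geq_max (leq_trans (size_scale_leq _ _)) ?size_polyX //.
exact: leq_trans (size_polyC_leq1 _) _.
Qed.
Lemma top_p_m : top p_m 2 3%:R.
Proof.
split; last by rewrite /p_m coefD coefZ coefXn coefC /= mulr1 addr0.
apply: leq_trans (size_polyD _ _) _; rewrite geq_max (leq_trans (size_scale_leq _ _)) ?size_polyXn //.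
exact: leq_trans (size_polyC_leq1 _) _.
Qed.
Lemma top_psi3 : top psi3 4 3%:R.
Proof.
have tX : top ('X : {poly K}) 1 1 by rewrite /top size_polyX coefX.
have -> : (3%:R : K) = 12%:R * (1 * 1) - 3%:R * 3%:R by ring.
exact: topD (topZ _ (topM tX top_fpoly)) (topN (topM top_p_m top_p_m)).
Qed.
Lemma top_psi4 : top psi4 6 1.
Proof.
have -> : (1 : K) = 3%:R * 3%:R - 8%:R * (1 * 1) by ring.
exact: topD (topM top_p_m top_psi3) (topN (topZ _ (topM top_fpoly top_fpoly))).
Qed.
Lemma top_psi7 : top psi7 24 7%:R.
Proof.
have t3 := topM (topM top_psi3 top_psi3) top_psi3.
have t4 := topM (topM top_psi4 top_psi4) top_psi4.
have tf := topM top_fpoly top_fpoly.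
have t5 : top psi5 12 5%:R.
  have -> : (5%:R : K) = 32%:R * (1 * 1 * 1) - 3%:R * 3%:R * 3%:R by ring.
  exact: topD (topZ _ (topM tf top_psi4)) (topN t3).
have -> : (7%:R : K) = 5%:R * (3%:R * 3%:R * 3%:R) - 128%:R * (1 * 1 * (1 * 1 * 1)) by ring.
exact: topD (topM t5 t3) (topN (topZ _ (topM tf t4))).
Qed.

(* [m/2y], [x - psi3/4y^2] and [psi4/8y^3] are the tangent slope and the coordinates of [2A]. *)
Lemma dbl_psi A x y : val A = Some (x, y) -> y != 0 ->
  val (A *+ 2) = Some (x - psi3.[x] / (4%:R * y ^+ 2), psi4.[x] / (8%:R * y ^+ 3)).
Proof.
move=> eA y0; rewrite mulr2n (dbl_val eA y0 (erefl _)); have o := valSomeP eA.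
by congr (Some (_, _)); rewrite ?psi4E psi3E -o; field.
Qed.

Lemma tor3E A x y : val A = Some (x, y) -> (A *+ 3 == 0) = (psi3.[x] == 0).
Proof.
move=> eA; have A0 : A != 0 by apply/eqP => h; move: eA; rewrite h.
have o := valSomeP eA; have [y0|y0] := eqVneq y 0.
  rewrite y0 in eA; rewrite mulrSr mulr2n (two_tor eA) add0r (negPf A0).
  have f0 : ecub E x = 0 by rewrite -o y0 expr0n.
  by rewrite psi3E f0 mulr0 sub0r oppr_eq0 sqrf_eq0 (negPf (ecub_simple f0)).
have e2 := dbl_psi eA y0.
have F0 : 4%:R * y ^+ 2 != 0 by rewrite mulf_neq0 ?expf_neq0 // pnatr_eq0.
apply/idP/idP => [h|/eqP h].
  have e : A *+ 2 = - A by apply/eqP; rewrite -addr_eq0 -mulrSr.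
  move: e2; rewrite e valN eA /= => -[/eqP]; rewrite eq_sym subr_eq addrC -subr_eq subrr eq_sym mulf_eq0 invr_eq0 (negPf F0) orbF.
  by [].
move: e2; rewrite h mul0r subr0 => e2; case: (same_x e2 eA) => e.
  by case/eqP: A0; apply: (addrI A); rewrite addr0 -mulr2n.
by rewrite mulrSr e addNr.
Qed.

Lemma tripl_val A x y : val A = Some (x, y) -> y != 0 -> psi3.[x] != 0 ->
  exists y', val (A *+ 3) = Some (x - 8%:R * y ^+ 2 * psi4.[x] / psi3.[x] ^+ 2, y').
Proof.
move=> eA y0 p0; have e2 := dbl_psi eA y0; have o := valSomeP eA.
have n : x != x - psi3.[x] / (4%:R * y ^+ 2).
  rewrite eq_sym subr_eq addrC -subr_eq subrr eq_sym mulf_eq0 invr_eq0 negb_or p0 /=.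
  by rewrite mulf_neq0 ?expf_neq0 // pnatr_eq0.
have := add_val eA e2 n (erefl _); rewrite -mulrS => ->.
eexists; congr (Some (_, _)).
have h : (3%:R * x ^+ 2 + a) ^+ 2 = 12%:R * x * y ^+ 2 - psi3.[x] by rewrite psi3E o; ring.
have -> : psi4.[x] = (3%:R * x ^+ 2 + a) * psi3.[x] - 8%:R * (y ^+ 2) ^+ 2 by rewrite psi4E o.
move: p0 h; move: (psi3.[x]) (3%:R * x ^+ 2 + a) => p m p0 h.
have -> : x - p / (4%:R * y ^+ 2) - x = - (p / (4%:R * y ^+ 2)) by ring.
transitivity (m ^+ 2 / (4%:R * y ^+ 2) + 4%:R * y ^+ 6 * 16%:R / p ^+ 2 - 8%:R * y ^+ 2 * m / p - x - x + p / (4%:R * y ^+ 2)).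
  by field; rewrite p0 y0.
by rewrite h; field; rewrite p0 y0.
Qed.

(** Here x(3B) = X reads (x - X) psi3^2 = 8 y^2 psi4. The leading coefficients 9 and 8 leave a monic
    equation of degree 9, whose other coefficients, with changed sign, are listed in [c]. *)
Lemma tripling A : exists B, B *+ 3 = A.
Proof.
have [->|/affineP[X [Y eA]]] := eqVneq A 0; first by exists 0; rewrite mul0rn.
pose c := [:: (1%:R * a ^+ 4 * X ^+ 1) + - (8%:R * a ^+ 3 * b ^+ 1) + - (64%:R * b ^+ 3);
     - (9%:R * a ^+ 4) + - (24%:R * a ^+ 2 * b ^+ 1 * X ^+ 1) + - (96%:R * a ^+ 1 * b ^+ 2);
     - (48%:R * a ^+ 2 * b ^+ 1) + - (12%:R * a ^+ 3 * X ^+ 1) + (144%:R * b ^+ 2 * X ^+ 1);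
     - (36%:R * a ^+ 3) + - (48%:R * b ^+ 2) + (144%:R * a ^+ 1 * b ^+ 1 * X ^+ 1);
     (24%:R * a ^+ 1 * b ^+ 1) + (30%:R * a ^+ 2 * X ^+ 1);
     - (30%:R * a ^+ 2) + (72%:R * b ^+ 1 * X ^+ 1);
     (96%:R * b ^+ 1) + (36%:R * a ^+ 1 * X ^+ 1);
     (12%:R * a ^+ 1);
     (9%:R * X ^+ 1)].
have [x hx] := @solve_monicpoly K 9%N (fun i => c`_i) isT.
rewrite !big_ord_recr big_ord0 /= add0r in hx.
have [P [y [eP oy]]] := ex_pt x.
have key : (x - X) * psi3.[x] ^+ 2 = 8%:R * y ^+ 2 * psi4.[x].
  rewrite psi4E psi3E oy /ecub; apply/eqP; rewrite -subr_eq0; apply/eqP.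
  by rewrite -[RHS](subrr (x ^+ 9)) {2}hx; ring.
have fin (Q : ept E) y' : val (Q *+ 3) = Some (X, y') -> exists B, B *+ 3 = A.
  by move=> e; case: (same_x eA e) => ->; [exists Q | exists (- Q); rewrite mulNrn].
have [y0|y0] := eqVneq y 0.
  have f0 : ecub E x = 0 by rewrite -oy y0 expr0n.
  have p0 : psi3.[x] != 0 by rewrite psi3E f0 mulr0 sub0r oppr_eq0 sqrf_eq0 ecub_simple.
  move: key; rewrite y0 expr0n mulr0 mul0r => /eqP; rewrite mulf_eq0 sqrf_eq0 (negPf p0) orbF subr_eq0 => /eqP ex.
  rewrite y0 ex in eP; apply: (fin P 0); by rewrite mulrSr mulr2n (two_tor eP) add0r.
have [p0|p0] := eqVneq (psi3.[x]) 0.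
  move/eqP: key; rewrite p0 expr0n mulr0 eq_sym mulf_eq0 (negPf (_ : 8%:R * y ^+ 2 != 0)); last first.
    by rewrite mulf_neq0 ?expf_neq0 // pnatr_eq0.
  by rewrite psi4E p0 mulr0 sub0r oppr_eq0 mulf_eq0 sqrf_eq0 -oy pnatr_eq0 /= expf_eq0 (negPf y0).
have [y' e3] := tripl_val eP y0 p0.
apply: (fin P y'); rewrite e3; congr (Some (_, _)).
apply: (mulIf (expf_neq0 2 p0)); rewrite mulrBl divfK ?expf_neq0 // -key; ring.
Qed.

(** [psi7] comes from x(4P) = x(3P) by clearing denominators; y, psi3 and psi4 do not vanish because
    P has no order 2, 3 or 4. *)
Lemma tor7_root P x y : P *+ 7 = 0 -> val P = Some (x, y) -> psi7.[x] = 0.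
Proof.
move=> t7 eP; have P0 : P != 0 by apply/eqP => h; move: eP; rewrite h.
have o := valSomeP eP.
have y0 : y != 0.
  apply/eqP => y0; rewrite y0 in eP; have t2 := two_tor eP.
  by case/eqP: P0; rewrite -t7 (mulrnDr P 6 1) (mulrnA P 2 3) mulr2n t2 mul0rn add0r mulr1n.
have p0 : psi3.[x] != 0.
  rewrite -(tor3E eP); apply: contraNneq P0 => t3.
  by rewrite -t7 (mulrnDr P 6 1) (mulrnA P 3 2) t3 mul0rn add0r mulr1n.
have [y3 e3] := tripl_val eP y0 p0.
have e2 := dbl_psi eP y0.
set x2 := x - _ / _ in e2; set y2 := _ / _ in e2.
have y20 : y2 != 0.
  apply/eqP => y20; rewrite y20 in e2; have t4 := two_tor e2.
  case/eqP: P0; rewrite -[P]mulr1n; have : P *+ 8 = 0 by rewrite (mulrnA P 2 4) (mulrnA (P *+ 2) 2 2) [_ *+ 2 *+ 2 in X in X *+ 2]mulr2n t4 mul0rn.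
  by rewrite (mulrnDr P 7 1) t7 add0r.
have := dbl_val e2 y20 (erefl _); rewrite -mulr2n -mulrnA; set l := _ / _ => e4.
have e43 : P *+ 4 = - (P *+ 3) by apply/eqP; rewrite -addr_eq0 -mulrnDr t7.
move: e4; rewrite e43 valN e3 /= => -[e _].
have g0 : psi4.[x] != 0 by apply: contraNneq y20; rewrite /y2 => ->; rewrite mul0r.
pose F := y ^+ 2.
have R : (3%:R * (4%:R * F * x - psi3.[x]) ^+ 2 + 16%:R * a * F ^+ 2) ^+ 2 = 48%:R * F * x * psi4.[x] ^+ 2
   - 8%:R * psi4.[x] ^+ 2 * psi3.[x] - psi3.[x] * (32%:R * F ^+ 2 * psi4.[x] - psi3.[x] ^+ 3).
  by rewrite psi4E psi3E -o -/F; ring.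
rewrite psi7E -o -/F; move: e; rewrite /l /x2 /y2; move: R p0 g0.
have yF : y ^+ 2 = F by []. have F0 : F != 0 by rewrite expf_neq0.
move: (psi3.[x]) (psi4.[x]) => p g R p0 g0 e.
have e' : x - 8%:R * F * g / p ^+ 2 = (3%:R * (4%:R * F * x - p) ^+ 2 + 16%:R * a * F ^+ 2) ^+ 2 / (16%:R * F * g ^+ 2)
   - 2%:R * (x - p / (4%:R * F)).
  by rewrite /F e; field; rewrite g0 y0.
rewrite R in e'.
have := congr1 (fun z => z * (16%:R * F * g ^+ 2 * p ^+ 2)) e'; rewrite /=.
have -> : (x - 8%:R * F * g / p ^+ 2) * (16%:R * F * g ^+ 2 * p ^+ 2) = 16%:R * F * g ^+ 2 * p ^+ 2 * x - 128%:R * F ^+ 2 * g ^+ 3.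
  by field.
move=> e''; apply/eqP; rewrite -[X in X == _](subrK (16%:R * F * g ^+ 2 * p ^+ 2 * x)).
have -> : (32%:R * F ^+ 2 * g - p ^+ 3) * p ^+ 3 - 128%:R * F ^+ 2 * g ^+ 3 - 16%:R * F * g ^+ 2 * p ^+ 2 * x
  = (16%:R * F * g ^+ 2 * p ^+ 2 * x - 128%:R * F ^+ 2 * g ^+ 3) + (32%:R * F ^+ 2 * g - p ^+ 3) * p ^+ 3 - 32%:R * F * g ^+ 2 * p ^+ 2 * x by ring.
by rewrite e''; apply/eqP; field; rewrite g0 F0.
Qed.

Section Span.
Variables (n : nat) (U V : ept E).
Hypotheses (n0 : (0 < n)%N) (tU : U *+ n = 0) (tV : V *+ n = 0).
Definition indep2 := forall i j : nat, U *+ i + V *+ j = 0 -> ((n %| i) && (n %| j))%N.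
Definition lc (r : nat * nat) : ept E := U *+ r.1 + V *+ r.2.
(** The vectors are neither equal nor opposite modulo n, with n - 1 in the role of -1. *)
Definition apart (r s : nat * nat) : bool :=
  ~~ ((n %| r.1 + n.-1 * s.1) && (n %| r.2 + n.-1 * s.2))%N && ~~ ((n %| r.1 + s.1) && (n %| r.2 + s.2))%N.
Definition good (reps : seq (nat * nat)) := all (fun r => ~~ ((n %| r.1) && (n %| r.2))%N) reps && pairwise apart reps.

Lemma lcD r s : lc r + lc s = lc (r.1 + s.1, r.2 + s.2)%N.
Proof. by rewrite /lc /= !mulrnDr addrACA. Qed.
Lemma lcN r : - lc r = lc (n.-1 * r.1, n.-1 * r.2)%N.
Proof.
apply/eqP; rewrite eq_sym -subr_eq0 opprK lcD /lc /= -!mulSnr prednK //.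
by rewrite !mulrnA tU tV !mul0rn addr0.
Qed.

(** The vectors of [reps] have distinct abscissae, which are roots of p and at least as many as its
    degree; so the abscissa of any torsion point is one of them. *)
Lemma span_of_bound (p : {poly K}) reps : indep2 -> good reps -> p != 0 -> (size p <= (size reps).+1)%N ->
  (forall P x y, P *+ n = 0 -> val P = Some (x, y) -> p.[x] = 0) ->
  forall P, P *+ n = 0 -> exists r, P = lc r.
Proof.
move=> ind /andP[gn gp] p0 sp rt P tP.
have [->|P0] := eqVneq P 0; first by exists (0, 0)%N; rewrite /lc !mulr0n addr0.
have [x [y eP]] := affineP P0.
pose xc X := if val X is Some (x', _) then x' else 0 : K.
have xcE X : X != 0 -> exists y', val X = Some (xc X, y').
  by move=> /affineP[u [v e]]; exists v; rewrite /xc e.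
have lc0 r : r \in reps -> lc r != 0.
  by move=> hr; apply/eqP => /ind h; move/allP: gn => /(_ r hr); rewrite h.
have tlc r : lc r *+ n = 0 by rewrite /lc mulrnDl mulrnAC tU mul0rn mulrnAC tV mul0rn addr0.
pose xs := [seq xc (lc r) | r <- reps].
have hx : x \in xs.
  apply/negPn/negP => nx.
  have : (size (x :: xs) < size p)%N.
    apply: max_poly_roots => //.
      rewrite /= /root (rt _ _ _ tP eP) eqxx; apply/allP => z /mapP[r hr ->].
      have [y' e] := xcE _ (lc0 r hr); by rewrite /root (rt _ _ _ (tlc r) e).
    rewrite /= nx /=; rewrite uniq_pairwise pairwise_map; apply: (@sub_in_pairwise _ (mem reps) apart) gp; last exact/allP.
    move=> r s hr hs /andP[a1 a2] /=; apply/eqP => e.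
    have [y1 e1] := xcE _ (lc0 r hr); have [y2 e2] := xcE _ (lc0 s hs); rewrite -e in e2.
    case: (same_x e1 e2) => /eqP.
      by rewrite -subr_eq0 lcN lcD => /eqP /ind; exact/negP.
    by rewrite -addr_eq0 lcD => /eqP /ind; exact/negP.
  by rewrite /= size_map => /leq_trans /(_ sp); rewrite ltnn.
case/mapP: hx => r hr ex; have [y' e] := xcE _ (lc0 r hr); rewrite -ex in e.
by case: (same_x eP e) => ->; [exists r | rewrite lcN; eexists].
Qed.

Lemma lc_mod r : lc r = lc (r.1 %% n, r.2 %% n)%N.
Proof.
have h (A : ept E) k : A *+ n = 0 -> A *+ k = A *+ (k %% n).
  by move=> e; rewrite {1}(divn_eq k n) mulrnDr mulnC mulrnA e mul0rn add0r.
by rewrite /lc /= (h U) // (h V).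
Qed.

Lemma span_fin : (forall P, P *+ n = 0 -> exists r, P = lc r) ->
  exists G : seq (ept E), forall P, P *+ n = 0 -> P \in G.
Proof.
move=> sp; exists [seq lc (i, j) | i <- iota 0 n, j <- iota 0 n] => P /sp[r ->].
by rewrite lc_mod; apply/allpairsP; exists (r.1 %% n, r.2 %% n)%N; split; rewrite ?mem_iota ?ltn_mod.
Qed.

End Span.

Lemma indep3 T1 T2 : T1 *+ 3 = 0 -> T2 *+ 3 = 0 -> T1 != 0 -> T2 != 0 -> T1 != T2 -> T1 != - T2 -> indep2 3 T1 T2.
Proof.
move=> t1 t2 n1 n2 n3 n4 i j.
have h (A : ept E) k : A *+ 3 = 0 -> A *+ k = A *+ (k %% 3).
  by move=> e; rewrite {1}(divn_eq k 3) mulrnDr mulnC mulrnA e mul0rn add0r.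
rewrite (h T1) // (h T2) // /dvdn.
have o2 (A : ept E) : A *+ 3 = 0 -> A *+ 2 = - A by move=> e; apply/eqP; rewrite -addr_eq0 -mulrSr; apply/eqP.
have : (i %% 3 < 3)%N by rewrite ltn_mod. have : (j %% 3 < 3)%N by rewrite ltn_mod.
case: (i %% 3)%N => [|[|[|//]]]; case: (j %% 3)%N => [|[|[|//]]] //= _ _; rewrite ?o2 ?mulr0n ?mulr1n ?addr0 ?add0r // => /eqP; rewrite ?oppr_eq0 ?(negPf n1) ?(negPf n2) //.
- by rewrite addr_eq0 (negPf n4).
- by rewrite subr_eq0 (negPf n3).
- by rewrite addrC subr_eq0 eq_sym (negPf n3).
- by rewrite -opprD oppr_eq0 addr_eq0 (negPf n4).
Qed.

Lemma span3 T1 T2 : T1 *+ 3 = 0 -> T2 *+ 3 = 0 -> T1 != 0 -> T2 != 0 -> T1 != T2 -> T1 != - T2 ->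
  forall P, P *+ 3 = 0 -> exists r, P = lc T1 T2 r.
Proof.
move=> t1 t2 n1 n2 n3 n4.
have [sp cp] := top_psi3.
apply: (@span_of_bound 3 T1 T2 isT t1 t2 psi3 [:: (1, 0); (0, 1); (1, 1); (1, 2)]%N) => //.
- exact: indep3.
- by apply: (top_neq0 top_psi3); rewrite pnatr_eq0.
by move=> P x y tP eP; apply/eqP; rewrite -(tor3E eP) tP.
Qed.

(** Two distinct roots of [psi3] are enough. If the four roots coincided, the missing x^3 term would
    put them at 0, and then a = b = 0. *)
Lemma ex_basis3 : exists T1 T2, [/\ T1 *+ 3 = 0, T2 *+ 3 = 0 & [/\ T1 != 0, T2 != 0, T1 != T2 & T1 != - T2]].
Proof.
have [sp cp] := top_psi3; have p0 : psi3 != 0 by apply: (top_neq0 top_psi3); rewrite pnatr_eq0.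
have [rs ers] := closed_field_poly_normal psi3.
have srs : size rs = 4%N.
  have := congr1 (fun q : {poly K} => size q) ers; rewrite size_scale ?lead_coef_eq0 // size_prod_XsubC.
  have -> : size psi3 = 5%N; last by case.
  apply/eqP; rewrite eqn_leq sp ltnNge; apply/negP => h.
  by move: cp; rewrite nth_default // => /eqP; rewrite eq_sym pnatr_eq0.
have rt z : z \in rs -> psi3.[z] = 0 by move=> hz; rewrite ers hornerZ; move: hz; rewrite -root_prod_XsubC => /eqP ->; rewrite mulr0.
have [x1 [x2 [h1 h2 n12]]] : exists x1 x2, [/\ x1 \in rs, x2 \in rs & x1 != x2].
  case: rs srs ers rt => [|z s] //= [ss] ers _.
  have [/allP h|/allPn[z' hz' nz]] := boolP (all (pred1 z) s); last by exists z, z'; rewrite !inE eqxx hz' orbT eq_sym.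
  have es : s = nseq 3 z by rewrite -ss; apply/all_pred1P/allP.
  have lead : lead_coef psi3 = 3%:R.
    rewrite lead_coefE -cp; congr (_`_ _); have := congr1 (fun q : {poly K} => size q) ers.
    by rewrite size_scale ?lead_coef_eq0 // size_prod_XsubC /= ss => ->.
  have g x : 3%:R * x ^+ 4 + 6%:R * a * x ^+ 2 + 12%:R * b * x - a ^+ 2 = 3%:R * (x - z) ^+ 4.
    by rewrite -psi3E' ers lead es !big_cons big_nil !hornE; ring.
  have n144 : (144%:R : K) != 0 by rewrite pnatr_eq0.
  have z0 : z = 0.
    apply: (mulfI n144); rewrite mulr0; have := g 2%:R; have := g 1; have := g (-1); have := g (- 2%:R) => g1 g2 g3 g4.
    pose d x := 3%:R * x ^+ 4 + 6%:R * a * x ^+ 2 + 12%:R * b * x - a ^+ 2 - 3%:R * (x - z) ^+ 4.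
    have d0 x : d x = 0 by rewrite /d g subrr.
    transitivity (d 2%:R - 2%:R * d 1 + 2%:R * d (-1) - d (- 2%:R)); first by rewrite /d; ring.
    by rewrite !d0; ring.
  subst z; have n12 : (12%:R : K) != 0 by rewrite pnatr_eq0.
  pose d x := 6%:R * a * x ^+ 2 + 12%:R * b * x - a ^+ 2.
  have d0 x : d x = 0 by apply: (addrI (3%:R * x ^+ 4)); rewrite /d addr0 -[RHS](congr1 (fun t => 3%:R * t ^+ 4) (subr0 x)) -g; ring.
  have a0 : a = 0.
    apply: (mulfI n12); transitivity (d 1 + d (-1) - 2%:R * d 0); first by rewrite /d; ring.
    by rewrite !d0; ring.
  have b0 : b = 0.
    apply: (mulfI n12); transitivity (d 1 - 6%:R * a + a ^+ 2); first by rewrite /d; ring.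
    by rewrite !d0 a0; ring.
  by case/eqP: (e_ns E); rewrite a0 b0; ring.
have [T1 [y1 [e1 _]]] := ex_pt x1; have [T2 [y2 [e2 _]]] := ex_pt x2.
exists T1, T2; split; first by apply/eqP; rewrite (tor3E e1) rt.
  by apply/eqP; rewrite (tor3E e2) rt.
split.
- by apply/eqP => h; move: e1; rewrite h.
- by apply/eqP => h; move: e2; rewrite h.
- by apply/eqP => h; move: e1; rewrite h e2 => -[h']; rewrite h' eqxx in n12.
- by apply/eqP => h; move: e1; rewrite h valN e2 => -[h']; rewrite h' eqxx in n12.
Qed.

Lemma lift9 T1 T2 P1 P2 : indep2 3 T1 T2 -> (forall P, P *+ 3 = 0 -> exists r, P = lc T1 T2 r) ->
  P1 *+ 3 = T1 -> P2 *+ 3 = T2 -> indep2 9 P1 P2 /\ (forall P, P *+ 9 = 0 -> exists r, P = lc P1 P2 r).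
Proof.
move=> ind sp e1 e2; split.
  move=> i j h; have h3 : T1 *+ i + T2 *+ j = 0.
    by rewrite -e1 -e2 -!mulrnA ![(3 * _)%N]mulnC !mulrnA -mulrnDl h mul0rn.
  have /andP[/dvdnP[i' ei] /dvdnP[j' ej]] := ind _ _ h3; subst i j.
  have : T1 *+ i' + T2 *+ j' = 0 by rewrite -e1 -e2 -!mulrnA ![(3 * _)%N]mulnC.
  by move=> /ind /andP[d1 d2]; rewrite (dvdn_mul d1 (dvdnn 3)) (dvdn_mul d2 (dvdnn 3)).
move=> P tP; have [|[i j] /= eP] := sp (P *+ 3); first by rewrite -mulrnA.
have [|[i' j'] /= eP'] := sp (P - (P1 *+ i + P2 *+ j)).
  by rewrite mulrnBl eP /lc /= mulrnDl -!mulrnA ![(_ * 3)%N]mulnC !mulrnA e1 e2 subrr.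
exists (i + i' * 3, j + j' * 3)%N; move/eqP: eP'; rewrite subr_eq => /eqP ->.
by rewrite /lc /= !mulrnDr -e1 -e2 -!mulrnA ![(3 * _)%N]mulnC [RHS]addrACA [RHS]addrC.
Qed.

(** [reps] holds one vector from each of the 24 = (49 - 1) / 2 pairs of opposite vectors, which
    matches the degree of [psi7]. *)
Lemma span7 U V : U *+ 7 = 0 -> V *+ 7 = 0 -> indep2 7 U V -> forall P, P *+ 7 = 0 -> exists r, P = lc U V r.
Proof.
move=> tU tV ind; have [sp cp] := top_psi7.
pose reps := ([:: (1, 0); (2, 0); (3, 0)] ++ [seq (i, j) | j <- [:: 1; 2; 3], i <- [:: 0; 1; 2; 3; 4; 5; 6]])%N.
apply: (@span_of_bound 7 U V isT tU tV psi7 reps) => //.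
  by apply: (top_neq0 top_psi7); rewrite pnatr_eq0.
exact: tor7_root.
Qed.

End Torsion.

End TorsionStructure.

(** * Twists and Galois action on the functions h; curves over Q *)

Module Transport.
Import CurveRing PointIdeals CocycleLaw CurveGroup Reciprocity MillerFunctions TorsionPairing HomogeneousForms LocalOrders WeilPairing TorsionStructure.

Section Transport.
Variables (K : numClosedFieldType) (E E' : ecurve K) (s : {rmorphism K -> K}) (u : K).
Hypotheses (u0 : u != 0) (ha : ea E' = u ^+ 4 * s (ea E)) (hb : eb E' = u ^+ 6 * s (eb E)).
Implicit Types (A B P Q S T X : ept E).

(** One map for two uses: u = 1 gives the action of a field automorphism, and s = id with u^2 = d
    gives the quadratic twist by d. *)
Definition trp (P : point K) : point K := if P is Some (x, y) then Some (u ^+ 2 * s x, u ^+ 3 * s y) else None.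

Lemma trp_onc (P : point K) : onc E P -> onc E' (trp P).
Proof.
case: P => [[x y]|] // /onc_eq; rewrite /trp oncE /ecub => o; apply/eqP.
by rewrite exprMn -rmorphXn o !(rmorphD, rmorphM, rmorphXn) ha hb; ring.
Qed.

Definition tr A : ept E' := exist _ (trp (val A)) (trp_onc (valP A)).

Lemma val_tr A : val (tr A) = trp (val A). Proof. by []. Qed.

Let u2 : u ^+ 2 != 0. Proof. by rewrite expf_neq0. Qed.
Let u3 : u ^+ 3 != 0. Proof. by rewrite expf_neq0. Qed.

Lemma tr_eqx x x' : (u ^+ 2 * s x == u ^+ 2 * s x') = (x == x').
Proof. by rewrite (inj_eq (mulfI u2)) fmorph_eq. Qed.

Lemma tr_opposite (P Q : point K) : opposite (trp P) (trp Q) = opposite P Q.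
Proof.
case: P => [[x y]|] //; case: Q => [[x' y']|] //=.
by rewrite tr_eqx -mulrDr mulf_eq0 (negPf u3) -rmorphD fmorph_eq0.
Qed.

Lemma tr_slope x y x' y' : slope E' (u ^+ 2 * s x) (u ^+ 3 * s y) (u ^+ 2 * s x') (u ^+ 3 * s y') = u * s (slope E x y x' y').
Proof.
rewrite /slope tr_eqx; case: ifP => _.
  rewrite fmorph_div !(rmorphD, rmorphM, rmorphXn, rmorph_nat) ha.
  have [->|y0] := eqVneq y 0; first by rewrite rmorph0 !mulr0 invr0 !mulr0.
  have sy : s y != 0 by rewrite fmorph_eq0.
  by field; rewrite sy u0.
rewrite fmorph_div !rmorphB -!mulrBr invfM.
have [->|d0] := eqVneq (s x' - s x) 0; first by rewrite invr0 !mulr0.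
by field; rewrite d0 u0.
Qed.

Lemma trD A B : tr (A + B) = tr A + tr B.
Proof.
apply: val_inj; rewrite valD !val_tr valD.
case: (val A) => [[x y]|]; last by rewrite !add0p.
case: (val B) => [[x' y']|]; last by rewrite !addp0.
rewrite [trp (Some (x, y))]/= [trp (Some (x', y'))]/= !addpE tr_eqx -mulrDr mulf_eq0 (negPf u3) -rmorphD fmorph_eq0.
case: ifP => // _; rewrite tr_slope /trp; congr (Some (_, _)); rewrite !(rmorphB, rmorphM, rmorphXn); ring.
Qed.

Lemma tr0 : tr 0 = 0. Proof. by apply: val_inj. Qed.
Lemma trN A : tr (- A) = - tr A.
Proof. by apply/eqP; rewrite -addr_eq0 -trD addNr tr0. Qed.
Lemma trMn A k : tr (A *+ k) = tr A *+ k.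
Proof. by elim: k => [|k IH]; rewrite ?mulr0n ?tr0 // !mulrS trD IH. Qed.
Lemma tr_inj : injective tr.
Proof.
move=> A B e; apply: val_inj; have := congr1 val e; rewrite !val_tr.
case: (val A) => [[x y]|]; case: (val B) => [[x' y']|] //= [/(mulfI u2) /fmorph_inj -> /(mulfI u3) /fmorph_inj ->] //.
Qed.
Lemma tr_eq0 A : (tr A == 0) = (A == 0).
Proof. by rewrite -tr0 (inj_eq tr_inj). Qed.

(** The constant comes from the normalisation at O. It does not depend on X, so it cancels in the
    quotients that form [wpv]. *)
Lemma hv_tr A B : exists2 c, c != 0 & forall X, X != 0 -> hv (tr A) (tr B) (tr X) = c * s (hv A B X).
Proof.
have [->|A0] := eqVneq A 0.
  by exists 1; rewrite ?oner_eq0 // => X X0; rewrite tr0 !hv0l ?tr_eq0 // rmorph1 mulr1.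
have [->|B0] := eqVneq B 0.
  by exists 1; rewrite ?oner_eq0 // => X X0; rewrite tr0 !hv0r ?tr_eq0 // rmorph1 mulr1.
have [x1 [y1 eA]] := affineP A0; have [x2 [y2 eB]] := affineP B0.
have op := tr_opposite (val A) (val B).
exists (if opposite (val A) (val B) then u ^+ 2 else u); first by case: ifP.
move=> X /affineP[x [y eX]]; rewrite /hv !val_tr eX; move: op; rewrite eA eB.
rewrite [trp (Some (x, y))]/= /numr /denr [trp (Some (x1, y1))]/= [trp (Some (x2, y2))]/= => ->.
case: ifP => _; rewrite !evX fmorph_div ?rmorph1 ?divr1 !rmorphB; first by ring.
rewrite tr_slope; move: (slope E x1 y1 x2 y2) => l.
rewrite !(rmorphB, rmorphM, rmorphXn).
have -> : u ^+ 2 * s x - ((u * s l) ^+ 2 - u ^+ 2 * s x1 - u ^+ 2 * s x2) = u ^+ 2 * (s x - (s l ^+ 2 - s x1 - s x2)) by ring.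
rewrite invfM; move: ((s x - _)^-1) => z; by field.
Qed.

Lemma ff_tr n P : exists2 c, c != 0 & forall X, X != 0 -> ff n (tr P) (tr X) = c * s (ff n P X).
Proof.
have h m : exists2 c, c != 0 & forall X, X != 0 ->
   \prod_(k < m) hv (tr P) (tr P *+ k) (tr X) = c * s (\prod_(k < m) hv P (P *+ k) X).
  elim: m => [|m [c c0 IH]].
    by exists 1; rewrite ?oner_eq0 // => X _; rewrite !big_ord0 rmorph1 mulr1.
  have [c' c'0 h] := hv_tr P (P *+ m); exists (c * c'); first by rewrite mulf_neq0.
  by move=> X X0; rewrite !big_ord_recr /= IH // -trMn h // rmorphM; ring.
exact: h.
Qed.

Lemma wpv_tr n P Q S T : T != 0 -> S != 0 -> Q + T != 0 -> P + S != 0 ->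
  wpv n (tr P) (tr Q) (tr S) (tr T) = s (wpv n P Q S T).
Proof.
move=> T0 S0 QT PS; rewrite /wpv -!trD.
have can (c x y : K) : c != 0 -> c * x / (c * y) = x / y by move=> c0; rewrite invfM mulrACA divff // mul1r.
have [c1 n1 h1] := ff_tr n P; have [c2 n2 h2] := ff_tr n Q.
have [c3 n3 h3] := hv_tr P S; have [c4 n4 h4] := hv_tr Q T.
rewrite !h1 // !h2 //.
rewrite !h3 // !h4 //.
rewrite !can //.
by rewrite !(rmorphM, fmorphV, rmorphXn).
Qed.

Lemma generic_tr n S T : generic n S T -> generic n (tr S) (tr T).
Proof. by case=> h1 h2 h3 h4; split; rewrite -?trN -?trD -trMn tr_eq0. Qed.

End Transport.

Section RationalCurves.

Lemma disc_wdisc (a b : rat) : wdisc (Weierstrass 0 0 0 a b) = - 16%:R * (4%:R * a ^+ 3 + 27%:R * b ^+ 2).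
Proof. by rewrite /wdisc /wb2 /wb4 /wb6 /wb8 /=; ring. Qed.

Lemma disc_neq0 (a b : rat) : 4%:R * a ^+ 3 + 27%:R * b ^+ 2 != 0 -> wdisc (Weierstrass 0 0 0 a b) != 0.
Proof. by move=> h; rewrite disc_wdisc mulf_neq0 //. Qed.

Definition ratcurve (a b : rat) (h : 4%:R * a ^+ 3 + 27%:R * b ^+ 2 != 0) : ellcurve := EllCurve (disc_neq0 h).

Lemma ratr_disc (a b : rat) : 4%:R * a ^+ 3 + 27%:R * b ^+ 2 != 0 ->
  4%:R * (ratr a : algC) ^+ 3 + 27%:R * (ratr b) ^+ 2 != 0.
Proof.
move=> h; have -> : 4%:R * (ratr a : algC) ^+ 3 + 27%:R * (ratr b) ^+ 2 = ratr (4%:R * a ^+ 3 + 27%:R * b ^+ 2).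
  by rewrite !(rmorphD, rmorphM, rmorphXn, rmorph_nat).
by rewrite fmorph_eq0.
Qed.

Definition ratecurve (a b : rat) (h : 4%:R * a ^+ 3 + 27%:R * b ^+ 2 != 0) : ecurve algC := ECurve (ratr_disc h).

Lemma geom_ratcurve a b (h : 4%:R * a ^+ 3 + 27%:R * b ^+ 2 != 0) : geom (ratcurve h) = ew (ratecurve h).
Proof. by rewrite /geom /map_weierstrass /ew /= !rmorph0. Qed.

Lemma jinv_ratcurve a b (h : 4%:R * a ^+ 3 + 27%:R * b ^+ 2 != 0) :
  jinv (ratcurve h) = 1728%:R * 4%:R * a ^+ 3 / (4%:R * a ^+ 3 + 27%:R * b ^+ 2).
Proof.
rewrite /jinv /wj disc_wdisc /wc4 /wb2 /wb4 /=.
by field.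
Qed.

Section Gal.
Variables (a b : rat) (h : 4%:R * a ^+ 3 + 27%:R * b ^+ 2 != 0).
Local Notation E := (ratecurve h).
Variable s : {rmorphism algC -> algC}.

Lemma gal_a : ea E = 1 ^+ 4 * s (ea E). Proof. by rewrite expr1n mul1r /= fmorph_rat. Qed.
Lemma gal_b : eb E = 1 ^+ 6 * s (eb E). Proof. by rewrite expr1n mul1r /= fmorph_rat. Qed.
Definition galp : ept E -> ept E := tr gal_a gal_b.

Lemma val_gal A : val (galp A) = galois_pt s (val A).
Proof. by rewrite /galp val_tr; case: (val A) => [[x y]|] //=; rewrite !expr1n !mul1r. Qed.
End Gal.

(* The hypotheses only concern n-torsion points. *)
Lemma reverse_congruentP n a1 b1 a2 b2 (h1 : 4%:R * a1 ^+ 3 + 27%:R * b1 ^+ 2 != 0)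
    (h2 : 4%:R * a2 ^+ 3 + 27%:R * b2 ^+ 2 != 0) (phi : ept (ratecurve h1) -> ept (ratecurve h2)) :
  odd n ->
  (forall P, P *+ n = 0 -> phi P *+ n = 0) ->
  (forall P Q, P *+ n = 0 -> Q *+ n = 0 -> phi P = phi Q -> P = Q) ->
  (forall Q, Q *+ n = 0 -> exists2 P, P *+ n = 0 & phi P = Q) ->
  (forall P Q, P *+ n = 0 -> Q *+ n = 0 -> phi (P + Q) = phi P + phi Q) ->
  (forall (s : {rmorphism algC -> algC}) P, P *+ n = 0 -> phi (galp s P) = galp s (phi P)) ->
  (forall P Q, P *+ n = 0 -> Q *+ n = 0 -> exists S T S' T', [/\ generic n S T, generic n S' T' &
     wpv n (phi P) (phi Q) S' T' = (wpv n P Q S T)^-1]) ->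
  reverse_congruent n (ratcurve h1) (ratcurve h2).
Proof.
move=> odd_n tphi inj surj add equi wp.
pose f (P : point algC) : point algC := if insub P is Some A then val (phi A) else None.
have fE (A : ept (ratecurve h1)) : f (val A) = val (phi A) by rewrite /f valK.
have tor a b (h : 4%:R * a ^+ 3 + 27%:R * b ^+ 2 != 0) P : P \in torsion (geom (ratcurve h)) n ->
    exists2 A : ept (ratecurve h), A *+ n = 0 & val A = P.
  rewrite geom_ratcurve => /andP[oP /eqP tP]; pose A : ept (ratecurve h) := exist _ P oP.
  by exists A => //; apply: val_inj; rewrite val_muln.
have tor' a b (h : 4%:R * a ^+ 3 + 27%:R * b ^+ 2 != 0) (A : ept (ratecurve h)) :
    A *+ n = 0 -> val A \in torsion (geom (ratcurve h)) n.
  move=> tA; rewrite geom_ratcurve inE; apply/andP; split; first exact: (valP A).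
  by rewrite -val_muln tA.
exists f; split; [split|].
- by move=> P /tor[A tA <-]; rewrite fE; apply: tor'; apply: tphi.
- by move=> P Q /tor[A tA <-] /tor[B tB <-]; rewrite !fE => /val_inj /inj ->.
- move=> Q /tor[B tB <-]; have [A tA eA] := surj B tB.
  by exists (val A); [exact: tor' | rewrite fE eA].
- move=> P Q /tor[A tA <-] /tor[B tB <-]; rewrite !geom_ratcurve -valD !fE add // valD //.
- by move=> s P /tor[A tA <-]; rewrite -val_gal !fE equi // val_gal.
move=> P Q /tor[A tA <-] /tor[B tB <-]; rewrite !fE.
have [S [T [S' [T' [g g' e]]]]] := wp A B tA tB.
exists (wpv n A B S T); rewrite !geom_ratcurve -e; split; apply: weil_wpv => //; exact: tphi.
Qed.

End RationalCurves.

End Transport.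

(** * Curves with a subgroup of order 7 *)

Module SevenKernel.
Import CurveRing PointIdeals CocycleLaw CurveGroup Reciprocity MillerFunctions TorsionPairing HomogeneousForms LocalOrders WeilPairing ExplicitPairing TorsionStructure Transport.

Section Kernel.
Variables (K : numClosedFieldType) (E : ecurve K) (t k : K).
(** Parametrisation of X_0(7), with j = (t^2 + 13 t + 49) (t^2 + 5 t + 1)^3 / t; [k7h] is the
    polynomial of the abscissae of the subgroup on the model with k = 1. *)
Definition k7q (t : K) := t ^+ 2 + 13%:R * t + 49%:R.
Definition k7h (t z : K) := z ^+ 3 + 3%:R * k7q t * z ^+ 2
  + (3%:R * t ^+ 4 + 78%:R * t ^+ 3 + 753%:R * t ^+ 2 + 3198%:R * t + 4851%:R) * z
  + (t ^+ 6 + 39%:R * t ^+ 5 + 606%:R * t ^+ 4 + 4899%:R * t ^+ 3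
     + (21%:R * 1000%:R + 726%:R) * t ^+ 2 + (49%:R * 1000%:R + 575%:R) * t + (43%:R * 1000%:R + 169%:R)).
Hypotheses (k0 : k != 0) (q0 : k7q t != 0).
Hypothesis ha : ea E = k ^+ 2 * (- 3%:R * k7q t * (t ^+ 2 + 5%:R * t + 1)).
Hypothesis hb : eb E = k ^+ 3 * (- 2%:R * k7q t * (t ^+ 4 + 14%:R * t ^+ 3 + 63%:R * t ^+ 2 + 70%:R * t - 7%:R)).

Definition xc (X : ept E) : K := if val X is Some (x, _) then x else 0.
Definition in7 (X : ept E) : Prop := X = 0 \/ exists x y, val X = Some (k * x, y) /\ k7h t x = 0.
(** X, 2X and 4X represent, up to sign, the nonzero elements of a group of order 7; the sum is an
    invariant of that group and serves to tell two groups apart. *)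
Definition xsum (X : ept E) : K := xc X + xc (X *+ 2) + xc (X *+ 4).

(* The roots of [k7h t] are the abscissae of three points on the line
   y = s (x - be), and doubling permutes them cyclically. *)
Lemma kernel7 : exists2 U : ept E, U != 0 /\ U *+ 7 = 0 &
  (forall X, in7 X <-> exists i, X = U *+ i) /\ (forall X, in7 X -> X != 0 -> xsum X = - (3%:R * k * k7q t)).
Proof.
(* [M] is doubling on abscissae, reduced to degree 2 modulo [k7h]; [be] is the abscissa at which the
   line through the three points meets y = 0. *)
pose M z := - (z ^+ 2 + (2%:R * t ^+ 2 + 30%:R * t + 130%:R) * z + (t ^+ 4 + 30%:R * t ^+ 3 + 331%:R * t ^+ 2 + 1626%:R * t + 2989%:R)) / 12%:R.
pose be := - (t ^+ 2 + 9%:R * t + 17%:R).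
pose al := t ^+ 2 + 5%:R * t + 1.
have n12 : (12%:R : K) != 0 by rewrite pnatr_eq0.
pose c := fun i => nth 0 [:: - (t ^+ 6 + 39%:R * t ^+ 5 + 606%:R * t ^+ 4 + 4899%:R * t ^+ 3
     + (21%:R * 1000%:R + 726%:R) * t ^+ 2 + (49%:R * 1000%:R + 575%:R) * t + (43%:R * 1000%:R + 169%:R));
    - (3%:R * t ^+ 4 + 78%:R * t ^+ 3 + 753%:R * t ^+ 2 + 3198%:R * t + 4851%:R); - (3%:R * k7q t)] i.
have [z1 hz1] := @solve_monicpoly K 3%N c isT.
rewrite !big_ord_recr big_ord0 /c /= add0r in hz1.
have cub1 z : k7h t z = 0 <-> z ^+ 3 = - (3%:R * k7q t) * z ^+ 2
   - (3%:R * t ^+ 4 + 78%:R * t ^+ 3 + 753%:R * t ^+ 2 + 3198%:R * t + 4851%:R) * z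
   - (t ^+ 6 + 39%:R * t ^+ 5 + 606%:R * t ^+ 4 + 4899%:R * t ^+ 3
     + (21%:R * 1000%:R + 726%:R) * t ^+ 2 + (49%:R * 1000%:R + 575%:R) * t + (43%:R * 1000%:R + 169%:R)).
  rewrite /k7h; split=> [h|->]; last by ring.
  by apply/eqP; rewrite -subr_eq0; apply/eqP; rewrite -h; ring.
have {}hz1 : k7h t z1 = 0 by apply/cub1; rewrite hz1; ring.
have hM z : k7h t z = 0 -> k7h t (M z) = 0.
  move/cub1=> h; apply: (mulfI (expf_neq0 3 n12)); rewrite mulr0 /k7h /M /k7q; rewrite /k7q in h.
  by field: h.
have hM2 z : k7h t z = 0 -> M (M z) = - (3%:R * k7q t) - z - M z.
  move/cub1=> h; rewrite /M /k7q; rewrite /k7q in h; by field: h.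
have hT z : k7h t z = 0 -> (3%:R * z ^+ 2 - 3%:R * k7q t * al) * (z - M z) = - 6%:R * k7q t * (z - be) * (z + M z - 2%:R * be).
  move/cub1=> h; rewrite /M /al /be /k7q; rewrite /k7q in h; by field: h.
have hB z : k7h t z = 0 -> z != be.
  move=> h; apply/eqP => e; rewrite e in h; have n : (1728%:R : K) != 0 by rewrite pnatr_eq0.
  by case/eqP: n; apply: oppr_inj; rewrite oppr0 -h /k7h /be /k7q; ring.
have hne z : k7h t z = 0 -> z != M z.
  move=> h; apply/eqP => e; have := hT z h; rewrite -e subrr mulr0 => /esym/eqP.
  rewrite (_ : z + z - 2%:R * be = 2%:R * (z - be)); last by ring.
  by rewrite !mulf_eq0 oppr_eq0 !pnatr_eq0 (negPf q0) subr_eq0 (negPf (hB z h)).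
pose dl := - 3%:R * k7q t * k.
have [s es] : exists s, s ^+ 2 = dl by exists (sqrtC dl); rewrite sqrtCK.
have dl0 : dl != 0 by rewrite /dl mulNr mulf_neq0 // oppr_eq0 mulf_neq0 ?pnatr_eq0.
have s0 : s != 0 by apply: contraNneq dl0 => e; rewrite -es e expr0n.
(* With s^2 = dl, the roots of [k7h] are the intersections of the curve with the line y = s (x - k
   be). *)
have fE x : ecub E (k * x) = k ^+ 3 * k7h t x + dl * (k * x - k * be) ^+ 2.
  by rewrite /ecub ha hb /k7h /dl /be /k7q; ring.
have pA z : k7h t z = 0 -> exists A : ept E, val A = Some (k * z, s * (k * z - k * be)).
  move=> h; have o : onc E (Some (k * z, s * (k * z - k * be))) by rewrite oncE fE h mulr0 add0r exprMn es.
  by pose A : ept E := exist _ (Some (k * z, s * (k * z - k * be))) o; exists A.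
have y0 z : k7h t z = 0 -> s * (k * z - k * be) != 0 by move=> h; rewrite mulf_neq0 // -mulrBr mulf_neq0 // subr_eq0 hB.
have dbl z (A B : ept E) : k7h t z = 0 -> val A = Some (k * z, s * (k * z - k * be)) ->
    val B = Some (k * M z, s * (k * M z - k * be)) -> A *+ 2 = B.
  move=> h eA eB; have y1 := y0 z h; have dv := dbl_val eA y1 (erefl _).
  move: dv; set y := s * (k * z - k * be) in eA y1 *; set y' := s * (_ - _) in eB; set l := _ / _ => dv.
  (* The tangent at A passes through -B; [hT] is this statement with denominators cleared. *)
  have tan : - y' = y + l * (k * M z - k * z).
    rewrite /l; apply: (mulIf (mulf_neq0 (two_neq0 K) y1)).
    have -> : (y + (3%:R * (k * z) ^+ 2 + ea E) / (2%:R * y) * (k * M z - k * z)) * (2%:R * y)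
       = 2%:R * y ^+ 2 + k ^+ 3 * - ((3%:R * z ^+ 2 - 3%:R * k7q t * al) * (z - M z)) by rewrite ha /al; field.
    rewrite hT // /y' /y !exprMn es /dl.
    transitivity (- 2%:R * s ^+ 2 * (k * M z - k * be) * (k * z - k * be)); first by ring.
    by rewrite es /dl; ring.
  have oA : onc E (Some (k * z, y)) by rewrite -eA; exact: valP.
  have no : ~~ ((k * z == k * z) && (y + y == 0)) by rewrite eqxx -mulr2n mulrn_eq0 negb_or y1.
  have := chord_cubic oA oA no (k * M z); rewrite /slope eqxx -/l -(valSomeP eB).
  have -> : y' ^+ 2 = (y + l * (k * M z - k * z)) ^+ 2 by rewrite -tan sqrrN.
  rewrite subrr => /esym/eqP; rewrite !mulf_eq0 subr_eq0 (inj_eq (mulfI k0)) [M z == z]eq_sym (negPf (hne z h)) /= subr_eq0 => /eqP ex.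
  apply: val_inj; rewrite mulr2n dv eB -ex; congr (Some (_, _)).
  by rewrite -[RHS]opprK tan; ring.
pose z2 := M z1; pose z3 := M z2; have hz2 : k7h t z2 = 0 by exact: hM. have hz3 : k7h t z3 = 0 by exact: hM.
have [A1 e1] := pA z1 hz1; have [A2 e2] := pA z2 hz2; have [A3 e3] := pA z3 hz3.
have d1 := dbl z1 A1 A2 hz1 e1 e2; have d2 := dbl z2 A2 A3 hz2 e2 e3.
have ez3 : z3 = - (3%:R * k7q t) - z1 - z2 by exact: hM2.
have ez1 : M z3 = z1 by have := hM2 z2 hz2; rewrite -/z3 => ->; rewrite ez3; ring.
have d3 : A3 *+ 2 = A1 by apply: (dbl z3); rewrite // ez1.
have d4 : A1 *+ 4 = A3 by rewrite (mulrnA A1 2 2) d1 d2.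
have t7 : A1 *+ 7 = 0.
  apply: (addIr A1); rewrite add0r -mulrSr (mulrnA A1 4 2) d4; exact: d3.
have fac x : k7h t x = (x - z1) * (x - z2) * (x - z3).
  have h1 : z1 * z2 + z1 * z3 + z2 * z3 = 3%:R * t ^+ 4 + 78%:R * t ^+ 3 + 753%:R * t ^+ 2 + 3198%:R * t + 4851%:R.
    by rewrite ez3 /z2 /M; move/cub1: hz1 => h; rewrite /k7q in h *; field: h.
  have h0 : z1 * z2 * z3 = - (t ^+ 6 + 39%:R * t ^+ 5 + 606%:R * t ^+ 4 + 4899%:R * t ^+ 3
     + (21%:R * 1000%:R + 726%:R) * t ^+ 2 + (49%:R * 1000%:R + 575%:R) * t + (43%:R * 1000%:R + 169%:R)).
    by rewrite ez3 /z2 /M; move/cub1: hz1 => h; rewrite /k7q in h *; field: h.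
  transitivity (x ^+ 3 - (z1 + z2 + z3) * x ^+ 2 + (z1 * z2 + z1 * z3 + z2 * z3) * x - z1 * z2 * z3); last by ring.
  by rewrite h1 h0 ez3 /k7h; ring.
have in7_of z (A X : ept E) : val A = Some (k * z, s * (k * z - k * be)) -> k7h t z = 0 -> X = A \/ X = - A -> in7 X.
  by move=> eA h [->|->]; right; [exists z, (s * (k * z - k * be)) | exists z, (- (s * (k * z - k * be))); rewrite valN eA].
have split7 X : in7 X -> X != 0 -> [\/ X = A1 \/ X = - A1, X = A2 \/ X = - A2 | X = A3 \/ X = - A3].
  case=> [->|[x [y [eX h]]]]; first by rewrite eqxx.
  move=> _; move: h; rewrite fac => /eqP; rewrite !mulf_eq0 !subr_eq0 => /orP[/orP[]|] /eqP ex; rewrite ex in eX.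
  - by constructor 1; exact: same_x eX e1.
  - by constructor 2; exact: same_x eX e2.
  - by constructor 3; exact: same_x eX e3.
have A10 : A1 != 0 by apply/eqP => h; move: e1; rewrite h.
have opp i : - (A1 *+ i) = A1 *+ (i * 6) by exact: (@tor_opp _ _ 7 isT).
exists A1 => //; split=> X.
  split=> [h|[i ->]].
    have [->|X0] := eqVneq X 0; first by exists 0%N; rewrite mulr0n.
    case: (split7 X h X0) => -[->|->]; [exists 1%N|exists 6%N|exists 2%N|exists 12%N|exists 4%N|exists 24%N] => //.
    - by rewrite -[A1 in LHS]mulr1n opp.
    - by rewrite -d1 opp.
    - by rewrite -d4 opp.
  have -> : A1 *+ i = A1 *+ (i %% 7) by rewrite {1}(divn_eq i 7) mulrnDr mulnC mulrnA t7 mul0rn add0r.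
  have : (i %% 7 < 7)%N by rewrite ltn_mod.
  have o3 : A1 *+ 3 = - A3 by apply/eqP; rewrite -addr_eq0 -d4 -mulrnDr t7.
  have o5 : A1 *+ 5 = - A2 by apply/eqP; rewrite -addr_eq0 -d1 -mulrnDr t7.
  have o6 : A1 *+ 6 = - A1 by apply/eqP; rewrite -addr_eq0 -mulrSr t7.
  case: (i %% 7)%N => [|[|[|[|[|[|[|//]]]]]]] _; first by left.
  - by apply: (in7_of _ _ _ e1 hz1); left.
  - by rewrite d1; apply: (in7_of _ _ _ e2 hz2); left.
  - by rewrite o3; apply: (in7_of _ _ _ e3 hz3); right.
  - by rewrite d4; apply: (in7_of _ _ _ e3 hz3); left.
  - by rewrite o5; apply: (in7_of _ _ _ e2 hz2); right.
  - by rewrite o6; apply: (in7_of _ _ _ e1 hz1); right.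
move=> h X0; have xcN Y : xc (- Y) = xc Y by rewrite /xc valN; case: (val Y) => [[x y]|].
have [x1 x2 x3] : [/\ xc A1 = k * z1, xc A2 = k * z2 & xc A3 = k * z3] by rewrite /xc e1 e2 e3.
have q1 : A2 *+ 4 = A1 by rewrite (mulrnA A2 2 2) d2 d3.
have q2 : A3 *+ 4 = A2 by rewrite (mulrnA A3 2 2) d3 d1.
by case: (split7 X h X0) => -[->|->]; rewrite /xsum ?mulNrn ?xcN ?d1 ?d2 ?d3 ?d4 ?q1 ?q2 x1 x2 x3 ez3; ring.
Qed.

End Kernel.

End SevenKernel.

(** * The reverse 7-congruence between a curve and its quadratic twist *)

Module ReverseSeven.
Import CurveRing PointIdeals CocycleLaw CurveGroup Reciprocity MillerFunctions TorsionPairing HomogeneousForms LocalOrders WeilPairing ExplicitPairing TorsionStructure Transport SevenKernel.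

Section PrimeOrder.
Variables (K : numClosedFieldType) (E : ecurve K).
Implicit Types (U V X : ept E).

Lemma mulrn_mod7 X i : X *+ 7 = 0 -> X *+ i = X *+ (i %% 7).
Proof. by move=> h; rewrite {1}(divn_eq i 7) mulrnDr mulnC mulrnA h mul0rn add0r. Qed.

Lemma inv7 i : (i %% 7 != 0)%N -> exists u, (u * i %% 7 = 1)%N.
Proof.
move=> h; have [u hu] : exists u, (u * (i %% 7) %% 7 = 1)%N.
  move: h; have : (i %% 7 < 7)%N by rewrite ltn_mod.
  by case: (i %% 7)%N => [|[|[|[|[|[|[|]]]]]]] // _ _; [exists 1%N|exists 4%N|exists 5%N|exists 2%N|exists 3%N|exists 6%N].
by exists u; rewrite -modnMmr.
Qed.

Lemma indep7 U V : U *+ 7 = 0 -> V *+ 7 = 0 -> V != 0 -> (forall k, U != V *+ k) -> indep2 7 U V.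
Proof.
move=> tU tV V0 n i j e.
have di : (7 %| i)%N.
  apply/negPn/negP => /inv7[u hu]; case/eqP: (n (j * u * 6)%N).
  rewrite -(@tor_opp _ _ 7 isT) // -[LHS]mulr1n -hu -(mulrn_mod7 _ tU) mulnC mulrnA.
  by apply/eqP; rewrite -addr_eq0 mulrnA -mulrnDl e mul0rn.
rewrite di /=; apply/negPn/negP => /inv7[u hu]; case/eqP: V0.
case/dvdnP: di => m em; move: e; rewrite em mulnC mulrnA tU mul0rn add0r => e.
by rewrite -[LHS]mulr1n -hu -(mulrn_mod7 _ tV) mulnC mulrnA e mul0rn.
Qed.
End PrimeOrder.

Section Reverse7.
Variables (a b d : rat) (h : 4%:R * a ^+ 3 + 27%:R * b ^+ 2 != 0).
(** [Tf] and [Kf] give the parameters t and k of [kernel7] as Galois compatible functions of a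
    square root of d, so that r and -r define two subgroups of order 7 on one rational curve. *)
Variables (r : algC) (Tf Kf : algC -> algC).
Hypotheses (d0 : d != 0) (rd : r ^+ 2 = ratr d).
Local Notation E := (ratecurve h).
Hypotheses (hK : forall s : algC, s ^+ 2 = ratr d -> Kf s != 0) (hq : forall s : algC, s ^+ 2 = ratr d -> k7q (Tf s) != 0).
Hypothesis ha : forall s : algC, s ^+ 2 = ratr d -> ratr a = Kf s ^+ 2 * (- 3%:R * k7q (Tf s) * (Tf s ^+ 2 + 5%:R * Tf s + 1)).
Hypothesis hb : forall s : algC, s ^+ 2 = ratr d -> ratr b = Kf s ^+ 3 * (- 2%:R * k7q (Tf s) *
  (Tf s ^+ 4 + 14%:R * Tf s ^+ 3 + 63%:R * Tf s ^+ 2 + 70%:R * Tf s - 7%:R)).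
Hypothesis hT : forall (s : {rmorphism algC -> algC}) x, s (Tf x) = Tf (s x).
Hypothesis hKs : forall (s : {rmorphism algC -> algC}) x, s (Kf x) = Kf (s x).
Hypothesis ncoin : Kf r * k7q (Tf r) != Kf (- r) * k7q (Tf (- r)).

Lemma disc_twist : 4%:R * (d ^+ 2 * a) ^+ 3 + 27%:R * (d ^+ 3 * b) ^+ 2 != 0.
Proof.
have -> : 4%:R * (d ^+ 2 * a) ^+ 3 + 27%:R * (d ^+ 3 * b) ^+ 2 = d ^+ 6 * (4%:R * a ^+ 3 + 27%:R * b ^+ 2) by ring.
by rewrite mulf_neq0 ?expf_neq0.
Qed.
Local Notation E2 := (ratecurve disc_twist).

Let r0 : r != 0.
Proof. by apply/eqP => e; move: rd; rewrite e expr0n => /esym/eqP; rewrite fmorph_eq0 (negPf d0). Qed.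

Let sid : {rmorphism algC -> algC} := idfun.
Let twa : ea E2 = r ^+ 4 * sid (ea E).
Proof.
have e : ratr (d ^+ 2 * a) = ratr d ^+ 2 * ratr a :> algC by rewrite rmorphM rmorphXn.
by rewrite [LHS]e -rd -exprM.
Qed.
Let twb : eb E2 = r ^+ 6 * sid (eb E).
Proof.
have e : ratr (d ^+ 3 * b) = ratr d ^+ 3 * ratr b :> algC by rewrite rmorphM rmorphXn.
by rewrite [LHS]e -rd -exprM.
Qed.
Let tw := tr twa twb.

Let rN : (- r) ^+ 2 = ratr d. Proof. by rewrite sqrrN. Qed.

Lemma gal_r (s : {rmorphism algC -> algC}) : s r = r \/ s r = - r.
Proof.
have : (s r) ^+ 2 = r ^+ 2 by rewrite -rmorphXn rd fmorph_rat.
by move/eqP; rewrite -subr_eq0 subr_sqr mulf_eq0 subr_eq0 addr_eq0 => /orP[] /eqP; [left | right].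
Qed.

Lemma gal_in7 (s : {rmorphism algC -> algC}) x (X : ept E) :
  in7 (Tf x) (Kf x) X -> in7 (Tf (s x)) (Kf (s x)) (galp s X).
Proof.
case=> [->|[z [y [eX hz]]]]; [by left; rewrite /galp tr0|right].
exists (s z), (s y); rewrite val_gal eX /= rmorphM hKs; split=> //.
have := congr1 s hz; rewrite rmorph0 => <-.
by rewrite /k7h /k7q !(rmorph_nat, rmorphXn, rmorphM, rmorphD) hT.
Qed.

Theorem reverse7 : reverse_congruent 7 (ratcurve h) (ratcurve disc_twist).
Proof.
have [U [U0 tU] [inU sumU]] := @kernel7 _ E (Tf r) (Kf r) (hK rd) (hq rd) (ha rd) (hb rd).
have [V [V0 tV] [inV sumV]] := @kernel7 _ E (Tf (- r)) (Kf (- r)) (hK rN) (hq rN) (ha rN) (hb rN).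
(* Equal subgroups would have equal sums of abscissae, against [ncoin]. *)
have UV k : U != V *+ k.
  apply/eqP => e; have i1 : in7 (Tf r) (Kf r) U by apply/inU; exists 1%N.
  have i2 : in7 (Tf (- r)) (Kf (- r)) U by apply/inV; exists k.
  have := sumU U i1 U0; rewrite (sumV U i2 U0) => /oppr_inj; rewrite -!mulrA => /(mulfI (three_neq0 _)) e'.
  by case/eqP: ncoin; rewrite -e'.
have ind := indep7 tU tV V0 UV.
have sp := span7 tU tV ind.
have [G hG] := @span_fin _ E 7 U V isT tU tV sp.
have [e he] := @ex_pairing _ E 7 isT G hG.
pose mi (x : nat * nat) : ept E := U *+ x.1 - V *+ x.2.
have lcI x y : lc U V x = lc U V y -> mi x = mi y.
  move=> exy; have : lc U V (x.1 + 6 * y.1, x.2 + 6 * y.2)%N = 0.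
    have := @lcN _ E 7 U V isT tU tV y => /= n6; rewrite -[LHS](lcD U V x (6 * y.1, 6 * y.2)%N) -n6 exy subrr //.
  move/ind => /andP[/= d1 d2].
  have cg i j : (7 %| i + 6 * j)%N -> (i %% 7 = j %% 7)%N by lia.
  by rewrite /mi (mulrn_mod7 x.1 tU) (mulrn_mod7 x.2 tV) (cg _ _ d1) (cg _ _ d2) -!mulrn_mod7.
(* i U + j V goes to i U - j V; the finite search for the coordinates makes this a total
   function. *)
pose phi0 (P : ept E) : ept E := if [pick x : 'I_7 * 'I_7 | P == lc U V (nat_of_ord x.1, nat_of_ord x.2)] is Some x
  then mi (nat_of_ord x.1, nat_of_ord x.2) else 0.
have phi0E x : phi0 (lc U V x) = mi x.
  rewrite /phi0; case: pickP => [y /eqP /lcI -> //|nn].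
  have := nn (inord (x.1 %% 7), inord (x.2 %% 7)); rewrite /= !inordK ?ltn_mod // -lc_mod //.
  by rewrite eqxx.
have miD x y : mi (x.1 + y.1, x.2 + y.2)%N = mi x + mi y.
  by rewrite /mi /= !mulrnDr opprD addrACA.
have tmi x : mi x *+ 7 = 0 by rewrite /mi mulrnBl mulrnAC tU mul0rn mulrnAC tV mul0rn subr0.
have twt X : X *+ 7 = 0 -> tw X *+ 7 = 0 by move=> t; rewrite -(trMn r0) t tr0.
have miN x : mi x = lc U V (x.1, x.2 * 6)%N by rewrite /mi /lc /= (@tor_opp _ _ 7 isT).
have mmi x : mi (x.1, x.2 * 6)%N = lc U V x.
  by rewrite /mi /= -(@tor_opp _ _ 7 isT) // opprK.
have phi00 P : P *+ 7 = 0 -> phi0 (phi0 P) = P.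
  by move=> /sp[x ->]; rewrite phi0E miN phi0E mmi.
have tphi0 P : P *+ 7 = 0 -> phi0 P *+ 7 = 0 by move=> /sp[x ->]; rewrite phi0E.
(* [P2 = tw Q] with [Q] on E: the inverse twist. *)
have [twi twK] : exists twi : ept E2 -> ept E, forall Y, tw (twi Y) = Y.
  have ia : ea E = r^-1 ^+ 4 * sid (ea E2) by change (sid (ea E2)) with (ea E2); rewrite twa mulrA -exprMn mulVf // expr1n mul1r.
  have ib : eb E = r^-1 ^+ 6 * sid (eb E2) by change (sid (eb E2)) with (eb E2); rewrite twb mulrA -exprMn mulVf // expr1n mul1r.
  have ri0 : r^-1 != 0 by rewrite invr_eq0.
  exists (tr ia ib) => Y; apply: val_inj; rewrite !val_tr; case: (val Y) => [[x y]|] //=.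
  by congr (Some (_, _)); field.
apply: (@reverse_congruentP 7 a b _ _ h disc_twist (fun P => tw (phi0 P))) => //.
- by move=> P tP; apply: twt; apply: tphi0.
- by move=> P Q tP tQ /(tr_inj r0) ePQ; rewrite -(phi00 P tP) ePQ phi00.
- move=> Q tQ; have tQ' : twi Q *+ 7 = 0 by apply: (tr_inj r0 (ha := twa) (hb := twb)); rewrite (trMn r0) tr0 -/tw twK.
  by exists (phi0 (twi Q)); [exact: tphi0 | rewrite phi00 // twK].
- by move=> P Q /sp[x ->] /sp[y ->]; rewrite lcD !phi0E miD -(trD r0).
- move=> s P /sp[x ->]; rewrite phi0E.
  have galD (A B : ept E) : galp s (A + B) = galp s A + galp s B by exact: (trD (oner_neq0 _)).
  have galMn (A : ept E) k : galp s (A *+ k) = galp s A *+ k by exact: (trMn (oner_neq0 _)).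
  have galN (A : ept E) : galp s (- A) = - galp s A by exact: (trN (oner_neq0 _)).
  rewrite /lc /mi galD !galMn.
  have gU : in7 (Tf (s r)) (Kf (s r)) (galp s U) by apply: gal_in7; apply/inU; exists 1%N.
  have gV : in7 (Tf (s (- r))) (Kf (s (- r))) (galp s V) by apply: gal_in7; apply/inV; exists 1%N.
  have gtw (X : ept E) ep : s r = ep * r -> (ep = 1 \/ ep = -1) -> galp s (tw X) = tw (if ep == 1 then galp s X else - galp s X).
    move=> er he'; apply: val_inj; rewrite val_gal !val_tr /trp.
    have n11 : (-1 : algC) == 1 = false by rewrite eqr_oppLR; apply/eqP => /eqP; rewrite -subr_eq0 opprK -mulr2n pnatr_eq0.
    case: he' er => ->; rewrite ?n11 ?eqxx ?valN val_gal; case: (val X) => [[x' y']|] //= er;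
      by congr (Some (_, _)); rewrite rmorphM rmorphXn er; ring.
  (* If s fixes r, it preserves both lines and commutes with [phi0] and with the twist. If s r = -r,
     it swaps the lines, hence anticommutes with [phi0], and the twist supplies the missing sign. *)
  case: (gal_r s) => er.
    rewrite rmorphN er in gV; rewrite er in gU.
    have [i1 e1] := (inU _).1 gU; have [i2 e2] := (inV _).1 gV.
    rewrite (gtw _ 1) ?mul1r //; [|by left].
    rewrite eqxx galD galN !galMn e1 e2 -!mulrnA.
    by rewrite -[X in phi0 X]/(lc U V (i1 * x.1, i2 * x.2)%N) phi0E.
  rewrite rmorphN er opprK in gV; rewrite er in gU.
  have [i1 e1] := (inV _).1 gU; have [i2 e2] := (inU _).1 gV.
  rewrite (gtw _ (-1)) ?mulN1r //; [|by right].
  have -> : (-1 : algC) == 1 = false by rewrite eqr_oppLR; apply/eqP => /eqP; rewrite -subr_eq0 opprK -mulr2n pnatr_eq0.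
  rewrite galD galN !galMn e1 e2 -!mulrnA addrC.
  by rewrite -[X in phi0 X]/(lc U V (i2 * x.2, i1 * x.1)%N) phi0E /mi /= opprD opprK addrC.
move=> P Q tP tQ; have [S [T g]] := ex_generic hG; have [nS nT g1 g2] := g.
have ntz (X : ept E) : X *+ 7 != 0 -> X != 0 by apply: contraNneq => ->; rewrite mul0rn.
have ntz2 (X Y : ept E) : X *+ 7 = 0 -> Y *+ 7 != 0 -> X + Y != 0.
  by move=> tX nY; apply: ntz; rewrite mulrnDl tX add0r.
exists S, T, (tw S), (tw T); split=> //; first exact: (generic_tr r0).
have w1 := ntz _ nS; have w2 := ntz _ nT; have w3 := ntz2 _ _ (tphi0 _ tQ) nT; have w4 := ntz2 _ _ (tphi0 _ tP) nS.
etransitivity; first exact: (@wpv_tr _ E E2 sid r r0 twa twb 7 (phi0 P) (phi0 Q) S T w2 w1 w3 w4).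
change (wpv 7 (phi0 P) (phi0 Q) S T = (wpv 7 P Q S T)^-1).
rewrite -(he _ _ S T) ?tphi0 // -(he P Q S T) //.
case: (sp P tP) => x ->; case: (sp Q tQ) => y ->; rewrite !phi0E /mi /lc.
have tm (X : ept E) i : X *+ 7 = 0 -> X *+ i *+ 7 = 0 by move=> t; rewrite mulrnAC t mul0rn.
have tn (X : ept E) : X *+ 7 = 0 -> - X *+ 7 = 0 by move=> t; rewrite mulNrn t oppr0.
have ta (X Y : ept E) : X *+ 7 = 0 -> Y *+ 7 = 0 -> (X + Y) *+ 7 = 0 by move=> tX tY; rewrite mulrnDl tX tY addr0.
have eNl (X Y : ept E) : X *+ 7 = 0 -> Y *+ 7 = 0 -> e (- X) Y = (e X Y)^-1.
  by move=> tX tY; rewrite (pair_sym hG he) ?tn // (pairNr hG he) // (pair_sym hG he tX tY) invrK.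
have eD := pairDr hG he. have eDl := pairDl hG he. have eN := pairNr hG he.
have eM := pairMr hG he.
have eMl := pairMl hG he.
have exx := pairxx (isT : odd 7) hG he.
(* Within each of the two lines the pairing is trivial; only the cross terms remain, and the sign
   change inverts them. *)
have key (A B A' B' : ept E) : A *+ 7 = 0 -> B *+ 7 = 0 -> A' *+ 7 = 0 -> B' *+ 7 = 0 -> e A A' = 1 -> e B B' = 1 ->
    e (A - B) (A' - B') = (e (A + B) (A' + B'))^-1.
  move=> tA tB tA' tB' h1 h2; have nB := tn _ tB; have nB' := tn _ tB'.
  rewrite (eDl A) ?ta // (eDl A B) ?ta // !eD // !eN // !eNl // h1 h2 invrK.
  by rewrite !mul1r !mulr1 invfM.
by apply: key; rewrite ?tm // eM ?tm // eMl // exx // !expr1n.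
Qed.

End Reverse7.

End ReverseSeven.

(** * Rational maps from a line to the curve are constant *)

Module ConstantCurves.
Import CurveRing PointIdeals CocycleLaw CurveGroup Reciprocity.

Section ConstantCurve.
Variables (K : numClosedFieldType) (a b : K).
Hypothesis ns : 4%:R * a ^+ 3 + 27%:R * b ^+ 2 != 0.
Implicit Types (p q r u v w : {poly K}).

Lemma coprime_no_root p q : (forall z, p.[z] = 0 -> q.[z] = 0 -> False) -> coprimep p q.
Proof.
move=> h; rewrite coprimep_def; apply/negPn/negP => /closed_rootP[z].
by rewrite root_gcd => /andP[/rootP h1 /rootP h2]; exact: (h z).
Qed.

(* r divides the Wronskian of p and q, whose degree is too small. *)
Lemma square_const p q r : coprimep p q -> q != 0 ->
  r * r = q * (p * p * p + a *: (p * (q * q)) + b *: (q * q * q)) -> exists c, p = c *: q.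
Proof.
move=> cpq q0 er.
have noroot z : p.[z] = 0 -> q.[z] = 0 -> False.
  move=> h1 h2; have : root (gcdp p q) z by rewrite root_gcd /root h1 h2 eqxx.
  move: cpq; rewrite coprimep_def => /eqP s; have [c c0 ->] : exists2 c, c != 0 & gcdp p q = c%:P.
    by apply/size_poly1P; rewrite s.
  by rewrite rootC (negPf c0).
(* [Mp] and [Mq] are the partial derivatives of the binary form q p^3 + a p q^3 + b q^4, so that W
   Mp and W Mq are combinations of r^2 and its derivative. *)
pose Mp := 3%:R *: (q * (p * p)) + a *: (q * q * q).
pose Mq := p * p * p + (3%:R * a) *: (p * (q * q)) + (4%:R * b) *: (q * q * q).
pose W := p^`() * q - p * q^`().
have dM : r^`() * r + r * r^`() = q^`() * (p * p * p + a *: (p * (q * q)) + b *: (q * q * q))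
   + q * (p^`() * p * p + p * p^`() * p + p * p * p^`() + a *: (p^`() * (q * q) + p * (q^`() * q + q * q^`()))
   + b *: ((q^`() * q + q * q^`()) * q + q * q * q^`())).
  by rewrite -derivM er !(derivM, derivD, derivZ); congr (_ + _ * _); rewrite -!mul_polyC; ring.
have W1 : W * Mp = r * (2%:R *: (q * r^`()) - 4%:R *: (q^`() * r)).
  have -> : r * (2%:R *: (q * r^`()) - 4%:R *: (q^`() * r)) = q * (r^`() * r + r * r^`()) - 4%:R *: (q^`() * (r * r)).
    by rewrite -!mul_polyC; ring.
  by rewrite dM er /W /Mp -!mul_polyC; ring.
have W2 : W * Mq = r * (4%:R *: (p^`() * r) - 2%:R *: (p * r^`())).
  have -> : r * (4%:R *: (p^`() * r) - 2%:R *: (p * r^`())) = 4%:R *: (p^`() * (r * r)) - p * (r^`() * r + r * r^`()).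
    by rewrite -!mul_polyC; ring.
  by rewrite dM er /W /Mq -!mul_polyC !polyCM; ring.
(* A common zero of the partial derivatives would be a double root of the form, against the
   discriminant. *)
have cM : coprimep Mp Mq.
  apply: coprime_no_root => z; rewrite /Mp /Mq !(hornerD, hornerZ, hornerM) => h1 h2.
  have hn := noroot z; move: h1 h2 hn; move: (p.[z]) (q.[z]) => x y h1 h2 hn.
  have [y0|y0] := eqVneq y 0.
    apply: hn => //; apply/eqP; have /eqP := h2; rewrite y0 !(mul0r, mulr0) !addr0 !mulf_eq0 => /orP[/orP[]|] //.
  have ea : a = - 3%:R * (x / y) ^+ 2.
    by apply: (mulfI (expf_neq0 3 y0)); apply/eqP; rewrite -subr_eq0; apply/eqP; rewrite -h1; field.
  have e4 : (4%:R : K) != 0 by rewrite pnatr_eq0.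
  have eb : b = 2%:R * (x / y) ^+ 3.
    apply: (mulfI (mulf_neq0 e4 (expf_neq0 3 y0))); apply/eqP; rewrite -subr_eq0; apply/eqP.
    by rewrite -h2 ea; field.
  by case/eqP: ns; rewrite ea eb; ring.
have rW : r %| W.
  have d1 : r %| W * Mp by rewrite W1 dvdp_mulr.
  have d2 : r %| W * Mq by rewrite W2 dvdp_mulr.
  have /Bezout_eq1_coprimepP[[u1 u2] /= e1] := cM.
  by rewrite -[W]mulr1 -e1 mulrDr !(mulrCA W); apply: dvdp_add; apply: dvdp_mull.
have [W0|W0] := eqVneq W 0.
  have e : p^`() * q = p * q^`() by apply/eqP; rewrite -subr_eq0; apply/eqP.
  have dq : q %| q^`() by rewrite -(Gauss_dvdpr _ (_ : coprimep q p)) 1?coprimep_sym // -e dvdp_mull.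
  have q'0 : q^`() = 0.
    apply/eqP; apply/negPn/negP => n0; have := dvdp_leq n0 dq; rewrite leqNgt lt_size_deriv //.
  have p'0 : p^`() = 0 by apply/eqP; move/eqP: e; rewrite q'0 mulr0 mulf_eq0 (negPf q0) orbF.
  have cst (g : {poly K}) : g^`() = 0 -> exists c, g = c%:P.
    move=> g0; exists g`_0; apply: size1_polyC; rewrite leqNgt; apply/negP => hs.
    have := congr1 (fun h : {poly K} => h`_(size g).-2) g0; rewrite coef_deriv coef0 => /eqP.
    have -> : (size g).-2.+1 = (size g).-1 by move: hs; case: (size g) => [|[|k]].
    rewrite mulrn_eq0 -lead_coefE lead_coef_eq0 => /orP[]; first by move: hs; case: (size g) => [|[|k]].
    by move/eqP=> g00; move: hs; rewrite g00 size_poly0.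
  have [c2 e2] := cst _ q'0; have [c1 ec1] := cst _ p'0.
  have c20 : c2 != 0 by apply: contraNneq q0 => z; rewrite e2 z.
  by exists (c1 / c2); rewrite ec1 e2 -mul_polyC -polyCM divfK.
have r0 : r != 0 by apply: contraNneq W0 => z; move: rW; rewrite z dvd0p.
have sW := dvdp_leq W0 rW.
have sr : size (r * r) = ((size r + size r).-1)%N by rewrite size_mul.
have sd (g : {poly K}) : g != 0 -> (size (g^`())%R < size g)%N by move=> g0; exact: lt_size_deriv.
have sWm (g h : {poly K}) : g != 0 -> h != 0 -> (size (g^`() * h - g * h^`())%R < (size g + size h).-1)%N.
  move=> g0 h0; have := sd _ g0; have := sd _ h0; have := size_polyMleq g^`() h; have := size_polyMleq g h^`().
  have := size_polyD (g^`() * h) (- (g * h^`())); rewrite size_polyN.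
  have : (0 < size g)%N by rewrite size_poly_gt0.
  have : (0 < size h)%N by rewrite size_poly_gt0.
  move: (size _) (size (g^`() * h)) (size (g * _)) (size g^`()) (size h^`()) (size g) (size h) => k1 k2 k3 k4 k5 k6 k7.
  by clear; lia.
have szq : (0 < size q)%N by rewrite size_poly_gt0.
have sq2 : size (q * q) = ((size q + size q).-1)%N by rewrite size_mul.
have sq3 : size (q * q * q) = (((size q + size q).-1 + size q).-1)%N by rewrite size_mul ?mulf_neq0 // sq2.
have sZ k (g : {poly K}) : (size (k *: g) <= size g)%N by apply: size_scale_leq.
(* Now compare deg W with deg r, which is half the degree of the form. For deg p > deg q its term q
   p^3 dominates. Otherwise subtracting c q from p leaves W unchanged and lowers deg p below deg q;
   when c is a root of the cubic, simplicity of the root gives the next term. *)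
case: (leqP (size p) (size q)) => hpq; last first.
  have p0 : p != 0 by rewrite -size_poly_gt0; apply: leq_ltn_trans hpq.
  have sp3 : size (p * p * p) = (((size p + size p).-1 + size p).-1)%N by rewrite !size_mul ?mulf_neq0.
  have spq : size (p * (q * q)) = ((size p + (size q + size q).-1).-1)%N by rewrite !size_mul ?mulf_neq0.
  have sM : size (p * p * p + a *: (p * (q * q)) + b *: (q * q * q)) = size (p * p * p).
    rewrite size_polyDl; last first.
      rewrite size_polyDl; first by apply: leq_ltn_trans (sZ _ _) _; rewrite sq3 sp3; clear -hpq szq; lia.
      by apply: leq_ltn_trans (sZ _ _) _; rewrite spq sp3; clear -hpq szq; lia.
    by rewrite size_polyDl //; apply: leq_ltn_trans (sZ _ _) _; rewrite spq sp3; clear -hpq szq; lia.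
  have := sWm _ _ p0 q0; rewrite -/W; move: sr; rewrite er size_mul //; last first.
    by rewrite -size_poly_gt0 sM size_poly_gt0 !mulf_neq0.
  rewrite sM sp3; move: sW hpq szq; move: (size r) (size W) (size p) (size q) => k1 k2 k3 k4.
  by clear; lia.
pose c := p`_(size q).-1 / lead_coef q; pose p1 := p - c *: q.
have lq : lead_coef q != 0 by rewrite lead_coef_eq0.
have [p10|p10] := eqVneq p1 0; first by exists c; apply/eqP; rewrite -subr_eq0 -/p1 p10.
have sp1 : (size p1 < size q)%N.
  rewrite -(prednK szq) ltnS; apply/leq_sizeP => j; rewrite leq_eqVlt => /orP[/eqP <-|hj].
    by rewrite coefB coefZ /c lead_coefE divfK ?subrr // -lead_coefE.
  have hq : (size q <= j)%N by rewrite -(prednK szq).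
  by rewrite coefB coefZ [q`_j]nth_default // [p`_j]nth_default ?mulr0 ?subrr //; exact: leq_trans hpq hq.
have ep : p = p1 + c *: q by rewrite /p1 subrK.
have WE : W = p1^`() * q - p1 * q^`().
  by rewrite /W ep derivD derivZ -!mul_polyC; ring.
have := sWm _ _ p10 q0; rewrite -WE => sW1.
have szp1 : (0 < size p1)%N by rewrite size_poly_gt0.
pose fc := c ^+ 3 + a * c + b; pose dc := 3%:R * c ^+ 2 + a.
have EM : p * p * p + a *: (p * (q * q)) + b *: (q * q * q) =
   fc *: (q * q * q) + (dc *: (p1 * (q * q)) + ((3%:R * c) *: (p1 * p1 * q) + p1 * p1 * p1)).
  by rewrite /fc /dc {1 2 3 4}ep -!mul_polyC !(polyCD, polyCM, rmorphXn, rmorph_nat) /=; ring.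
have s1 : size (p1 * (q * q)) = ((size p1 + (size q + size q).-1).-1)%N by rewrite !size_mul ?mulf_neq0.
have s2 : size (p1 * p1 * q) = (((size p1 + size p1).-1 + size q).-1)%N by rewrite !size_mul ?mulf_neq0.
have s3 : size (p1 * p1 * p1) = (((size p1 + size p1).-1 + size p1).-1)%N by rewrite !size_mul ?mulf_neq0.
have sA : (size ((3%:R * c) *: (p1 * p1 * q) + p1 * p1 * p1)%R < size (p1 * (q * q))%R)%N.
  apply: leq_ltn_trans (size_polyD _ _) _; rewrite gtn_max; apply/andP; split.
    by apply: leq_ltn_trans (sZ _ _) _; rewrite s1 s2; clear -sp1 szp1; lia.
  by rewrite s1 s3; clear -sp1 szp1; lia.
have [f0|f0] := eqVneq fc 0.
  have d0 : dc != 0.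
    apply: contraNneq ns => d0; have ea : a = - 3%:R * c ^+ 2 by apply/eqP; rewrite -subr_eq0 -d0 /dc; apply/eqP; ring.
    have eb : b = 2%:R * c ^+ 3 by apply/eqP; rewrite -subr_eq0 -f0 /fc ea; apply/eqP; ring.
    by rewrite ea eb; apply/eqP; ring.
  have sM : size (p * p * p + a *: (p * (q * q)) + b *: (q * q * q)) = size (p1 * (q * q)).
    by rewrite EM f0 scale0r add0r size_polyDl size_scale.
  move: sr; rewrite er size_mul // -?size_poly_gt0 sM ?size_poly_gt0 ?mulf_neq0 // s1.
  move: sW sW1 sp1 szp1; move: (size r) (size W) (size p1) (size q) => k1 k2 k3 k4.
  by clear; lia.
have sM : size (p * p * p + a *: (p * (q * q)) + b *: (q * q * q)) = size (q * q * q).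
  rewrite EM size_polyDl size_scale //; apply: leq_ltn_trans (size_polyD _ _) _; rewrite gtn_max; apply/andP; split.
    by apply: leq_ltn_trans (sZ _ _) _; rewrite s1 sq3; clear -sp1 szp1; lia.
  by apply: ltn_trans sA _; rewrite s1 sq3; clear -sp1 szp1; lia.
move: sr; rewrite er size_mul // -?size_poly_gt0 sM ?size_poly_gt0 ?mulf_neq0 // sq3.
move: sW sW1 sp1 szp1; move: (size r) (size W) (size p1) (size q) => k1 k2 k3 k4.
by clear; lia.
Qed.

(* A rational map from the line to the curve is constant. *)
Lemma line_map_const p q u v : q != 0 -> v != 0 ->
  u * u * (q * q * q) = v * v * (p * p * p + a *: (p * (q * q)) + b *: (q * q * q)) -> exists c, p = c *: q.
Proof.
move=> q0 v0 e.
pose g := gcdp p q; have g0 : g != 0 by rewrite gcdp_eq0 negb_and q0 orbT.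
have /dvdpP[p1 ep] : g %| p := dvdp_gcdl _ _; have /dvdpP[q1 eq] : g %| q := dvdp_gcdr _ _.
have q10 : q1 != 0 by apply: contraNneq q0 => z; rewrite eq z mul0r.
have cpq : coprimep p1 q1.
  have : gcdp (p1 * g) (q1 * g) %= gcdp p1 q1 * g by rewrite eqp_sym mulp_gcdl.
  rewrite -ep -eq -/g => h; rewrite coprimep_def size_poly_eq1.
  have : 1 * g %= gcdp p1 q1 * g by rewrite mul1r.
  by rewrite eqp_mul2r // eqp_sym.
have e1 : u * u * (q1 * q1 * q1) = v * v * (p1 * p1 * p1 + a *: (p1 * (q1 * q1)) + b *: (q1 * q1 * q1)).
  apply: (mulIf (_ : g * g * g != 0)); first by rewrite !mulf_neq0.
  have -> : u * u * (q1 * q1 * q1) * (g * g * g) = u * u * (q * q * q) by rewrite eq; ring.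
  by rewrite e {1 2 3 4}ep eq -!mul_polyC; ring.
(* After multiplication by q1 the left side is a square; so v divides u q1^2, and the quotient r
   satisfies the hypothesis of [square_const]. *)
have e2 : (u * (q1 * q1)) * (u * (q1 * q1)) = v * v * (q1 * (p1 * p1 * p1 + a *: (p1 * (q1 * q1)) + b *: (q1 * q1 * q1))).
  have -> : u * (q1 * q1) * (u * (q1 * q1)) = q1 * (u * u * (q1 * q1 * q1)) by ring.
  by rewrite e1; ring.
have : v ^+ 2 %| (u * (q1 * q1)) ^+ 2 by rewrite !expr2 e2 dvdp_mulr.
rewrite dvdp_pexp2r // => /dvdpP[r er].
have e3 : r * r = q1 * (p1 * p1 * p1 + a *: (p1 * (q1 * q1)) + b *: (q1 * q1 * q1)).
  apply: (mulfI (_ : v * v != 0)); first by rewrite mulf_neq0.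
  by rewrite -e2 er; ring.
have [c ec] := square_const cpq q10 e3.
by exists c; rewrite ep ec eq scalerAl.
Qed.

End ConstantCurve.

End ConstantCurves.

(** * Rational functions and rational maps outside finite sets *)

Module AlmostEverywhere.
Import CurveRing PointIdeals CocycleLaw CurveGroup Reciprocity TorsionStructure ConstantCurves.

Section AlmostEverywhere.
Variables (K : numClosedFieldType) (E : ecurve K).
Implicit Types (X Y H : ept E) (P Q R : ept E -> Prop) (f g : ept E -> K) (u w : rg K).

(** Cofinite validity; since the curve has infinitely many points, any two such statements hold
    together somewhere. *)
Definition ae P := exists L : seq (ept E), forall X, X \notin L -> P X.

Lemma ae1 P R : ae P -> (forall X, P X -> R X) -> ae R.
Proof. by case=> L h k; exists L => X /h /k. Qed.
Lemma ae2 P Q R : ae P -> ae Q -> (forall X, P X -> Q X -> R X) -> ae R.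
Proof.
case=> L h [L' h'] k; exists (L ++ L') => X; rewrite mem_cat negb_or => /andP[/h hX /h' hX'].
exact: k.
Qed.
Lemma ae3 P Q S R : ae P -> ae Q -> ae S -> (forall X, P X -> Q X -> S X -> R X) -> ae R.
Proof. by move=> h1 h2 h3 k; apply: (ae2 h1 (ae2 h2 h3 (fun X a b => conj a b))) => X p [q s]; exact: k. Qed.
Lemma ae_nz : ae (fun X => X != 0).
Proof. by exists [:: 0] => X; rewrite inE. Qed.
Lemma ae_shift P H : ae P -> ae (fun X => P (X + H)).
Proof. by case=> L h; exists [seq Y - H | Y <- L] => X hX; apply: h; apply: contra hX => hX; apply/mapP; exists (X + H); rewrite ?addrK. Qed.
Lemma ae_opp P : ae P -> ae (fun X => P (- X)).
Proof. by case=> L h; exists [seq - Y | Y <- L] => X hX; apply: h; apply: contra hX => hX; apply/mapP; exists (- X); rewrite ?opprK. Qed.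

Definition xc X : K := if val X is Some (x, y) then x else 0.
Definition yc X : K := if val X is Some (x, y) then y else 0.

Lemma val_xy X : X != 0 -> val X = Some (xc X, yc X).
Proof. by case/affineP=> x [y e]; rewrite /xc /yc e. Qed.
Lemma eq_xy X : X != 0 -> yc X ^+ 2 = ecub E (xc X).
Proof. by move/val_xy/valSomeP. Qed.
Lemma xcN X : xc (- X) = xc X.
Proof. by rewrite /xc valN; case: (val X) => [[]|]. Qed.
Lemma ycN X : yc (- X) = - yc X.
Proof. by rewrite /yc valN; case: (val X) => [[]|] //=; rewrite oppr0. Qed.

Lemma poly_roots (p : {poly K}) : p != 0 -> exists rs : seq K, (size rs < size p)%N /\ forall x, p.[x] = 0 -> x \in rs.
Proof.
move=> p0; have [rs e] := closed_field_poly_normal p; have lp : lead_coef p != 0 by rewrite lead_coef_eq0.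
exists rs; split; first by rewrite e size_scale // size_prod_XsubC.
move=> x /eqP; rewrite e hornerZ mulf_eq0 (negPf lp) /= => h.
by have : root (\prod_(z <- rs) ('X - z%:P)) x by []; rewrite root_prod_XsubC.
Qed.

Lemma points_over (rs : seq K) : exists L : seq (ept E), (size L <= (size rs).*2)%N /\ forall X, X != 0 -> xc X \in rs -> X \in L.
Proof.
elim: rs => [|x rs [L [s h]]]; first by exists [::].
have [A [y [eA _]]] := ex_pt E x; exists (A :: - A :: L); split; first by rewrite /= doubleS !ltnS.
move=> X X0; rewrite inE => /orP[/eqP ex|/(h X X0)]; last by rewrite !inE => ->; rewrite !orbT.
have eX := val_xy X0; rewrite ex in eX; rewrite !inE.
by case: (same_x eX eA) => ->; rewrite eqxx ?orbT.
Qed.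

Lemma points_inf (L : seq (ept E)) : exists X, X \notin L.
Proof.
have [x hx] : exists x : K, x \notin [seq xc Y | Y <- L].
  pose p := \prod_(z <- [seq xc Y | Y <- L]) ('X - z%:P).
  have p0 : p != 0 by rewrite monic_neq0 // monic_prod_XsubC.
  case: (boolP (all (fun k : nat => (k%:R : K) \in [seq xc Y | Y <- L]) (iota 0 (size L).+1))) => [h|/allPn[k _ hk]]; last by exists k%:R.
  have := max_poly_roots p0 (rs := [seq k%:R | k <- iota 0 (size L).+1]).
  rewrite size_map size_iota size_prod_XsubC size_map ltnn => hf; exfalso; suff : false by []; apply: hf.
    by apply/allP => _ /mapP[k /(allP h) hk ->]; rewrite root_prod_XsubC.
  by rewrite map_inj_uniq ?iota_uniq // => i j /eqP; rewrite eqr_nat => /eqP.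
have [A [y [eA _]]] := ex_pt E x; exists A; apply: contra hx => hA; apply/mapP; exists A => //.
by rewrite /xc eA.
Qed.
Lemma ae_ex P : ae P -> exists X, P X.
Proof. by case=> L h; have [X /h] := points_inf L; exists X. Qed.

Definition eva u X := ev u (xc X) (yc X).
Definition nm u : {poly K} := u.1 * u.1 - u.2 * u.2 * fpoly E.
Definition cj u : rg K := (u.1, - u.2).

Lemma nmE u X : X != 0 -> (nm u).[xc X] = eva u X * eva (cj u) X.
Proof.
move=> X0; rewrite /nm /eva /ev /cj /= hornerD !hornerN !hornerM fpolyE -eq_xy //.
by move: (_.[_]) (u.2.[_]) => p q; ring.
Qed.
Lemma nm_neq0 u : u != (0, 0) -> nm u != 0.
Proof.
move=> u0; apply/negP => /eqP n0; have nz (v : rg K) : v != (0, 0) -> rwt v != 0 by move=> v0; apply: contraNneq v0 => /rwt_eq0 ->.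
have c0 : cj u != (0, 0) by apply: contraNneq u0 => -[e1 /eqP]; rewrite oppr_eq0 => /eqP e2; rewrite [u]surjective_pairing e1 e2.
have := rmul_neq0 E (nz _ u0) (nz _ c0); have -> : rmul E u (cj u) = (0, 0).
  by apply: (@ev_inj _ E) => x y e; rewrite evM //; move: n0 => /(congr1 (horner^~ x)); rewrite /nm /ev /= hornerD !hornerN !hornerM fpolyE -e horner0 => h; rewrite mul0r addr0 -h; move: (_.[_]) (u.2.[_]) => p q; ring.
by rewrite rwt0 eqxx.
Qed.
(** The zeros lie over the roots of the norm. The bound is explicit because it will be compared with
    a number of torsion translates. *)
Lemma zeros_bound u m : u != (0, 0) -> (size u.1 <= m)%N -> (size u.2 <= m)%N ->
  exists L : seq (ept E), (size L <= 4 * m + 8)%N /\ forall X, X != 0 -> eva u X = 0 -> X \in L.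
Proof.
move=> u0 s1 s2; have [rs [srs hrs]] := poly_roots (nm_neq0 u0); have [L [sL hL]] := points_over rs.
exists L; split; last by move=> X X0 e; apply: hL => //; apply: hrs; rewrite nmE // e mul0r.
have := size_polyD (u.1 * u.1) (- (u.2 * u.2 * fpoly E)); rewrite size_polyN.
have := size_polyMleq u.1 u.1; have := size_polyMleq u.2 u.2; have := size_polyMleq (u.2 * u.2) (fpoly E).
have [sf _] := top_fpoly E; move: sL srs s1 s2 sf; rewrite /nm; move: (size (u.1 * u.1 - _)).
move: (size (u.2 * u.2 * _)) (size (u.2 * u.2)) (size (u.1 * u.1)) (size u.1) (size u.2) (size (fpoly E)) (size L) (size rs).
by move=> k1 k2 k3 k4 k5 k6 k7 k8 k9; clear; rewrite -mul2n; lia.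
Qed.
Lemma eva_dich u : u = (0, 0) \/ ae (fun X => eva u X != 0).
Proof.
have [->|u0] := eqVneq u (0, 0); [by left | right].
have [L [_ h]] := zeros_bound u0 (leq_maxl _ _) (leq_maxr _ _).
exists (0 :: L) => X; rewrite inE negb_or => /andP[X0 hX]; apply: contra hX => /eqP; exact: h.
Qed.
Lemma eva_ae0 u : ae (fun X => eva u X = 0) -> u = (0, 0).
Proof.
move=> h; case: (eva_dich u) => // h'; have [X [e /negP[]]] := ae_ex (ae2 h h' (fun X a b => conj a b)).
by rewrite e.
Qed.

(** Rational functions as plain functions on points, known up to finitely many values; [RF_dich]
    then plays the role of integrality of the curve. *)
Definition RF f := exists u w, ae (fun X => eva w X != 0 /\ f X = eva u X / eva w X).

Lemma RF_ext f g : RF f -> ae (fun X => g X = f X) -> RF g.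
Proof. by case=> u [w h] e; exists u, w; apply: (ae2 h e) => X [? ?] ->. Qed.
Lemma RF_cst c : RF (fun _ => c).
Proof. by exists (rc c), (rc 1), [::] => X _; rewrite /eva !evc oner_eq0 divr1. Qed.
Lemma RF_x : RF xc.
Proof. by exists (rx K), (rc 1), [::] => X _; rewrite /eva !evc evx oner_eq0 divr1. Qed.
Lemma RF_y : RF yc.
Proof. by exists (ry K), (rc 1), [::] => X _; rewrite /eva !evc evy oner_eq0 divr1. Qed.
Lemma evaM u w X : X != 0 -> eva (rmul E u w) X = eva u X * eva w X.
Proof. by move=> X0; rewrite /eva evM // eq_xy. Qed.
Lemma RF_mul f g : RF f -> RF g -> RF (fun X => f X * g X).
Proof.
move=> [u [w h]] [u' [w' h']]; exists (rmul E u u'), (rmul E w w').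
apply: (ae3 ae_nz h h') => X X0 [n e] [n' e']; rewrite !evaM // e e' mulf_neq0 //; split=> //.
by rewrite invfM mulrACA.
Qed.
Lemma RF_add f g : RF f -> RF g -> RF (fun X => f X + g X).
Proof.
move=> [u [w h]] [u' [w' h']]; exists (radd (rmul E u w') (rmul E u' w)), (rmul E w w').
apply: (ae3 ae_nz h h') => X X0 [n e] [n' e']; rewrite {2}/eva evD -!/(eva _ _) !evaM // e e' mulf_neq0 //; split=> //.
by rewrite addf_div // mulrC.
Qed.
Lemma RF_opp f : RF f -> RF (fun X => - f X).
Proof. by move=> h; apply: (RF_ext (RF_mul (RF_cst (-1)) h)); exists [::] => X _; rewrite mulN1r. Qed.
Lemma RF_sub f g : RF f -> RF g -> RF (fun X => f X - g X).
Proof. by move=> h k; apply: RF_add h (RF_opp k). Qed.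
Lemma RF_dich f : RF f -> ae (fun X => f X = 0) \/ ae (fun X => f X != 0).
Proof.
move=> [u [w h]]; case: (eva_dich u) => [u0|h']; [left | right].
  by apply: (ae1 h) => X [_ ->]; rewrite u0 /eva /ev /= !horner0 mul0r addr0 mul0r.
by apply: (ae2 h h') => X [n ->] n'; rewrite mulf_neq0 ?invr_eq0.
Qed.
Lemma RF_inv f : RF f -> RF (fun X => (f X)^-1).
Proof.
move=> hf; case: (RF_dich hf) => hd.
  by apply: (RF_ext (RF_cst 0)); apply: (ae1 hd) => X ->; rewrite invr0.
have [u [w h]] := hf; exists w, u; apply: (ae2 h hd) => X [n e] n'; rewrite e invf_div; split=> //.
by apply: contraNneq n' => z; rewrite e z mul0r.
Qed.
Lemma RF_div f g : RF f -> RF g -> RF (fun X => f X / g X).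
Proof. by move=> h k; apply: RF_mul h (RF_inv k). Qed.
Lemma RF_poly (p : {poly K}) f : RF f -> RF (fun X => p.[f X]).
Proof.
move=> h; elim/poly_ind: p => [|p c IH].
  by apply: (RF_ext (RF_cst 0)); exists [::] => X _; rewrite horner0.
apply: (RF_ext (RF_add (RF_mul IH h) (RF_cst c))); exists [::] => X _; by rewrite hornerMXaddC.
Qed.

Lemma RF_comp (T : ept E -> ept E) f : (forall P, ae P -> ae (fun X => P (T X))) ->
  RF (fun X => xc (T X)) -> RF (fun X => yc (T X)) -> RF f -> RF (fun X => f (T X)).
Proof.
move=> hT hx hy [u [w h]].
have he v : RF (fun X => eva v (T X)).
  by apply: RF_add (RF_poly _ hx) (RF_mul (RF_poly _ hx) hy).
by apply: (RF_ext (RF_div (he u) (he w))); apply: (ae1 (hT _ h)) => X [_ ->].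
Qed.
Lemma RF_neg f : RF f -> RF (fun X => f (- X)).
Proof.
apply: RF_comp; first by move=> P; exact: ae_opp.
  by apply: (RF_ext RF_x); exists [::] => X _; rewrite xcN.
by apply: (RF_ext (RF_opp RF_y)); exists [::] => X _; rewrite ycN.
Qed.

(** Multiplying by the conjugate of the denominator gives (al + be y) / N with al, be, N in K[x];
    evenness kills be. *)
Lemma RF_even f : RF f -> ae (fun X => f (- X) = f X) -> exists p q : {poly K}, q != 0 /\ ae (fun X => f X = p.[xc X] / q.[xc X]).
Proof.
move=> [u [w h]] hev.
have w0 : w != (0, 0).
  have [X [hw _]] := ae_ex h; apply/eqP => wz; move/eqP: hw; rewrite wz; apply; rewrite /eva /ev /= !horner0 mul0r addr0 //.
have n0 := nm_neq0 w0.
pose al := u.1 * w.1 - u.2 * w.2 * fpoly E; pose be := u.2 * w.1 - u.1 * w.2.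
have hn : ae (fun X => (nm w).[xc X] != 0).
  case: (eva_dich (nm w, 0)) => [[/eqP]|h']; first by rewrite (negPf n0).
  by apply: (ae1 h') => X; rewrite /eva /ev /= horner0 mul0r addr0.
have fE : ae (fun X => f X = (al.[xc X] + be.[xc X] * yc X) / (nm w).[xc X]).
  apply: (ae3 ae_nz h hn) => X X0 [m e] m'; rewrite e; move: m'; rewrite nmE // mulf_eq0 negb_or => /andP[_ m'].
  have -> : eva u X / eva w X = eva u X * eva (cj w) X / (eva w X * eva (cj w) X) by field; rewrite m m'.
  congr (_ / _).
  have := eq_xy X0; rewrite -fpolyE /al /be /eva /ev /cj /=; move: (fpoly E) => ff fx.
  rewrite !(hornerD, hornerN, hornerM) -fx.
  by move: (_.[_]) (u.2.[_]) (w.1.[_]) (w.2.[_]) => k1 k2 k3 k4; ring.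
have be0 : be = 0.
  have : ae (fun X => eva (0, be) X = 0).
    apply: (ae3 fE (ae_opp fE) (ae2 hn hev (fun X a b => conj a b))) => X e1 e2 [m e3].
    move: e2; rewrite e3 e1 xcN ycN => /(mulIf (invr_neq0 m)) /addrI /eqP; rewrite mulrN -addr_eq0 -mulr2n mulrn_eq0 /=.
    by rewrite /eva /ev /= horner0 add0r => /eqP.
  by move/eva_ae0 => [].
exists al, (nm w); split=> //; apply: (ae1 fE) => X ->; by rewrite be0 horner0 mul0r addr0.
Qed.

Lemma poly_ae0 (p : {poly K}) : ae (fun X => p.[xc X] = 0) -> p = 0.
Proof.
move=> h; have : ae (fun X => eva (p, 0) X = 0) by apply: (ae1 h) => X e; rewrite /eva /ev /= e horner0 mul0r addr0.
by move/eva_ae0 => [].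
Qed.
End AlmostEverywhere.

Section RationalMaps.
Variables (K : numClosedFieldType) (E F : ecurve K).
Implicit Types (X Y H : ept E) (psi : ept E -> ept F).

Definition RM psi := ae (fun X => psi X = 0) \/
  [/\ ae (fun X => psi X != 0), RF (fun X => xc (psi X)) & RF (fun X => yc (psi X))].

Lemma RM_ext psi psi' : RM psi -> ae (fun X => psi' X = psi X) -> RM psi'.
Proof.
case=> [h|[h h1 h2]] e; [left | right]; first by apply: (ae2 h e) => X ? ->.
split; first by apply: (ae2 h e) => X ? ->.
  by apply: (RF_ext h1); apply: (ae1 e) => X ->.
by apply: (RF_ext h2); apply: (ae1 e) => X ->.
Qed.
Lemma RM_opp psi : RM psi -> RM (fun X => - psi X).
Proof.
case=> [h|[h h1 h2]]; [left | right]; first by apply: (ae1 h) => X ->; rewrite oppr0.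
split; first by apply: (ae1 h) => X; rewrite oppr_eq0.
  by apply: (RF_ext h1); exists [::] => X _; rewrite xcN.
by apply: (RF_ext (RF_opp h2)); exists [::] => X _; rewrite ycN.
Qed.

Lemma add_xy (A B : ept F) l : A != 0 -> B != 0 -> ~~ ((xc A == xc B) && (yc A + yc B == 0)) ->
  l = slope F (xc A) (yc A) (xc B) (yc B) ->
  [/\ A + B != 0, xc (A + B) = l ^+ 2 - xc A - xc B & yc (A + B) = l * (xc A - (l ^+ 2 - xc A - xc B)) - yc A].
Proof.
move=> A0 B0 h el; have := valD A B; rewrite (val_xy A0) (val_xy B0) addpE (negPf h) -el => e.
split; [|by rewrite {1}/xc e|by rewrite {1}/yc e].
by apply/eqP => z; move: e; rewrite z.
Qed.

(** [RF_dich] decides which case of the addition law is the generic one: distinct abscissae,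
    opposite points or a doubling. *)
Lemma RM_add psi psi' : RM psi -> RM psi' -> RM (fun X => psi X + psi' X).
Proof.
case=> [h|[n1 hx1 hy1]].
  by move=> h'; apply: (RM_ext h'); apply: (ae1 h) => X ->; rewrite add0r.
case=> [h|[n2 hx2 hy2]].
  have h1 : RM psi by right.
  by apply: (RM_ext h1); apply: (ae1 h) => X ->; rewrite addr0.
have fin (l : ept E -> K) : RF l -> ae (fun X => ~~ ((xc (psi X) == xc (psi' X)) && (yc (psi X) + yc (psi' X) == 0)) /\
    l X = slope F (xc (psi X)) (yc (psi X)) (xc (psi' X)) (yc (psi' X))) -> RM (fun X => psi X + psi' X).
  move=> hl h; right.
  have hxx : RF (fun X => l X * l X - xc (psi X) - xc (psi' X)) by apply: RF_sub hx2; apply: RF_sub hx1; apply: RF_mul.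
  split.
  - by apply: (ae3 n1 n2 h) => X a1 a2 [a3 a4]; have [] := add_xy a1 a2 a3 a4.
  - by apply: (RF_ext hxx); apply: (ae3 n1 n2 h) => X a1 a2 [a3 a4]; have [_ -> _] := add_xy a1 a2 a3 a4; rewrite expr2.
  apply: (RF_ext (RF_sub (RF_mul hl (RF_sub hx1 hxx)) hy1)).
  by apply: (ae3 n1 n2 h) => X a1 a2 [a3 a4]; have [_ _ ->] := add_xy a1 a2 a3 a4; rewrite expr2.
case: (RF_dich (RF_sub hx2 hx1)) => hd; last first.
  apply: (fin _ (RF_div (RF_sub hy2 hy1) (RF_sub hx2 hx1))); apply: (ae1 hd) => X; rewrite subr_eq0 eq_sym => /negPf e.
  by rewrite /slope e.
case: (RF_dich (RF_add hy1 hy2)) => hs.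
  left; apply: (ae3 n1 n2 (ae2 hd hs (fun X a b => conj a b))) => X a1 a2 [/eqP a3 a4].
  apply: val_inj; rewrite valD (val_xy a1) (val_xy a2) addpE; move: a3; rewrite subr_eq0 eq_sym => ->.
  by rewrite a4 eqxx.
apply: (fin _ (RF_div (RF_add (RF_mul (RF_cst _ 3%:R) (RF_mul hx1 hx1)) (RF_cst _ (ea F))) (RF_mul (RF_cst _ 2%:R) hy1))).
apply: (ae2 hd hs) => X /eqP; rewrite subr_eq0 eq_sym => a3 /negPf a4; rewrite a4 andbF; split=> //.
by rewrite /slope a3 expr2.
Qed.

Lemma RM_cst (C : ept F) : RM (fun X : ept E => C).
Proof.
have [->|C0] := eqVneq C 0; first by left; exists [::].
by right; split; [exists [::] | exact: RF_cst | exact: RF_cst].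
Qed.

End RationalMaps.

Lemma RM_id (K : numClosedFieldType) (E : ecurve K) : RM (fun X : ept E => X).
Proof. right; split; [exact: ae_nz | exact: RF_x | exact: RF_y]. Qed.

Section EvenMaps.
Variables (K : numClosedFieldType) (E F : ecurve K).
Implicit Types (X Y H : ept E) (psi : ept E -> ept F).

Lemma RM_shift psi H : RM psi -> RM (fun X => psi (X + H)).
Proof.
have hT (P : ept E -> Prop) : ae P -> ae (fun X => P (X + H)) by apply: ae_shift.
have [h0|[_ hx hy]] := RM_add (RM_id E) (RM_cst E H).
  by have [X [/eqP]] := ae_ex (ae2 h0 (ae_shift (- H) (ae_shift H (ae_shift H (ae_nz E)))) (fun X a b => conj a b)); rewrite subrK => /eqP ->; rewrite eqxx.
case=> [h|[n h1 h2]]; [left; exact: (hT _ h)|right; split; first exact: (hT _ n)].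
  exact: (@RF_comp _ _ (fun X => X + H) (fun X => xc (psi X)) hT hx hy h1).
exact: (@RF_comp _ _ (fun X => X + H) (fun X => yc (psi X)) hT hx hy h2).
Qed.
Lemma RM_neg psi : RM psi -> RM (fun X => psi (- X)).
Proof.
case=> [h|[n h1 h2]]; [left; exact: (ae_opp h)|right; split; first exact: (ae_opp n)].
  exact: (RF_neg h1).
exact: (RF_neg h2).
Qed.

(* An even rational map factors through the x-line. *)
Lemma RM_even_const psi : RM psi -> ae (fun X => psi (- X) = psi X) -> exists C, ae (fun X => psi X = C).
Proof.
move=> hpsi hev; case: hpsi => [h|[n hx hy]]; first by exists 0.
have [p [q [q0 hp]]] : exists p q : {poly K}, q != 0 /\ ae (fun X => xc (psi X) = p.[xc X] / q.[xc X]).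
  by apply: RF_even => //; apply: (ae1 hev) => X ->.
have [u [v [v0 hu]]] : exists p q : {poly K}, q != 0 /\ ae (fun X => yc (psi X) = p.[xc X] / q.[xc X]).
  by apply: RF_even => //; apply: (ae1 hev) => X ->.
have pz (r : {poly K}) : r != 0 -> ae (fun X : ept E => r.[xc X] != 0).
  move=> r0; case: (eva_dich E (r, 0)) => [[/eqP]|h']; first by rewrite (negPf r0).
  by apply: (ae1 h') => X; rewrite /eva /ev /= horner0 mul0r addr0.
have e : u * u * (q * q * q) = v * v * (p * p * p + ea F *: (p * (q * q)) + eb F *: (q * q * q)).
  apply/eqP; rewrite -subr_eq0; apply/eqP; apply: (@poly_ae0 _ E).
  apply: (ae3 n (ae2 hp hu (fun X a b => conj a b)) (ae2 (pz _ q0) (pz _ v0) (fun X a b => conj a b))) => X n0 [e1 e2] [q1 v1].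
  have := eq_xy n0; rewrite e1 e2 /ecub !(hornerD, hornerN, hornerM, hornerZ).
  move: q1 v1; move: (p.[_]) (q.[_]) (u.[_]) (v.[_]) => k1 k2 k3 k4 q1 v1 e3.
  have -> : k3 * k3 * (k2 * k2 * k2) = (k3 / k4) ^+ 2 * (k4 * k4 * (k2 * k2 * k2)) by field.
  by rewrite e3; field.
have [c ec] := line_map_const (e_ns F) q0 v0 e.
have hc : ae (fun X => xc (psi X) = c) by apply: (ae2 hp (pz _ q0)) => X -> q1; rewrite ec hornerZ mulfK.
have [X0 [n0 c0]] := ae_ex (ae2 n hc (fun X a b => conj a b)).
set C := psi X0 in n0 c0.
have y2 X : psi X != 0 -> xc (psi X) = c -> (yc (psi X) - yc C) * (yc (psi X) + yc C) = 0.
  by move=> m1 m2; have := eq_xy m1; have := eq_xy n0; rewrite m2 c0 => <- /eqP; rewrite -subr_eq0 => /eqP h; rewrite -h; ring.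
case: (RF_dich (RF_sub hy (RF_cst E (yc C)))) => hd.
  exists C; apply: (ae3 n hc hd) => X m1 m2 /eqP; rewrite subr_eq0 => /eqP m3.
  by apply: val_inj; rewrite (val_xy m1) (val_xy n0) m2 m3 c0.
exists (- C); apply: (ae3 n hc hd) => X m1 m2 m3; have /eqP := y2 X m1 m2; rewrite mulf_eq0 (negPf m3) /= addr_eq0 => /eqP m4.
apply: val_inj; have n0' : - C != 0 by rewrite oppr_eq0.
by rewrite (val_xy m1) (val_xy n0') m2 m4 xcN ycN c0.
Qed.

(* First phi is odd up to a constant; then X |-> phi (X + D) - phi X is even after a translation. *)
Lemma RM_translation phi D : RM phi -> exists C : ept F, ae (fun X : ept E => phi (X + D) - phi X = C).
Proof.
move=> h.
have [C hC] : exists C, ae (fun X => phi X + phi (- X) = C).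
  apply: RM_even_const; first exact: (RM_add h (RM_neg h)).
  by exists [::] => X _; rewrite opprK addrC.
have [H0 eH] := halving D; pose psi X := phi (X + H0) - phi (X - H0).
have [C' hC'] : exists C, ae (fun X => psi X = C).
  apply: RM_even_const; first exact: (RM_add (RM_shift H0 h) (RM_opp (RM_shift (- H0) h))).
  apply: (ae2 (ae_shift H0 hC) (ae_shift (- H0) hC)) => X e1 e2; rewrite /psi.
  have -> : - X + H0 = - (X - H0) by rewrite opprB addrC.
  have -> : - X - H0 = - (X + H0) by rewrite opprD.
  rewrite (canRL (addKr _) e2) (canRL (addKr _) e1) opprD opprK addrACA subrr addr0 addrC //.
exists C'; apply: (ae1 (ae_shift H0 hC')) => X; rewrite /psi addrK -addrA -mulr2n eH => <- //.
Qed.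

End EvenMaps.

End AlmostEverywhere.

(** * Morphisms over Q, and a criterion for non-isogeny at one prime *)

Module Isogenies.
Import CurveRing PointIdeals CocycleLaw CurveGroup Reciprocity HomogeneousForms TorsionStructure Transport ConstantCurves AlmostEverywhere.

Lemma map_form_homog d (F : {mpoly rat[3]}) : F \is d.-homog -> map_mpoly (ratr : rat -> algC) F \is d.-homog.
Proof.
move=> /dhomogP h; apply/dhomogP => m hm; apply: h; move: hm.
by rewrite !mcoeff_msupp mcoeff_map_mpoly fmorph_eq0.
Qed.

Lemma coords_gal (s : {rmorphism algC -> algC}) (P : point algC) i : tnth (coords (galois_pt s P)) i = s (tnth (coords P) i).
Proof.
case: P => [[x y]|]; move: i; apply: I3P; rewrite /galois_pt.
- by case: (crd_aff (s x) (s y)) => -> _ _; case: (crd_aff x y) => -> _ _.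
- by case: (crd_aff (s x) (s y)) => _ -> _; case: (crd_aff x y) => _ -> _.
- by case: (crd_aff (s x) (s y)) => _ _ ->; case: (crd_aff x y) => _ _ ->; rewrite rmorph1.
- by case: (crd_inf algC) => -> _ _; rewrite rmorph0.
- by case: (crd_inf algC) => _ -> _; rewrite rmorph1.
- by case: (crd_inf algC) => _ _ ->; rewrite rmorph0.
Qed.

Lemma evalf_gal (s : {rmorphism algC -> algC}) (F : {mpoly rat[3]}) P :
  evalf (map_mpoly (ratr : rat -> algC) F) (galois_pt s P) = s (evalf (map_mpoly (ratr : rat -> algC) F) P).
Proof.
elim/mpolyind: F => [|c m F _ _ IH]; first by rewrite rmorph0 !evf0 rmorph0.
rewrite rmorphD /= map_mpolyZ map_mpolyX !evfD !evfZ IH rmorphD rmorphM fmorph_rat; congr (_ * _ + _).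
by rewrite /evalf !mevalX rmorph_prod; apply: eq_bigr => i _; rewrite coords_gal rmorphXn.
Qed.

Section Proportional.
Variable K : numClosedFieldType.
Implicit Types P Q : point K.

Definition crd P i : K := tnth (coords P) i.

Lemma crd_inj P Q : (forall i j, crd P i * crd Q j = crd P j * crd Q i) -> P = Q.
Proof.
rewrite /crd; case: P => [[x y]|]; case: Q => [[x' y']|] // h.
- move: (h i0 i2) (h i1 i2); case: (crd_aff x y) => -> -> ->; case: (crd_aff x' y') => -> -> ->.
  by rewrite !mulr1 !mul1r => -> ->.
- move: (h i1 i2); case: (crd_aff x y) => _ -> ->; case: (crd_inf K) => _ -> ->.
  by rewrite mulr0 mul1r => /eqP; rewrite eq_sym oner_eq0.
- move: (h i1 i2); case: (crd_aff x' y') => _ -> ->; case: (crd_inf K) => _ -> ->.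
  by rewrite mulr1 mul0r => /eqP; rewrite oner_eq0.
Qed.
End Proportional.

Lemma ae_all (K : numClosedFieldType) (E : ecurve K) (T : eqType) (s : seq T) (P : T -> ept E -> Prop) :
  (forall i, i \in s -> ae (P i)) -> ae (fun X => forall i, i \in s -> P i X).
Proof.
elim: s => [|i s IH] h; first by exists [::].
have h1 : ae (P i) by apply: h; rewrite inE eqxx.
have h2 : ae (fun X => forall j, j \in s -> P j X) by apply: IH => j hj; apply: h; rewrite inE hj orbT.
by apply: (ae2 h1 h2) => X a1 a2 j; rewrite inE => /orP[/eqP ->|] //; apply: a2.
Qed.

Section NoIsogeny.
Variables (a1 b1 a2 b2 : rat) (h1 : 4%:R * a1 ^+ 3 + 27%:R * b1 ^+ 2 != 0) (h2 : 4%:R * a2 ^+ 3 + 27%:R * b2 ^+ 2 != 0).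
Local Notation E1 := (ratecurve h1).
Local Notation E2 := (ratecurve h2).
Implicit Types (X Y D A B : ept E1) (g : ept E1 -> ept E2) (s : {rmorphism algC -> algC}).

Definition galois_hom g := (forall A B, g (A + B) = g A + g B) /\ (forall s A, g (galp s A) = galp s (g A)).
(** Abstract Galois homomorphisms are quantified over: the quotients by multiplication by l in
    [hom_factor] are built by choice, with no algebraicity attached. *)
Definition no_hom l := forall g, galois_hom g -> forall A, A *+ l = 0 -> g A = 0.

Lemma galp_inj (a b : rat) (h : 4%:R * a ^+ 3 + 27%:R * b ^+ 2 != 0) s : injective (@galp _ _ h s).
Proof. by rewrite /galp; apply: tr_inj; exact: oner_neq0. Qed.
Lemma galpD (a b : rat) (h : 4%:R * a ^+ 3 + 27%:R * b ^+ 2 != 0) s (A B : ept (ratecurve h)) : galp s (A + B) = galp s A + galp s B.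
Proof. by rewrite /galp trD ?oner_neq0. Qed.
Lemma galpN (a b : rat) (h : 4%:R * a ^+ 3 + 27%:R * b ^+ 2 != 0) s (A : ept (ratecurve h)) : galp s (- A) = - galp s A.
Proof. by rewrite /galp trN ?oner_neq0. Qed.
Lemma galpMn (a b : rat) (h : 4%:R * a ^+ 3 + 27%:R * b ^+ 2 != 0) s (A : ept (ratecurve h)) k : galp s (A *+ k) = galp s A *+ k.
Proof. by rewrite /galp trMn ?oner_neq0. Qed.

Lemma ae_gal (s : {rmorphism algC -> algC}) (P : ept E1 -> Prop) : ae P -> ae (fun X => P (galp s X)).
Proof.
case=> L hL; suff [L' h'] : exists L' : seq (ept E1), forall X, X \notin L' -> galp s X \notin L by exists L' => X /h' /hL.
elim: L {hL} => [|a L [L' h']]; first by exists [::].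
case: (boolp.pselect (exists X, galp s X = a)) => [[X eX]|no].
  exists (X :: L') => Y; rewrite !inE !negb_or => /andP[n /h' ->]; rewrite andbT -eX.
  by apply: contra n => /eqP /galp_inj ->.
exists L' => Y /h' hY; rewrite inE negb_or hY andbT; apply/eqP => e; apply: no; by exists Y.
Qed.

Variable phi : point algC -> point algC.
Hypothesis hphi : morphism_over_Q (ratcurve h1) (ratcurve h2) phi.

Let onc_phi A : onc E2 (phi (val A)).
Proof. by have [h _] := hphi; have := h (val A); rewrite !geom_ratcurve; apply; exact: (valP A). Qed.
Definition mor A : ept E2 := exist _ (phi (val A)) (onc_phi A).

(** The local forms have rational coefficients, so the homogeneous coordinates of the two points are
    proportional. *)
Lemma mor_gal s A : mor (galp s A) = galp s (mor A).
Proof.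
apply: val_inj; rewrite val_gal -[val (mor (galp s A))]/(phi (val (galp s A))) val_gal; apply: crd_inj => i j; rewrite /crd coords_gal.
have [_ /(_ (val A))] := hphi; rewrite geom_ratcurve => /(_ (valP A)) [d [F [_ [k hk] hF]]].
have [c ec] := hF _ (valP A) (ex_intro _ k hk).
have ne : evalf (map_mpoly (ratr : rat -> algC) (F k)) (galois_pt s (val A)) != 0 by rewrite evalf_gal fmorph_eq0.
have onA : onc E1 (galois_pt s (val A)) by rewrite -val_gal; exact: (valP (galp s A)).
have [c' ec'] := hF _ onA (ex_intro _ k ne).
have c0 : s c != 0 by rewrite fmorph_eq0; apply: contraNneq hk => z; rewrite ec z mul0r.
have c'0 : c' != 0 by apply: contraNneq ne => z; rewrite ec' z mul0r.
have e m : c' * tnth (coords (phi (galois_pt s (val A)))) m = s c * s (tnth (coords (phi (val A))) m).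
  by rewrite -ec' evalf_gal ec rmorphM.
rewrite coords_gal; apply: (mulfI (mulf_neq0 c'0 c0)).
rewrite -[val (mor A)]/(phi (val A)) mulrACA -!e.
have -> (x y : algC) : c' * s c * (x * s y) = c' * x * (s c * s y) by ring.
by rewrite -!e; ring.
Qed.

Lemma mor_local A : exists d (G : 'I_3 -> {mpoly algC[3]}), [/\ forall i, G i \is d.-homog,
  exists i, evalf (G i) (val A) != 0 & forall X, (exists i, evalf (G i) (val X) != 0) ->
  exists2 c, c != 0 & forall i, evalf (G i) (val X) = c * crd (val (mor X)) i].
Proof.
have [_ /(_ (val A))] := hphi; rewrite geom_ratcurve => /(_ (valP A)) [d [F [hd hk hF]]].
exists d, (fun i => map_mpoly (ratr : rat -> algC) (F i)); split=> //; first by move=> i; apply: map_form_homog.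
move=> X hX; have [c ec] := hF _ (valP X) hX; exists c => //.
by case: hX => i; apply: contraNneq => z; rewrite ec z mul0r.
Qed.

(** The forms that describe the map near O do not vanish identically, so one triple describes it at
    almost every point. *)
Lemma mor_generic : exists g : 'I_3 -> rg algC,
  ae (fun X => exists2 c, c != 0 & forall i, eva (g i) X = c * crd (val (mor X)) i).
Proof.
have [d [G [hG [k hk] hF]]] := mor_local 0.
have hg i : exists g : rg algC, form_rg E1 d (G i) g by apply: form_rg_ex.
have [g gP] := boolp.choice hg; exists g.
have gE X i : X != 0 -> evalf (G i) (val X) = eva (g i) X.
  by move=> X0; have [e _ _] := gP i; rewrite (val_xy X0) e // eq_xy.
have := eva_dich E1 (g k); case=> [gk|ge].
  by have [_ _] := gP k; rewrite gk rwt0 coef0 => e; move: hk; rewrite val0 -e eqxx.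
apply: (ae2 (@ae_nz _ E1) ge) => X X0 n; have [|c c0 ec] := hF X; first by exists k; rewrite gE.
by exists c => // i; rewrite -gE.
Qed.

Lemma mor_RM : RM mor.
Proof.
have [g hg] := mor_generic.
case: (eva_dich E1 (g i2)) => hd.
  left; apply: (ae1 hg) => X [c c0 e]; apply: val_None; have := e i2; rewrite hd /eva /ev /= !horner0 mul0r addr0 /crd.
  case: (phi (val X)) => [[x y]|] //; case: (crd_aff x y) => _ _ -> /eqP; rewrite mulr1 eq_sym => c1; by move: c0; rewrite c1.
have hc : ae (fun X => [/\ mor X != 0, xc (mor X) = eva (g i0) X / eva (g i2) X & yc (mor X) = eva (g i1) X / eva (g i2) X]).
  apply: (ae2 hg hd) => X [c c0 e]; rewrite !e mulf_eq0 negb_or c0 andTb => n2.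
  have m0 : mor X != 0 by apply: contraNneq n2 => ->; rewrite /crd; case: (crd_inf algC) => _ _ ->.
  move: n2; rewrite (val_xy m0) /crd; case: (crd_aff (xc (mor X)) (yc (mor X))) => -> -> -> _.
  by rewrite !mulr1 !(mulrC c) !mulfK.
right; split; first by apply: (ae1 hc) => X [].
  by exists (g i0), (g i2); apply: (ae2 hc hd) => X [_ e _].
by exists (g i1), (g i2); apply: (ae2 hc hd) => X [_ _ e].
Qed.

(** The 2 by 2 minors of the local forms against C vanish almost everywhere, hence everywhere on the
    curve by [form_affine]. *)
Lemma mor_const (C : ept E2) : ae (fun X => mor X = C) -> forall A, mor A = C.
Proof.
move=> hC A; have [d [G [hG [k hk] hF]]] := mor_local A.
have hz i j (X : point algC) : onc E1 X -> evalf (crd (val C) j *: G i - crd (val C) i *: G j) X = 0.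
  have hH : (crd (val C) j *: G i - crd (val C) i *: G j) \is d.-homog.
    by rewrite -scaleNr; apply: dhomogD; apply: dhomogZ.
  move: X; apply: (form_affine hH) => x y e.
  have [g [gE _ _]] := form_rg_ex E1 hH.
  rewrite gE //; suff -> : g = (0, 0) by rewrite /ev /= !horner0 mul0r addr0.
  apply: (@eva_ae0 _ E1); apply: (ae2 hC (@ae_nz _ E1)) => X eX X0.
  rewrite /eva -gE ?eq_xy // -val_xy // evfD evfN !evfZ.
  case: (boolp.pselect (exists i, evalf (G i) (val X) != 0)) => [h|h].
    by have [c c0 ec] := hF X h; rewrite !ec eX; ring.
  have z m : evalf (G m) (val X) = 0 by apply/eqP; apply/negPn/negP => hm; apply: h; exists m.
  by rewrite !z !mulr0 subrr.
have [c c0 ec] := hF A (ex_intro _ k hk).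
apply: val_inj; apply: crd_inj => i j; have := hz i j _ (valP A).
rewrite evfD evfN !evfZ !ec => /eqP; rewrite subr_eq0 => /eqP e; apply: (mulfI c0).
by rewrite mulrA [RHS]mulrA -[LHS]mulrC e mulrC.
Qed.

(** By [RM_translation] the difference is generically a constant g D; additivity and equivariance
    follow by comparing it at a common generic point. *)
Lemma mor_hom : exists g, galois_hom g /\ forall D, ae (fun X => mor (X + D) - mor X = g D).
Proof.
have [g hg] := boolp.choice (fun D => RM_translation D mor_RM).
have uniq (P : ept E1 -> ept E2) C C' : ae (fun X => P X = C) -> ae (fun X => P X = C') -> C = C'.
  by move=> a b; have [X [<- <-]] := ae_ex (ae2 a b (fun X u v => conj u v)).
exists g; split; last exact: hg.
split=> [A B|s A].
  apply: (uniq (fun X => mor (X + (A + B)) - mor X)); first exact: hg.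
  apply: (ae2 (hg A) (ae_shift A (hg B))) => X <- <-.
  by rewrite addrA [RHS]addrC addrA subrK.
apply: (uniq (fun X => mor (galp s X + galp s A) - mor (galp s X))); first exact: (ae_gal s (hg (galp s A))).
by apply: (ae1 (hg A)) => X <-; rewrite -galpD !mor_gal galpD galpN.
Qed.

Variable l : nat.
Hypotheses (l1 : (1 < l)%N) (divl : forall A, exists B, B *+ l = A) (torl : exists T : ept E1, T != 0 /\ T *+ l = 0) (noh : no_hom l).

(** The next quotient takes its value at a chosen l-th part of the argument; two choices differ by
    l-torsion, which is killed. *)
Lemma hom_factor g k : galois_hom g -> exists g', galois_hom g' /\ forall D, g D = g' (D *+ l ^ k).
Proof.
move=> hg; elim: k => [|k [g' [hg' e]]]; first by exists g; split.
have [r hr] := boolp.choice divl.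
have ker A B : A *+ l = B *+ l -> g' A = g' B.
  move=> eAB; have := noh hg' (A := A - B); rewrite mulrnBl eAB subrr => /(_ erefl).
  case: hg' => hD _; move=> z; by rewrite -[A](subrK B) hD z add0r.
exists (fun D => g' (r D)); split; last by move=> D; rewrite e expnSr mulrnA; apply: ker; rewrite hr.
have [hD hs] := hg'; split=> [A B|s A].
  by rewrite -hD; apply: ker; rewrite mulrnDl !hr.
by rewrite -hs; apply: ker; rewrite hr -galpMn hr.
Qed.

(** The multiples of P by l^n, for n < k, are distinct and killed by h, so the map takes one value
    at k = 4 m + 9 translates of X. The minors that test this value have at most 4 m + 8 zeros
    unless they vanish. *)
Lemma mor_constant : exists C, ae (fun X => mor X = C).
Proof.
have [h [hh hX]] := mor_hom; have [g hg] := mor_generic.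
pose m := (size (g i0).1 + size (g i0).2 + size (g i1).1 + size (g i1).2 + size (g i2).1 + size (g i2).2)%N.
have hm i : (size (g i).1 <= m)%N /\ (size (g i).2 <= m)%N.
  by move: i; apply: I3P; rewrite /m; move: (size _) (size (g i0).2) (size (g i1).1) (size (g i1).2) (size (g i2).1) (size (g i2).2); clear; lia.
pose k := (4 * m + 9)%N.
have [T [T0 Tl]] := torl.
have [P eP] : exists P, P *+ l ^ k = T.
  elim: (k) => [|n [P eP]]; first by exists T.
  by have [Q eQ] := divl P; exists Q; rewrite expnS mulrnA eQ.
have hk n : (n <= k)%N -> h (P *+ l ^ n) = 0.
  move=> hn; have [g' [[hD _] e]] := hom_factor (k.+1 - n) hh.
  have g0 : g' 0 = 0 by apply: (@addrI _ (g' 0)); rewrite -hD !addr0.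
  by rewrite e -mulrnA -expnD subnKC ?(leqW hn) // expnSr mulrnA eP Tl g0.
have inj i j : (i < j)%N -> (j <= k)%N -> P *+ l ^ i <> P *+ l ^ j.
  move=> hij hj /(congr1 (fun Q => Q *+ l ^ (k - i))); rewrite -!mulrnA -!expnD subnKC; last by apply: leq_trans hj; apply: ltnW.
  rewrite eP => e; case/eqP: T0; rewrite e (_ : (j + (k - i) = k + (j - i).-1.+1)%N); last by clear -hij hj; lia.
  by rewrite expnD mulrnA eP expnS mulrnA Tl mul0rn.
have good : ae (fun X => forall n, n \in iota 0 k -> [/\ X + P *+ l ^ n != 0, mor (X + P *+ l ^ n) = mor X &
    exists2 c, c != 0 & forall i, eva (g i) (X + P *+ l ^ n) = c * crd (val (mor (X + P *+ l ^ n))) i]).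
  apply: ae_all => n; rewrite mem_iota add0n => /andP[_ /ltnW hn].
  apply: (ae3 (hX (P *+ l ^ n)) (ae_shift (P *+ l ^ n) (@ae_nz _ E1)) (ae_shift (P *+ l ^ n) hg)) => X e1 e2 e3.
  by split=> //; apply/eqP; rewrite -subr_eq0 e1 hk.
have [X hX0] := ae_ex good; exists (mor X).
pose G i j := radd (rsc (crd (val (mor X)) j) (g i)) (rsc (- crd (val (mor X)) i) (g j)).
have GE i j Y : eva (G i j) Y = crd (val (mor X)) j * eva (g i) Y - crd (val (mor X)) i * eva (g j) Y.
  by rewrite /eva /G evD !evsc mulNr.
have G0 i j : G i j = (0, 0).
  apply/eqP; apply/negPn/negP => n0.
  have sz (f1 f2 : {poly algC}) (c1 c2 : algC) : (size f1 <= m)%N -> (size f2 <= m)%N -> (size (c1 *: f1 + c2 *: f2)%R <= m)%N.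
    move=> s1 s2; apply: leq_trans (size_polyD _ _) _; rewrite geq_max; apply/andP; split.
      by apply: leq_trans (size_scale_leq _ _) s1.
    by apply: leq_trans (size_scale_leq _ _) s2.
  have [m1 m2] := hm i; have [m3 m4] := hm j.
  have [L [sL hL]] := zeros_bound E1 (m := m) n0 (sz _ _ _ _ m1 m3) (sz _ _ _ _ m2 m4).
  have : (size (map (fun n => (X + P *+ (l ^ n)%N)%R) (iota 0 k)) <= size L)%N.
    apply: uniq_leq_size; last first.
      move=> _ /mapP[n hn ->]; have [e1 e2 [c c0 e3]] := hX0 n hn; apply: hL => //.
      by rewrite GE !e3 e2; ring.
    rewrite map_inj_in_uniq ?iota_uniq // => u v; rewrite !mem_iota !add0n /= => hu hv /addrI e.
    case: (ltngtP u v) => // huv; [case: (inj u v huv (ltnW hv) e)|case: (inj v u huv (ltnW hu) (esym e))].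
  by rewrite size_map size_iota leqNgt /k => /negP; apply; apply: leq_ltn_trans sL _; clear; lia.
apply: (ae1 hg) => Y [c c0 e]; apply: val_inj; apply: crd_inj => i j; apply: (mulfI c0).
rewrite !mulrA -!e; apply/eqP; rewrite -subr_eq0; have := GE i j Y; rewrite G0.
have z : @eva _ E1 (0, 0) Y = 0 by rewrite /eva /ev /= !horner0 mul0r addr0.
by rewrite z ![crd _ _ * _]mulrC => <-.
Qed.

End NoIsogeny.

Theorem not_isogenous a1 b1 a2 b2 (h1 : 4%:R * a1 ^+ 3 + 27%:R * b1 ^+ 2 != 0) (h2 : 4%:R * a2 ^+ 3 + 27%:R * b2 ^+ 2 != 0) l :
  (1 < l)%N -> (forall A : ept (ratecurve h1), exists B, B *+ l = A) ->
  (exists T : ept (ratecurve h1), T != 0 /\ T *+ l = 0) -> no_hom h1 h2 l -> ~ isogenous (ratcurve h1) (ratcurve h2).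
Proof.
move=> l1 dl tl noh [phi [hphi phi0 [P oP nP]]].
have [C hC] := mor_constant hphi dl tl noh.
have hc := mor_const hC; rewrite geom_ratcurve in oP.
have := hc (exist _ P oP); rewrite -(hc 0) => /(congr1 val) /=.
by rewrite phi0.
Qed.

End Isogenies.

(** * Conjugates, and Galois and complex conjugation on E[3] *)

Module GaloisAction.
Import CurveRing PointIdeals CocycleLaw CurveGroup Reciprocity TorsionStructure Transport AlmostEverywhere Isogenies.

Local Notation pQtoC := (map_poly (ratr : rat -> algC)).

(** The map x -> y is extended first to the splitting field of the minimal polynomial, then to
    algC. *)
Lemma minCpoly_conj (x y : algC) : root (minCpoly x) y -> exists s : {rmorphism algC -> algC}, s x = y.
Proof.
move=> ry; have [q [eq mq] minq] := minCpolyP x.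
have [rs ers] := closed_field_poly_normal (minCpoly x).
rewrite (monicP (minCpoly_monic x)) scale1r in ers.
have inrs z : root (minCpoly x) z -> z \in rs by rewrite ers root_prod_XsubC.
have [Qr [QrC [rr err genQr]]] := num_field_exists rs.
have lift z : root (minCpoly x) z -> exists z1, QrC z1 = z.
  by move=> /inrs; rewrite -err => /mapP[z1 _ ->]; exists z1.
have [x1 ex] := lift _ (root_minCpoly x); have [y1 ey] := lift _ ry.
pose phi := kHomExtend 1 \1 x1 y1.
have hom1 : kHom 1 1 (\1%VF : 'End(Qr)) by rewrite kHom1.
have rt : root (map_poly \1%VF (minPoly 1 x1)) y1.
  rewrite -(fmorph_root QrC) ey -map_poly_comp.
  rewrite (@eq_map_poly _ _ _ QrC) => [|u]; last by rewrite /= id_lfunE.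
  set p1 := map_poly _ _.
  have [q1 Dp1] : exists q1, p1 = pQtoC q1.
    have aP i : (minPoly 1 x1)`_i \in 1%VS by apply/polyOverP; apply: minPolyOver.
    have{aP} a_ i := sig_eqW (vlineP _ _ (aP i)).
    exists (\poly_(i < size (minPoly 1 x1)) sval (a_ i)).
    apply/polyP=> i; rewrite coef_poly coef_map coef_poly /=.
    case: ifP => _; rewrite ?rmorph0 //; case: (a_ i) => u /= ->.
    by rewrite alg_num_field fmorph_rat.
  have : root p1 x by rewrite -ex fmorph_root root_minPoly.
  rewrite Dp1 minq => /dvdpP[r1 ->]; rewrite rmorphM rootM /= -eq.
  by rewrite ry orbT.
have hphi : kHom 1 <<1; x1>> phi by apply: kHomExtendP => //; rewrite ?subv_refl.
pose pr := map_poly (in_alg Qr) q.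
have Qpr : pr \is a polyOver 1%VS.
  by apply/polyOverP=> i; rewrite coef_map memvZ ?memv_line.
have Sinj (p : {poly rat}) : map_poly QrC (map_poly (in_alg Qr) p) = pQtoC p.
  rewrite -map_poly_comp; apply: eq_map_poly => u /=; by rewrite alg_num_field fmorph_rat.
have spl : splittingFieldFor 1 pr fullv.
  exists rr => //; congr (_ %= _): (eqpxx pr); apply/(map_poly_inj QrC).
  rewrite Sinj -eq ers -err big_map rmorph_prod /=; apply: eq_bigr => zz _.
  by rewrite map_polyXsubC.
have spl2 : splittingFieldFor <<1; x1>>%AS pr fullv.
  by apply: splittingFieldForS spl; rewrite ?sub1v ?subvf.
have [f1 aut_f1 Df1] := kHom_extends (sub1v <<1; x1>>%AS) hphi Qpr spl2.
have f1m : monoid_morphism f1 by apply/kHom_monoid_morphism.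
pose f1mM := GRing.isMonoidMorphism.Build _ _ f1 f1m.
pose nu0 : {rmorphism _ -> _} := HB.pack (fun_of_lfun f1) f1mM.
have [nu Dnu] := extend_algC_subfield_aut QrC nu0.
exists nu; rewrite -ex -Dnu /= -Df1 ?memv_adjoin // -ey.
congr (QrC _); rewrite -{1}[x1]hornerX /phi (kHomExtend_poly hom1) ?polyOverX //.
rewrite map_polyE map_id_in => [|?]; last by rewrite id_lfunE.
by rewrite polyseqK hornerX.
Qed.

Lemma prod_XsubC_const (R : comNzRingType) (rs : seq R) x : (forall z, z \in rs -> z = x) -> \prod_(z <- rs) ('X - z%:P) = ('X - x%:P) ^+ size rs.
Proof.
elim: rs => [|z r IH] h; first by rewrite big_nil expr0.
rewrite big_cons exprS (h z) ?inE ?eqxx //; congr (_ * _); apply: IH => w hw; apply: h.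
by rewrite inE hw orbT.
Qed.

(** All roots of the minimal polynomial equal x by [minCpoly_conj]; it has only one, as otherwise
    its derivative would vanish at x in lower degree. *)
Lemma galois_fixed_rat (x : algC) : (forall s : {rmorphism algC -> algC}, s x = x) -> exists q : rat, x = ratr q.
Proof.
move=> fx; have [q [eq mq] minq] := minCpolyP x.
have [rs ers] := closed_field_poly_normal (minCpoly x).
rewrite (monicP (minCpoly_monic x)) scale1r in ers.
have al z : z \in rs -> z = x.
  rewrite -root_prod_XsubC -ers => /minCpoly_conj[s <-]; by rewrite fx.
have ep : minCpoly x = ('X - x%:P) ^+ size rs.
  by rewrite ers; apply: prod_XsubC_const.
suff s1 : size rs = 1%N.
  move: ep; rewrite s1 expr1 eq => /(congr1 (fun p : {poly algC} => p`_0)); rewrite coef_map coefB coefX coefC /= sub0r.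
  by move=> e; exists (- q`_0); rewrite rmorphN /= -[LHS]opprK -e.
have : (1 < size (minCpoly x))%N := size_minCpoly x.
rewrite {1}ep size_exp_XsubC ltnS; case es: (size rs) => [|[|n]] // _; exfalso.
have dr : root (pQtoC q^`()) x.
  by rewrite -deriv_map -eq ep es exprSr derivM derivXsubC mulr1 rootE hornerD hornerM exprS !hornerM hornerXsubC subrr !(mulr0, mul0r) addr0.
have q'0 : q^`() != 0.
  apply/eqP => z; have := congr1 (fun p : {poly rat} => p`_(size q).-2) z; rewrite coef_deriv coef0.
  have sq : size q = n.+3 by rewrite -(size_map_poly (ratr : {rmorphism rat -> algC})) -eq ep es size_exp_XsubC.
  rewrite sq /=; have := monicP mq; rewrite lead_coefE sq /= => -> /eqP; by rewrite pnatr_eq0.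
by move: dr; rewrite minq => /(dvdp_leq q'0); rewrite leqNgt lt_size_deriv // monic_neq0.
Qed.

Lemma sqrt_conj (r : algC) (d : rat) : r ^+ 2 = ratr d -> (forall q : rat, r <> ratr q) ->
  exists s : {rmorphism algC -> algC}, s r = - r.
Proof.
move=> er nr; case: (boolp.pselect (exists s : {rmorphism algC -> algC}, s r = - r)) => // no; exfalso.
have [q /nr //] : exists q : rat, r = ratr q.
apply: galois_fixed_rat => s; have : s r ^+ 2 = r ^+ 2 by rewrite -rmorphXn er fmorph_rat.
by move/eqP; rewrite eqf_sqr => /orP[/eqP // | /eqP e]; case: no; exists s.
Qed.

Section Vieta.
Variable K : numClosedFieldType.

(** The gap is a cubic polynomial in z; its coefficients are combinations of its values at 0, 1, 2
    and -1. *)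
Definition quartic_gap (x1 x2 x3 x4 a b z : K) :=
  3%:R * z ^+ 4 + 6%:R * a * z ^+ 2 + 12%:R * b * z - a ^+ 2 - 3%:R * ((z - x1) * (z - x2) * (z - x3) * (z - x4)).

Lemma quartic_coefs (x1 x2 x3 x4 a b : K) :
  (forall z, 3%:R * z ^+ 4 + 6%:R * a * z ^+ 2 + 12%:R * b * z - a ^+ 2 = 3%:R * ((z - x1) * (z - x2) * (z - x3) * (z - x4))) ->
  [/\ x1 + x2 + x3 + x4 = 0, x1 * x2 + x1 * x3 + x1 * x4 + x2 * x3 + x2 * x4 + x3 * x4 = 2%:R * a,
      x1 * x2 * x3 + x1 * x2 * x4 + x1 * x3 * x4 + x2 * x3 * x4 = - 4%:R * b & 3%:R * (x1 * x2 * x3 * x4) = - a ^+ 2].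
Proof.
move=> h; have D0 z : quartic_gap x1 x2 x3 x4 a b z = 0 by rewrite /quartic_gap h subrr.
have n18 : (18%:R : K) != 0 by rewrite pnatr_eq0.
have n6 : (6%:R : K) != 0 by rewrite pnatr_eq0.
have z0 := D0 0; have z1 := D0 1; have z2 := D0 2%:R; have zm := D0 (-1).
have r1 : 18%:R * (x1 + x2 + x3 + x4) = quartic_gap x1 x2 x3 x4 a b 2%:R - 3%:R * quartic_gap x1 x2 x3 x4 a b 1
   - quartic_gap x1 x2 x3 x4 a b (-1) + 3%:R * quartic_gap x1 x2 x3 x4 a b 0 by rewrite /quartic_gap; ring.
have r2 : 6%:R * (x1 * x2 + x1 * x3 + x1 * x4 + x2 * x3 + x2 * x4 + x3 * x4 - 2%:R * a) =
   2%:R * quartic_gap x1 x2 x3 x4 a b 0 - quartic_gap x1 x2 x3 x4 a b 1 - quartic_gap x1 x2 x3 x4 a b (-1) by rewrite /quartic_gap; ring.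
have r3 : 18%:R * (x1 * x2 * x3 + x1 * x2 * x4 + x1 * x3 * x4 + x2 * x3 * x4 + 4%:R * b) =
   6%:R * quartic_gap x1 x2 x3 x4 a b 1 - 2%:R * quartic_gap x1 x2 x3 x4 a b (-1) - quartic_gap x1 x2 x3 x4 a b 2%:R
   - 3%:R * quartic_gap x1 x2 x3 x4 a b 0 by rewrite /quartic_gap; ring.
have r4 : 3%:R * (x1 * x2 * x3 * x4) + a ^+ 2 = - quartic_gap x1 x2 x3 x4 a b 0 by rewrite /quartic_gap; ring.
rewrite z0 z1 z2 zm in r1 r2 r3 r4; rewrite ?(mulr0, subr0, addr0, oppr0) in r1 r2 r3 r4.
split.
- by apply: (mulfI n18); rewrite r1 mulr0.
- by apply/eqP; rewrite -subr_eq0; apply/eqP; apply: (mulfI n6); rewrite r2 mulr0.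
- by apply/eqP; rewrite mulNr -addr_eq0; apply/eqP; apply: (mulfI n18); rewrite r3 mulr0.
- by apply/eqP; rewrite -addr_eq0; apply/eqP.
Qed.

(* The resolvent cubic of the 3-division polynomial. *)
Lemma resolvent3 (x1 x2 x3 x4 a b : K) :
  x1 + x2 + x3 + x4 = 0 -> x1 * x2 + x1 * x3 + x1 * x4 + x2 * x3 + x2 * x4 + x3 * x4 = 2%:R * a ->
  x1 * x2 * x3 + x1 * x2 * x4 + x1 * x3 * x4 + x2 * x3 * x4 = - 4%:R * b -> 3%:R * (x1 * x2 * x3 * x4) = - a ^+ 2 ->
  27%:R * (x1 * x2 + x3 * x4 - 2%:R / 3%:R * a) ^+ 3 = 16%:R * (4%:R * a ^+ 3 + 27%:R * b ^+ 2).
Proof.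
move=> e1 e2 e3 e4; set y := x1 * x2 + x3 * x4.
have res : y ^+ 3 - (2%:R * a) * y ^+ 2 - 4%:R * (x1 * x2 * x3 * x4) * y - ((- 4%:R * b) ^+ 2 - 4%:R * (2%:R * a) * (x1 * x2 * x3 * x4)) = 0.
  rewrite -e2 -e3; have -> : x4 = - (x1 + x2 + x3) by apply/eqP; rewrite -addr_eq0 addrC e1.
  by rewrite /y; have -> : x4 = - (x1 + x2 + x3) by [apply/eqP; rewrite -addr_eq0 addrC e1]; ring.
have e4' : x1 * x2 * x3 * x4 = - a ^+ 2 / 3%:R by rewrite -e4; field.
rewrite e4' in res; apply/eqP; rewrite -subr_eq0; apply/eqP.
by rewrite -[RHS](mulr0 27%:R) -res; field.
Qed.

Variable E : ecurve K.
Implicit Types T P : ept E.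

Lemma xc_eq P T : P != 0 -> T != 0 -> xc P = xc T -> P = T \/ P = - T.
Proof. by move=> /val_xy eP /val_xy eT e; rewrite e in eP; exact: same_x eP eT. Qed.

Variables T1 T2 : ept E.
Hypotheses (t1 : T1 *+ 3 = 0) (t2 : T2 *+ 3 = 0) (n1 : T1 != 0) (n2 : T2 != 0) (n3 : T1 != T2) (n4 : T1 != - T2).

Lemma psi3_basis z : (psi3 E).[z] = 3%:R * ((z - xc T1) * (z - xc T2) * (z - xc (T1 + T2)) * (z - xc (T1 - T2))).
Proof.
have ind := indep3 t1 t2 n1 n2 n3 n4.
have nz r : ~~ ((3 %| r.1) && (3 %| r.2))%N -> lc T1 T2 r != 0 by apply: contra => /eqP /ind.
have ne r s : ~~ ((3 %| r.1) && (3 %| r.2))%N -> ~~ ((3 %| s.1) && (3 %| s.2))%N ->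
    ~~ ((3 %| r.1 + 2 * s.1) && (3 %| r.2 + 2 * s.2))%N -> ~~ ((3 %| r.1 + s.1) && (3 %| r.2 + s.2))%N ->
    xc (lc T1 T2 r) != xc (lc T1 T2 s).
  move=> a b c d; apply/eqP => /(xc_eq (nz _ a) (nz _ b)) [] e; [case/negP: c | case/negP: d]; apply: ind.
    have := @lcN _ E 3 T1 T2 isT t1 t2 s => /= n6.
    by rewrite -[LHS](lcD T1 T2 r (2 * s.1, 2 * s.2)%N) -n6 e subrr.
  by rewrite -[LHS](lcD T1 T2 r s) e addNr.
have e1 : T1 = lc T1 T2 (1, 0)%N by rewrite /lc /= mulr1n mulr0n addr0.
have e2 : T2 = lc T1 T2 (0, 1)%N by rewrite /lc /= mulr1n mulr0n add0r.
have e3 : T1 + T2 = lc T1 T2 (1, 1)%N by rewrite /lc.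
have e4 : T1 - T2 = lc T1 T2 (1, 2)%N.
  by rewrite /lc /= mulr1n; congr (_ + _); apply/eqP; rewrite eq_sym -addr_eq0 -mulrSr t2.
have rt r : ~~ ((3 %| r.1) && (3 %| r.2))%N -> root (psi3 E) (xc (lc T1 T2 r)).
  by move=> /nz /val_xy e; rewrite rootE -(tor3E e) /lc mulrnDl -!mulrnA mulnC mulrnA t1 mulnC mulrnA t2 !mul0rn addr0.
have [sp cp] := top_psi3 E.
have sz : size (psi3 E) = 5%N.
  by apply/eqP; rewrite eqn_leq sp ltnNge; apply/negP => h; move/eqP: cp; rewrite nth_default // eq_sym pnatr_eq0.
have es : [:: xc T1; xc T2; xc (T1 + T2); xc (T1 - T2)] = [seq xc (lc T1 T2 r) | r <- [:: (1, 0); (0, 1); (1, 1); (1, 2)]%N].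
  by rewrite /= -e1 -e2 -e3 -e4.
have := @all_roots_prod_XsubC _ (psi3 E) [:: xc T1; xc T2; xc (T1 + T2); xc (T1 - T2)].
rewrite lead_coefE sz cp => /(_ erefl) ->.
- by rewrite hornerZ !big_cons big_nil mulr1 !hornerM !hornerXsubC !mulrA.
- by rewrite es /= !rt.
by rewrite uniq_rootsE es /= !inE !negb_or !ne.
Qed.

Lemma vieta3 : let x1 := xc T1 in let x2 := xc T2 in let x3 := xc (T1 + T2) in let x4 := xc (T1 - T2) in
  [/\ x1 + x2 + x3 + x4 = 0, x1 * x2 + x1 * x3 + x1 * x4 + x2 * x3 + x2 * x4 + x3 * x4 = 2%:R * ea E,
      x1 * x2 * x3 + x1 * x2 * x4 + x1 * x3 * x4 + x2 * x3 * x4 = - 4%:R * eb E & 3%:R * (x1 * x2 * x3 * x4) = - ea E ^+ 2].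
Proof. by apply: quartic_coefs => z; rewrite -psi3_basis psi3E'. Qed.

End Vieta.

Lemma tor23 (V : zmodType) (A : V) : A *+ 3 = 0 -> A + A = 0 -> A = 0.
Proof. by rewrite mulrS mulr2n => + e; rewrite e addr0. Qed.

Definition conjA : {rmorphism algC -> algC} := Num.conj.

Section RealCurve.
Variables (a b : rat) (h : 4%:R * a ^+ 3 + 27%:R * b ^+ 2 != 0).
Local Notation E := (ratecurve h).
Local Notation cj := (@galp _ _ h conjA).
Implicit Types T P : ept E.

Lemma xc_gal s P : xc (galp s P) = s (xc P).
Proof. by rewrite /xc val_gal; case: (val P) => [[]|] //=; rewrite rmorph0. Qed.
Lemma yc_gal s P : yc (galp s P) = s (yc P).
Proof. by rewrite /yc val_gal; case: (val P) => [[]|] //=; rewrite rmorph0. Qed.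
Lemma galp_conjK P : cj (cj P) = P.
Proof. by apply: val_inj; rewrite !val_gal; case: (val P) => [[x y]|] //=; rewrite !conjCK. Qed.

Lemma xy_tor3 P : P *+ 3 = 0 -> P != 0 -> 12%:R * xc P * yc P ^+ 2 = (3%:R * xc P ^+ 2 + ea E) ^+ 2.
Proof.
move=> t P0; have eP := val_xy P0; have := tor3E eP; rewrite t eqxx => /esym /eqP.
by rewrite psi3E -eq_xy // => /eqP; rewrite subr_eq0 => /eqP.
Qed.

(* If conjugation acted on E[3] by a sign, all abscissas of 3-torsion points would be real of the same sign, but their sum is 0. *)
Lemma conj_not_sign : ~ (forall P, P *+ 3 = 0 -> cj P = P) /\ ~ (forall P, P *+ 3 = 0 -> cj P = - P).
Proof.
have [T1 [T2 [t1 t2 [n1 n2 n3 n4]]]] := ex_basis3 E.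
have [v1 _ _ _] := vieta3 t1 t2 n1 n2 n3 n4.
have n5 : T1 + T2 != 0 by rewrite addr_eq0.
have n6 : T1 - T2 != 0 by rewrite subr_eq0.
have t5 : (T1 + T2) *+ 3 = 0 by rewrite mulrnDl t1 t2 addr0.
have t6 : (T1 - T2) *+ 3 = 0 by rewrite mulrnBl t1 t2 subr0.
have ne : xc T1 != xc T2 by apply/eqP => /(xc_eq n1 n2) [/eqP|/eqP]; rewrite ?(negPf n3) ?(negPf n4).
have y0 P : P *+ 3 = 0 -> P != 0 -> yc P != 0.
  move=> t P0; apply/eqP => z; have eP := val_xy P0; rewrite z in eP.
  by move: P0; rewrite (tor23 t (two_tor eP)) eqxx.
have key P Y : P *+ 3 = 0 -> conjA (xc P) = xc P -> 0 < Y -> 0 <= 12%:R * xc P * Y -> 0 <= xc P.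
  by move=> _ _ y2; rewrite pmulr_lge0 // pmulr_rge0 ?ltr0n.
have sq0 P : xc P \is Num.real -> 0 <= (3%:R * xc P ^+ 2 + ea E) ^+ 2.
  move=> rx; apply: real_exprn_even_ge0 => //; apply: realD; last by apply: Creal_Crat; exact: Crat_rat.
  by apply: realM; [exact: realn | exact: realX].
have zero P (f : ept E -> algC) : f T1 + f T2 + f (T1 + T2) + f (T1 - T2) = 0 -> (forall P, P *+ 3 = 0 -> P != 0 -> 0 <= f P) -> f T1 = 0 /\ f T2 = 0.
  move=> v pos; have p1 := pos _ t1 n1; have p2 := pos _ t2 n2; have p5 := pos _ t5 n5; have p6 := pos _ t6 n6.
  by move: v => /eqP; rewrite !paddr_eq0 ?addr_ge0 // => /andP[/andP[/andP[/eqP z1 /eqP z2] _] _].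
split=> hs.
- have [|P t P0|z1 z2] := zero T1 (@xc _ E); first exact: v1.
    have ex : conjA (xc P) = xc P by rewrite -xc_gal hs.
    have ey : conjA (yc P) = yc P by rewrite -yc_gal hs.
    have rx : xc P \is Num.real by apply/CrealP.
    have ry : yc P \is Num.real by apply/CrealP.
    have y2 : 0 < yc P ^+ 2 by rewrite lt_def sqrf_eq0 y0 // real_exprn_even_ge0.
    by apply: (key P _ t ex y2); rewrite xy_tor3 // sq0.
  by rewrite z1 z2 eqxx in ne.
have [|P t P0|z1 z2] := zero T1 (fun P => - xc P).
- by rewrite -!opprD v1 oppr0.
- have ex : conjA (xc P) = xc P by rewrite -xc_gal hs // xcN.
  have ey : conjA (yc P) = - yc P by rewrite -yc_gal hs // ycN.
  have rx : xc P \is Num.real by apply/CrealP.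
  have ry : 'i * yc P \is Num.real by apply/CrealP; rewrite rmorphM /= conjCi [_^*](ey : _ = - yc P) mulrNN.
  have y2 : 0 < ('i * yc P) ^+ 2 by rewrite lt_def sqrf_eq0 mulf_neq0 ?neq0Ci ?y0 // real_exprn_even_ge0.
  rewrite -(pmulr_lge0 _ y2) -(pmulr_rge0 _ (_ : 0 < 12%:R)) ?ltr0n //.
  have -> : 12%:R * (- xc P * ('i * yc P) ^+ 2) = 12%:R * xc P * yc P ^+ 2 by rewrite exprMn sqrCi; ring.
  by rewrite xy_tor3 // sq0.
by move/oppr_inj: (etrans z1 (esym z2)) => z; rewrite z eqxx in ne.
Qed.

(** P + conj P and Q - conj Q are eigenvectors; [conj_not_sign] provides P and Q for which they are
    nonzero. *)
Lemma conj_basis3 : exists T1 T2, [/\ T1 *+ 3 = 0, T2 *+ 3 = 0, cj T1 = T1, cj T2 = - T2 & [/\ T1 != 0, T2 != 0, T1 != T2 & T1 != - T2]].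
Proof.
have [nf ns] := conj_not_sign.
have [P [tP nP]] : exists P, P *+ 3 = 0 /\ P + cj P != 0.
  case: (boolp.pselect (exists P, P *+ 3 = 0 /\ P + cj P != 0)) => // no; case: ns => P tP.
  by apply/eqP; rewrite -addr_eq0 addrC; apply/negPn/negP => k; apply: no; exists P.
have [Q [tQ nQ]] : exists Q, Q *+ 3 = 0 /\ Q - cj Q != 0.
  case: (boolp.pselect (exists P, P *+ 3 = 0 /\ P - cj P != 0)) => // no; case: nf => Q tQ.
  by apply/eqP; rewrite eq_sym -subr_eq0; apply/negPn/negP => k; apply: no; exists Q.
have tc A : A *+ 3 = 0 -> cj A *+ 3 = 0 by move=> t; rewrite -galpMn t /galp tr0.
have c1 : cj (P + cj P) = P + cj P by rewrite galpD galp_conjK addrC.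
have c2 : cj (Q - cj Q) = - (Q - cj Q) by rewrite galpD galpN galp_conjK opprB addrC.
have s1 : (P + cj P) *+ 3 = 0 by rewrite mulrnDl tP tc // addr0.
have s2 : (Q - cj Q) *+ 3 = 0 by rewrite mulrnBl tQ tc // subr0.
have neN A B : A *+ 3 = 0 -> A != 0 -> cj A = A -> cj B = - B -> A != B.
  move=> tA A0 cA cB; apply/eqP => e; rewrite -e cA in cB.
  by move: A0; rewrite (tor23 tA) ?eqxx // {1}cB addNr.
exists (P + cj P), (Q - cj Q); split=> //; split=> //; apply: neN => //.
by rewrite galpN c2.
Qed.

End RealCurve.

End GaloisAction.

(** * No Galois homomorphism on 3-torsion between a curve and its twist *)

Module TwistThree.
Import CurveRing PointIdeals CocycleLaw CurveGroup Reciprocity TorsionStructure Transport ReverseSeven AlmostEverywhere Isogenies GaloisAction.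

Lemma lc_eq3 (K : numClosedFieldType) (E : ecurve K) (T1 T2 : ept E) r s : T1 *+ 3 = 0 -> T2 *+ 3 = 0 -> indep2 3 T1 T2 ->
  lc T1 T2 r = lc T1 T2 s -> ((3 %| r.1 + 2 * s.1) && (3 %| r.2 + 2 * s.2))%N.
Proof.
move=> t1 t2 ind e; apply: ind; have := @lcN _ E 3 T1 T2 isT t1 t2 s => /= n6.
by rewrite -[LHS](lcD T1 T2 r (2 * s.1, 2 * s.2)%N) -n6 e subrr.
Qed.

Section NoHomTwist.
Variables (a b d : rat) (r : algC).
Hypotheses (d0 : d != 0) (h : 4%:R * a ^+ 3 + 27%:R * b ^+ 2 != 0) (rd : r ^+ 2 = ratr d) (rr : conjA r = r)
  (irr : forall q : rat, r <> ratr q)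
  (ncube : forall q : rat, 27%:R * q ^+ 3 <> 16%:R * (4%:R * a ^+ 3 + 27%:R * b ^+ 2)).
Local Notation E := (ratecurve h).
Local Notation E2 := (ratecurve (disc_twist h d0)).
Local Notation cj := (@galp _ _ h conjA).

Let r0 : r != 0.
Proof. by apply/eqP => e; move: rd; rewrite e expr0n => /esym/eqP; rewrite fmorph_eq0 (negPf d0). Qed.
Let ri0 : r^-1 != 0. Proof. by rewrite invr_eq0. Qed.
Let sid : {rmorphism algC -> algC} := idfun.
Let twa : ea E = r^-1 ^+ 4 * sid (ea E2).
Proof.
have e : ratr (d ^+ 2 * a) = ratr d ^+ 2 * ratr a :> algC by rewrite rmorphM rmorphXn.
by rewrite [sid _]e -rd -exprM mulrA -exprMn mulVf // expr1n mul1r.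
Qed.
Let twb : eb E = r^-1 ^+ 6 * sid (eb E2).
Proof.
have e : ratr (d ^+ 3 * b) = ratr d ^+ 3 * ratr b :> algC by rewrite rmorphM rmorphXn.
by rewrite [sid _]e -rd -exprM mulrA -exprMn mulVf // expr1n mul1r.
Qed.
Let tw := tr twa twb.

Lemma untwist_gal (s : {rmorphism algC -> algC}) Y : (s r = r -> tw (galp s Y) = galp s (tw Y)) /\
  (s r = - r -> tw (galp s Y) = - galp s (tw Y)).
Proof.
split=> er; apply: val_inj; rewrite ?valN [in RHS]val_gal [LHS]val_tr [in RHS]val_tr val_gal /trp; case: (val Y) => [[x y]|] //=;
  congr (Some (_, _)); rewrite /sid /= !(rmorphM, rmorphXn, fmorphV) er ?invrN; ring.
Qed.

(** Untwisting g gives [chi], which commutes with the automorphisms fixing r and anticommutes with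
    the others. As r is real, [chi] is diagonal in the eigenbasis of conjugation. A scalar [chi]
    must vanish; with distinct eigenvalues Galois permutes the two eigenlines, which makes the root
    x1 x2 + x3 x4 of the resolvent cubic rational, against [ncube]. *)
Theorem no_hom_twist3 : no_hom h (disc_twist h d0) 3.
Proof.
move=> g [gD gs].
pose chi A := tw (g A).
have chiD A B : chi (A + B) = chi A + chi B by rewrite /chi gD /tw trD.
have chi0 : chi 0 = 0 by apply: (@addrI _ (chi 0)); rewrite -chiD !addr0.
have chiM A k : chi (A *+ k) = chi A *+ k by elim: k => [|k IH]; rewrite ?mulr0n // !mulrS chiD IH.
have chiN A : chi (- A) = - chi A by apply/eqP; rewrite -addr_eq0 -chiD addNr chi0.
have chis (s : {rmorphism algC -> algC}) A : (s r = r -> chi (galp s A) = galp s (chi A)) /\ (s r = - r -> chi (galp s A) = - galp s (chi A)).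
  by rewrite /chi gs; exact: untwist_gal.
have [T1 [T2 [t1 t2 c1 c2 [n1 n2 n3 n4]]]] := conj_basis3 h.
have ind := indep3 t1 t2 n1 n2 n3 n4; have sp := span3 t1 t2 n1 n2 n3 n4.
have eqlc := lc_eq3 t1 t2 ind.
have o2 (A : ept E) : A *+ 3 = 0 -> - A = A *+ 2 by move=> e; apply/eqP; rewrite eq_sym -addr_eq0 -mulrSr e.
have lcm := @lc_mod _ E 3 T1 T2 t1 t2.
have [be eb] : exists be, chi T1 = T1 *+ be.
  have tc : chi T1 *+ 3 = 0 by rewrite -chiM t1 chi0.
  have [[i j] e] := sp _ tc; exists i.
  have : cj (chi T1) = chi T1 by rewrite -(proj1 (chis _ _) rr) c1.
  rewrite e /lc galpD !galpMn c1 c2 o2 // -mulrnA => /(eqlc (i, 2 * j)%N (i, j)) /andP[_ /= dv].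
  have /dvdnP[j' ->] : (3 %| j)%N by clear -dv; lia.
  by rewrite mulnC mulrnA t2 mul0rn addr0.
have [ga eg] : exists ga, chi T2 = T2 *+ ga.
  have tc : chi T2 *+ 3 = 0 by rewrite -chiM t2 chi0.
  have [[i j] e] := sp _ tc; exists j.
  have : cj (chi T2) = - chi T2 by rewrite -(proj1 (chis _ _) rr) c2 chiN.
  rewrite e (@lcN _ E 3 T1 T2 isT t1 t2) /lc galpD !galpMn c1 c2 o2 // -mulrnA => /(eqlc (i, 2 * j)%N (2 * i, 2 * j)%N) /andP[/= dv _].
  have /dvdnP[j' ->] : (3 %| i)%N by clear -dv; lia.
  by rewrite mulnC mulrnA t1 mul0rn add0r.
have chilc x : chi (lc T1 T2 x) = lc T1 T2 (be * x.1, ga * x.2)%N by rewrite /lc chiD !chiM eb eg -!mulrnA.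
have gt (s : {rmorphism algC -> algC}) (A : ept E) : A *+ 3 = 0 -> galp s A *+ 3 = 0 by move=> t; rewrite -galpMn t /galp tr0.
have gn (s : {rmorphism algC -> algC}) (A : ept E) : A != 0 -> galp s A != 0.
  by apply: contra => /eqP e; apply/eqP; apply: (@galp_inj _ _ h s); rewrite e /galp tr0.
have nz x : ~~ ((3 %| x.1) && (3 %| x.2))%N -> lc T1 T2 x != 0 by apply: contra => /eqP /ind.
have zz x : ((3 %| x.1) && (3 %| x.2))%N -> lc T1 T2 x = 0.
  by case/andP=> /dvdnP[u e1] /dvdnP[v e2]; rewrite /lc e1 e2 mulnC mulrnA t1 mul0rn mulnC mulrnA t2 mul0rn addr0.
suff [/dvdnP[u e1] /dvdnP[v e2]] : (3 %| be)%N /\ (3 %| ga)%N.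
  move=> A /sp[x ->]; have : chi (lc T1 T2 x) = 0 by rewrite chilc; apply: zz; rewrite e1 e2 /=; apply/andP; split; apply: dvdn_mulr; exact: dvdn_mull.
  by move/eqP; rewrite /chi /tw tr_eq0 // => /eqP.
have sgn s : exists e, ((e == 1) || (e == 2))%N /\ forall A, A *+ 3 = 0 -> chi (galp s A) = galp s (chi A) *+ e.
  case: (gal_r rd s) => er; [exists 1%N | exists 2%N]; split=> // A tA; first by rewrite (proj1 (chis s A) er).
  by rewrite (proj2 (chis s A) er) o2 // -galpMn -chiM tA chi0 /galp tr0.
have modT (A : ept E) i j : A *+ 3 = 0 -> (3 %| i + 2 * j)%N -> A *+ i = A *+ j.
  move=> t /dvdnP[k ek]; have e : (i + 3 * j = k * 3 + j)%N by clear -ek; lia.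
  transitivity (A *+ (i + 3 * j)%N); first by rewrite mulrnDr mulrnA t mul0rn addr0.
  by rewrite e mulrnDr (mulnC k) mulrnA t mul0rn add0r.
(* Scalar case: an automorphism with s r = -r both commutes and anticommutes with [chi]. *)
have [ebg|nbg] := boolP (3 %| be + 2 * ga)%N.
  have [s sr] := sqrt_conj rd irr.
  have := proj2 (chis s T1) sr; have [x ex] := sp _ (gt s _ t1).
  have -> : chi (galp s T1) = galp s T1 *+ be.
    by rewrite ex chilc /lc /= mulrnDl mulnC mulrnA (mulnC ga) mulrnA -(modT (T2 *+ x.2) be ga) // mulrnAC t2 mul0rn.
  rewrite eb galpMn => /eqP; rewrite -addr_eq0 => /eqP /tor23 z.
  have : galp s T1 *+ be = 0 by apply: z; rewrite mulrnAC gt // mul0rn.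
  rewrite -galpMn => /eqP; have -> : 0 = galp s (0 : ept E) by rewrite /galp tr0.
  move=> /eqP /galp_inj e; have /andP[db _] : ((3 %| be) && (3 %| 0))%N by apply: ind; rewrite e mulr0n addr0.
  by split=> //; clear -db ebg; lia.
exfalso.
pose be3 := (be %% 3)%N; pose ga3 := (ga %% 3)%N.
(* The finite check modulo 3 that [chi], up to the sign e, sends eigenvectors moved by s to
   eigenvectors only on the two eigenlines. *)
have fin (i j k l be' ga' e : nat) : (i < 3)%N -> (j < 3)%N -> (be' < 3)%N -> (ga' < 3)%N -> ~~ (3 %| be' + 2 * ga')%N -> (e == 1%N) || (e == 2%N) ->
    (3 %| be' * i + 2 * (k * i * e))%N -> (3 %| ga' * j + 2 * (k * j * e))%N -> (k == be') || (k == ga') -> (i == 0%N) || (j == 0%N).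
  move=> hi hj hb hg n he; case: i hi => [|[|[|//]]] _ //; case: j hj => [|[|[|//]]] _ //;
    case: be' hb n => [|[|[|//]]] _; case: ga' hg => [|[|[|//]]] _ // _;
    case/orP: he => /eqP -> h1 h2 /orP[] /eqP ek; move: h1 h2; rewrite ek => h1 h2; (try exact: isT); (try by vm_compute in h1); by vm_compute in h2.
have one s k T : T *+ 3 = 0 -> chi T = T *+ k -> ((k %% 3)%N == be3) || ((k %% 3)%N == ga3) ->
    exists i j : nat, [/\ galp s T = lc T1 T2 (i, j), (i < 3)%N, (j < 3)%N & (i == 0%N) || (j == 0%N)].
  move=> tT eT hk; have [x ex] := sp _ (gt s _ tT); rewrite lcm // in ex.
  exists (x.1 %% 3)%N, (x.2 %% 3)%N; rewrite ltn_mod ltn_mod; split=> //.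
  have [e [he hs]] := sgn s; have := hs T tT; rewrite eT galpMn ex chilc.
  set i := (x.1 %% 3)%N; set j := (x.2 %% 3)%N => /=.
  have -> : lc T1 T2 (i, j) *+ k *+ e = lc T1 T2 (i * k * e, j * k * e)%N by rewrite /lc /= !mulrnDl -!mulrnA !mulnA.
  move=> /eqlc /andP[/= d1 d2].
  have m3 (u v w k' : nat) : (3 %| u * v + 2 * (v * k * w))%N -> (3 %| (u %% 3) * v + 2 * ((k %% 3) * v * w))%N.
    move=> hm; have e3 : (u * v + 2 * (v * k * w) = (u %/ 3 * v + 2 * (k %/ 3 * v * w)) * 3 + (u %% 3 * v + 2 * (k %% 3 * v * w)))%N.
      by rewrite {1}(divn_eq u 3) {1}(divn_eq k 3); move: (u %/ 3)%N (u %% 3)%N (k %/ 3)%N (k %% 3)%N; clear; move=> a1 a2 a3 a4; lia.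
    by move: hm; rewrite e3 dvdn_addr // dvdn_mull.
  apply: (fin _ _ (k %% 3)%N 0%N be3 ga3 e) => //; rewrite ?ltn_mod //; try exact: m3.
  by move: nbg; clear; rewrite /be3 /ga3; lia.
have four (i j : nat) : (i < 3)%N -> (j < 3)%N -> (i == 0%N) || (j == 0%N) -> lc T1 T2 (i, j) != 0 ->
    (lc T1 T2 (i, j) = T1 \/ lc T1 T2 (i, j) = - T1) \/ (lc T1 T2 (i, j) = T2 \/ lc T1 T2 (i, j) = - T2).
  rewrite /lc /= (o2 _ t1) (o2 _ t2); case: i => [|[|[|//]]] _; case: j => [|[|[|//]]] //= _ _; rewrite ?mulr0n ?add0r ?addr0 ?eqxx //; auto.
have lines s : ((galp s T1 = T1 \/ galp s T1 = - T1) /\ (galp s T2 = T2 \/ galp s T2 = - T2)) \/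
    ((galp s T1 = T2 \/ galp s T1 = - T2) /\ (galp s T2 = T1 \/ galp s T2 = - T1)).
  have [i [j [e1 hi hj zi]]] := one s be T1 t1 eb (introT orP (or_introl (eq_refl _))).
  have [k [l [e2 hk hl zk]]] : exists i j : nat, [/\ galp s T2 = lc T1 T2 (i, j), (i < 3)%N, (j < 3)%N & (i == 0%N) || (j == 0%N)].
    by apply: (one s ga T2 t2 eg); rewrite eqxx orbT.
  have g1 := gn s _ n1; have g2 := gn s _ n2; rewrite e1 in g1; rewrite e2 in g2.
  have q1 : lc T1 T2 (i, j) != lc T1 T2 (k, l) by rewrite -e1 -e2; apply: contra n3 => /eqP /galp_inj ->.
  have q2 : lc T1 T2 (i, j) != - lc T1 T2 (k, l) by rewrite -e1 -e2 -galpN; apply: contra n4 => /eqP /galp_inj ->.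
  rewrite e1 e2; move: (four _ _ hi hj zi g1) (four _ _ hk hl zk g2) q1 q2.
  by case=> [] [] -> [] [] ->; rewrite ?opprK ?eqxx //; move=> _ _; [left|left|left|left|right|right|right|right]; split; auto.
have [q eq] : exists q : rat, xc T1 * xc T2 + xc (T1 + T2) * xc (T1 - T2) = ratr q.
  apply: galois_fixed_rat => s; rewrite rmorphD !rmorphM /= -!xc_gal galpD [galp s (T1 - T2)]galpD galpN.
  have m1 (A B : ept E) : xc (- A + B) = xc (A - B) by rewrite -[in RHS]xcN opprB addrC.
  have m2 (A B : ept E) : xc (- A - B) = xc (A + B) by rewrite -[in RHS]xcN opprD.
  have m3 (A B : ept E) : xc (A - B) = xc (B - A) by rewrite -[in RHS]xcN opprB.
  by case: (lines s) => [] [[] -> [] ->]; rewrite ?xcN ?m2 ?m2 ?m1 ?m1 ?opprK ?(m3 T2 T1) ?(addrC T2 T1); ring.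
have [v1 v2 v3 v4] := vieta3 t1 t2 n1 n2 n3 n4.
have := resolvent3 v1 v2 v3 v4; rewrite eq => e.
apply: (ncube (q := q - 2%:R / 3%:R * a)); apply: (fmorph_inj (ratr : {rmorphism rat -> algC})).
have e1 : ratr (q - 2%:R / 3%:R * a) = ratr q - 2%:R / 3%:R * ratr a :> algC by rewrite rmorphB !rmorphM fmorphV !rmorph_nat.
transitivity (27%:R * (ratr q - 2%:R / 3%:R * ratr a) ^+ 3 : algC); first by rewrite -e1 rmorphM rmorphXn rmorph_nat.
transitivity (16%:R * (4%:R * (ratr a) ^+ 3 + 27%:R * (ratr b) ^+ 2) : algC); first exact: e.
by rewrite !(rmorph_nat, rmorphXn, rmorphM, rmorphD).
Qed.
End NoHomTwist.

End TwistThree.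

(** * Polynomial identities of the family for n = 7 *)

Module FamilySevenIdentities.
Import CurveRing PointIdeals CocycleLaw CurveGroup Reciprocity TorsionStructure Transport SevenKernel ReverseSeven AlmostEverywhere Isogenies GaloisAction TwistThree.

Section Family7.
Variable R : comNzRingType.
Implicit Type t : R.

(** The curve [p7a], [p7b] has j = t [p7K]^3 / [p7D]^7, and its two subgroups of order 7 are defined
    over the field generated by a square root of [p7d]. *)
Definition p7m t := t ^+ 2 - 5%:R * t + 1.
Definition p7d t := p7m t ^+ 2 - 28%:R.
Definition p7D t := t ^+ 3 - 4%:R * t ^+ 2 + 3%:R * t + 1.
Definition p7S t := t ^+ 4 - 10%:R * t ^+ 3 + 27%:R * t ^+ 2 - 10%:R * t - 13%:R.
Definition p7K t := (t + 1) * p7m t * (t ^+ 2 - 5%:R * t + 8%:R) * (t ^+ 4 - 5%:R * t ^+ 3 + 8%:R * t ^+ 2 - 7%:R * t + 7%:R).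
Definition p7s t := t ^+ 12 - 16%:R * t ^+ 11 + 108%:R * t ^+ 10 - 396%:R * t ^+ 9 + 845%:R * t ^+ 8 - 1014%:R * t ^+ 7
  + 581%:R * t ^+ 6 - 384%:R * t ^+ 5 + 1398%:R * t ^+ 4 - 2090%:R * t ^+ 3 + 1067%:R * t ^+ 2 - 324%:R * t + 8%:R.
Definition p7U t := 6%:R * t * (2%:R * t ^+ 4 - 13%:R * t ^+ 3 + 26%:R * t ^+ 2 - 13%:R * t - 5%:R).
Definition p7V t := - 3%:R * t * (3%:R * t ^+ 2 - 8%:R * t + 3%:R).
Definition p7a t := - 3%:R * t * p7K t * p7d t.
Definition p7b t := - 2%:R * t * p7d t ^+ 2 * p7s t.

Lemma p7_disc t : 4%:R * p7a t ^+ 3 + 27%:R * p7b t ^+ 2 = - (1728%:R * 108%:R) * (t ^+ 2 * p7d t ^+ 3 * p7D t ^+ 7).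
Proof.
have e : t * p7K t ^+ 3 - p7d t * p7s t ^+ 2 = 1728%:R * p7D t ^+ 7.
  by rewrite /p7K /p7d /p7s /p7D /p7m; ring.
transitivity (- 108%:R * (t ^+ 2 * p7d t ^+ 3) * (t * p7K t ^+ 3 - p7d t * p7s t ^+ 2)); first by rewrite /p7a /p7b; ring.
by rewrite e; ring.
Qed.

(* Arithmetic of u + v s with s^2 = d. *)
Definition qm (d : R) (x y : R * R) := (x.1 * y.1 + d * (x.2 * y.2), x.1 * y.2 + x.2 * y.1).
Definition qa (x y : R * R) := (x.1 + y.1, x.2 + y.2).
Definition qs (c : R) (x : R * R) := (c * x.1, c * x.2).
Definition qv (s : R) (x : R * R) := x.1 + x.2 * s.

Lemma qvM d s x y : s ^+ 2 = d -> qv s (qm d x y) = qv s x * qv s y.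
Proof. by move=> <-; rewrite /qv /qm /=; ring. Qed.
Lemma qvA s x y : qv s (qa x y) = qv s x + qv s y. Proof. by rewrite /qv /qa /=; ring. Qed.
Lemma qvS s c x : qv s (qs c x) = c * qv s x. Proof. by rewrite /qv /qs /=; ring. Qed.
Lemma qv1 s c : qv s (c, 0) = c. Proof. by rewrite /qv /=; ring. Qed.

(** [t7] is 2 D times the parameter tau of X_0(7); [q7], [u7] and [w7] are the three polynomials of
    that parametrisation, homogenised at 2 D. *)
Definition t7 t := (p7S t, p7m t).
Definition h7 t := (p7U t, p7V t).
Definition q7 t := qa (qm (p7d t) (t7 t) (t7 t)) (qa (qs (26%:R * p7D t) (t7 t)) (196%:R * p7D t ^+ 2, 0)).
Definition u7 t := qa (qm (p7d t) (t7 t) (t7 t)) (qa (qs (10%:R * p7D t) (t7 t)) (4%:R * p7D t ^+ 2, 0)).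
Definition w7 t := let d := p7d t in let T := t7 t in let T2 := qm d T T in
  qa (qm d T2 T2) (qa (qs (28%:R * p7D t) (qm d T2 T)) (qa (qs (252%:R * p7D t ^+ 2) T2) (qa (qs (560%:R * p7D t ^+ 3) T) (- (112%:R * p7D t ^+ 4), 0)))).

Lemma id7a t : qm (p7d t) (qm (p7d t) (h7 t) (h7 t)) (u7 t) = qs (9%:R * t * p7K t) (q7 t).
Proof.
by rewrite /u7 /q7 /qm /qa /qs /h7 /t7 /=; congr (_, _); rewrite /p7U /p7V /p7S /p7D /p7K /p7d /p7m; ring.
Qed.
Lemma id7b t : qm (p7d t) (qm (p7d t) (h7 t) (qm (p7d t) (h7 t) (h7 t))) (w7 t) = qs (27%:R * t * p7s t) (qm (p7d t) (0, 1) (qm (p7d t) (q7 t) (q7 t))).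
Proof.
rewrite /w7 /q7 /qm /qa /qs /h7 /t7 /=; congr (_, _); rewrite /p7U /p7V /p7S /p7D /p7s /p7d /p7m; ring.
Qed.
End Family7.

Section Morph7.
Variables (R R' : comNzRingType) (f : {rmorphism R -> R'}).
Lemma f7m t : f (p7m t) = p7m (f t). Proof. by rewrite /p7m !(rmorph_nat, rmorph1, rmorphXn, rmorphM, rmorphB, rmorphD, rmorphN). Qed.
Lemma f7d t : f (p7d t) = p7d (f t). Proof. by rewrite /p7d rmorphB rmorphXn f7m rmorph_nat. Qed.
Lemma f7D t : f (p7D t) = p7D (f t). Proof. by rewrite /p7D !(rmorph_nat, rmorph1, rmorphXn, rmorphM, rmorphB, rmorphD, rmorphN). Qed.
Lemma f7S t : f (p7S t) = p7S (f t). Proof. by rewrite /p7S !(rmorph_nat, rmorph1, rmorphXn, rmorphM, rmorphB, rmorphD, rmorphN). Qed.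
Lemma f7K t : f (p7K t) = p7K (f t). Proof. by rewrite /p7K /p7m !(rmorph_nat, rmorph1, rmorphXn, rmorphM, rmorphB, rmorphD, rmorphN). Qed.
Lemma f7s t : f (p7s t) = p7s (f t). Proof. by rewrite /p7s !(rmorph_nat, rmorph1, rmorphXn, rmorphM, rmorphB, rmorphD, rmorphN). Qed.
Lemma f7U t : f (p7U t) = p7U (f t). Proof. by rewrite /p7U !(rmorph_nat, rmorph1, rmorphXn, rmorphM, rmorphB, rmorphD, rmorphN). Qed.
Lemma f7V t : f (p7V t) = p7V (f t). Proof. by rewrite /p7V !(rmorph_nat, rmorph1, rmorphXn, rmorphM, rmorphB, rmorphD, rmorphN). Qed.
Lemma f7a t : f (p7a t) = p7a (f t). Proof. by rewrite /p7a 3!rmorphM f7K f7d rmorphN rmorph_nat. Qed.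
Lemma f7b t : f (p7b t) = p7b (f t). Proof. by rewrite /p7b 3!rmorphM rmorphXn f7s f7d rmorphN rmorph_nat. Qed.
End Morph7.

Lemma id7_field (F : fieldType) (t s tau h : F) : s ^+ 2 = p7d t -> 2%:R * p7D t != 0 -> 2%:R * p7D t * tau = p7S t + p7m t * s ->
  h = p7U t + p7V t * s ->
  h ^+ 2 * (tau ^+ 2 + 5%:R * tau + 1) = 9%:R * t * p7K t * (tau ^+ 2 + 13%:R * tau + 49%:R) /\
  h ^+ 3 * (tau ^+ 4 + 14%:R * tau ^+ 3 + 63%:R * tau ^+ 2 + 70%:R * tau - 7%:R) =
    27%:R * t * p7s t * (s * (tau ^+ 2 + 13%:R * tau + 49%:R) ^+ 2).
Proof.
move=> es D0 et eh.
have M := qvM _ _ es; have hv : qv s (h7 t) = h by rewrite eh.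
have tv : qv s (t7 t) = 2%:R * p7D t * tau by rewrite et.
have qE : qv s (q7 t) = (2%:R * p7D t) ^+ 2 * (tau ^+ 2 + 13%:R * tau + 49%:R).
  by rewrite /q7 !qvA M qvS qv1 tv; ring.
have uE : qv s (u7 t) = (2%:R * p7D t) ^+ 2 * (tau ^+ 2 + 5%:R * tau + 1).
  by rewrite /u7 !qvA M qvS qv1 tv; ring.
have wE : qv s (w7 t) = (2%:R * p7D t) ^+ 4 * (tau ^+ 4 + 14%:R * tau ^+ 3 + 63%:R * tau ^+ 2 + 70%:R * tau - 7%:R).
  by rewrite /w7 /= !(qvA, qvS, M) qv1 tv; ring.
split.
  have := congr1 (qv s) (id7a t); rewrite !M qvS hv qE uE => e.
  apply: (mulfI (expf_neq0 2 D0)).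
  have -> : (2%:R * p7D t) ^+ 2 * (h ^+ 2 * (tau ^+ 2 + 5%:R * tau + 1)) = h * h * ((2%:R * p7D t) ^+ 2 * (tau ^+ 2 + 5%:R * tau + 1)) by ring.
  by rewrite e; ring.
have := congr1 (qv s) (id7b t); rewrite !M qvS !M hv qE wE => e.
have s1 : qv s (0, 1) = s by rewrite /qv /=; ring.
rewrite s1 in e; apply: (mulfI (expf_neq0 4 D0)).
have -> : (2%:R * p7D t) ^+ 4 * (h ^+ 3 * (tau ^+ 4 + 14%:R * tau ^+ 3 + 63%:R * tau ^+ 2 + 70%:R * tau - 7%:R)) =
  h * (h * h) * ((2%:R * p7D t) ^+ 4 * (tau ^+ 4 + 14%:R * tau ^+ 3 + 63%:R * tau ^+ 2 + 70%:R * tau - 7%:R)) by ring.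
by rewrite e; ring.
Qed.

End FamilySevenIdentities.

(** * Rational non-squares and non-cubes *)

Module RationalPowers.
Import CurveRing PointIdeals CocycleLaw CurveGroup Reciprocity TorsionStructure Transport SevenKernel ReverseSeven AlmostEverywhere Isogenies GaloisAction TwistThree FamilySevenIdentities.

Lemma rat_frac (q : rat) : exists n e : int, [/\ e != 0, coprime `|n| `|e| & q = n%:~R / e%:~R].
Proof.
exists (numq q), (denq q); split; [exact: denq_neq0 | exact: coprime_num_den | by rewrite divq_num_den].
Qed.

Lemma rat_pow_nat (q : rat) m N : q ^+ m = N%:R -> exists n e : nat, [/\ (0 < e)%N, coprime n e & (n ^ m = N * e ^ m)%N].
Proof.
have [n [e [e0 c ->]]] := rat_frac q; rewrite expr_div_n => h.
exists `|n|%N, `|e|%N; split=> //; first by rewrite absz_gt0.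
have e1 : (e%:~R : rat) ^+ m != 0 by rewrite expf_neq0 // intr_eq0.
have : n ^+ m = N%:R * e ^+ m.
  apply: (@intr_inj rat); rewrite rmorphM !rmorphXn rmorph_nat /= -h divfK //.
by move=> /(congr1 absz); rewrite abszM !abszX natz absz_nat.
Qed.

Lemma odd_sq n : odd n -> exists X, (n ^ 2 = 8 * X + 1)%N.
Proof.
move=> o; rewrite -(odd_double_half n) o; set m := n./2; exists 'C(m.+1, 2).
have : (2 * 'C(m.+1, 2) = m.+1 * m)%N by rewrite -mul_bin_diag /= bin1.
by rewrite -muln2; move: ('C(m.+1, 2))%N => X; clear; rewrite expnS expn1; nia.
Qed.

(** Numerator and denominator are both odd, and odd squares are 1 modulo 8. *)
Lemma not_square_5mod8 (q : rat) w : q ^+ 2 <> (8 * w + 5)%:R.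
Proof.
move=> /rat_pow_nat[n [e [e0 c h]]].
have oe : odd e.
  apply/negPn/negP => ev; have on : ~~ odd n.
    by have := congr1 odd h; rewrite oddX oddM oddX (negPf ev) andbF /= => ->.
  have : (2 %| gcdn n e)%N by rewrite dvdn_gcd !dvdn2 on ev.
  by move: c; rewrite /coprime => /eqP ->.
have on : odd n by have := congr1 odd h; rewrite oddX oddM oddX oe oddD oddM.
have [X eX] := odd_sq on; have [Y eY] := odd_sq oe; move: h; rewrite eX eY; clear; nia.
Qed.

(** The 2-adic valuation would be 2, not a multiple of 3. *)
Lemma not_cube_val2 (q : rat) m : odd m -> q ^+ 3 <> (4 * m)%:R.
Proof.
move=> om /rat_pow_nat[n [e [e0 c h]]].
have m0 : (0 < m)%N by case: m om {h}.
have n0 : (0 < n)%N.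
  rewrite lt0n; apply/eqP => z; have : (0 < 4 * m * e ^ 3)%N by rewrite !muln_gt0 m0 e0.

  by rewrite -h z.
have := congr1 (logn 2) h; rewrite lognM ?expn_gt0 ?e0 ?muln_gt0 // lognM // !lognX.
have -> : logn 2 m = 0%N by rewrite lognE dvdn2 om andbF.
have -> : logn 2 4 = 2 by [].
by clear; lia.
Qed.

(** On the progression t = 4 k + 10 one has d = 5 modulo 8, so d is no square, and t^2 D is 4 times
    an odd number, so it is no cube. The expansions in k have nonnegative coefficients, which makes
    nonvanishing evident. *)
Definition t7n k := (4 * k + 10)%N.
Definition d7n k := (8 * (32 * k ^ 4 + 240 * k ^ 3 + 654 * k ^ 2 + 765 * k + 321) + 5)%N.
Definition D7n k := (64 * k ^ 3 + 416 * k ^ 2 + 892 * k + 631)%N.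
Definition V7n k := (48 * k ^ 2 + 208 * k + 223)%N.
Definition U7n k := (512 * k ^ 4 + 4288 * k ^ 3 + 16 * 836 * k ^ 2 + 68 * 271 * k + 15 * 631)%N.

Section Nat7.
Variables (R : comNzRingType) (k : nat).
Lemma d7nE : p7d ((t7n k)%:R : R) = (d7n k)%:R.
Proof. by rewrite /p7d /p7m /t7n /d7n !(natrD, natrM, natrX); move: (k%:R) => x; ring. Qed.
Lemma D7nE : p7D ((t7n k)%:R : R) = (D7n k)%:R.
Proof. by rewrite /p7D /t7n /D7n !(natrD, natrM, natrX); move: (k%:R) => x; ring. Qed.
Lemma V7nE : p7V ((t7n k)%:R : R) = - 3%:R * (t7n k)%:R * (V7n k)%:R.
Proof. by rewrite /p7V /t7n /V7n !(natrD, natrM, natrX); move: (k%:R) => x; ring. Qed.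
Lemma U7nE : p7U ((t7n k)%:R : R) = 6%:R * (t7n k)%:R * (U7n k)%:R.
Proof. by rewrite /p7U /t7n /U7n !(natrD, natrM, natrX); move: (k%:R) => x; ring. Qed.
End Nat7.

Lemma t7n_gt0 k : (0 < t7n k)%N. Proof. by rewrite /t7n addn_gt0 orbT. Qed.
Lemma d7n_gt0 k : (0 < d7n k)%N. Proof. by rewrite /d7n addn_gt0 orbT. Qed.
Lemma D7n_gt0 k : (0 < D7n k)%N. Proof. by rewrite /D7n addn_gt0 orbT. Qed.
Lemma V7n_gt0 k : (0 < V7n k)%N. Proof. by rewrite /V7n addn_gt0 orbT. Qed.
Lemma U7n_gt0 k : (0 < U7n k)%N. Proof. by rewrite /U7n addn_gt0 orbT. Qed.

End RationalPowers.

(** * The curves of the family for n = 7 *)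

Module FamilySeven.
Import CurveRing PointIdeals CocycleLaw CurveGroup Reciprocity TorsionStructure Transport SevenKernel ReverseSeven AlmostEverywhere Isogenies GaloisAction TwistThree FamilySevenIdentities RationalPowers.

Section Inst7.
Variable k : nat.
Let t : rat := (t7n k)%:R.
Let u : algC := (t7n k)%:R.
Let nz (F : numDomainType) n : (0 < n)%N -> (n%:R : F) != 0. Proof. by rewrite pnatr_eq0 lt0n. Qed.
Let tu : ratr t = u. Proof. exact: rmorph_nat. Qed.

Let t0 : t != 0. Proof. by rewrite /t nz ?t7n_gt0. Qed.
Lemma d70 : p7d t != 0. Proof. by rewrite /t d7nE nz ?d7n_gt0. Qed.
Let D70 : p7D t != 0. Proof. by rewrite /t D7nE nz ?D7n_gt0. Qed.
Lemma disc7 : 4%:R * p7a t ^+ 3 + 27%:R * p7b t ^+ 2 != 0.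
Proof.
rewrite p7_disc; apply: mulf_neq0; first by rewrite oppr_eq0; apply: mulf_neq0; rewrite pnatr_eq0.
apply: mulf_neq0; [apply: mulf_neq0; apply: expf_neq0 | apply: expf_neq0];
  [exact: t0 | exact: d70 | exact: D70].
Qed.

Let r : algC := sqrtC (ratr (p7d t)).
Let rd : r ^+ 2 = ratr (p7d t). Proof. exact: sqrtCK. Qed.
Let irr (s : algC) : s ^+ 2 = ratr (p7d t) -> forall q : rat, s <> ratr q.
Proof.
move=> es q e; move: es; rewrite e -rmorphXn => /fmorph_inj; rewrite /t d7nE; exact: not_square_5mod8.
Qed.
Let rr : conjA r = r.
Proof.
apply: conj_Creal; apply: ger0_real; rewrite sqrtC_ge0 /t d7nE rmorph_nat; exact: ler0n.
Qed.

(** Up to cubes the right side is t^2 D, by [p7_disc]. *)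
Lemma ncube7 (q : rat) : 27%:R * q ^+ 3 <> 16%:R * (4%:R * p7a t ^+ 3 + 27%:R * p7b t ^+ 2).
Proof.
rewrite p7_disc => e; have nd := d70; have nD : p7D t != 0 by rewrite /t D7nE nz ?D7n_gt0.
have e2 : (- 3%:R * q / (144%:R * p7d t * p7D t ^+ 2)) ^+ 3 = t ^+ 2 * p7D t.
  transitivity (- (27%:R * q ^+ 3) / (144%:R * p7d t * p7D t ^+ 2) ^+ 3); first by field; rewrite nd nD.
  by rewrite e; field; rewrite nd nD.
have om : odd ((2 * k + 5) ^ 2 * D7n k).
  have -> : D7n k = (32 * k ^ 3 + 208 * k ^ 2 + 446 * k + 315).*2.+1%N by rewrite /D7n -mul2n; move: (k ^ 3)%N (k ^ 2)%N; clear; move=> x y; lia.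
  have -> : (2 * k + 5 = (k + 2).*2.+1)%N by rewrite -mul2n; clear; lia.
  by rewrite oddM oddX /= !odd_double.
apply: (@not_cube_val2 (- 3%:R * q / (144%:R * p7d t * p7D t ^+ 2)) _ om).
rewrite e2 /t D7nE /t7n !(natrM, natrD, natrX); move: ((D7n k)%:R : rat) (k%:R : rat) => x y; ring.
Qed.

Definition T7 (s : algC) : algC := (p7S u + p7m u * s) / (2%:R * p7D u).
Definition K7 (s : algC) : algC := s * (p7U u + p7V u * s) / (3%:R * k7q (T7 s)).

Let D0 : 2%:R * p7D u != 0. Proof. by rewrite /u D7nE mulf_neq0 ?nz ?D7n_gt0. Qed.
Let du : ratr (p7d t) = p7d u :> algC. Proof. by rewrite -tu -f7d. Qed.

Let h0 (s : algC) : s ^+ 2 = ratr (p7d t) -> p7U u + p7V u * s != 0.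
Proof.
move=> es; apply/eqP => e; apply: (irr es (q := - p7U t / p7V t)).
have V0 : p7V u != 0 by rewrite /u V7nE !mulf_neq0 ?oppr_eq0 ?nz ?t7n_gt0 ?V7n_gt0.
have -> : ratr (- p7U t / p7V t) = - p7U u / p7V u :> algC.
  have eU : ratr (p7U t) = p7U u :> algC by rewrite -tu -f7U.
  have eV : ratr (p7V t) = p7V u :> algC by rewrite -tu -f7V.
  by rewrite rmorphM rmorphN fmorphV /= eU eV.
by apply: (mulfI V0); rewrite mulrCA mulfV // mulr1; apply/eqP; rewrite -addr_eq0 addrC e.
Qed.
Let s0 (s : algC) : s ^+ 2 = ratr (p7d t) -> s != 0.
Proof. by move=> es; apply/eqP => e; apply: (irr es (q := 0)); rewrite rmorph0. Qed.
Let q0 (s : algC) : s ^+ 2 = ratr (p7d t) -> k7q (T7 s) != 0.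
Proof.
move=> es; have e2 : 2%:R * p7D u * T7 s = p7S u + p7m u * s by rewrite /T7 mulrC divfK.
have [e _] := id7_field (etrans es du) D0 e2 erefl.
apply/eqP => q; rewrite /k7q in q; move: e; rewrite q mulr0 => /eqP; rewrite mulf_eq0 expf_eq0 (negPf (h0 es)) /= => /eqP z.
(* Both quadratics in tau vanish only if 8 tau + 48 = 0, but at tau = -6 the second one is 7. *)
have t6 : T7 s = - 6%:R.
  have e8 : (8%:R : algC) != 0 by rewrite pnatr_eq0.
  apply: (mulfI e8); transitivity (T7 s ^+ 2 + 13%:R * T7 s + 49%:R - (T7 s ^+ 2 + 5%:R * T7 s + 1) - 48%:R); first by ring.
  by rewrite q z; ring.
have : (7%:R : algC) != 0 by rewrite pnatr_eq0.
by case/eqP; rewrite -z t6; ring.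
Qed.

Theorem reverse7_inst : reverse_congruent 7 (ratcurve disc7) (ratcurve (disc_twist disc7 d70)).
Proof.
have au : ratr (p7a t) = p7a u :> algC by rewrite -tu -f7a.
have bu : ratr (p7b t) = p7b u :> algC by rewrite -tu -f7b.
have tE s : 2%:R * p7D u * T7 s = p7S u + p7m u * s by rewrite /T7 mulrC divfK.
have su (s : {rmorphism algC -> algC}) : s u = u by exact: rmorph_nat.
have sT (s : {rmorphism algC -> algC}) x : s (T7 x) = T7 (s x).
  by rewrite /T7 fmorph_div rmorphD !rmorphM f7S f7m f7D su rmorph_nat.
apply: (@reverse7 _ _ _ disc7 r T7 K7 d70 rd) => //.
- move=> s es; apply: mulf_neq0; first by apply: mulf_neq0; [exact: s0 | exact: h0].
  by rewrite invr_eq0; apply: mulf_neq0; [rewrite pnatr_eq0 | exact: q0].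
- move=> s es; have [e _] := id7_field (etrans es du) D0 (tE s) erefl; have qn := q0 es.
  rewrite au /p7a -(etrans es du) /K7; move: e qn; rewrite -/(k7q (T7 s)) => e qn.
  transitivity (- 3%:R * s ^+ 2 / (9%:R * k7q (T7 s)) * ((p7U u + p7V u * s) ^+ 2 * (T7 s ^+ 2 + 5%:R * T7 s + 1))).
    by rewrite e; field.
  by field.
- move=> s es; have [_ e] := id7_field (etrans es du) D0 (tE s) erefl; have qn := q0 es.
  rewrite bu /p7b -(etrans es du) /K7; move: e qn; rewrite -/(k7q (T7 s)) => e qn.
  transitivity (- 2%:R * s ^+ 3 / (27%:R * k7q (T7 s) ^+ 2) * ((p7U u + p7V u * s) ^+ 3 * (T7 s ^+ 4 + 14%:R * T7 s ^+ 3 + 63%:R * T7 s ^+ 2 + 70%:R * T7 s - 7%:R))).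
    by rewrite e; field.
  by field.
- move=> s x; rewrite /K7 fmorph_div rmorphM rmorphD [s (p7V u * x)]rmorphM f7U f7V su [s (3%:R * _)]rmorphM rmorph_nat -sT.
  by rewrite /k7q !(rmorph_nat, rmorphXn, rmorphM, rmorphD).
(* The values of k q at r and -r are r (U + V r) / 3 and - r (U - V r) / 3; they differ by 2 r U /
   3. *)
have rN : (- r) ^+ 2 = ratr (p7d t) by rewrite sqrrN.
have c3 x y : y != 0 -> x / (3%:R * y) * y = x / 3%:R :> algC by move=> y0; field.
rewrite /K7 !c3 ?q0 //; apply/eqP => /(mulIf (_ : 3%:R^-1 != 0)) e.
have : r * (2%:R * p7U u) = 0.
  by have := e; rewrite invr_eq0 pnatr_eq0 => /(_ isT) e'; transitivity (r * (p7U u + p7V u * r) - (- r * (p7U u + p7V u * - r))); [ring | rewrite e' subrr].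
apply/eqP; apply: mulf_neq0; first exact: s0 rd.
apply: mulf_neq0; first by rewrite pnatr_eq0.
rewrite /u U7nE; apply: mulf_neq0; last exact: nz (U7n_gt0 k).
by apply: mulf_neq0; [rewrite pnatr_eq0 | exact: nz (t7n_gt0 k)].
Qed.

Theorem nonisog7_inst : ~ isogenous (ratcurve disc7) (ratcurve (disc_twist disc7 d70)).
Proof.
apply: (@not_isogenous _ _ _ _ disc7 (disc_twist disc7 d70) 3) => //.
- exact: tripling.
- by have [T1 [_ [t1 _ [n1 _ _ _]]]] := ex_basis3 (ratecurve disc7); exists T1.
exact: (@no_hom_twist3 _ _ _ r d70 disc7 rd rr (irr rd) ncube7).
Qed.
End Inst7.

End FamilySeven.

(** * The pairing on E[3] in coordinates, and theta under translation and Galois *)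

Module ThetaGalois.
Import CurveRing PointIdeals CocycleLaw CurveGroup Reciprocity MillerFunctions TorsionPairing ExplicitPairing ThetaFunction TorsionStructure Transport AlmostEverywhere Isogenies GaloisAction.

Section ThreePairing.
Variables (K : numClosedFieldType) (E : ecurve K).
Implicit Types (C Q T X Y : ept E).
Local Notation a := (ea E).

Definition tsl X : K := (3%:R * xc X ^+ 2 + a) / (2%:R * yc X).
(** By [pair3_N] this is 2 y(Q) y(T) (e - 1/e) for e = e_3(Q, T): the pairing on E[3] read from
    abscissae. *)
Definition e3N (x z : K) : K := (3%:R * x ^+ 2 + a) * (z - x) + 6%:R * ecub E x.

Lemma yc_odd_tor X n : odd n -> X *+ n = 0 -> X != 0 -> yc X != 0.
Proof.
move=> on tX X0; apply/eqP => z; have eX := val_xy X0; rewrite z in eX.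
have h := two_tor eX; move: tX; rewrite -(odd_double_half n) on add1n mulrS -mul2n mulrnA mulr2n h mul0rn addr0.
by move/eqP; rewrite (negPf X0).
Qed.

Lemma hv_dbl X Y : X != 0 -> yc X != 0 -> Y != 0 ->
  hv X X Y = (yc Y - yc X - tsl X * (xc Y - xc X)) / (xc Y - (tsl X ^+ 2 - xc X - xc X)).
Proof.
move=> X0 y0 Y0; have s : slope E (xc X) (yc X) (xc X) (yc X) = tsl X by rewrite /slope eqxx.
rewrite /hv (val_xy Y0) (val_xy X0) /numr /denr /opposite eqxx -mulr2n mulrn_eq0 /= (negPf y0) !evX s.
by [].
Qed.

Lemma tsl_flex X : X *+ 3 = 0 -> X != 0 -> tsl X ^+ 2 - xc X - xc X = xc X.
Proof.
move=> tX X0; have y0 := yc_odd_tor (isT : odd 3) tX X0.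
have e : X + X = - X by apply/eqP; rewrite -addr_eq0 -mulr2n -mulrSr tX.
have := dbl_val (val_xy X0) y0 (erefl (tsl X)); rewrite ?mulr2n e valN (val_xy X0) /= => -[e1 _].
exact: esym e1.
Qed.

Lemma ff3_val X Y : X *+ 3 = 0 -> X != 0 -> Y != 0 -> xc Y != xc X ->
  ff 3 X Y = yc Y - yc X - tsl X * (xc Y - xc X).
Proof.
move=> tX X0 Y0 ne; have y0 := yc_odd_tor (isT : odd 3) tX X0.
rewrite ff3 // hv_dbl // (hv_opp (val_xy X0) (val_xy Y0)) tsl_flex // divfK // subr_eq0 //.
Qed.

Lemma mulrn_mod3 X k : X *+ 3 = 0 -> X *+ k = X *+ (k %% 3).
Proof. by move=> t; rewrite {1}(divn_eq k 3) mulrnDr mulnC mulrnA t mul0rn add0r. Qed.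

Lemma off3 X Y : X *+ 3 = 0 -> Y != 0 -> Y != X -> Y != - X -> off X Y.
Proof.
move=> t h0 h1 h2 k; rewrite (mulrn_mod3 k t); have : (k %% 3 < 3)%N by rewrite ltn_mod.
case: (k %% 3)%N => [|[|[|//]]] _; rewrite ?mulr0n ?mulr1n //.
by rewrite (_ : X *+ 2 = - X) //; apply/eqP; rewrite -addr_eq0 -mulrSr t.
Qed.

Variables (G3 : seq (ept E)) (e : ept E -> ept E -> K).
Hypotheses (fin3 : forall P : ept E, P *+ 3 = 0 -> P \in G3) (he : is_pairing 3 e).

Section Two.
Variables Q T : ept E.
Hypotheses (tQ : Q *+ 3 = 0) (tT : T *+ 3 = 0) (Q0 : Q != 0) (T0 : T != 0) (n1 : Q != T) (n2 : Q != - T).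

Let x0 : xc T != xc Q.
Proof.
apply/eqP => h; case: (xc_eq T0 Q0 h) => h'; [by case/eqP: n1|].
by case/eqP: n2; rewrite h' opprK.
Qed.

Lemma pair3_ff : e Q T = - ff 3 Q T / ff 3 T Q.
Proof.
apply: (pair_explicit (isT : odd 3) fin3 he tQ tT); apply: off3 => //; first by rewrite eq_sym.
by rewrite -eqr_oppLR eq_sym.
Qed.

Lemma pair3_ffT : ff 3 T Q != 0.
Proof.
apply: (ff_off_neq0 (isT : odd 3) tT); exact: off3.
Qed.

Let yQ := yc_odd_tor (isT : odd 3) tQ Q0.

Lemma pair3_eq : e Q T * (yc Q - yc T - tsl T * (xc Q - xc T)) = - (yc T - yc Q - tsl Q * (xc T - xc Q)).
Proof.
have x1 : xc Q != xc T by rewrite eq_sym.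
by have := pair3_ff; have := pair3_ffT; rewrite !ff3_val // => h ->; rewrite divfK.
Qed.
End Two.

(** The tangent at T is eliminated between the formulas for e(Q, T) and for e(Q, -T) = 1 / e(Q,
    T). *)
Lemma pair3_sum Q T : Q *+ 3 = 0 -> T *+ 3 = 0 -> Q != 0 -> T != 0 -> Q != T -> Q != - T ->
  2%:R * yc Q = yc T * (e Q T - (e Q T)^-1) + (yc Q + tsl Q * (xc T - xc Q)) * (e Q T + (e Q T)^-1).
Proof.
move=> tQ tT Q0 T0 n1 n2; have h1 := pair3_eq tQ tT Q0 T0 n1 n2.
have n0 : e Q T != 0 := pair_neq0 fin3 he tQ tT.
have tT' : - T *+ 3 = 0 by rewrite mulNrn tT oppr0.
have T0' : - T != 0 by rewrite oppr_eq0.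
have n3 : Q != - - T by rewrite opprK.
have h2 := pair3_eq tQ tT' Q0 T0' n2 n3.
rewrite (pairNr fin3 he tQ tT) xcN ycN (_ : tsl (- T) = - tsl T) in h2; last first.
  by rewrite /tsl xcN ycN mulrN invrN mulrN.
move: (e Q T) n0 h1 h2 => z z0 h1 h2.
have e1 : yc T + tsl T * (xc Q - xc T) = yc Q + (yc T - yc Q - tsl Q * (xc T - xc Q)) / z.
  by apply: (mulfI z0); transitivity (z * yc Q - z * (yc Q - yc T - tsl T * (xc Q - xc T))); [ring|rewrite h1; field].
have e2 : yc T + tsl T * (xc Q - xc T) = z * (yc T + yc Q + tsl Q * (xc T - xc Q)) - yc Q.
  transitivity (z * (z^-1 * (yc Q - - yc T - - tsl T * (xc Q - xc T))) - yc Q); first by field.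
  by rewrite h2; ring.
apply/eqP; rewrite -subr_eq0; apply/eqP.
transitivity (yc T + tsl T * (xc Q - xc T) - (yc T + tsl T * (xc Q - xc T))); last by rewrite subrr.
by rewrite {1}e1 e2; field.
Qed.

(** If e were 1, [pair3_sum] would make the tangents at Q and at T horizontal; [psi3] then puts both
    abscissae at 0. *)
Lemma pair3_neq1 Q T : Q *+ 3 = 0 -> T *+ 3 = 0 -> Q != 0 -> T != 0 -> Q != T -> Q != - T -> e Q T != 1.
Proof.
move=> tQ tT Q0 T0 n1 n2; apply/eqP => e1.
have x0 : xc T != xc Q.
  by apply/eqP => h; case: (xc_eq T0 Q0 h) => h'; [case/eqP: n1|case/eqP: n2; rewrite h' opprK].
have key X Y : X *+ 3 = 0 -> Y *+ 3 = 0 -> X != 0 -> Y != 0 -> X != Y -> X != - Y -> e X Y = 1 -> xc Y != xc X -> 3%:R * xc X ^+ 2 + a = 0.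
  move=> tX tY X0 Y0 m1 m2 eXY xne; have := pair3_sum tX tY X0 Y0 m1 m2; rewrite eXY invr1 subrr mulr0 add0r.
  have y0 := yc_odd_tor (isT : odd 3) tX X0.
  have -> : (1 + 1 : K) = 2%:R by ring.
  rewrite [RHS]mulrC => /(mulfI (two_neq0 K)) /eqP; rewrite -subr_eq0 opprD addrA subrr add0r oppr_eq0 mulf_eq0 subr_eq0 (negPf xne) orbF.
  by rewrite /tsl mulf_eq0 invr_eq0 mulf_eq0 (negPf (two_neq0 K)) (negPf y0) !orbF => /eqP.
have k1 := key Q T tQ tT Q0 T0 n1 n2 e1 x0.
have k2 : 3%:R * xc T ^+ 2 + a = 0.
  apply: (key T Q) => //; [by rewrite eq_sym|by rewrite -eqr_oppLR eq_sym| |by rewrite eq_sym].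
  by rewrite (pair_sym fin3 he tQ tT) e1 invr1.
have z X : X *+ 3 = 0 -> X != 0 -> 3%:R * xc X ^+ 2 + a = 0 -> xc X = 0.
  move=> tX X0 h; have := tor3E (val_xy X0); rewrite tX eqxx => /esym; rewrite psi3E h expr0n subr0 -eq_xy //.
  have y0 := yc_odd_tor (isT : odd 3) tX X0.
  by rewrite mulf_eq0 expf_eq0 (negPf y0) andbF orbF mulf_eq0 pnatr_eq0 /= => /eqP.
by move: x0; rewrite (z Q) // (z T) // eqxx.
Qed.

Lemma pair3_N Q T : Q *+ 3 = 0 -> T *+ 3 = 0 -> Q != 0 -> T != 0 -> Q != T -> Q != - T ->
  e3N (xc Q) (xc T) = 2%:R * yc Q * yc T * (e Q T - (e Q T)^-1).
Proof.
move=> tQ tT Q0 T0 n1 n2; have h := pair3_sum tQ tT Q0 T0 n1 n2; have h1 := pair3_neq1 tQ tT Q0 T0 n1 n2.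
have n0 : e Q T != 0 := pair_neq0 fin3 he tQ tT.
have c3 := pair_unity fin3 he tQ tT; have y0 := yc_odd_tor (isT : odd 3) tQ Q0.
have ez : e Q T + (e Q T)^-1 = -1.
  have m1 : e Q T - 1 != 0 by rewrite subr_eq0.
  apply: (mulfI n0); apply: (mulfI m1); apply/eqP; rewrite -subr_eq0; apply/eqP.
  by transitivity (e Q T ^+ 3 - 1); [field|rewrite c3 subrr].
rewrite ez in h; rewrite /e3N -eq_xy //.
transitivity (2%:R * yc Q * (tsl Q * (xc T - xc Q)) + 6%:R * yc Q ^+ 2); first by rewrite /tsl; field.
transitivity (2%:R * yc Q * (yc T * (e Q T - (e Q T)^-1) + (yc Q + tsl Q * (xc T - xc Q)) * -1 + tsl Q * (xc T - xc Q) + yc Q)); last by ring.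
by rewrite -h; ring.
Qed.

Lemma theta_val C : C *+ 9 = 0 -> C *+ 3 != 0 -> theta C = (xc C - xc (C *+ 3)) * (xc (C *+ 3) - (tsl C ^+ 2 - xc C - xc C)) /
  (- yc (C *+ 3) - yc C - tsl C * (xc (C *+ 3) - xc C)).
Proof.
move=> t9 c3; have C0 : C != 0 by apply: contraNneq c3 => ->; rewrite mul0rn.
have y0 := yc_odd_tor (isT : odd 9) t9 C0.
rewrite /theta; have n0 : - (C *+ 3) != 0 by rewrite oppr_eq0.
have -> : hv (- (C *+ 3)) (C *+ 3) C = xc C - xc (C *+ 3).
  by rewrite -{2}[C *+ 3]opprK (hv_opp (val_xy n0) (val_xy C0)) xcN.
by rewrite hv_dbl // xcN ycN invf_div mulrA.
Qed.

Lemma thetaN C : C *+ 9 = 0 -> C *+ 3 != 0 -> theta (- C) = - theta C.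
Proof.
move=> t9 c3; have t9' : - C *+ 9 = 0 by rewrite mulNrn t9 oppr0.
have c3' : - C *+ 3 != 0 by rewrite mulNrn oppr_eq0.
have st : tsl (- C) = - tsl C by rewrite /tsl xcN ycN mulrN invrN mulrN.
rewrite !theta_val // mulNrn !xcN !ycN st sqrrN.
have -> : - - yc (C *+ 3) - - yc C - - tsl C * (xc (C *+ 3) - xc C) = - (- yc (C *+ 3) - yc C - tsl C * (xc (C *+ 3) - xc C)) by ring.
by rewrite invrN mulrN.
Qed.

Lemma offC C T : C *+ 9 = 0 -> C *+ 3 != 0 -> T *+ 3 = 0 -> T != 0 -> C *+ 3 != T -> C *+ 3 != - T -> forall k, T != C *+ k.
Proof.
move=> t9 c3 t3 T0 n1 n2 k; apply/eqP => eT; have t33 : C *+ 3 *+ 3 = 0 by rewrite -mulrnA.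
have d3 : (3 %| k)%N.
  rewrite /dvdn; have : C *+ 3 *+ k = 0 by rewrite mulrnAC -eT t3.
  rewrite (mulrn_mod3 _ t33); have : (k %% 3 < 3)%N by rewrite ltn_mod.
  case: (k %% 3)%N => [|[|[|//]]] _ // /eqP; first by rewrite mulr1n (negPf c3).
  by rewrite (_ : C *+ 3 *+ 2 = - (C *+ 3)) ?oppr_eq0 ?(negPf c3) //; apply/eqP; rewrite -addr_eq0 -mulrSr t33.
move: eT; rewrite -(divnK d3) mulnC mulrnA (mulrn_mod3 _ t33); have : (k %/ 3 %% 3 < 3)%N by rewrite ltn_mod.
case: (k %/ 3 %% 3)%N => [|[|[|//]]] _ eT; move: T0 n1 n2; rewrite eT ?mulr0n ?mulr1n ?eqxx //.
by rewrite (_ : C *+ 3 *+ 2 = - (C *+ 3)) ?opprK ?eqxx //; apply/eqP; rewrite -addr_eq0 -mulrSr t33.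
Qed.

(** [theta_trans] covers T outside the group generated by C. For T = 3C or -3C the translation goes
    through an auxiliary W in E[3] and T - W. *)
Lemma theta_add C T : C *+ 9 = 0 -> C *+ 3 != 0 -> T *+ 3 = 0 -> theta (C + T) = theta C * e (- (C *+ 3)) T.
Proof.
move=> t9 c3 t3.
have gen C' T' : C' *+ 9 = 0 -> C' *+ 3 != 0 -> T' *+ 3 = 0 -> T' != 0 -> C' *+ 3 != T' -> C' *+ 3 != - T' ->
    theta (C' + T') = theta C' * e (- (C' *+ 3)) T'.
  move=> u9 u3 v3 T0 n1 n2; have ind := offC u9 u3 v3 T0 n1 n2; have h := theta_trans u9 u3 v3 ind.
  have tQ : - (C' *+ 3) *+ 3 = 0 by rewrite mulNrn -mulrnA u9 oppr0.
  have Q0 : - (C' *+ 3) != 0 by rewrite oppr_eq0.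
  have m1 : - (C' *+ 3) != T' by rewrite eqr_oppLR.
  have m2 : - (C' *+ 3) != - T' by rewrite eqr_opp.
  rewrite (pair3_ff tQ v3 Q0 T0 m1 m2); rewrite (ptQ C' T') in h.
  have nf : ff 3 T' (- (C' *+ 3)) != 0 by apply: pair3_ffT.
  by apply: (mulIf nf); rewrite h -mulrA divfK // mulrC.
have tQ : - (C *+ 3) *+ 3 = 0 by rewrite mulNrn -mulrnA t9 oppr0.
have [->|T0] := eqVneq T 0; first by rewrite addr0 (pair0r fin3 he) ?mulr1.
have sp : (C *+ 3 = T \/ C *+ 3 = - T) -> theta (C + T) = theta C * e (- (C *+ 3)) T.
  move=> hC; have o2 : T *+ 2 = - T by apply/eqP; rewrite -addr_eq0 -mulrSr t3.
  have [U [V [tU tV [U0 V0 UV UV']]]] := ex_basis3 E.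
  have [W [tW W0 W1 W2]] : exists W, [/\ W *+ 3 = 0, W != 0, T != W & T != - W].
    have [eU|m1] := eqVneq T U; first by exists V; split=> //; rewrite eU.
    have [eU|m2] := eqVneq T (- U); first by exists V; split=> //; rewrite eU ?eqr_opp // eqr_oppLR.
    by exists U.
  have e1 : (C + W) *+ 3 = C *+ 3 by rewrite mulrnDl tW addr0.
  have tTW : (T - W) *+ 3 = 0 by rewrite mulrnBl t3 tW subrr.
  have -> : C + T = C + W + (T - W) by rewrite -addrA [W + _]addrC subrK.
  have g9 : (C + W) *+ 9 = 0 by rewrite (mulrnA _ 3 3) e1 -mulrnA.
  have W1' : T - W != 0 by rewrite subr_eq0.
  have exT : e (- (C *+ 3)) T = 1.
    have exx := pairxx (isT : odd 3) fin3 he t3; have tN : - T *+ 3 = 0 by rewrite mulNrn t3 oppr0.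
    by case: hC => ->; rewrite ?opprK // (pair_sym fin3 he t3 tN) (pairNr fin3 he t3 t3) exx !invr1.
  have [q1 q2] : C *+ 3 != T - W /\ C *+ 3 != - (T - W).
    case: hC => ->; split.
    - by rewrite -subr_eq0 opprB addrCA subrr addr0.
    - by rewrite opprB -subr_eq0 opprB addrA -mulr2n o2 -opprD oppr_eq0 addr_eq0.
    - by rewrite -subr_eq0 -opprD oppr_eq0 addrA -mulr2n o2 -opprD oppr_eq0 addr_eq0.
    by rewrite eqr_opp -subr_eq0 opprB addrCA subrr addr0.
  have [q3 q4] : C *+ 3 != W /\ C *+ 3 != - W by case: hC => ->; split; rewrite ?eqr_opp // eqr_oppLR.
  rewrite gen ?e1 // gen // exT -mulrA -(pairDr fin3 he) // [W + _]addrC subrK exT //.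
have [n1|n1] := eqVneq (C *+ 3) T; first by apply: sp; left.
have [n2|n2] := eqVneq (C *+ 3) (- T); first by apply: sp; right.
exact: gen.
Qed.

End ThreePairing.

Section ThetaMore.
Variables (K : numClosedFieldType) (E : ecurve K).
Implicit Types (C T : ept E).

Lemma ex_indep9 C : C *+ 9 = 0 -> C *+ 3 != 0 -> exists T, T *+ 3 = 0 /\ forall k, T != C *+ k.
Proof.
move=> t9 c3; have [U [V [tU tV [U0 V0 UV UV']]]] := ex_basis3 E.
have [e1|n1] := eqVneq (C *+ 3) U.
  by exists V; split=> //; apply: offC => //; rewrite e1.
have [e1|n2] := eqVneq (C *+ 3) (- U); last by exists U; split=> //; apply: offC.
by exists V; split=> //; apply: offC => //; rewrite e1 ?eqr_opp // eqr_oppLR.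
Qed.

Lemma theta_cubed C : C *+ 9 = 0 -> C *+ 3 != 0 -> theta C ^+ 3 = - (2%:R * yc (C *+ 3)).
Proof.
move=> t9 c3; have [T [tT iT]] := ex_indep9 t9 c3.
have n0 : - (C *+ 3) != 0 by rewrite oppr_eq0.
have := theta_cube t9 c3 tT iT; rewrite ptQ => /(_ _ _ (val_xy n0)) ->.
by rewrite ycN mulrN.
Qed.

Lemma pair_lc n (G : seq (ept E)) (e : ept E -> ept E -> K) (on : odd n) (fin : forall P : ept E, P *+ n = 0 -> P \in G) (he : is_pairing n e)
  (U V : ept E) (tU : U *+ n = 0) (tV : V *+ n = 0) r s :
  e (lc U V r) (lc U V s) = e U V ^+ (r.1 * s.2) / e U V ^+ (r.2 * s.1).
Proof.
have tm (X : ept E) i : X *+ n = 0 -> X *+ i *+ n = 0 by move=> t; rewrite mulrnAC t mul0rn.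
have ta (X Y : ept E) : X *+ n = 0 -> Y *+ n = 0 -> (X + Y) *+ n = 0 by move=> tX tY; rewrite mulrnDl tX tY addr0.
have eD := pairDr fin he. have eDl := pairDl fin he. have eM := pairMr fin he. have eMl := pairMl fin he.
have exx := pairxx on fin he.
rewrite /lc eDl ?eD ?eM ?eMl ?ta ?tm // !exx // !expr1n (pair_sym fin he tU tV) -!exprM.
by rewrite mul1r mulr1 exprVn.
Qed.

Lemma pair9_3 (G9 G3 : seq (ept E)) (e9 e3 : ept E -> ept E -> K) (f9 : forall P : ept E, P *+ 9 = 0 -> P \in G9) (h9 : is_pairing 9 e9)
  (f3 : forall P : ept E, P *+ 3 = 0 -> P \in G3) (h3 : is_pairing 3 e3) C T : C *+ 9 = 0 -> C *+ 3 != 0 -> T *+ 3 = 0 -> T != 0 ->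
  C *+ 3 != T -> C *+ 3 != - T -> e9 C T = e3 (C *+ 3) T.
Proof.
move=> t9 c3 t3 T0 n1 n2.
have t9' : - C *+ 9 = 0 by rewrite mulNrn t9 oppr0.
have c3' : - C *+ 3 != 0 by rewrite mulNrn oppr_eq0.
have ind := offC t9' c3' t3 T0; rewrite mulNrn eqr_opp eqr_oppLR in ind.
have := pair9 t9' c3' t3 (ind n2 n1) f9 h9; rewrite opprK => ->.
rewrite ptQ mulNrn opprK (pair3_ff f3 h3) //.
by rewrite -mulrnA.
Qed.
End ThetaMore.

Section ThetaGal.
Variables (a b : rat) (h : 4%:R * a ^+ 3 + 27%:R * b ^+ 2 != 0).
Local Notation E := (ratecurve h).
Implicit Types (C T P Q : ept E) (s : {rmorphism algC -> algC}).

Lemma galp0 s : galp s (0 : ept E) = 0. Proof. by rewrite /galp tr0. Qed.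
Lemma galp_eq0 s P : (galp s P == 0) = (P == 0).
Proof. by rewrite -(galp0 s) (inj_eq (@galp_inj _ _ h s)). Qed.

Lemma theta_gal s C : C *+ 9 = 0 -> C *+ 3 != 0 -> theta (galp s C) = s (theta C).
Proof.
move=> t9 c3; have t9' : galp s C *+ 9 = 0 by rewrite -galpMn t9 galp0.
have c3' : galp s C *+ 3 != 0 by rewrite -galpMn galp_eq0.
have ts : tsl (galp s C) = s (tsl C).
  have ee : s (ea E) = ea E := fmorph_rat s a.
  rewrite /tsl !xc_gal !yc_gal; move: (xc C) (yc C) (ea E) ee => x y w ee.
  by rewrite fmorph_div !(rmorph_nat, rmorphXn, rmorphM, rmorphD) ee.
rewrite !theta_val // -galpMn !xc_gal !yc_gal ts.
move: (tsl C) (xc C) (yc C) (xc (C *+ 3)) (yc (C *+ 3)) => l x y z w.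
by rewrite fmorph_div !(rmorphXn, rmorphM, rmorphB, rmorphN).
Qed.

Lemma pair_gal n (G : seq (ept E)) (e : ept E -> ept E -> algC) (fin : forall P : ept E, P *+ n = 0 -> P \in G) (he : is_pairing n e) s P Q :
  odd n -> P *+ n = 0 -> Q *+ n = 0 -> e (galp s P) (galp s Q) = s (e P Q).
Proof.
move=> on tP tQ; have [S [T g]] := ex_generic fin; have [nS nT g1 g2] := g.
have ntz (X : ept E) : X *+ n != 0 -> X != 0 by apply: contraNneq => ->; rewrite mul0rn.
have ntz2 (X Y : ept E) : X *+ n = 0 -> Y *+ n != 0 -> X + Y != 0.
  by move=> tX nY; apply: ntz; rewrite mulrnDl tX add0r.
have g' : generic n (galp s S) (galp s T) by apply: (generic_tr (oner_neq0 _)).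
rewrite (he _ _ _ _ _ _ g') -?galpMn ?tP ?tQ ?galp0 // (he _ _ _ _ tP tQ g).
exact: (@wpv_tr _ E E s 1 (oner_neq0 _) (gal_a h s) (gal_b h s) n P Q S T (ntz _ nT) (ntz _ nS) (ntz2 _ _ tQ nT) (ntz2 _ _ tP nS)).
Qed.
End ThetaGal.

End ThetaGalois.

(** * The anti-isometry on E[3] built from abscissae *)

Module ThreeTorsionMap.
Import CurveRing PointIdeals CocycleLaw CurveGroup Reciprocity MillerFunctions TorsionPairing ExplicitPairing ThetaFunction TorsionStructure Transport AlmostEverywhere Isogenies GaloisAction ThetaGalois.

Section Aux9.
Variables (K : numClosedFieldType) (E F : ecurve K).

Lemma lc_cong n (U V : ept E) (X Y : ept F) r s : (0 < n)%N -> U *+ n = 0 -> V *+ n = 0 -> X *+ n = 0 -> Y *+ n = 0 -> indep2 n U V ->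
  lc U V r = lc U V s -> lc X Y r = lc X Y s.
Proof.
move=> n0 tU tV tX tY ind exy.
have mm (A : ept F) k : A *+ n = 0 -> A *+ k = A *+ (k %% n).
  by move=> e; rewrite {1}(divn_eq k n) mulrnDr mulnC mulrnA e mul0rn add0r.
have /ind /andP[/= d1 d2] : lc U V (r.1 + n.-1 * s.1, r.2 + n.-1 * s.2)%N = 0.
  have n6 := @lcN _ E n U V n0 tU tV s; rewrite -[LHS](lcD U V r (n.-1 * s.1, n.-1 * s.2)%N) -n6 exy subrr //.
have cg i j : (n %| i + n.-1 * j)%N -> (i %% n = j %% n)%N.
  move=> d; have e : (i + n * j = (i + n.-1 * j) + j)%N by rewrite -{1}(prednK n0) mulSn; clear; lia.
  by rewrite -[LHS](modnMDl j) addnC mulnC e -modnDml; move/eqP: d => ->.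
by rewrite /lc (mm X r.1) // (mm Y r.2) // (cg _ _ d1) (cg _ _ d2) -!mm.
Qed.

Lemma cube_roots (z w : K) : z ^+ 3 = 1 -> z != 1 -> w ^+ 3 = 1 -> exists2 k : nat, (k < 3)%N & w * z ^+ k = 1.
Proof.
move=> z3 z1 w3; have z0 : z != 0 by apply/eqP => e; move: z3; rewrite e expr0n => /esym/eqP; rewrite oner_eq0.
have e0 : z ^+ 2 + z + 1 = 0.
  have m1 : z - 1 != 0 by rewrite subr_eq0.
  by apply: (mulfI m1); rewrite mulr0; transitivity (z ^+ 3 - 1); [ring | rewrite z3 subrr].
have : (w - 1) * (w - z) * (w - z ^+ 2) = 0.
  transitivity (w ^+ 3 - z ^+ 3 - (z ^+ 2 + z + 1) * w ^+ 2 + z * (z ^+ 2 + z + 1) * w); first by ring.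
  by rewrite e0 w3 z3; ring.
move/eqP; rewrite !mulf_eq0 !subr_eq0 => /orP[/orP[]|] /eqP ->.
- by exists 0%N; rewrite ?expr0 ?mulr1.
- by exists 2%N; rewrite // -exprS.
by exists 1%N; rewrite // -exprSr.
Qed.

End Aux9.

Lemma real_cube_root1 (x : algC) : conjA x = x -> x ^+ 3 = 1 -> x = 1.
Proof.
move=> /CrealP rx x3; apply/eqP; rewrite -subr_eq0; have : (x - 1) * (x ^+ 2 + x + 1) == 0.
  by apply/eqP; transitivity (x ^+ 3 - 1); [ring | rewrite x3 subrr].
rewrite mulf_eq0 => /orP[] // /eqP e; exfalso.
have h2 : (2%:R : algC) \is Num.real by exact: realn.
have p : 0 <= (2%:R * x + 1) ^+ 2 by apply: real_exprn_even_ge0; rewrite // realD ?realM ?real1.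
have : (2%:R * x + 1) ^+ 2 = - 3%:R by transitivity (4%:R * (x ^+ 2 + x + 1) - 3%:R); [ring | rewrite e mulr0 sub0r].
by move=> e2; move: p; rewrite e2 oppr_ge0 lern0.
Qed.

Section Lift.
Variables (a b : rat) (h : 4%:R * a ^+ 3 + 27%:R * b ^+ 2 != 0).
Local Notation E := (ratecurve h).
Local Notation cj := (@galp _ _ h conjA).

(** Sum or difference of a preimage of T and its conjugate, times 5: this lies over 10 T = T. *)
Lemma lift_conj (T : ept E) : T *+ 3 = 0 -> (cj T = T -> exists2 C, C *+ 3 = T & cj C = C) /\ (cj T = - T -> exists2 C, C *+ 3 = T & cj C = - C).
Proof.
move=> t3; have [D eD] := tripling T; have c3 : cj D *+ 3 = cj T by rewrite -galpMn eD.
have t10 : T *+ 2 *+ 5 = T by rewrite -mulrnA (_ : (2 * 5 = 3 * 3 + 1)%N) // mulrnDr mulrnA t3 mul0rn add0r.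
split=> hT.
  exists ((D + cj D) *+ 5); last by rewrite galpMn galpD galp_conjK addrC.
  have e3 : (D + cj D) *+ 3 = T *+ 2 by rewrite mulrnDl eD c3 hT mulr2n.
  by rewrite mulrnAC e3 t10.
exists ((D - cj D) *+ 5); last by rewrite galpMn galpD galpN galp_conjK -mulNrn opprB addrC.
have e3 : (D - cj D) *+ 3 = T *+ 2 by rewrite mulrnBl eD c3 hT opprK mulr2n.
by rewrite mulrnAC e3 t10.
Qed.
End Lift.

Section PhiBar.
Variables (a b a' b' : rat) (h : 4%:R * a ^+ 3 + 27%:R * b ^+ 2 != 0) (h' : 4%:R * a' ^+ 3 + 27%:R * b' ^+ 2 != 0).
Local Notation E := (ratecurve h).
Local Notation E' := (ratecurve h').
(** u runs over the four elements of [us], [qf] and [qf'] give abscissae of corresponding 3-torsion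
    points, and [al] will be the cube root of 4 y y'. Through [pair3_N], [nn] says that the
    correspondence inverts e_3. *)
Variables (qf qf' al : algC -> algC) (gr : algC -> Prop) (us : seq algC).
Hypotheses (sq : forall (s : {rmorphism algC -> algC}) x, s (qf x) = qf (s x))
  (sq' : forall (s : {rmorphism algC -> algC}) x, s (qf' x) = qf' (s x))
  (sal : forall (s : {rmorphism algC -> algC}) x, s (al x) = al (s x))
  (sgr : forall (s : {rmorphism algC -> algC}) x, gr x -> gr (s x)).
Hypotheses (usu : uniq us) (sz : size us = 4%N) (usg : forall u, u \in us -> gr u).
Hypotheses (p3 : forall u, gr u -> (psi3 E).[qf u] = 0) (p3' : forall u, gr u -> (psi3 E').[qf' u] = 0)
  (prod : forall u, gr u -> 16%:R * ecub E (qf u) * ecub E' (qf' u) = al u ^+ 6) (al0 : forall u, gr u -> al u != 0)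
  (nn : forall u v, gr u -> gr v -> u != v -> 4%:R * e3N E (qf u) (qf v) * e3N E' (qf' u) (qf' v) = 3%:R * al u ^+ 3 * al v ^+ 3).

Lemma fin3_ex (K : numClosedFieldType) (F : ecurve K) : exists G3 : seq (ept F), forall P : ept F, P *+ 3 = 0 -> P \in G3.
Proof.
have [U [V [tU tV [U0 V0 n1 n2]]]] := ex_basis3 F.
exact: (@span_fin _ F 3 U V isT tU tV (span3 tU tV U0 V0 n1 n2)).
Qed.

Lemma e3N_anti (K : numClosedFieldType) (F : ecurve K) x z : (psi3 F).[x] = 0 -> (psi3 F).[z] = 0 -> x != z -> e3N F x z = - e3N F z x.
Proof.
move=> hx hz n; have [P [y [eP _]]] := ex_pt F x; have [Q [w [eQ _]]] := ex_pt F z.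
have tP : P *+ 3 = 0 by apply/eqP; rewrite (tor3E eP) hx.
have tQ : Q *+ 3 = 0 by apply/eqP; rewrite (tor3E eQ) hz.
have P0 : P != 0 by apply/eqP => e; rewrite e in eP.
have Q0 : Q != 0 by apply/eqP => e; rewrite e in eQ.
have ex : xc P = x by rewrite /xc eP. have ez : xc Q = z by rewrite /xc eQ.
have n1 : P != Q by apply: contraNneq n => e; rewrite -ex -ez e.
have n2 : P != - Q by apply: contraNneq n => e; rewrite -ex -ez e xcN.
have n1' : Q != P by rewrite eq_sym. have n2' : Q != - P by rewrite -eqr_oppLR eq_sym.
have [G hG] := fin3_ex F; have [e he] := ex_pairing (isT : odd 3) hG.
rewrite -ex -ez !(pair3_N hG he) // (pair_sym hG he tP tQ) invrK; ring.
Qed.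

(** A coincidence on one curve only makes the left side of [nn] antisymmetric in u and v, while its
    right side is symmetric; a coincidence on both contradicts [prod]. *)
Lemma qf_inj2 u v : gr u -> gr v -> u != v -> qf u != qf v /\ qf' u != qf' v.
Proof.
move=> gu gv n; have n' : v != u by rewrite eq_sym.
have h1 := nn gu gv n; have h2 := nn gv gu n'.
have au := expf_neq0 3 (al0 gu); have av := expf_neq0 3 (al0 gv).
have e6 (F : ecurve algC) x : e3N F x x = 6%:R * ecub F x by rewrite /e3N subrr mulr0 add0r.
have k6 : (6%:R : algC) * al u ^+ 3 * al v ^+ 3 != 0 by apply: mulf_neq0 => //; apply: mulf_neq0 => //; rewrite pnatr_eq0.
have bad : 3%:R * al u ^+ 3 * al v ^+ 3 = - (3%:R * al v ^+ 3 * al u ^+ 3) -> False.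
  move=> e; case/eqP: k6; transitivity (3%:R * al u ^+ 3 * al v ^+ 3 + 3%:R * al v ^+ 3 * al u ^+ 3); first by ring.
  by rewrite e addNr.
have nq : qf u != qf v.
  apply/eqP => e; have [e'|ne'] := eqVneq (qf' u) (qf' v).
    have q1 := prod gu; have q2 := prod gv; move: h1; rewrite -e -e' !e6 => h1.
    have q3 : al u ^+ 6 = al v ^+ 6 by rewrite -q1 -q2 e e'.
    have q4 : 9%:R * al u ^+ 6 = 3%:R * al u ^+ 3 * al v ^+ 3 by rewrite -h1 -q1; ring.
    have q5 : 3%:R * al u ^+ 3 = al v ^+ 3.
      have t3 : (3%:R : algC) != 0 by rewrite pnatr_eq0.
      by apply: (mulfI (mulf_neq0 t3 au)); rewrite -q4; ring.
    have q6 : (8%:R : algC) * al u ^+ 6 = 0.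
      by transitivity ((3%:R * al u ^+ 3) ^+ 2 - al u ^+ 6); [ring | rewrite q5 q3; ring].
    by move/eqP: q6; rewrite mulf_eq0 pnatr_eq0 expf_eq0 (negPf (al0 gu)).
  apply: bad; rewrite -h1 -h2 -e (e3N_anti (p3' gu) (p3' gv) ne'); ring.
split=> //; apply/eqP => e; apply: bad; rewrite -h1 -h2 -e (e3N_anti (p3 gu) (p3 gv) nq); ring.
Qed.

Lemma qf_surj x : (psi3 E).[x] = 0 -> exists u, gr u /\ qf u = x.
Proof.
move=> hx; have [/mapP[u hu ->]|nx] := boolP (x \in [seq qf u | u <- us]); first by exists u; split=> //; exact: usg.
have [sp cp] := top_psi3 E; have p0 : psi3 E != 0 by apply: (top_neq0 (top_psi3 E)); rewrite pnatr_eq0.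
have := max_poly_roots p0 (rs := x :: [seq qf u | u <- us]).
rewrite /= size_map sz => k; suff : (5 < 5)%N by [].
apply: leq_trans sp; apply: k.
  rewrite rootE hx eqxx; apply/allP => _ /mapP[u hu ->]; apply/eqP; exact: p3 (usg hu).
rewrite nx map_inj_in_uniq // => u v hu hv e; apply/eqP; apply/negPn/negP => n.
by have [] := qf_inj2 (usg hu) (usg hv) n; rewrite e eqxx.
Qed.

(** The ordinate of the image is al^3 / (4 y): [prod] puts this point on the second curve, and the
    formula makes the map odd. *)
Lemma ex_phibar : exists (uu : algC -> algC) (phib : ept E -> ept E'),
  [/\ forall P : ept E, P *+ 3 = 0 -> P != 0 -> gr (uu (xc P)) /\ qf (uu (xc P)) = xc P,
      phib 0 = 0,
      forall P : ept E, P *+ 3 = 0 -> P != 0 -> [/\ phib P *+ 3 = 0, phib P != 0, xc (phib P) = qf' (uu (xc P)) &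
         4%:R * yc P * yc (phib P) = al (uu (xc P)) ^+ 3],
      forall (s : {rmorphism algC -> algC}) (P : ept E), P *+ 3 = 0 -> P != 0 -> uu (xc (galp s P)) = s (uu (xc P)) &
      forall P : ept E, P *+ 3 = 0 -> phib (- P) = - phib P].
Proof.
have hx0 x : exists u, (psi3 E).[x] = 0 -> gr u /\ qf u = x.
  case: (boolp.pselect ((psi3 E).[x] = 0)) => [/qf_surj[u hu]|n]; [by exists u | by exists 0].
have [uu huu] := boolp.choice hx0.
have px (P : ept E) : P *+ 3 = 0 -> P != 0 -> (psi3 E).[xc P] = 0.
  by move=> t /val_xy eP; apply/eqP; rewrite -(tor3E eP) t.
have hu (P : ept E) : P *+ 3 = 0 -> P != 0 -> gr (uu (xc P)) /\ qf (uu (xc P)) = xc P by move=> t P0; apply: huu; exact: px.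
have y0 (P : ept E) : P *+ 3 = 0 -> P != 0 -> yc P != 0 by move=> t; exact: (yc_odd_tor (isT : odd 3)).
have hp0 (P : ept E) : exists P' : ept E', (P = 0 -> P' = 0) /\ (P *+ 3 = 0 -> P != 0 -> val P' = Some (qf' (uu (xc P)), al (uu (xc P)) ^+ 3 / (4%:R * yc P))).
  have [->|P0] := eqVneq P 0; first by exists 0.
  have [t|t] := eqVneq (P *+ 3) 0; last by exists 0; split=> // /eqP; rewrite (negPf t).
  have o : onc E' (Some (qf' (uu (xc P)), al (uu (xc P)) ^+ 3 / (4%:R * yc P))).
    rewrite oncE; have [g e] := hu P t P0; have := prod g; rewrite e -eq_xy // => pr; have yP := y0 P t P0.
    apply/eqP; transitivity (al (uu (xc P)) ^+ 6 / (16%:R * yc P ^+ 2)); first by field.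
    by rewrite -pr; field.
  pose P' : ept E' := exist _ (Some (qf' (uu (xc P)), al (uu (xc P)) ^+ 3 / (4%:R * yc P))) o; exists P'; split; [by move=> e; case/eqP: P0 | by []].
have [phib hphib] := boolp.choice hp0.
have pv (P : ept E) : P *+ 3 = 0 -> P != 0 -> [/\ phib P *+ 3 = 0, phib P != 0, xc (phib P) = qf' (uu (xc P)) &
         4%:R * yc P * yc (phib P) = al (uu (xc P)) ^+ 3].
  move=> t P0; have [_ /(_ t P0) e] := hphib P; have [g _] := hu P t P0; split.
  - by apply/eqP; rewrite (tor3E e) p3'.
  - by apply/eqP => z; rewrite z in e.
  - by rewrite /xc e.
  by rewrite /yc e -/(yc P); have yP := y0 P t P0; field.
exists uu, phib; split=> //; first by have [-> //] := hphib 0.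
  move=> s P t P0; have t' : galp s P *+ 3 = 0 by rewrite -galpMn t galp0.
  have P0' : galp s P != 0 by rewrite galp_eq0.
  have [g e] := hu P t P0; have [g' e'] := hu _ t' P0'; have gs := sgr s g.
  apply/eqP; apply/negPn/negP => n; have [ne _] := qf_inj2 g' gs n; case/eqP: ne.
  by rewrite e' -sq e xc_gal.
move=> P t; have [->|P0] := eqVneq P 0; first by have [-> //] := hphib 0; rewrite ?oppr0; have [-> //] := hphib 0.
have t' : - P *+ 3 = 0 by rewrite mulNrn t oppr0.
have P0' : - P != 0 by rewrite oppr_eq0.
have [_ /(_ t P0) e] := hphib P; have [_ /(_ t' P0') e'] := hphib (- P).
by apply: val_inj; rewrite valN e e' xcN ycN /= mulrN invrN mulrN.
Qed.

End PhiBar.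

End ThreeTorsionMap.

(** * Lifting the anti-isometry from E[3] to E[9] *)

Module ReverseNine.
Import CurveRing PointIdeals CocycleLaw CurveGroup Reciprocity MillerFunctions TorsionPairing ExplicitPairing ThetaFunction TorsionStructure Transport AlmostEverywhere Isogenies GaloisAction TwistThree ThetaGalois ThreeTorsionMap.

Section Reverse9.
Variables (a b a' b' : rat) (h : 4%:R * a ^+ 3 + 27%:R * b ^+ 2 != 0) (h' : 4%:R * a' ^+ 3 + 27%:R * b' ^+ 2 != 0).
Local Notation E := (ratecurve h).
Local Notation E' := (ratecurve h').
Variables (qf qf' al : algC -> algC) (gr : algC -> Prop) (us : seq algC).
Hypotheses (sq : forall (s : {rmorphism algC -> algC}) x, s (qf x) = qf (s x))
  (sq' : forall (s : {rmorphism algC -> algC}) x, s (qf' x) = qf' (s x))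
  (sal : forall (s : {rmorphism algC -> algC}) x, s (al x) = al (s x))
  (sgr : forall (s : {rmorphism algC -> algC}) x, gr x -> gr (s x)).
Hypotheses (usu : uniq us) (sz : size us = 4%N) (usg : forall u, u \in us -> gr u).
Hypotheses (p3 : forall u, gr u -> (psi3 E).[qf u] = 0) (p3' : forall u, gr u -> (psi3 E').[qf' u] = 0)
  (prod : forall u, gr u -> 16%:R * ecub E (qf u) * ecub E' (qf' u) = al u ^+ 6) (al0 : forall u, gr u -> al u != 0)
  (nn : forall u v, gr u -> gr v -> u != v -> 4%:R * e3N E (qf u) (qf v) * e3N E' (qf' u) (qf' v) = 3%:R * al u ^+ 3 * al v ^+ 3).

Theorem reverse9 : reverse_congruent 9 (ratcurve h) (ratcurve h').
Proof.
have [uu [phib [huu phi0 hphi ugal phiN]]] := ex_phibar sq sgr usu sz usg p3 p3' prod al0 nn.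
have inj2 := qf_inj2 p3 p3' prod al0 nn.
pose A (P : ept E) := al (uu (xc P)).
have odd3 : odd 3 := isT. have odd9 : odd 9 := isT.
have y30 (P : ept E) : P *+ 3 = 0 -> P != 0 -> yc P != 0 by exact: yc_odd_tor.
have gt s (P : ept E) n : P *+ n = 0 -> galp s P *+ n = 0 by move=> t; rewrite -galpMn t galp0.
have gt' s (P : ept E') n : P *+ n = 0 -> galp s P *+ n = 0 by move=> t; rewrite -galpMn t galp0.
have galA s P : P *+ 3 = 0 -> P != 0 -> A (galp s P) = s (A P) by move=> t P0; rewrite /A ugal // sal.
have A0 P : P *+ 3 = 0 -> P != 0 -> A P != 0 by move=> t P0; apply: al0; have [] := huu P t P0.
have phigal s (P : ept E) : P *+ 3 = 0 -> phib (galp s P) = galp s (phib P).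
  move=> t; have [->|P0] := eqVneq P 0; first by rewrite galp0 phi0 galp0.
  have gP0 : galp s P != 0 by rewrite galp_eq0.
  have [t1 m1 ex1 ey1] := hphi P t P0; have [t2 m2 ex2 ey2] := hphi _ (gt s _ _ t) gP0.
  have m3 : galp s (phib P) != 0 by rewrite galp_eq0.
  apply: val_inj; rewrite (val_xy m2) (val_xy m3); congr (Some (_, _)); first by rewrite [in RHS]xc_gal ex1 ex2 ugal // sq'.
  have y0 : 4%:R * yc (galp s P) != 0 by apply: mulf_neq0; [rewrite pnatr_eq0 | apply: y30 => //; exact: gt].
  apply: (mulfI y0); rewrite ey2 ugal // -sal -rmorphXn -ey1 !yc_gal !rmorphM rmorph_nat //.
have [G3 f3] := fin3_ex E; have [G3' f3'] := fin3_ex E'.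
have [e3 he3] := ex_pairing odd3 f3; have [e3' he3'] := ex_pairing odd3 f3'.
have xne (K : numClosedFieldType) (F : ecurve K) (Q T : ept F) : Q != 0 -> T != 0 -> Q != T -> Q != - T -> xc Q != xc T.
  by move=> Q0 T0 m1 m2; apply/eqP => /(xc_eq Q0 T0) [] /eqP; rewrite ?(negPf m1) ?(negPf m2).
have pne (Q T : ept E) : Q *+ 3 = 0 -> T *+ 3 = 0 -> Q != 0 -> T != 0 -> Q != T -> Q != - T -> [/\ uu (xc Q) != uu (xc T), phib Q != phib T & phib Q != - phib T].
  move=> tQ tT Q0 T0 m1 m2; have [g1 k1] := huu Q tQ Q0; have [g2 k2] := huu T tT T0.
  have nu : uu (xc Q) != uu (xc T) by apply: contraNneq (xne _ _ _ _ Q0 T0 m1 m2) => e; rewrite -k1 -k2 e.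
  have [_ nq] := inj2 _ _ g1 g2 nu; have [_ _ ex1 _] := hphi Q tQ Q0; have [_ _ ex2 _] := hphi T tT T0.
  by split=> //; apply: contraNneq nq => e; rewrite -ex1 -ex2 e ?xcN.
(* For primitive cube roots of unity z and w, [nn] gives (z - 1/z) (w - 1/w) = 3; it would be -3 for
   w = z, so w = 1/z. *)
have anti (Q T : ept E) : Q *+ 3 = 0 -> T *+ 3 = 0 -> Q != 0 -> T != 0 -> Q != T -> Q != - T -> e3' (phib Q) (phib T) = (e3 Q T)^-1.
  move=> tQ tT Q0 T0 m1 m2; have [nu m3 m4] := pne _ _ tQ tT Q0 T0 m1 m2.
  have [g1 k1] := huu Q tQ Q0; have [g2 k2] := huu T tT T0.
  have [tQ' Q0' exQ eyQ] := hphi Q tQ Q0; have [tT' T0' exT eyT] := hphi T tT T0.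
  have := nn g1 g2 nu; rewrite k1 k2 -exQ -exT (pair3_N f3 he3) // (pair3_N f3' he3') // -eyQ -eyT.
  have z0 : e3 Q T != 0 := pair_neq0 f3 he3 tQ tT; have w0 : e3' (phib Q) (phib T) != 0 := pair_neq0 f3' he3' tQ' tT'.
  have z3 := pair_unity f3 he3 tQ tT; have w3 := pair_unity f3' he3' tQ' tT'.
  have z1 := pair3_neq1 f3 he3 tQ tT Q0 T0 m1 m2; have w1 := pair3_neq1 f3' he3' tQ' tT' Q0' T0' m3 m4.
  have yy : 16%:R * (yc Q * yc T * yc (phib Q) * yc (phib T)) != 0.
    by apply: mulf_neq0; [rewrite pnatr_eq0 | rewrite !mulf_neq0 // ?y30 // (yc_odd_tor odd3)].
  move: (e3 Q T) (e3' (phib Q) (phib T)) z0 w0 z3 w3 z1 w1 => z w z0 w0 z3 w3 z1 w1 e.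
  have e1 : (z - z^-1) * (w - w^-1) = 3%:R.
    apply: (mulfI yy); transitivity (4%:R * (2%:R * yc Q * yc T * (z - z^-1)) * (2%:R * yc (phib Q) * yc (phib T) * (w - w^-1))); first by ring.
    by rewrite e; ring.
  have s0 (x : algC) : x ^+ 3 = 1 -> x != 1 -> x ^+ 2 + x + 1 = 0.
    move=> x3 x1; have m : x - 1 != 0 by rewrite subr_eq0.
    by apply: (mulfI m); rewrite mulr0; transitivity (x ^+ 3 - 1); [ring | rewrite x3 subrr].
  have zi : z^-1 = z ^+ 2 by apply: (mulfI z0); rewrite mulfV // -exprS z3.
  have wi : w^-1 = w ^+ 2 by apply: (mulfI w0); rewrite mulfV // -exprS w3.
  have : (w - z) * (w - z ^+ 2) = 0.
    transitivity ((w ^+ 2 + w + 1) - w * (z ^+ 2 + z + 1) + (z ^+ 3 - 1)); first by ring.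
    by rewrite !s0 // z3; ring.
  move/eqP; rewrite mulf_eq0 !subr_eq0 => /orP[] /eqP ew; last by rewrite zi ew.
  exfalso; rewrite ew in e1; rewrite zi in e1.
  have e2 : (z - z ^+ 2) * (z - z ^+ 2) = - 3%:R.
    transitivity ((z ^+ 2 + z + 1) - 3%:R + (z ^+ 3 - 1) * (z - 2%:R)); first by ring.
    by rewrite s0 // z3; ring.
  have ezz : (z - z ^+ 2) * (z - z ^+ 2) = 3%:R := e1.
  have : (6%:R : algC) = 0 by transitivity (3%:R - - 3%:R : algC); [ring | rewrite -e2 ezz subrr].
  by apply/eqP; rewrite pnatr_eq0.
have [T1 [T2 [t1 t2 c1 c2 [n1 n2 n3 n4]]]] := conj_basis3 h.
have [x1t x10 _ _] := hphi _ t1 n1; have [x2t x20 _ _] := hphi _ t2 n2; have [_ n3' n4'] := pne _ _ t1 t2 n1 n2 n3 n4.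
set X1 := phib T1 in x1t x10 n3' n4' *; set X2 := phib T2 in x2t x20 n3' n4' *.
have ind := indep3 t1 t2 n1 n2 n3 n4; have sp := span3 t1 t2 n1 n2 n3 n4.
have ind' := indep3 x1t x2t x10 x20 n3' n4'; have sp' := span3 x1t x2t x10 x20 n3' n4'.
have lcT := @lc_mod _ E 3 T1 T2 t1 t2; have lcX := @lc_mod _ E' 3 X1 X2 x1t x2t.
have o2 (V : zmodType) (P : V) : P *+ 3 = 0 -> P *+ 2 = - P by move=> t; apply/eqP; rewrite -addr_eq0 -mulrSr t.
have z1 := pair3_neq1 f3 he3 t1 t2 n1 n2 n3 n4; have z3 := pair_unity f3 he3 t1 t2.
have wz := anti _ _ t1 t2 n1 n2 n3 n4; rewrite -/X1 -/X2 in wz.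
have z0 : e3 T1 T2 != 0 := pair_neq0 f3 he3 t1 t2.
have w1 : e3' X1 X2 != 1 by rewrite wz invr_eq1. have w3 : e3' X1 X2 ^+ 3 = 1 := pair_unity f3' he3' x1t x2t.
have w0 : e3' X1 X2 != 0 := pair_neq0 f3' he3' x1t x2t.
have lcN3 r : - lc T1 T2 r = lc T1 T2 (2 * r.1, 2 * r.2)%N by exact: (@lcN _ E 3 T1 T2 isT t1 t2).
have lcN3' r : - lc X1 X2 r = lc X1 X2 (2 * r.1, 2 * r.2)%N by exact: (@lcN _ E' 3 X1 X2 isT x1t x2t).
have tlc r : lc T1 T2 r *+ 3 = 0 by rewrite /lc mulrnDl mulrnAC t1 mul0rn mulrnAC t2 mul0rn addr0.
have tlc' r : lc X1 X2 r *+ 3 = 0 by rewrite /lc mulrnDl mulrnAC x1t mul0rn mulrnAC x2t mul0rn addr0.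
have nzT r : ~~ ((3 %| r.1) && (3 %| r.2))%N -> lc T1 T2 r != 0 by apply: contra => /eqP /ind.
have neT r s : ~~ ((3 %| r.1 + 2 * s.1) && (3 %| r.2 + 2 * s.2))%N -> lc T1 T2 r != lc T1 T2 s.
  by apply: contra => /eqP; exact: lc_eq3.
have antiL r s : ~~ ((3 %| r.1) && (3 %| r.2))%N -> ~~ ((3 %| s.1) && (3 %| s.2))%N -> ~~ ((3 %| r.1 + 2 * s.1) && (3 %| r.2 + 2 * s.2))%N ->
    ~~ ((3 %| r.1 + 2 * (2 * s.1)) && (3 %| r.2 + 2 * (2 * s.2)))%N ->
    e3' (phib (lc T1 T2 r)) (phib (lc T1 T2 s)) = (e3 T1 T2 ^+ (r.1 * s.2) / e3 T1 T2 ^+ (r.2 * s.1))^-1.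
  move=> k1 k2 k3 k4; rewrite anti ?tlc ?nzT ?neT //; last by rewrite lcN3 neT.
  by rewrite (pair_lc odd3 f3 he3 t1 t2).
have d10 : T1 = lc T1 T2 (1, 0)%N by rewrite /lc /= mulr1n mulr0n addr0.
have d01 : T2 = lc T1 T2 (0, 1)%N by rewrite /lc /= mulr1n mulr0n add0r.
have d10' : X1 = lc X1 X2 (1, 0)%N by rewrite /lc /= mulr1n mulr0n addr0.
have d01' : X2 = lc X1 X2 (0, 1)%N by rewrite /lc /= mulr1n mulr0n add0r.
have pairX r s : e3' (lc X1 X2 r) (lc X1 X2 s) = e3' X1 X2 ^+ (r.1 * s.2) / e3' X1 X2 ^+ (r.2 * s.1) by exact: (pair_lc odd3 f3' he3' x1t x2t).
have pairT r s : e3 (lc T1 T2 r) (lc T1 T2 s) = e3 T1 T2 ^+ (r.1 * s.2) / e3 T1 T2 ^+ (r.2 * s.1) by exact: (pair_lc odd3 f3 he3 t1 t2).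
have w21 : e3' X1 X2 ^+ 2 != 1 by apply: contraNneq w1 => e; rewrite -[X in X == _]mulr1 -{1}e -exprS w3.
have pw i j : (i < 3)%N -> (0 < j < 3)%N -> e3' X1 X2 ^+ i = e3' X1 X2 ^+ j -> i = j.
  move=> hi hj; case: j hj => [|[|[|//]]] // _; case: i hi => [|[|[|//]]] // _; rewrite ?expr0 ?expr1 => e; exfalso.
  - by rewrite -e eqxx in w1.
  - by case/eqP: w1; apply: (mulfI w0); rewrite mulr1 -expr2.
  - by rewrite -e eqxx in w21.
  by case/eqP: w1; apply: (mulfI w0); rewrite mulr1 -expr2.
(* The image of T1 + k T2 is determined by its pairings with X1 and X2; with oddness this makes
   [phib] linear. *)
have lin1 k : (0 < k < 3)%N -> phib (lc T1 T2 (1, k)%N) = lc X1 X2 (1, k)%N.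
  move=> hk; have k0 : ~~ (3 %| k)%N by case: k hk => [|[|[|]]].
  have [r er] : exists r, phib (lc T1 T2 (1, k)%N) = lc X1 X2 r.
    have n0 : lc T1 T2 (1, k)%N != 0 by apply: nzT.
    by have [tt _ _ _] := hphi _ (tlc _) n0; exact: sp'.
  rewrite lcX in er; have h1 : (r.1 %% 3 < 3)%N by rewrite ltn_mod. have h2 : (r.2 %% 3 < 3)%N by rewrite ltn_mod.
  have b3 : ~~ ((3 %| 1 + 2 * 1) && (3 %| 0 + 2 * k))%N by case: k hk {k0 er} => [|[|[|]]].
  have b4 : ~~ ((3 %| 1 + 2 * (2 * 1)) && (3 %| 0 + 2 * (2 * k)))%N by [].
  have b5 : ~~ ((3 %| 0 + 2 * 1) && (3 %| 1 + 2 * k))%N by [].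
  have b6 : ~~ ((3 %| 0 + 2 * (2 * 1)) && (3 %| 1 + 2 * (2 * k)))%N by [].
  have a1 : e3' X1 (phib (lc T1 T2 (1, k)%N)) = e3' X1 X2 ^+ k.
    have := antiL (1, 0)%N (1, k)%N isT isT b3 b4; rewrite -d10 -/X1 => ->.
    by rewrite /= mul1n mul0n expr0 divr1 wz exprVn.
  have a2 : e3' X2 (phib (lc T1 T2 (1, k)%N)) = (e3' X1 X2)^-1.
    have := antiL (0, 1)%N (1, k)%N isT isT b5 b6; rewrite -d01 -/X2 => ->.
    by rewrite /= mul1n mul0n expr0 expr1 div1r wz.
  rewrite er {1}d10' pairX /= mul1n mul0n expr0 divr1 in a1; rewrite er {1}d01' pairX /= mul1n mul0n expr0 div1r in a2.
  rewrite er (pw _ _ h2 hk a1) (pw (r.1 %% 3)%N 1%N h1 isT) // expr1; exact: invr_inj a2.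
have linS : phib (T1 + T2) = X1 + X2 /\ phib (T1 - T2) = X1 - X2.
  split; first exact: (lin1 1%N isT).
  by have := lin1 2%N isT; rewrite /lc /= !mulr1n !o2.
have lin r : phib (lc T1 T2 r) = lc X1 X2 r.
  rewrite lcT lcX; have : (r.1 %% 3 < 3)%N by rewrite ltn_mod. have : (r.2 %% 3 < 3)%N by rewrite ltn_mod.
  have [l1 l2] := linS; rewrite /lc /=.
  case: (r.1 %% 3)%N => [|[|[|//]]]; case: (r.2 %% 3)%N => [|[|[|//]]] _ _; rewrite ?mulr0n ?mulr1n ?o2 ?addr0 ?add0r ?phi0 ?phiN //.
  - have td : (T1 - T2) *+ 3 = 0 by rewrite mulrnBl t1 t2 subrr.
    have -> : - T1 + T2 = - (T1 - T2) by rewrite opprB addrC.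
    by rewrite (phiN _ td) l2 opprB addrC.
  have td : (T1 + T2) *+ 3 = 0 by rewrite mulrnDl t1 t2 addr0.
  by rewrite -opprD (phiN _ td) l1 opprD.
have antilc r s : e3' (lc X1 X2 r) (lc X1 X2 s) = (e3 (lc T1 T2 r) (lc T1 T2 s))^-1.
  by rewrite pairX pairT wz !exprVn invf_div invrK mulrC.
have cX1 : galp conjA X1 = X1 by rewrite -phigal // c1.
have cX2 : galp conjA X2 = - X2 by rewrite -phigal // c2 phiN.
have [C1 e1C cC1] := (proj1 (lift_conj t1)) c1; have [C2 e2C cC2] := (proj2 (lift_conj t2)) c2.
have [D1 e1D cD1] := (proj1 (lift_conj x1t)) cX1; have [D2 e2D cD2] := (proj2 (lift_conj x2t)) cX2.
have [iC sC] := lift9 ind sp e1C e2C.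
have t9 (V : zmodType) (C T : V) : C *+ 3 = T -> T *+ 3 = 0 -> C *+ 9 = 0 by move=> e t; rewrite (mulrnA _ 3 3) e.
have C19 := t9 _ _ _ e1C t1; have C29 := t9 _ _ _ e2C t2.
have [G9 f9] := @span_fin _ E 9 C1 C2 isT C19 C29 sC.
pose prim (r : nat * nat) := ~~ ((3 %| r.1) && (3 %| r.2))%N.
have lc3 (K : numClosedFieldType) (F : ecurve K) (U V P Q : ept F) r : U *+ 3 = P -> V *+ 3 = Q -> lc U V r *+ 3 = lc P Q r.
  by move=> <- <-; rewrite /lc mulrnDl mulrnAC (mulrnAC V).
have CT r : lc C1 C2 r *+ 3 = lc T1 T2 r by exact: lc3.
have lC9 r : lc C1 C2 r *+ 9 = 0 by exact: t9 (CT r) (tlc r).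
have lC3 r : prim r -> lc C1 C2 r *+ 3 != 0 by move=> /nzT; rewrite CT.
have nzX r : prim r -> lc X1 X2 r != 0 by apply: contra => /eqP /ind'.
(* [R] is the theta relation for the lift given by D1, D2, and [rho] its defect, a cube root of
   unity. *)
pose R (D1 D2 : ept E') r := theta (lc C1 C2 r) * theta (lc D1 D2 r) = A (lc T1 T2 r).
pose rho (D1 D2 : ept E') r := theta (lc C1 C2 r) * theta (lc D1 D2 r) / A (lc T1 T2 r).
have A0r r : prim r -> A (lc T1 T2 r) != 0 by move=> /nzT; apply: A0.
have rhoR F1 F2 r : prim r -> rho F1 F2 r = 1 -> R F1 F2 r.
  by move=> /A0r n e; rewrite /R -[LHS](divfK n) -/(rho _ _ _) e mul1r.
have rho3 F1 F2 r : F1 *+ 3 = X1 -> F2 *+ 3 = X2 -> prim r -> rho F1 F2 r ^+ 3 = 1.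
  move=> d1 d2 pr; have DX := lc3 _ _ _ _ _ _ r d1 d2; have l9 := t9 _ _ _ DX (tlc' r).
  have l3 : lc F1 F2 r *+ 3 != 0 by rewrite DX nzX.
  rewrite /rho expr_div_n exprMn theta_cubed ?lC9 ?lC3 // theta_cubed // DX CT -lin.
  have [_ _ _ e] := hphi _ (tlc r) (nzT _ pr); rewrite /A -e.
  have yn := y30 _ (tlc r) (nzT _ pr); have yn' : yc (phib (lc T1 T2 r)) != 0.
    by have [ta tb _ _] := hphi _ (tlc r) (nzT _ pr); exact: yc_odd_tor odd3 ta tb.
  by field; rewrite yn yn'.
have rhoc (F1 F2 : ept E') i j : F1 *+ 3 = X1 -> F2 *+ 3 = X2 -> galp conjA F1 = F1 -> galp conjA F2 = - F2 -> prim (i, j) ->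
    conjA (rho F1 F2 (i, j)) = theta (lc C1 (- C2) (i, j)) * theta (lc F1 (- F2) (i, j)) / A (lc T1 (- T2) (i, j)).
  move=> d1 d2 g1 g2 pr; have DX := lc3 _ _ _ _ _ _ (i, j) d1 d2; have l9 := t9 _ _ _ DX (tlc' _).
  have l3 : lc F1 F2 (i, j) *+ 3 != 0 by rewrite DX nzX.
  rewrite /rho fmorph_div rmorphM -(galA conjA) ?tlc ?nzT // -!theta_gal ?lC9 ?lC3 //.
  by rewrite /lc /= !galpD !galpMn c1 c2 cC1 cC2 g1 g2.
have m8 (V : zmodType) (P : V) : P *+ 9 = 0 -> P *+ 8 = - P by move=> t; apply/eqP; rewrite -addr_eq0 -mulrSr t.
have m8' (V : zmodType) (P : V) : P *+ 3 = 0 -> P *+ 8 = - P by move=> t; apply: m8; rewrite (mulrnA _ 3 3) t mul0rn.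
have AN P : A (- P) = A P by rewrite /A xcN.
have D9 (D X : ept E') : D *+ 3 = X -> X *+ 3 = 0 -> D *+ 9 = 0 by exact: t9.
(* For lifts compatible with conjugation the defects at (1, 0) and (0, 1) are real, hence 1, and
   those at (1, 1) and (1, -1) are conjugate; 8 stands for -1. *)
have step1 (F1 F2 : ept E') : F1 *+ 3 = X1 -> F2 *+ 3 = X2 -> galp conjA F1 = F1 -> galp conjA F2 = - F2 ->
    [/\ R F1 F2 (1, 0)%N, R F1 F2 (0, 1)%N & rho F1 F2 (1, 1)%N = 1 -> R F1 F2 (1, 8)%N].
  move=> d1 d2 g1 g2; split.
  - apply: rhoR => //; apply: real_cube_root1; last exact: rho3.
    by rewrite rhoc // /rho /lc /= !mulr0n.
  - apply: rhoR => //; apply: real_cube_root1; last exact: rho3.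
    have C23 : C2 *+ 3 != 0 by rewrite e2C.
    have F23 : F2 *+ 3 != 0 by rewrite d2.
    rewrite rhoc // /rho /lc /= !mulr0n !mulr1n !add0r thetaN // thetaN ?(D9 _ _ d2 x2t) // AN mulrNN //.
  move=> r1; apply: rhoR => //; have := rhoc F1 F2 1%N 1%N d1 d2 g1 g2 isT; rewrite r1 rmorph1 => ->.
  by rewrite /rho /lc /= !mulr1n (m8 _ C2) // (m8 _ F2) ?(D9 _ _ d2 x2t) // m8'.
have thD (F1 F2 : ept E') r (T : ept E') : F1 *+ 3 = X1 -> F2 *+ 3 = X2 -> prim r -> T *+ 3 = 0 ->
    theta (lc F1 F2 r + T) = theta (lc F1 F2 r) * e3' (- lc X1 X2 r) T.
  move=> d1 d2 pr tT; have DX := lc3 _ _ _ _ _ _ r d1 d2; have l9 := t9 _ _ _ DX (tlc' _).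
  by rewrite (theta_add f3' he3') // DX // nzX.
have thC r (T : ept E) : prim r -> T *+ 3 = 0 -> theta (lc C1 C2 r + T) = theta (lc C1 C2 r) * e3 (- lc T1 T2 r) T.
  by move=> pr tT; rewrite (theta_add f3 he3) ?lC9 ?lC3 // CT.
(* Adding a multiple of X1 to D1 preserves its reality and multiplies the defect at (1, 1) by any
   prescribed cube root of unity. *)
have [F1 [F2 [d1 d2 [R10 R01 R11 R18]]]] : exists F1 F2 : ept E', [/\ F1 *+ 3 = X1, F2 *+ 3 = X2 &
    [/\ R F1 F2 (1, 0)%N, R F1 F2 (0, 1)%N, R F1 F2 (1, 1)%N & R F1 F2 (1, 8)%N]].
  pose v := e3' (- lc X1 X2 (1, 1)%N) X1.
  have ev : v = (e3' X1 X2 ^+ 2)^-1.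
    by rewrite /v lcN3' {2}d10' pairX /= expr0 mul1r.
  have v3 : v ^+ 3 = 1 by rewrite ev exprVn -exprM mulnC exprM w3 expr1n invr1.
  have v1 : v != 1 by rewrite ev invr_eq1.
  have [k k3 ek] := cube_roots v3 v1 (rho3 D1 D2 (1, 1)%N e1D e2D isT).
  have d1 : (D1 + X1 *+ k) *+ 3 = X1 by rewrite mulrnDl e1D mulrnAC x1t mul0rn addr0.
  have g1 : galp conjA (D1 + X1 *+ k) = D1 + X1 *+ k by rewrite galpD galpMn cD1 cX1.
  have rk : rho (D1 + X1 *+ k) D2 (1, 1)%N = 1.
    rewrite -[RHS]ek /rho; have -> : lc (D1 + X1 *+ k) D2 (1, 1)%N = lc D1 D2 (1, 1)%N + X1 *+ k by rewrite /lc /= !mulr1n addrAC.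
    rewrite thD // ?(pairMr f3' he3') ?mulNrn ?tlc' ?oppr0 //; last by rewrite mulrnAC x1t mul0rn.
    by rewrite -/v; ring.
  have [r10 r01 r18] := step1 _ D2 d1 e2D g1 cD2.
  by exists (D1 + X1 *+ k), D2; split=> //; split=> //; [exact: rhoR | exact: r18].
have [iF sF] := lift9 ind' sp' d1 d2.
have F19 := D9 _ _ d1 x1t; have F29 := D9 _ _ d2 x2t.
have [G9' f9'] := @span_fin _ E' 9 F1 F2 isT F19 F29 sF.
have [e9 he9] := ex_pairing odd9 f9; have [e9' he9'] := ex_pairing odd9 f9'.
have z93 : e9 C1 C2 ^+ 3 = e3 T1 T2.
  rewrite -(pairMr f9 he9) // e2C (pair9_3 f9 he9 f3 he3) ?e1C //.
have w93 : e9' F1 F2 ^+ 3 = e3' X1 X2.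
  rewrite -(pairMr f9' he9') // d2 (pair9_3 f9' he9' f3' he3') ?d1 //.
have z90 : e9 C1 C2 != 0 := pair_neq0 f9 he9 C19 C29.
have w90 : e9' F1 F2 != 0 := pair_neq0 f9' he9' F19 F29.
(* Multiplying the lift by 1 + 3 c preserves [R], because e_3(X, X) = 1, and multiplies e_9 by the
   power 2 c of e_3; a suitable c makes e_9 exactly inverse. *)
have {R10 R01 R11 R18} [H1 [H2 [h1 h2 [R10 R01 R11 R18] eH]]] : exists H1 H2 : ept E', [/\ H1 *+ 3 = X1, H2 *+ 3 = X2,
    [/\ R H1 H2 (1, 0)%N, R H1 H2 (0, 1)%N, R H1 H2 (1, 1)%N & R H1 H2 (1, 8)%N] & e9' H1 H2 = (e9 C1 C2)^-1].
  have w23 : (e3' X1 X2 ^+ 2) ^+ 3 = 1 by rewrite -exprM mulnC exprM w3 expr1n.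
  have k3 : (e9 C1 C2 * e9' F1 F2) ^+ 3 = 1 by rewrite exprMn z93 w93 wz mulfV.
  have [c c3 ec] := cube_roots w23 w21 k3.
  have sc (F X : ept E') : F *+ 3 = X -> F *+ (1 + 3 * c) = F + X *+ c by move=> <-; rewrite mulrnDr mulr1n mulrnA.
  have sR r : prim r -> R F1 F2 r -> R (F1 *+ (1 + 3 * c)) (F2 *+ (1 + 3 * c)) r.
    move=> pr; rewrite /R (sc _ _ d1) (sc _ _ d2).
    have -> : lc (F1 + X1 *+ c) (F2 + X2 *+ c) r = lc F1 F2 r + lc X1 X2 r *+ c.
      by rewrite /lc !mulrnDl addrACA !(mulrnAC _ c).
    rewrite thD //; last by rewrite mulrnAC tlc' mul0rn.
    rewrite (pairMr f3' he3') ?mulNrn ?tlc' ?oppr0 // lcN3' pairX /= -!mulnA (mulnC r.2) divff ?expr1n ?mulr1 //.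
    by rewrite expf_neq0.
  exists (F1 *+ (1 + 3 * c)), (F2 *+ (1 + 3 * c)); split; [| |by split; apply: sR|].
  - by rewrite (sc _ _ d1) mulrnDl d1 mulrnAC x1t mul0rn addr0.
  - by rewrite (sc _ _ d2) mulrnDl d2 mulrnAC x2t mul0rn addr0.
  have tk : F1 *+ (1 + 3 * c) *+ 9 = 0 by rewrite mulrnAC F19 mul0rn.
  rewrite (pairMr f9' he9' _ tk F29) (pairMl f9' he9' _ F19 F29).
  apply: (mulfI z90); rewrite mulfV // -[RHS]ec -mulrA; congr (_ * _).
  rewrite -exprM; have -> : ((1 + 3 * c) * (1 + 3 * c) = 1 + 3 * (2 * c) + 3 * (3 * (c * c)))%N by clear; lia.
  rewrite (exprD _ (1 + 3 * (2 * c))) (exprD _ 1) expr1 [e9' F1 F2 ^+ (3 * (2 * c))]exprM w93 [e9' F1 F2 ^+ (3 * _)]exprM w93.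
  by rewrite [e3' X1 X2 ^+ (3 * _)]exprM w3 expr1n mulr1 exprM.
have h19 := D9 _ _ h1 x1t; have h29 := D9 _ _ h2 x2t.
have [iH sH] := lift9 ind' sp' h1 h2.
have HX r : lc H1 H2 r *+ 3 = lc X1 X2 r by exact: lc3.
have congC r s : lc C1 C2 r = lc C1 C2 s -> lc H1 H2 r = lc H1 H2 s by exact: (lc_cong (isT : (0 < 9)%N) C19 C29 h19 h29 iC).
have congT r s : lc T1 T2 r = lc T1 T2 s -> lc X1 X2 r = lc X1 X2 s by exact: (lc_cong (isT : (0 < 3)%N) t1 t2 x1t x2t ind).
have Rcong r s : lc C1 C2 r = lc C1 C2 s -> R H1 H2 r -> R H1 H2 s.
  by move=> e; rewrite /R -!CT e (congC _ _ e).
have Rtr r s : prim r -> R H1 H2 r -> R H1 H2 (r.1 + 3 * s.1, r.2 + 3 * s.2)%N.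
  move=> pr; rewrite /R.
  have eC : lc C1 C2 (r.1 + 3 * s.1, r.2 + 3 * s.2)%N = lc C1 C2 r + lc T1 T2 s.
    by rewrite -(lcD C1 C2 r (3 * s.1, 3 * s.2)%N); congr (_ + _); rewrite -e1C -e2C /lc /= !(mulrnA _ 3).
  have eH' : lc H1 H2 (r.1 + 3 * s.1, r.2 + 3 * s.2)%N = lc H1 H2 r + lc X1 X2 s.
    by rewrite -(lcD H1 H2 r (3 * s.1, 3 * s.2)%N); congr (_ + _); rewrite -h1 -h2 /lc /= !(mulrnA _ 3).
  have eT : lc T1 T2 (r.1 + 3 * s.1, r.2 + 3 * s.2)%N = lc T1 T2 r.
    by rewrite -(lcD T1 T2 r (3 * s.1, 3 * s.2)%N) {2}/lc /= !(mulrnA _ 3) t1 t2 !mul0rn !addr0.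
  rewrite eC eH' eT thC // thD // lcN3 lcN3' antilc => <-.
  have n0 : e3 (lc T1 T2 (2 * r.1, 2 * r.2)%N) (lc T1 T2 s) != 0 by apply: (pair_neq0 f3 he3).
  by field.
have Rng r : prim r -> R H1 H2 r -> R H1 H2 (8 * r.1, 8 * r.2)%N.
  move=> pr; rewrite /R; have eN (K : numClosedFieldType) (F : ecurve K) (U V : ept F) : U *+ 9 = 0 -> V *+ 9 = 0 -> lc U V (8 * r.1, 8 * r.2)%N = - lc U V r.
    by move=> u v; rewrite /lc /= !mulrnA !m8 // !mulNrn opprD.
  have t19 := t9 _ _ _ (erefl (T1 *+ 3)) ; rewrite !eN ?(mulrnA _ 3 3) ?t1 ?t2 ?x1t ?x2t ?e1C ?e2C ?h1 ?h2 ?mul0rn // AN.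
  rewrite thetaN ?lC9 ?lC3 // thetaN ?mulrNN //; last by rewrite HX nzX.
  by rewrite (t9 _ _ _ (HX r) (tlc' _)).
have Rmod r r' : prim r -> (3 %| r'.1 + 8 * r.1)%N -> (3 %| r'.2 + 8 * r.2)%N -> R H1 H2 r -> R H1 H2 r'.
  move=> pr /dvdnP[s1 v1] /dvdnP[s2 v2] hr; apply: (Rcong _ _ _ (Rtr _ (s1, s2) pr hr)).
  have q1 : (r.1 + 3 * s1 = r'.1 + 9 * r.1)%N by clear -v1; lia.
  have q2 : (r.2 + 3 * s2 = r'.2 + 9 * r.2)%N by clear -v2; lia.
  have -> : (r.1 + 3 * (s1, s2).1, r.2 + 3 * (s1, s2).2)%N = (r'.1 + 9 * r.1, r'.2 + 9 * r.2)%N by rewrite /= q1 q2.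
  by rewrite -(lcD C1 C2 r' (9 * r.1, 9 * r.2)%N) {2}/lc /= !(mulrnA _ 9) C19 C29 !mul0rn !addr0.
(* Translations by E[3] and the sign reduce every primitive vector to one of (1, 0), (0, 1), (1, 1),
   (1, 8). *)
have Rall r : prim r -> R H1 H2 r.
  rewrite /prim => pr; have u1 : (r.1 %% 3 < 3)%N by rewrite ltn_mod. have u2 : (r.2 %% 3 < 3)%N by rewrite ltn_mod.
  have dm (i j : nat) : (i %% 3 = j %% 3)%N -> (3 %| i + 8 * j)%N by clear; lia.
  have fin s : prim s -> R H1 H2 s -> (r.1 %% 3 = s.1 %% 3)%N -> (r.2 %% 3 = s.2 %% 3)%N -> R H1 H2 r.
    by move=> ps rs v1 v2; apply: (Rmod _ _ ps (dm _ _ v1) (dm _ _ v2) rs).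
  have c10 := fin _ _ R10; have c01 := fin _ _ R01; have c11 := fin _ _ R11; have c18 := fin _ _ R18.
  have c80 := fin _ _ (Rng (1, 0)%N isT R10); have c08 := fin _ _ (Rng (0, 1)%N isT R01).
  have c88 := fin _ _ (Rng (1, 1)%N isT R11); have c81 := fin _ _ (Rng (1, 8)%N isT R18).
  move: pr c10 c01 c11 c18 c80 c08 c88 c81 {fin}; rewrite /dvdn.
  case: (r.1 %% 3)%N u1 => [|[|[|//]]] _; case: (r.2 %% 3)%N u2 => [|[|[|//]]] _ //= _ c10 c01 c11 c18 c80 c08 c88 c81;
   solve [exact: c10|exact: c01|exact: c11|exact: c18|exact: c80|exact: c08|exact: c88|exact: c81].
have galTX s r r' : galp s (lc T1 T2 r) = lc T1 T2 r' -> galp s (lc X1 X2 r) = lc X1 X2 r'.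
  by move=> e; rewrite -lin -phigal ?tlc // e lin.
have lcM (K : numClosedFieldType) (F : ecurve K) (U V : ept F) p q r :
    lc (lc U V p) (lc U V q) r = lc U V (p.1 * r.1 + q.1 * r.2, p.2 * r.1 + q.2 * r.2)%N.
  by rewrite /lc /= !mulrnDl !mulrnDr !mulrnA addrACA.
(* The lift before and after s satisfies the same theta relation, so on each primitive vector the
   two differ by a factor 1 + 3 l. Comparison at (1, 1) makes l common to the basis, and
   equivariance of e_9 gives (1 + 3 l)^2 = 1 modulo 9, so l = 0. *)
have gal9 s p q : galp s C1 = lc C1 C2 p -> galp s C2 = lc C1 C2 q -> galp s H1 = lc H1 H2 p /\ galp s H2 = lc H1 H2 q.
  move=> gp gq; pose M (r : nat * nat) := (p.1 * r.1 + q.1 * r.2, p.2 * r.1 + q.2 * r.2)%N.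
  have gC r : galp s (lc C1 C2 r) = lc C1 C2 (M r) by rewrite -lcM -gp -gq /lc galpD !galpMn.
  have gT r : galp s (lc T1 T2 r) = lc T1 T2 (M r) by rewrite -!CT galpMn gC.
  have gX r : galp s (lc X1 X2 r) = lc X1 X2 (M r) by exact: galTX (gT r).
  have pM r : prim r -> prim (M r).
    move=> /nzT; apply: contraNN => /andP[/dvdnP[i e1] /dvdnP[j e2]]; rewrite -(galp_eq0 s) gT /lc e1 e2.
    by rewrite mulnC mulrnA t1 mul0rn mulnC mulrnA t2 mul0rn addr0.
  have key r : prim r -> exists2 l, (l < 3)%N & galp s (lc H1 H2 r) = lc H1 H2 (M r) + galp s (lc X1 X2 r) *+ l.
    move=> pr; pose d := galp s (lc H1 H2 r) - lc H1 H2 (M r).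
    have td : d *+ 3 = 0 by rewrite /d mulrnBl -galpMn !HX gX subrr.
    have ed : galp s (lc H1 H2 r) = lc H1 H2 (M r) + d by rewrite /d addrC subrK.
    have R0 := Rall _ pr; have RM := Rall _ (pM _ pr); rewrite /R in R0 RM.
    have tH9 : lc H1 H2 r *+ 9 = 0 by exact: t9 (HX r) (tlc' r).
    have tH3 : lc H1 H2 r *+ 3 != 0 by rewrite HX nzX.
    have ne := A0r _ (pM _ pr).
    have := congr1 (fun x => s x) R0; rewrite rmorphM -(theta_gal s (lC9 r) (lC3 _ pr)) -(theta_gal s tH9 tH3) -(galA s _ (tlc r) (nzT _ pr)) gC gT ed thD ?pM //.
    rewrite mulrA RM => /(canRL (mulKf ne)); rewrite mulVf // => e1.
    have nX := nzX _ (pM _ pr).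
    have [d0|d0] := eqVneq d 0; first by exists 0%N => //; rewrite d0 mulr0n.
    have [d1'|m1] := eqVneq d (lc X1 X2 (M r)); first by exists 1%N => //; rewrite gX d1' mulr1n.
    have [d2'|m2] := eqVneq d (- lc X1 X2 (M r)); first by exists 2%N => //; rewrite gX d2' o2 ?tlc'.
    have : e3' (- lc X1 X2 (M r)) d != 1.
      by apply: (pair3_neq1 f3' he3') => //; rewrite ?mulNrn ?tlc' ?oppr0 ?oppr_eq0 ?eqr_opp // eq_sym.
    by rewrite e1 eqxx.
  have [l1 _ k1] := key (1, 0)%N isT; have [l2 _ k2] := key (0, 1)%N isT; have [l l3 k3] := key (1, 1)%N isT.
  have b10 (F : ecurve algC) (U V : ept F) : lc U V (1, 0)%N = U by rewrite /lc /= mulr1n mulr0n addr0.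
  have b01 (F : ecurve algC) (U V : ept F) : lc U V (0, 1)%N = V by rewrite /lc /= mulr1n mulr0n add0r.
  have b11 (F : ecurve algC) (U V : ept F) : lc U V (1, 1)%N = U + V by rewrite /lc /= !mulr1n.
  have M10 : M (1, 0)%N = p by rewrite /M /= !muln1 !muln0 !addn0 -surjective_pairing.
  have M01 : M (0, 1)%N = q by rewrite /M /= !muln1 !muln0 !add0n -surjective_pairing.
  have MD (U V : ept E') : lc U V (M (1, 1)%N) = lc U V p + lc U V q by rewrite lcD /M /= !muln1.
  rewrite b10 M10 b10 in k1; rewrite b01 M01 b01 in k2; rewrite !b11 MD !galpD k1 k2 in k3.
  have k4 : lc X1 X2 (l1, l2) = lc X1 X2 (l, l).
    apply: (@galp_inj _ _ h' s); rewrite /lc /= !galpD !galpMn.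
    by move: k3; rewrite addrACA mulrnDl => /addrI.
  have zz : (0 : ept E') *+ 3 = 0 by rewrite mul0rn.
  have e1 := lc_cong (isT : (0 < 3)%N) x1t x2t x1t zz ind' k4; have e2 := lc_cong (isT : (0 < 3)%N) x1t x2t zz x2t ind' k4.
  rewrite /lc /= !mul0rn !addr0 in e1; rewrite /lc /= !mul0rn !add0r in e2.
  have Xp : galp s X1 = lc H1 H2 p *+ 3 by rewrite HX; have := gX (1, 0)%N; rewrite b10 M10 => ->.
  have Xq : galp s X2 = lc H1 H2 q *+ 3 by rewrite HX; have := gX (0, 1)%N; rewrite b01 M01 => ->.
  have g1 : galp s H1 = lc H1 H2 p *+ (1 + 3 * l) by rewrite k1 -galpMn e1 galpMn Xp (mulrnDr _ 1 (3 * l)) mulr1n mulrnA.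
  have g2 : galp s H2 = lc H1 H2 q *+ (1 + 3 * l) by rewrite k2 -galpMn e2 galpMn Xq (mulrnDr _ 1 (3 * l)) mulr1n mulrnA.
  have tp r : lc H1 H2 r *+ 9 = 0 by exact: t9 (HX r) (tlc' r).
  have ez : s (e9 C1 C2) = e9 (lc C1 C2 p) (lc C1 C2 q) by rewrite -gp -gq (pair_gal f9 he9 s odd9 C19 C29).
  have ew : s (e9' H1 H2) = (s (e9 C1 C2))^-1 ^+ ((1 + 3 * l) * (1 + 3 * l)).
    have tk : lc H1 H2 p *+ (1 + 3 * l) *+ 9 = 0 by rewrite mulrnAC tp mul0rn.
    rewrite -(pair_gal f9' he9' s odd9 h19 h29) g1 g2 (pairMr f9' he9' _ tk (tp q)) (pairMl f9' he9' _ (tp p) (tp q)).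
    rewrite -exprM; congr (_ ^+ _); rewrite ez (pair_lc odd9 f9' he9' h19 h29) (pair_lc odd9 f9 he9 C19 C29) eH !exprVn.
    by rewrite invf_div invrK mulrC.
  have W1 : (s (e9 C1 C2) ^+ 3)^-1 != 1 by rewrite -rmorphXn z93 invr_eq1 fmorph_eq1.
  have W3 : (s (e9 C1 C2) ^+ 3)^-1 ^+ 3 = 1 by rewrite -rmorphXn z93 exprVn -rmorphXn z3 rmorph1 invr1.
  have s0 : (s (e9 C1 C2))^-1 != 0 by rewrite invr_eq0 fmorph_eq0.
  have ll : l = 0%N.
    move: ew; rewrite eH fmorphV.
    have -> : ((1 + 3 * l) * (1 + 3 * l) = 1 + 3 * (2 * l + 3 * (l * l)))%N by clear; lia.
    rewrite exprD expr1 -[LHS]mulr1 => /(mulfI s0) /esym; rewrite exprM exprVn exprD [_ ^+ (3 * _)]exprM W3 expr1n mulr1.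
    move: l3 W1 W3; case: (l) => [|[|[|//]]] // _; set W := (_)^-1 => w1' w3' e; case/eqP: w1'.
    - by move: w3'; rewrite exprSr e mul1r.
    by move: e; rewrite (_ : 2 * 2 = 3 + 1)%N // exprD w3' mul1r expr1.
  by rewrite g1 g2 ll muln0 addn0 !mulr1n.
have hPhi (P : ept E) : exists Y : ept E', forall r, P = lc C1 C2 r -> Y = lc H1 H2 r.
  case: (boolp.pselect (exists r, P = lc C1 C2 r)) => [[r0 ->]|nr]; first by exists (lc H1 H2 r0) => r; exact: congC.
  by exists 0 => r e; case: nr; exists r.
have [Phi hP] := boolp.choice hPhi; have PE r : Phi (lc C1 C2 r) = lc H1 H2 r by exact: hP.
have tp r : lc H1 H2 r *+ 9 = 0 by exact: t9 (HX r) (tlc' r).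
apply: (@reverse_congruentP 9 _ _ _ _ h h' Phi) => //.
- by move=> P /sC[r ->]; rewrite PE tp.
- by move=> P Q /sC[r ->] /sC[r' ->]; rewrite !PE; exact: (lc_cong (isT : (0 < 9)%N) h19 h29 C19 C29 iH).
- by move=> Q /sH[r ->]; exists (lc C1 C2 r); rewrite ?lC9 ?PE.
- by move=> P Q /sC[r ->] /sC[r' ->]; rewrite lcD !PE lcD.
- move=> s P /sC[r ->]; have [p ep] := sC _ (gt s _ _ C19); have [q eq] := sC _ (gt s _ _ C29).
  have [g1 g2] := gal9 s p q ep eq.
  have -> : galp s (lc C1 C2 r) = lc (lc C1 C2 p) (lc C1 C2 q) r by rewrite -ep -eq /lc galpD !galpMn.
  by rewrite lcM !PE -lcM -g1 -g2 /lc galpD !galpMn.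
move=> P Q tP tQ; have [S [T g]] := ex_generic f9; have [S' [T' g']] := ex_generic f9'.
exists S, T, S', T'; split=> //.
have [r eP] := sC _ tP; have [r' eQ] := sC _ tQ.
rewrite -(he9 _ _ _ _ tP tQ g) eP eQ !PE -(he9' _ _ _ _ (tp r) (tp r') g') (pair_lc odd9 f9' he9' h19 h29) (pair_lc odd9 f9 he9 C19 C29) eH !exprVn.
by rewrite invf_div invrK mulrC.
Qed.
End Reverse9.

End ReverseNine.

(** * Polynomial identities by computation on lists of integers *)

Module PolynomialReflection.
Import CurveRing TorsionStructure ThetaGalois.
Delimit Scope Z_scope with Z.

(** Arithmetic on syntactic coefficients with a test for zero. By [ops_ok] and [eq_of_cz] an
    identity in any commutative ring follows from a boolean computation. *)
Record coef_ops (C : Type) := CoefOps { c0 : C; cadd : C -> C -> C; cmul : C -> C -> C; copp : C -> C; cz : C -> bool }.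
Definition ops_ok (C : Type) (R : comNzRingType) (o : coef_ops C) (ev : C -> R) :=
  [/\ ev (c0 o) = 0, forall x y, ev (cadd o x y) = ev x + ev y, forall x y, ev (cmul o x y) = ev x * ev y,
      forall x, ev (copp o x) = - ev x & forall x, cz o x -> ev x = 0].

Section PolyOps.
Variables (C : Type) (o : coef_ops C).
Fixpoint padd (p q : seq C) : seq C :=
  match p, q with [::], _ => q | _, [::] => p | x :: p', y :: q' => cadd o x y :: padd p' q' end.
Definition pscale c (p : seq C) := map (cmul o c) p.
(** Applied after each sum and each Horner step of a product, so that in a quotient ring the excess
    over the degree is at most one coefficient. *)
Variable red : seq C -> seq C.
Fixpoint pmul (p q : seq C) : seq C :=
  if p is x :: p' then padd (pscale x q) (red (c0 o :: pmul p' q)) else [::].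
Definition pops : coef_ops (seq C) := CoefOps [::] (fun p q => red (padd p q)) pmul (map (copp o)) (all (cz o)).
(* Reduction modulo the monic polynomial X^d - ng, for at most one excess coefficient. *)
Definition redm d (ng p : seq C) := if drop d p is [:: c] then padd (take d p) (pscale c ng) else p.

Variables (R : comNzRingType) (ev : C -> R) (x : R).
Definition pe (p : seq C) : R := foldr (fun c acc => ev c + x * acc) 0 p.
Hypothesis ok : ops_ok o ev.
Lemma pe_add p q : pe (padd p q) = pe p + pe q.
Proof.
have [_ D _ _ _] := ok; elim: p q => [|a p IH] [|b q] //=; rewrite ?add0r ?addr0 // D IH; ring.
Qed.
Lemma pe_scale c p : pe (pscale c p) = ev c * pe p.
Proof. have [_ _ M _ _] := ok; elim: p => [|a p IH] /=; rewrite ?mulr0 // M IH; ring. Qed.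
Lemma pe_cat p q : pe (p ++ q) = pe p + x ^+ size p * pe q.
Proof. by elim: p => [|a p IH] /=; rewrite ?expr0 ?mul1r ?add0r // IH exprS; ring. Qed.
Lemma pe_redm d ng p : x ^+ d = pe ng -> pe (redm d ng p) = pe p.
Proof.
move=> e; rewrite /redm; case ed: (drop d p) => [//|c [|//]].
rewrite pe_add pe_scale -[in RHS](cat_take_drop d p) pe_cat ed /= mulr0 addr0.
have -> : size (take d p) = d.
  by apply: size_takel; rewrite ltnW // ltnNge; apply/negP => /drop_oversize e'; rewrite e' in ed.
by rewrite e mulrC.
Qed.
Hypothesis hred : forall p, pe (red p) = pe p.
Lemma pops_ok : ops_ok pops pe.
Proof.
have [Z0 _ _ N Z] := ok; split=> //=; first by move=> p q; rewrite hred pe_add.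
- move=> p q; elim: p => [|a p IH] /=; first by rewrite mul0r.
  by rewrite pe_add pe_scale hred /= Z0 IH; ring.
- by elim=> [|a p IH] /=; rewrite ?oppr0 // N IH; ring.
by elim=> [|a p IH] //= /andP[/Z -> /IH ->]; rewrite mulr0 addr0.
Qed.
End PolyOps.

Lemma eq_of_cz (C : Type) (R : comNzRingType) (o : coef_ops C) (ev : C -> R) x y : ops_ok o ev -> cz o (cadd o x (copp o y)) -> ev x = ev y.
Proof. by move=> [_ D _ N Z] /Z; rewrite D N => /eqP; rewrite subr_eq0 => /eqP. Qed.

Definition zops : coef_ops Z := CoefOps 0%Z Z.add Z.mul Z.opp (Z.eqb 0%Z).
Definition evZ (R : comNzRingType) (z : Z) : R := (int_of_Z z)%:~R.
Lemma zops_ok (R : comNzRingType) : ops_ok zops (@evZ R).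
Proof.
split=> //.
- by move=> x y; rewrite /evZ /= -rmorphD; congr (_%:~R); exact: (rmorphD int_of_Z).
- by move=> x y; rewrite /evZ /= -rmorphM; congr (_%:~R); exact: (rmorphM int_of_Z).
- by move=> x; rewrite /evZ /= -rmorphN; congr (_%:~R); exact: (rmorphN int_of_Z).
by move=> x /Z.eqb_eq <-.
Qed.
Fixpoint trim (p : seq Z) : seq Z :=
  if p is x :: p' then (if trim p' is y :: t then x :: y :: t else if Z.eqb 0 x then [::] else [:: x]) else [::].
Definition mops := pops zops trim.
Notation em := (pe (@evZ _)).
Lemma em_trim (R : comNzRingType) (m : R) p : em m (trim p) = em m p.
Proof.
have tE x p' : trim (x :: p') = if trim p' is y :: t then x :: y :: t else if Z.eqb 0 x then [::] else [:: x] by [].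
elim: p => [|x p IH] //; rewrite tE [RHS]/= -IH; case: (trim p) => [|y t] //.
case: Z.eqb_spec => [<-|_] //; have -> : evZ R 0 = 0 by [].
by rewrite /= mulr0 addr0.
Qed.
Lemma mops_ok (R : comNzRingType) (m : R) : ops_ok mops (em m).
Proof. by apply: pops_ok; [exact: zops_ok | exact: em_trim]. Qed.
Lemma em_morph (R S : comNzRingType) (f : {rmorphism R -> S}) m l : f (em m l) = em (f m) l.
Proof. by elim: l => [|c l IH] /=; rewrite ?rmorph0 // rmorphD rmorphM IH /evZ rmorph_int. Qed.
Lemma pe_morph (R S : comNzRingType) (f : {rmorphism R -> S}) m u (l : seq (seq Z)) : f (pe (em m) u l) = pe (em (f m)) (f u) l.
Proof. by elim: l => [|c l IH] /=; rewrite ?rmorph0 // rmorphD rmorphM IH em_morph. Qed.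

Section Lists.
Local Open Scope Z_scope.
Definition m1 : seq Z := [:: 0; 1].
Definition Zx (z : Z) : seq Z := [:: z].
Local Notation "p *m q" := (cmul mops p q) (at level 40, left associativity).
Definition pc9 : seq Z := [:: -100; 66; -21; 1].
Definition h49 : seq Z := [:: 400; -304; 60; -4; 1].
Definition h59 : seq Z := [:: -4; -166; -61; 25; -11; 1].
Definition s19 : seq Z := [:: 800000; -1440000; 1123200; -491136; 129456; -18576; 312; 288; -27; 1].
Definition s29 : seq Z := [:: 80; -7488; -24948; 14448; -6759; 2133; -1002; 234; -27; 1].
Definition m29 := m1 *m m1. Definition m49 := m29 *m m29. Definition c29 := pc9 *m pc9.
Definition A9 := Zx (-3) *m (c29 *m h49).
Definition B9 := Zx (-2) *m (c29 *m s19).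
Definition A9' := Zx (-3) *m (c29 *m pc9 *m (h59 *m m49)).
Definition B9' := Zx (-2) *m (c29 *m c29 *m (s29 *m (m49 *m m29))).
(** The roots u of X^4 = [ng9] index the four pairs of opposite points of order 3 on both curves.
    [nh9] comes from the quotient (g(V) - g(U)) / (V - U) with g = X^4 - [ng9], the cubic equation
    of a second root over the first. *)
Definition ng9 : seq (seq Z) := [:: [:: 0; 0; 12; -4]; [:: 0; 0; 6; -2]; [:: 0; 18; -6]; [:: 10; -6]].
Definition nh9 : seq (seq (seq Z)) := [:: [:: [:: 0; 0; 6; -2]; [:: 0; 18; -6]; [:: 10; -6]; [:: -1]];
  [:: [:: 0; 18; -6]; [:: 10; -6]; [:: -1]]; [:: [:: 10; -6]; [:: -1]]].
Definition q9 : seq (seq Z) := [:: [:: -2000; 2080; -1148; 336; -45; 3]; [:: 0; -384; 240; -84; 12]; [:: 0; -24; 12; 12]; [:: 8; 8; 2]].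
(* m times the paper-style abscissa: the second curve is rescaled by m to clear its denominators. *)
Definition q9' : seq (seq Z) := map (cmul mops (pc9 *m m1))
  [:: [:: 0; 20; -110; 51; -24; 3]; [:: 0; -72; 132; -72; 12]; [:: 120; -24; -36; 12]; [:: -12; -2; 2]].
(** Arithmetic in Z[m][u] modulo the quartic, and then with v adjoined modulo [nh9]. *)
Definition uops := pops mops (redm mops 4 ng9).
Definition vops := pops uops (redm uops 3 nh9).
(* U (g(U) - g(-2)) / (U + 2), where g is the quartic X^4 - ng9 *)
Definition al9 : seq (seq Z) := map (cmul mops (Zx (-1) *m (pc9 *m m1)))
  (cmul uops [:: [::]; [:: 1]] [:: [:: -48; 60; -18; 2]; [:: 24; -30; 6]; [:: -12; 6]; [:: 1]]).
End Lists.

End PolynomialReflection.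

(** * Polynomial identities of the family for n = 9 *)

Module FamilyNineIdentities.
Import CurveRing PointIdeals CocycleLaw CurveGroup Reciprocity TorsionStructure Transport ConstantCurves AlmostEverywhere Isogenies GaloisAction ThetaGalois ThreeTorsionMap ReverseNine PolynomialReflection.
Delimit Scope Z_scope with Z.

Notation em := (pe (@evZ _)).
Local Notation pm m := (pe (em m)).
Definition cubx C (o : coef_ops C) A B x := cadd o (cadd o (cmul o x (cmul o x x)) (cmul o A x)) B.
Definition k2 z := [:: Zx z].
Definition psx C (o : coef_ops C) (n3 n6 n12 A B : C) x := let x2 := cmul o x x in cadd o (cadd o (cmul o n3 (cmul o x2 x2)) (cmul o n6 (cmul o A x2))) (cadd o (cmul o n12 (cmul o B x)) (copp o (cmul o A A))).
Definition ex C (o : coef_ops C) n3 n6 A B x z := cadd o (cmul o (cadd o (cmul o n3 (cmul o x x)) A) (cadd o z (copp o x))) (cmul o n6 (cubx o A B x)).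
Definition k3 z := [:: k2 z].
Definition inV (l : seq (seq Z)) : seq (seq (seq Z)) := map (fun c => [:: c]) l.
Definition cube C (o : coef_ops C) x := cmul o x (cmul o x x).
Definition disc_list C (o : coef_ops C) n4 n27 A B := cadd o (cmul o n4 (cube o A)) (cmul o n27 (cmul o B B)).
Definition prodL C (o : coef_ops C) n16 A B x A' B' x' := cmul o n16 (cmul o (cubx o A B x) (cubx o A' B' x')).
Definition nnL C (o : coef_ops C) n4 n3 n6 A B x z A' B' x' z' := cmul o (cmul o n4 (ex o n3 n6 A B x z)) (ex o n3 n6 A' B' x' z').
Definition nnR C (o : coef_ops C) n3 x z := cmul o (cmul o n3 (cube o x)) (cube o z).

Section EvalOps.
Variables (C : Type) (R : comNzRingType) (o : coef_ops C) (ev : C -> R).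
Hypothesis ok : ops_ok o ev.
Lemma ev_prodL n16 A B x A' B' x' : ev (prodL o n16 A B x A' B' x') =
  ev n16 * (ev x ^+ 3 + ev A * ev x + ev B) * (ev x' ^+ 3 + ev A' * ev x' + ev B').
Proof. have [_ D M _ _] := ok; rewrite /prodL /cubx !(D, M); ring. Qed.
Lemma ev_sixth x : ev (cube o (cmul o x x)) = ev x ^+ 6.
Proof. have [_ D M _ _] := ok; rewrite /cube !M; ring. Qed.
Lemma ev_nnR n3 x z : ev (nnR o n3 x z) = ev n3 * ev x ^+ 3 * ev z ^+ 3.
Proof. have [_ D M _ _] := ok; rewrite /nnR /cube !M; ring. Qed.
Lemma ev_psx n3 n6 n12 A B x : ev (psx o n3 n6 n12 A B x) =
  ev n3 * ev x ^+ 4 + ev n6 * ev A * ev x ^+ 2 + ev n12 * ev B * ev x - ev A ^+ 2.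
Proof. have [_ D M N _] := ok; rewrite /psx !(D, N, M); ring. Qed.
Lemma ev_nnL n4 n3 n6 A B x z A' B' x' z' : ev (nnL o n4 n3 n6 A B x z A' B' x' z') =
  ev n4 * ((ev n3 * ev x ^+ 2 + ev A) * (ev z - ev x) + ev n6 * (ev x ^+ 3 + ev A * ev x + ev B)) *
  ((ev n3 * ev x' ^+ 2 + ev A') * (ev z' - ev x') + ev n6 * (ev x' ^+ 3 + ev A' * ev x' + ev B')).
Proof. have [_ D M N _] := ok; rewrite /nnL /ex /cubx !(D, N, M); ring. Qed.
Lemma ev_disc_list n4 n27 A B : ev (disc_list o n4 n27 A B) = ev n4 * ev A ^+ 3 + ev n27 * ev B ^+ 2.
Proof. have [_ D M N _] := ok; rewrite /disc_list /cube !(D, M); ring. Qed.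
Lemma pe1 x c : pe ev x [:: c] = ev c.
Proof. by rewrite /= mulr0 addr0. Qed.
End EvalOps.

Section Ident9.
Variables (R : comNzRingType) (m : R).
Local Notation c := (em m pc9).

(** The factored form makes the sign visible for negative m, which is what the 2-torsion argument
    uses. *)
Lemma disc9_eq : 4%:R * em m A9 ^+ 3 + 27%:R * em m B9 ^+ 2 =
  864%:R * 864%:R * c ^+ 4 * (m ^+ 5 * (m - 3%:R) * (m - 4%:R) ^+ 9).
Proof.
have ok := mops_ok m; have [_ _ M _ _] := ok.
pose p2 x := cmul mops x x.
pose L := cmul mops (cmul mops (cmul mops (Zx 864) (Zx 864)) (p2 (p2 pc9))) (cmul mops (cmul mops (cmul mops m1 (p2 (p2 m1))) [:: (-3)%Z; 1%Z]) (cube mops (cube mops [:: (-4)%Z; 1%Z]))).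
have : em m (disc_list mops (Zx 4) (Zx 27) A9 B9) = em m L by apply: (eq_of_cz ok); vm_compute.
have em1 : em m m1 = m by rewrite /m1 /= /evZ /= mulr0 addr0 mulr1 add0r.
have e3 : em m [:: (-3)%Z; 1%Z] = m - 3%:R by rewrite /= /evZ /= mulr0 addr0 mulr1 addrC.
have e4 : em m [:: (-4)%Z; 1%Z] = m - 4%:R by rewrite /= /evZ /= mulr0 addr0 mulr1 addrC.
have e864 : em m (Zx 864) = 864%:R by rewrite /Zx pe1.
move=> h; have eL : em m L = 864%:R * 864%:R * c ^+ 4 * (m ^+ 5 * (m - 3%:R) * (m - 4%:R) ^+ 9).
  by rewrite /L /p2 /cube !M em1 e3 e4 e864; ring.
by apply: etrans (etrans _ h) eL; rewrite (ev_disc_list ok) /Zx !pe1.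
Qed.

Lemma disc9'_eq : 4%:R * em m A9' ^+ 3 + 27%:R * em m B9' ^+ 2 =
  864%:R * 864%:R * 32%:R * c ^+ 8 * (m ^+ 13 * (m - 1) ^+ 9 * (m - 3%:R) ^+ 2).
Proof.
have ok := mops_ok m; have [_ _ M _ _] := ok.
pose p2 x := cmul mops x x.
pose L := cmul mops (cmul mops (cmul mops (cmul mops (Zx 864) (Zx 864)) (Zx 32)) (p2 (p2 (p2 pc9))))
  (cmul mops (cmul mops (cmul mops m1 (p2 (p2 (cube mops m1)))) (cube mops (cube mops [:: (-1)%Z; 1%Z]))) (p2 [:: (-3)%Z; 1%Z])).
have : em m (disc_list mops (Zx 4) (Zx 27) A9' B9') = em m L by apply: (eq_of_cz ok); vm_compute.
have em1 : em m m1 = m by rewrite /m1 /= /evZ /= mulr0 addr0 mulr1 add0r.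
have e3 : em m [:: (-3)%Z; 1%Z] = m - 3%:R by rewrite /= /evZ /= mulr0 addr0 mulr1 addrC.
have e4 : em m [:: (-1)%Z; 1%Z] = m - 1 by rewrite /= /evZ /= mulr0 addr0 mulr1 addrC.
have e864 : em m (Zx 864) = 864%:R by rewrite /Zx pe1.
have e32 : em m (Zx 32) = 32%:R by rewrite /Zx pe1.
move=> h; have eL : em m L = 864%:R * 864%:R * 32%:R * c ^+ 8 * (m ^+ 13 * (m - 1) ^+ 9 * (m - 3%:R) ^+ 2).
  by rewrite /L /p2 /cube !M em1 e3 e4 e864 e32; ring.
by apply: etrans (etrans _ h) eL; rewrite (ev_disc_list ok) /Zx !pe1.
Qed.

Definition root9 (u : R) := u ^+ 4 = pm m u ng9.
Definition n9 i := em m (nth [::] ng9 i).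
Lemma ng9E (u : R) : pm m u ng9 = n9 0 + n9 1 * u + n9 2 * u ^+ 2 + n9 3 * u ^+ 3.
Proof. by rewrite /n9 /ng9; cbn [nth]; move: [:: 0%Z; 0%Z; 12%Z; _] [:: 0%Z; 0%Z; 6%Z; _] [:: 0%Z; 18%Z; _] [:: 10%Z; _] => a b d e; rewrite /=; ring. Qed.
Lemma nh9E (u v : R) : pe (pm m u) v nh9 = (n9 1 + n9 2 * u + n9 3 * u ^+ 2 - u ^+ 3) + (n9 2 + n9 3 * u - u ^+ 2) * v + (n9 3 - u) * v ^+ 2.
Proof.
have e1 : em m [:: (-1)%Z] = -1 by rewrite pe1.
rewrite /n9 /ng9 /nh9; cbn [nth]; move: [:: 0%Z; 0%Z; 6%Z; _] [:: 0%Z; 18%Z; _] [:: 10%Z; _] [:: (-1)%Z] e1 => a b d e e1; rewrite /= e1; ring.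
Qed.

Section Two.
Variables u v : R.
Hypotheses (gu : root9 u) (hv : v ^+ 3 = pe (pm m u) v nh9).
Let ok1 := mops_ok m.
Let uok : ops_ok uops (pm m u).
Proof. by apply: pops_ok => // p; apply: pe_redm. Qed.
Let vok : ops_ok vops (pe (pm m u) v).
Proof. by apply: pops_ok => // p; apply: pe_redm. Qed.
Let e2 z : pm m u (k2 z) = evZ R z. Proof. by rewrite /k2 /Zx !pe1. Qed.
Let e3 z : pe (pm m u) v (k3 z) = evZ R z. Proof. by rewrite /k3 pe1. Qed.

Lemma psi9 : 3%:R * pm m u q9 ^+ 4 + 6%:R * em m A9 * pm m u q9 ^+ 2 + 12%:R * em m B9 * pm m u q9 - em m A9 ^+ 2 = 0.
Proof.
have : pm m u (psx uops (k2 3) (k2 6) (k2 12) [:: A9] [:: B9] q9) = 0.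
  by have [_ _ _ _ Z] := uok; apply: Z; vm_compute.
by rewrite (ev_psx uok) !e2 !(pe1 (em m)).
Qed.
Lemma psi9' : 3%:R * pm m u q9' ^+ 4 + 6%:R * em m A9' * pm m u q9' ^+ 2 + 12%:R * em m B9' * pm m u q9' - em m A9' ^+ 2 = 0.
Proof.
have : pm m u (psx uops (k2 3) (k2 6) (k2 12) [:: A9'] [:: B9'] q9') = 0.
  by have [_ _ _ _ Z] := uok; apply: Z; vm_compute.
by rewrite (ev_psx uok) !e2 !(pe1 (em m)).
Qed.
Lemma prod9 : 16%:R * (pm m u q9 ^+ 3 + em m A9 * pm m u q9 + em m B9) * (pm m u q9' ^+ 3 + em m A9' * pm m u q9' + em m B9') = pm m u al9 ^+ 6.
Proof.
pose P1 := prodL uops (k2 16) [:: A9] [:: B9] q9 [:: A9'] [:: B9'] q9'; pose P2 := cube uops (cmul uops al9 al9).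
have e : pm m u P1 = pm m u P2 by apply: (eq_of_cz uok); vm_compute.
have eL : pm m u P1 = 16%:R * (pm m u q9 ^+ 3 + em m A9 * pm m u q9 + em m B9) * (pm m u q9' ^+ 3 + em m A9' * pm m u q9' + em m B9').
  by rewrite /P1 (ev_prodL uok) e2 !(pe1 (em m)).
exact: etrans (etrans (esym eL) e) (ev_sixth uok al9).
Qed.
(** At a root u of g the construction of [al9] gives (u + 2) al = c m u g(-2), and g(-2) = 24 (m -
    1) (m - 4); so [al9] can vanish only for u = 0. *)
Lemma al9E : pm m u al9 * (u + 2%:R) = 24%:R * c * m * (m - 1) * (m - 4%:R) * u.
Proof.
pose L := cmul mops (cmul mops (cmul mops (cmul mops (Zx 24) pc9) m1) [:: (-1)%Z; 1%Z]) [:: (-4)%Z; 1%Z].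
have : pm m u (cmul uops al9 [:: Zx 2; Zx 1]) = pm m u (cmul uops [:: L] [:: [::]; Zx 1]).
  by apply: (eq_of_cz uok); vm_compute.
have [_ _ M _ _] := uok; have [_ _ M1 _ _] := ok1; rewrite (M al9) (M [:: L]) (pe1 (em m)) /L !M1.
have -> : em m m1 = m by rewrite /m1 /= /evZ /= mulr0 addr0 mulr1 add0r.
have -> : em m [:: (-1)%Z; 1%Z] = m - 1 by rewrite /= /evZ /= mulr0 addr0 mulr1 addrC.
have -> : em m [:: (-4)%Z; 1%Z] = m - 4%:R by rewrite /= /evZ /= mulr0 addr0 mulr1 addrC.
have -> : em m (Zx 24) = 24%:R by rewrite /Zx pe1.
have -> : pm m u [:: Zx 2; Zx 1] = u + 2%:R by rewrite /Zx /= /evZ /= !mulr0 !addr0 mulr1 addrC.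
by have -> : pm m u [:: [::]; Zx 1] = u by rewrite /Zx /= /evZ /= !mulr0 !addr0 mulr1 add0r.
Qed.
Lemma nn9 : 4%:R * ((3%:R * pm m u q9 ^+ 2 + em m A9) * (pm m v q9 - pm m u q9) + 6%:R * (pm m u q9 ^+ 3 + em m A9 * pm m u q9 + em m B9)) *
  ((3%:R * pm m u q9' ^+ 2 + em m A9') * (pm m v q9' - pm m u q9') + 6%:R * (pm m u q9' ^+ 3 + em m A9' * pm m u q9' + em m B9')) =
  3%:R * pm m u al9 ^+ 3 * pm m v al9 ^+ 3.
Proof.
(* A polynomial in v alone, of degree 3, needs one reduction modulo the cubic. *)
have ei l : pe (pm m u) v (redm uops 3 nh9 (inV l)) = pm m v l.
  rewrite (pe_redm uok) // /inV; elim: l => [|d l IH] //=; by rewrite -IH mulr0 addr0.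
pose W l := redm uops 3 nh9 (inV l).
pose P1 := nnL vops (k3 4) (k3 3) (k3 6) [:: [:: A9]] [:: [:: B9]] [:: q9] (W q9) [:: [:: A9']] [:: [:: B9']] [:: q9'] (W q9').
pose P2 := nnR vops (k3 3) [:: al9] (W al9).
have e : pe (pm m u) v P1 = pe (pm m u) v P2 by apply: (eq_of_cz vok); vm_compute.
have eL := ev_nnL vok (k3 4) (k3 3) (k3 6) [:: [:: A9]] [:: [:: B9]] [:: q9] (W q9) [:: [:: A9']] [:: [:: B9']] [:: q9'] (W q9').
have eR := ev_nnR vok (k3 3) [:: al9] (W al9).
rewrite -/P1 in eL; rewrite -/P2 in eR; rewrite e eR in eL.
have eW l : pe (pm m u) v (W l) = pm m v l := ei l.
move: eL; rewrite !e3 !eW !(pe1 (pm m u)) !(pe1 (em m)) => <- //.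
Qed.
End Two.
End Ident9.

End FamilyNineIdentities.

(** * The curves of the family for n = 9 *)

Module FamilyNine.
Import CurveRing PointIdeals CocycleLaw CurveGroup Reciprocity TorsionStructure Transport ConstantCurves AlmostEverywhere Isogenies GaloisAction ThetaGalois ThreeTorsionMap ReverseNine PolynomialReflection FamilyNineIdentities.

Local Notation pm m := (pe (em m)).
(** The parameter m = -(5 k + 4) is negative, which fixes the signs of the two discriminants, and 1
    modulo 5, which excludes rational 2-torsion on the first curve. *)
Definition m9n k := (5 * k + 4)%N.
Definition m9 (R : pzRingType) k : R := - (m9n k)%:R.
Lemma m9_morph (R S : comNzRingType) (f : {rmorphism R -> S}) k : f (m9 R k) = m9 S k.
Proof. by rewrite /m9 rmorphN rmorph_nat. Qed.

Section Signs.
Variables (F : numDomainType) (k : nat).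
Local Notation m := (m9 F k).
Let x0 : 0 < (m9n k)%:R :> F. Proof. by rewrite ltr0n /m9n addnS. Qed.
Lemma m9_lt j : m - j%:R < 0.
Proof. by rewrite /m9 -opprD oppr_lt0 -natrD ltr0n /m9n addnS. Qed.
Lemma m9_neq j : m - j%:R != 0. Proof. exact: ltr0_neq0 (m9_lt j). Qed.
Lemma m9_neq0 : m != 0. Proof. by have := m9_neq 0; rewrite subr0. Qed.
Lemma c9_neq0 : em m pc9 != 0.
Proof.
have -> : em m pc9 = - (100%:R + 66%:R * (m9n k)%:R + 21%:R * (m9n k)%:R ^+ 2 + (m9n k)%:R ^+ 3).
  have e1 : evZ F (-100) = - 100%:R by []. have e2 : evZ F (-21) = - 21%:R by [].
  have e3 : evZ F 66 = 66%:R by []. have e4 : evZ F 1 = 1 by [].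
  by rewrite /pc9 /= e1 e2 e3 e4 /m9; ring.
by rewrite oppr_eq0 -!(natrX, natrM, natrD) pnatr_eq0.
Qed.
End Signs.

Lemma disc9_sign (F : realDomainType) (c m : F) : c != 0 -> m < 0 -> m - 3%:R < 0 -> m - 4%:R < 0 ->
  864%:R * 864%:R * c ^+ 4 * (m ^+ 5 * (m - 3%:R) * (m - 4%:R) ^+ 9) < 0.
Proof.
move=> c0 h0 h3 h4; have c4 : 0 < c ^+ 4 by rewrite exprn_even_gt0.
rewrite pmulr_rlt0; last by apply: mulr_gt0 => //; apply: mulr_gt0; rewrite ltr0n.
rewrite -mulrA nmulr_rlt0; last by rewrite exprn_odd_lt0.
by rewrite nmulr_rgt0 ?exprn_odd_lt0.
Qed.
Lemma disc9'_sign (F : realDomainType) (c m : F) : c != 0 -> m < 0 -> m - 1%:R < 0 -> m - 3%:R < 0 ->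
  0 < 864%:R * 864%:R * 32%:R * c ^+ 8 * (m ^+ 13 * (m - 1) ^+ 9 * (m - 3%:R) ^+ 2).
Proof.
move=> c0 h0 h1 h3; apply: mulr_gt0.
  apply: mulr_gt0; last by rewrite exprn_even_gt0.
  by apply: mulr_gt0; [apply: mulr_gt0 |]; rewrite ltr0n.
apply: mulr_gt0; last by rewrite exprn_even_gt0 // ltr0_neq0.
by rewrite nmulr_rgt0 ?exprn_odd_lt0.
Qed.

Local Opaque pc9 A9 B9 A9' B9' q9 q9' al9.

Section Quartic.
Variables (R : idomainType) (n0 n1 n2 n3 : R).
Definition quartic : {poly R} := 'X^4 - (n3%:P * 'X^3 + n2%:P * 'X^2 + n1%:P * 'X + n0%:P).
Lemma quarticE u : quartic.[u] = u ^+ 4 - (n0 + n1 * u + n2 * u ^+ 2 + n3 * u ^+ 3).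
Proof. by rewrite /quartic !hornerE; ring. Qed.
Lemma quartic_deriv u : quartic^`().[u] = 3%:R * (u ^+ 3) + (u ^+ 3 - (3%:R * n3 * u ^+ 2 + 2%:R * n2 * u + n1)).
Proof. by rewrite /quartic !derivE !hornerE /=; ring. Qed.
Lemma quartic_monic : size (quartic : seq R) = 5%N /\ quartic \is monic.
Proof.
have sl : (size (- (n3%:P * 'X^3 + n2%:P * 'X^2 + n1%:P * 'X + n0%:P) : {poly R})%R < size ('X^4 : {poly R})%R)%N.
  rewrite size_polyXn size_polyN ltnS; apply/leq_sizeP => j hj; rewrite !coefD !coefCM !coefXn coefX coefC.
  by case: j hj => [|[|[|[|j]]]] //= _; rewrite !mulr0 !addr0.
by split; [rewrite /quartic size_polyDl // size_polyXn | rewrite monicE /quartic lead_coefDl // lead_coefXn].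
Qed.
End Quartic.

Definition nhv (R : comNzRingType) (n1 n2 n3 u v : R) := (n1 + n2 * u + n3 * u ^+ 2 - u ^+ 3) + (n2 + n3 * u - u ^+ 2) * v + (n3 - u) * v ^+ 2.
Lemma nhv_deriv (R : comNzRingType) (n1 n2 n3 u : R) : 3%:R * (u ^+ 3) + (u ^+ 3 - (3%:R * n3 * u ^+ 2 + 2%:R * n2 * u + n1)) = 0 -> u ^+ 3 = nhv n1 n2 n3 u u.
Proof. by move=> e; apply/eqP; rewrite -subr_eq0; apply/eqP; rewrite -[RHS]e /nhv; ring. Qed.
Lemma nhv_roots (R : idomainType) (n0 n1 n2 n3 u v : R) : u ^+ 4 = n0 + n1 * u + n2 * u ^+ 2 + n3 * u ^+ 3 ->
  v ^+ 4 = n0 + n1 * v + n2 * v ^+ 2 + n3 * v ^+ 3 -> u != v -> v ^+ 3 = nhv n1 n2 n3 u v.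
Proof.
move=> gu gv nuv; have n : u - v != 0 by rewrite subr_eq0.
apply/eqP; rewrite -subr_eq0; apply/eqP; apply: (mulfI n); rewrite mulr0 /nhv.
transitivity ((u ^+ 4 - (n0 + n1 * u + n2 * u ^+ 2 + n3 * u ^+ 3)) - (v ^+ 4 - (n0 + n1 * v + n2 * v ^+ 2 + n3 * v ^+ 3))); first by ring.
by rewrite gu gv !subrr.
Qed.
Lemma sixth_eq0 (F : numDomainType) (f f' al : F) : 16%:R * f * f' = al ^+ 6 -> 4%:R * (6%:R * f) * (6%:R * f') = 3%:R * al ^+ 3 * al ^+ 3 -> al = 0.
Proof.
move=> e1 e2; have : 6%:R * al ^+ 6 = 0.
  transitivity (9%:R * al ^+ 6 - 3%:R * al ^+ 3 * al ^+ 3); first by ring.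
  by rewrite -e1 -e2; ring.
by move/eqP; rewrite mulf_eq0 expf_eq0 pnatr_eq0 /= => /eqP.
Qed.

Lemma uniq_roots (p : {poly algC}) : p \is monic -> (forall z, p.[z] = 0 -> p^`().[z] = 0 -> False) ->
  exists rs, [/\ uniq rs, (size rs).+1 = size p & forall u, u \in rs -> p.[u] = 0].
Proof.
move=> mp nd; have [rs ers] := closed_field_poly_normal p; rewrite (monicP mp) scale1r in ers; exists rs; split.
- rewrite -separable_prod_XsubC -ers separable_poly.unlock; exact: coprime_no_root.
- by rewrite ers size_prod_XsubC.
by move=> u hu; apply/rootP; rewrite ers root_prod_XsubC.
Qed.

Lemma e3N_diag (K : numClosedFieldType) (F : ecurve K) x : e3N F x x = 6%:R * ecub F x.
Proof. by rewrite /e3N subrr mulr0 add0r. Qed.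

Section Inst9.
Variable k : nat.
Let mr : rat := m9 rat k.
Let m : algC := m9 algC k.
Let cr0 : em mr pc9 != 0 := c9_neq0 rat k.
Lemma disc9_lt0 : 4%:R * em mr A9 ^+ 3 + 27%:R * em mr B9 ^+ 2 < 0.
Proof.
rewrite (disc9_eq mr); apply: disc9_sign cr0 _ (m9_lt rat k 3) (m9_lt rat k 4).
by have := m9_lt rat k 0; rewrite subr0.
Qed.
Lemma disc9'_gt0 : 0 < 4%:R * em mr A9' ^+ 3 + 27%:R * em mr B9' ^+ 2.
Proof.
rewrite (disc9'_eq mr); apply: disc9'_sign cr0 _ (m9_lt rat k 1) (m9_lt rat k 3).
by have := m9_lt rat k 0; rewrite subr0.
Qed.
Lemma disc9 : 4%:R * em mr A9 ^+ 3 + 27%:R * em mr B9 ^+ 2 != 0.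
Proof. exact: ltr0_neq0 disc9_lt0. Qed.
Lemma disc9' : 4%:R * em mr A9' ^+ 3 + 27%:R * em mr B9' ^+ 2 != 0.
Proof. exact: lt0r_neq0 disc9'_gt0. Qed.

Let rm l : ratr (em mr l) = em m l.
Proof. by rewrite (em_morph (ratr : {rmorphism rat -> algC})) m9_morph. Qed.
Let sm (s : {rmorphism algC -> algC}) l x : s (pm m x l) = pm m (s x) l.
Proof. by rewrite pe_morph m9_morph. Qed.

Let N i := n9 m i.
Let g9 : {poly algC} := quartic (N 0) (N 1) (N 2) (N 3).
Let g9E u : g9.[u] = u ^+ 4 - pm m u ng9.
Proof. by rewrite ng9E /g9 quarticE. Qed.
Let g9d u : g9^`().[u] = 3%:R * (u ^+ 3) + (u ^+ 3 - (3%:R * N 3 * u ^+ 2 + 2%:R * N 2 * u + N 1)).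
Proof. exact: quartic_deriv. Qed.
Let sg : size (g9 : {poly algC}) = 5%N /\ g9 \is monic.
Proof. exact: quartic_monic. Qed.

Let al0 u : root9 m u -> pm m u al9 != 0.
Proof.
move=> gu; apply/eqP => e; have := al9E gu; rewrite e mul0r => /esym/eqP.
have m10 : m - 1 != 0 := m9_neq algC k 1. have m40 : m - 4%:R != 0 := m9_neq algC k 4.
have c0 : em m pc9 != 0 := c9_neq0 algC k. have m0 : m != 0 := m9_neq0 algC k.
have n24 : (24%:R : algC) != 0 by rewrite pnatr_eq0.
rewrite !mulf_eq0 (negPf n24) (negPf c0) (negPf m0) (negPf m10) (negPf m40) /= => /eqP u0.
move: gu; rewrite /root9 ng9E u0 !expr0n /= !mulr0 !addr0 /n9; cbn [nth ng9].
have e1 : evZ algC 12 = 12%:R by []. have e2 : evZ algC (-4) = - 4%:R by []. have e3 : evZ algC 0 = 0 by [].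
rewrite /= e1 e2 e3 => /esym/eqP.
rewrite (_ : _ + _ = (- 4%:R) * (m * m * (m - 3%:R))); last by ring.
have m30 : m - 3%:R != 0 := m9_neq algC k 3.
by rewrite !mulf_eq0 oppr_eq0 pnatr_eq0 (negPf m0) (negPf m30).
Qed.

Let hE : ea (ratecurve disc9) = em m A9. Proof. exact: rm. Qed.
Let hE' : ea (ratecurve disc9') = em m A9'. Proof. exact: rm. Qed.
Let hB : eb (ratecurve disc9) = em m B9. Proof. exact: rm. Qed.
Let hB' : eb (ratecurve disc9') = em m B9'. Proof. exact: rm. Qed.

Let prod u : root9 m u -> 16%:R * ecub (ratecurve disc9) (pm m u q9) * ecub (ratecurve disc9') (pm m u q9') = pm m u al9 ^+ 6.
Proof. by move=> gu; rewrite /ecub hE hE' hB hB'; exact: prod9. Qed.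

Let nnh u v : root9 m u -> v ^+ 3 = pe (pm m u) v nh9 ->
  4%:R * e3N (ratecurve disc9) (pm m u q9) (pm m v q9) * e3N (ratecurve disc9') (pm m u q9') (pm m v q9') = 3%:R * pm m u al9 ^+ 3 * pm m v al9 ^+ 3.
Proof. by move=> gu hv; rewrite /e3N /ecub hE hE' hB hB'; exact: nn9. Qed.

(** At a double root the pair (u, u) satisfies the cubic of a second root, so the identity of [nnh]
    holds on the diagonal; with [prod] it gives 9 al^6 = 3 al^6. *)
Let nodouble u : root9 m u -> g9^`().[u] = 0 -> False.
Proof.
move=> gu; rewrite g9d => e.
have hv : u ^+ 3 = pe (pm m u) u nh9 by rewrite nh9E; exact: nhv_deriv e.
have e1 := nnh gu hv.
rewrite (e3N_diag (ratecurve disc9) (pm m u q9)) (e3N_diag (ratecurve disc9') (pm m u q9')) in e1.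
by move: (al0 gu); rewrite (sixth_eq0 (prod gu) e1) eqxx.
Qed.

Lemma reverse9_inst : reverse_congruent 9 (ratcurve disc9) (ratcurve disc9').
Proof.
have [s5 gm] := sg.
have [rs [urs srs rg0]] : exists rs, [/\ uniq rs, (size rs).+1 = size g9 & forall u, u \in rs -> g9.[u] = 0].
  apply: (uniq_roots gm) => z r1; apply: (@nodouble z).
  by rewrite /root9; apply/eqP; rewrite -subr_eq0 -g9E r1.
have sz : size rs = 4%N by apply: succn_inj; rewrite srs s5.
have rg u : u \in rs -> root9 m u by move=> /rg0 e; apply/eqP; rewrite -subr_eq0 -g9E e.
apply: (@reverse9 _ _ _ _ disc9 disc9' (fun x => pm m x q9) (fun x => pm m x q9') (fun x => pm m x al9) (root9 m) rs
  (fun s x => sm s q9 x) (fun s x => sm s q9' x) (fun s x => sm s al9 x) _ urs sz rg _ _ prod al0 _).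
- by move=> s x gx; rewrite /root9 -sm -gx rmorphXn.
- by move=> u gu; rewrite psi3E' hE hB; exact: psi9 gu.
- by move=> u gu; rewrite psi3E' hE' hB'; exact: psi9' gu.
move=> u v gu gv nuv; have hv : v ^+ 3 = pe (pm m u) v nh9.
  by move: gu gv; rewrite /root9 !ng9E nh9E => gu gv; exact: nhv_roots gu gv nuv.
exact: nnh gu hv.
Qed.
End Inst9.

End FamilyNine.

(** * Real and rational 2-torsion: non-isogeny for n = 9 *)

Module TwoTorsionMaps.
Import CurveRing PointIdeals CocycleLaw CurveGroup Reciprocity TorsionStructure Transport ConstantCurves AlmostEverywhere Isogenies GaloisAction ThetaGalois ThreeTorsionMap ReverseNine RationalPowers PolynomialReflection FamilyNineIdentities FamilyNine.

Delimit Scope int_scope with Z.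

Section TwoTorsion.
Variables (K : numClosedFieldType) (F : ecurve K).
Implicit Types P Q S : ept F.

Lemma tor2N P : P *+ 2 = 0 -> - P = P.
Proof. by move=> t; apply/eqP; rewrite eq_sym -addr_eq0 -mulr2n t. Qed.

Lemma tor2_root P : P *+ 2 = 0 -> P != 0 -> yc P = 0 /\ ecub F (xc P) = 0.
Proof.
move=> t P0; have y0 : yc P = 0.
  have e : yc P = - yc P by rewrite -ycN tor2N.
  have : yc P *+ 2 == 0 by rewrite mulr2n {2}e subrr.
  by rewrite mulrn_eq0 => /eqP.
by split=> //; rewrite -(eq_xy P0) y0 expr0n.
Qed.

Lemma tor2_xc_inj P Q : P *+ 2 = 0 -> Q *+ 2 = 0 -> P != 0 -> Q != 0 -> xc P = xc Q -> P = Q.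
Proof. by move=> _ tQ P0 Q0 /(xc_eq P0 Q0) [|->] //; exact: tor2N. Qed.

Lemma ecub_pair x y : ecub F x = 0 -> ecub F y = 0 -> x != y -> x ^+ 2 + x * y + y ^+ 2 + ea F = 0.
Proof.
move=> fx fy n; have m : x - y != 0 by rewrite subr_eq0.
by apply: (mulfI m); rewrite mulr0 -[RHS](subrr 0) -{1}fx -fy /ecub; ring.
Qed.

Lemma ecub_sum x y z : ecub F x = 0 -> ecub F y = 0 -> ecub F z = 0 -> x != y -> z != x -> z != y -> z = - x - y.
Proof.
move=> fx fy fz n n1 n2; have e1 := ecub_pair fx fy n; have e2 := ecub_pair fz fy n2.
have m : z - x != 0 by rewrite subr_eq0.
have : z + x + y = 0 by apply: (mulfI m); rewrite mulr0 -[RHS](subrr 0) -{1}e2 -e1; ring.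
by move/eqP; rewrite -addrA addr_eq0 opprD => /eqP.
Qed.

(** The third root is -x - y, so the left side is the squared product of the differences of the
    roots. *)
Lemma ecub_disc x y : ecub F x = 0 -> ecub F y = 0 -> x != y ->
  ((x - y) * (x + 2%:R * y) * (2%:R * x + y)) ^+ 2 = - (4%:R * ea F ^+ 3 + 27%:R * eb F ^+ 2).
Proof.
move=> fx fy n; have e1 := ecub_pair fx fy n.
have eA : ea F = - (x ^+ 2 + x * y + y ^+ 2) by apply/eqP; rewrite -addr_eq0 addrC e1.
have eB : eb F = x * y * (x + y).
  by transitivity (ecub F x - x ^+ 3 - ea F * x); [rewrite /ecub; ring | rewrite fx eA; ring].
by rewrite eA eB; ring.
Qed.

Lemma tor2_sum P Q S : P *+ 2 = 0 -> Q *+ 2 = 0 -> S *+ 2 = 0 -> P != 0 -> Q != 0 -> S != 0 -> P != Q -> S != P -> S != Q -> S = P + Q.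
Proof.
move=> tP tQ tS P0 Q0 S0 n1 n2 n3.
have tR : (P + Q) *+ 2 = 0 by rewrite mulrnDl tP tQ addr0.
have R0 : P + Q != 0 by rewrite addr_eq0 tor2N.
have m1 : P + Q != P by rewrite -subr_eq0 addrC addKr.
have m2 : P + Q != Q by rewrite -subr_eq0 addrK.
have ne (A B : ept F) : A *+ 2 = 0 -> B *+ 2 = 0 -> A != 0 -> B != 0 -> A != B -> xc A != xc B.
  by move=> tA tB A0 B0; apply: contra => /eqP /(tor2_xc_inj tA tB A0 B0) /eqP.
apply: tor2_xc_inj => //.
have [_ fP] := tor2_root tP P0; have [_ fQ] := tor2_root tQ Q0; have [_ fS] := tor2_root tS S0; have [_ fR] := tor2_root tR R0.
by rewrite (ecub_sum fP fQ fS) ?ne // (ecub_sum fP fQ fR) ?ne.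
Qed.
End TwoTorsion.

Lemma ex_other_tor2 (F : ecurve algC) (P : ept F) : P *+ 2 = 0 -> P != 0 -> exists T : ept F, [/\ T *+ 2 = 0, T != 0 & T != P].
Proof.
move=> tP P0; have [_ fP] := tor2_root tP P0; set x := xc P in fP.
pose w := sqrtC (- 3%:R * x ^+ 2 - 4%:R * ea F); have w2 : w ^+ 2 = - 3%:R * x ^+ 2 - 4%:R * ea F by exact: sqrtCK.
pose z := (w - x) / 2%:R; have n2 : (2%:R : algC) != 0 by rewrite pnatr_eq0.
have ez : z ^+ 2 + x * z + x ^+ 2 + ea F = 0.
  by transitivity ((w ^+ 2 - (- 3%:R * x ^+ 2 - 4%:R * ea F)) / 4%:R); [rewrite /z; field | rewrite w2 subrr mul0r].
have fz : ecub F z = 0.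
  by transitivity ((z - x) * (z ^+ 2 + x * z + x ^+ 2 + ea F) + ecub F x); [rewrite /ecub; ring | rewrite ez fP mulr0 addr0].
have zx : z != x.
  apply/eqP => e; have := ecub_simple fP; rewrite (_ : _ + _ = 0) ?eqxx //.
  by rewrite -[RHS]ez e; ring.
have [T [y [eT ey]]] := ex_pt F z; have y0 : y = 0 by apply/eqP; rewrite -sqrf_eq0 ey fz.
rewrite y0 in eT; exists T; split; first by rewrite mulr2n (two_tor eT).
  by apply/eqP => e; rewrite e in eT.
by apply: contraNneq zx => e; rewrite /x -e /xc eT.
Qed.

Section RealTwo.
Variables (a b : rat) (h : 4%:R * a ^+ 3 + 27%:R * b ^+ 2 != 0).
Local Notation E := (ratecurve h).

Lemma ecub_gal (s : {rmorphism algC -> algC}) x : s (ecub E x) = ecub E (s x).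
Proof.
have e1 : s (ea E) = ea E := fmorph_rat s a. have e2 : s (eb E) = eb E := fmorph_rat s b.
rewrite /ecub; move: (ea E) (eb E) e1 e2 => A B e1 e2.
by rewrite !(rmorphD, rmorphM, rmorphXn) e1 e2.
Qed.

Lemma disc_ratr : 4%:R * ea E ^+ 3 + 27%:R * eb E ^+ 2 = ratr (4%:R * a ^+ 3 + 27%:R * b ^+ 2).
Proof. by rewrite /= !(rmorph_nat, rmorphXn, rmorphM, rmorphD). Qed.

(** For a non-real root and its conjugate the product d of differences satisfies conj d = -d, so d
    conj d would equal the negative number 4 a^3 + 27 b^2. *)
Lemma tor2_real (P : ept E) : 4%:R * a ^+ 3 + 27%:R * b ^+ 2 < 0 -> P *+ 2 = 0 -> galp conjA P = P.
Proof.
move=> dn tP; have [->|P0] := eqVneq P 0; first exact: galp0.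
have gP0 : galp conjA P != 0 by rewrite galp_eq0.
have tg : galp conjA P *+ 2 = 0 by rewrite -galpMn tP galp0.
have [_ fP] := tor2_root tP P0; apply: tor2_xc_inj => //; rewrite xc_gal; apply/eqP/negPn/negP => ne.
have fc : ecub E (conjA (xc P)) = 0 by rewrite -ecub_gal fP rmorph0.
rewrite eq_sym in ne; have := ecub_disc fP fc ne; rewrite disc_ratr; set y := conjA (xc P); set x := xc P in y *.
have cy : conjA y = x by exact: conjCK.
set d := _ * _ * _ => ed; have cd : conjA d = - d.
  by rewrite /d !(rmorph_nat, rmorphM, rmorphB, rmorphD) cy -/y; ring.
have : 0 <= d * conjA d by exact: mul_conjC_ge0.
by rewrite cd mulrN -expr2 ed opprK ler0q leNgt dn.
Qed.

Lemma tor2_real_uniq (P Q : ept E) : 0 < 4%:R * a ^+ 3 + 27%:R * b ^+ 2 -> P *+ 2 = 0 -> Q *+ 2 = 0 -> P != 0 -> Q != 0 ->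
  galp conjA P = P -> galp conjA Q = Q -> P = Q.
Proof.
move=> dp tP tQ P0 Q0 cP cQ; have [_ fP] := tor2_root tP P0; have [_ fQ] := tor2_root tQ Q0.
apply: tor2_xc_inj => //; apply/eqP/negPn/negP => ne.
have cx : conjA (xc P) = xc P by rewrite -xc_gal cP. have cy : conjA (xc Q) = xc Q by rewrite -xc_gal cQ.
have := ecub_disc fP fQ ne; rewrite disc_ratr; move: (xc P) (xc Q) cx cy => x y cx cy.
set d := _ * _ * _ => ed; have cd : conjA d = d.
  by rewrite /d !(rmorph_nat, rmorphM, rmorphB, rmorphD) cx cy.
have : 0 <= d * conjA d by exact: mul_conjC_ge0.
by rewrite cd -expr2 ed oppr_ge0 lerq0 leNgt dp.
Qed.
End RealTwo.

(* The kernel of a nonzero Galois map on the 2-torsion has order 2, so its generator is rational. *)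
Theorem no_hom2 a b a' b' (h : 4%:R * a ^+ 3 + 27%:R * b ^+ 2 != 0) (h' : 4%:R * a' ^+ 3 + 27%:R * b' ^+ 2 != 0) :
  4%:R * a ^+ 3 + 27%:R * b ^+ 2 < 0 -> 0 < 4%:R * a' ^+ 3 + 27%:R * b' ^+ 2 -> (forall q : rat, q ^+ 3 + a * q + b != 0) ->
  @no_hom _ _ _ _ h h' 2.
Proof.
move=> dn dp nr g [gD gg] A tA; have g0 : g 0 = 0 by apply: (addrI (g 0)); rewrite -gD !addr0.
have gt P : P *+ 2 = 0 -> g P *+ 2 = 0 by move=> t; rewrite mulr2n -gD -mulr2n t.
have gc P : P *+ 2 = 0 -> galp conjA (g P) = g P by move=> t; rewrite -gg tor2_real.
apply/eqP/negPn/negP => gA; have A0 : A != 0 by apply: contraNneq gA => ->; rewrite g0.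
have [T [tT T0 nT]] := ex_other_tor2 tA A0.
(* All 2-torsion of the first curve is real, while the second has a single real point of order two,
   so g takes at most one nonzero value there. *)
have [B [tB B0 gB]] : exists B, [/\ B *+ 2 = 0, B != 0 & g B = 0].
  have [e|gT] := eqVneq (g T) 0; first by exists T.
  have e : g T = g A by apply: (tor2_real_uniq dp); auto.
  exists (T + A); split; first by rewrite mulrnDl tT tA addr0.
    by rewrite addr_eq0 tor2N.
  by rewrite gD e -mulr2n gt.
have fixB s : galp s B = B.
  apply/eqP/negPn/negP => n; have tS : galp s B *+ 2 = 0 by rewrite -galpMn tB galp0.
  have S0 : galp s B != 0 by rewrite galp_eq0.
  have gS : g (galp s B) = 0 by rewrite gg gB galp0.
  have n1 : A != B by apply: contraNneq gA => ->; rewrite gB.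
  have n2 : A != galp s B by apply: contraNneq gA => ->; rewrite gS.
  rewrite eq_sym in n; have eA := tor2_sum tB tS tA B0 S0 A0 n n1 n2.
  by case/eqP: gA; rewrite eA gD gB gS addr0.
have [q eq] : exists q : rat, xc B = ratr q by apply: galois_fixed_rat => s; rewrite -xc_gal fixB.
have [_ fB] := tor2_root tB B0; move: (nr q); rewrite -(fmorph_eq0 (ratr : {rmorphism rat -> algC})).
by rewrite !(rmorphD, rmorphM, rmorphXn) /= -eq; move: fB; rewrite /ecub /= => ->; rewrite eqxx.
Qed.

Lemma not_isogenous2 a b a' b' (h : 4%:R * a ^+ 3 + 27%:R * b ^+ 2 != 0) (h' : 4%:R * a' ^+ 3 + 27%:R * b' ^+ 2 != 0) :
  4%:R * a ^+ 3 + 27%:R * b ^+ 2 < 0 -> 0 < 4%:R * a' ^+ 3 + 27%:R * b' ^+ 2 -> (forall q : rat, q ^+ 3 + a * q + b != 0) ->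
  ~ isogenous (ratcurve h) (ratcurve h').
Proof.
move=> dn dp nr; apply: (@not_isogenous _ _ _ _ h h' 2 isT _ _ (no_hom2 dn dp nr)); first exact: halving.
have [x hx] : exists x, ecub (ratecurve h) x = 0.
  have [x hx] := @solve_monicpoly algC 3%N (fun i => [:: - eb (ratecurve h); - ea (ratecurve h)]`_i) isT.
  exists x; rewrite /ecub hx !big_ord_recl big_ord0; move: (ea _) (eb _) => A B; rewrite /= /bump /=; ring.
have [T [y [eT ey]]] := ex_pt (ratecurve h) x; have y0 : y = 0 by apply/eqP; rewrite -sqrf_eq0 ey hx.
rewrite y0 in eT; exists T; split; first by apply/eqP => e; rewrite e in eT.
by rewrite mulr2n (two_tor eT).
Qed.

(** x^3 + x + 4 has no root modulo 5; the residues of n and e are checked one by one. *)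
Lemma cubic_mod5 (n e t t' : int) : n * n * n + (1 + 5 * t) * n * e * e + (4 + 5 * t') * e * e * e = 0 ->
  (5 %| n)%Z && (5 %| e)%Z.
Proof.
have dec (z : int) : exists u i : int, z = 5 * u + i /\ (i = 0 \/ i = 1 \/ i = 2 \/ i = 3 \/ i = 4).
  exists (z %/ 5)%Z, (z %% 5)%Z; split; first by lia.
  have : 0 <= (z %% 5)%Z < 5 by lia.
  by move: (z %% 5)%Z => i; lia.
have [u [i [-> hi]]] := dec n; have [v [j [-> hj]]] := dec e.
case: hi => [->|[->|[->|[->|->]]]]; case: hj => [->|[->|[->|[->|->]]]] H; try (exfalso; lia).
by apply/andP; split; apply/dvdzP; [exists u | exists v]; rewrite addr0 mulrC.
Qed.

Lemma em_mod5 l (s : int) : exists t, em (1 + 5 * s) l = em 1 l + 5 * t.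
Proof.
elim: l => [|x l [t IH]]; first by exists 0; rewrite /=; ring.
by exists (s * em 1 l + (1 + 5 * s) * t); rewrite [em _ (_ :: _)]/= [em 1 (_ :: _)]/= IH; ring.
Qed.
Lemma em_1 l : em (1 : int) l = evZ int (foldr Z.add Z0 l).
Proof.
have [_ D _ _ _] := zops_ok int; elim: l => [|x l IH] //=.
by rewrite mul1r IH; exact: esym (D _ _).
Qed.
Lemma em_1mod5 l (r w : Z) : foldr Z.add Z0 l = Z.add r (Z.mul 5 w) -> em (1 : int) l = evZ int r + 5 * evZ int w.
Proof.
have [_ D M _ _] := zops_ok int => e; rewrite em_1 e; etransitivity; first exact: (D r (Z.mul 5 w)).
by congr (_ + _); etransitivity; first exact: (M 5 w).
Qed.
Lemma em_mod5Z l (r w : Z) (m s : int) : foldr Z.add Z0 l = Z.add r (Z.mul 5 w) -> m = 1 + 5 * s -> exists t, em m l = evZ int r + 5 * t.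
Proof.
by move=> /em_1mod5 e ->; have [t ->] := em_mod5 l s; exists (evZ int w + t); rewrite e; ring.
Qed.
Lemma int_cubic (x y n d : int) (q : rat) : (d%:~R : rat) != 0 -> q = n%:~R / d%:~R -> q ^+ 3 + x%:~R * q + y%:~R = 0 ->
  n * n * n + x * n * d * d + y * d * d * d = 0.
Proof.
move=> d1 eq e; apply: (@intr_inj rat); rewrite !(rmorphD, rmorphM) rmorph0 /=.
transitivity ((q ^+ 3 + x%:~R * q + y%:~R) * d%:~R ^+ 3); last by rewrite e mul0r.
by rewrite eq; field.
Qed.

Local Opaque pc9 A9 B9 A9' B9' q9 q9' al9.

Lemma no_root9 k (q : rat) : q ^+ 3 + em (m9 rat k) A9 * q + em (m9 rat k) B9 != 0.
Proof.
apply/eqP => e; have [mi emi] : exists mi, mi = m9 int k by exists (m9 int k).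
have ri l : em (m9 rat k) l = (em mi l)%:~R by rewrite emi (em_morph (intmul 1 : {rmorphism int -> rat})) m9_morph.
have em' : mi = 1 + 5 * - (k.+1)%:Z by rewrite emi /m9 /m9n; lia.
have hA : foldr Z.add Z0 A9 = Z.add 1 (Z.mul 5 (Z.div (foldr Z.add Z0 A9) 5)) by vm_compute.
have hB : foldr Z.add Z0 B9 = Z.add 4 (Z.mul 5 (Z.div (foldr Z.add Z0 B9) 5)) by vm_compute.
have [t1 h1] := em_mod5Z hA em'; have [t2 h2] := em_mod5Z hB em'.
have [n [d [d0 cnd eq]]] := rat_frac q.
have d1 : (d%:~R : rat) != 0 by rewrite intr_eq0.
have o1 : evZ int 1 = 1 by []. have o4 : evZ int 4 = 4 by [].
move: e; rewrite (ri A9) (ri B9) h1 h2 o1 o4 => /(int_cubic d1 eq) /cubic_mod5 /andP[].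
rewrite /dvdz => k1 k2; have : (5 %| gcdn `|n| `|d|)%N by rewrite dvdn_gcd; apply/andP; split; [exact: k1 | exact: k2].
by move: cnd; rewrite /coprime => /eqP ->.
Qed.

Theorem nonisog9_inst k : ~ isogenous (ratcurve (disc9 k)) (ratcurve (disc9' k)).
Proof.
have h1 := disc9_lt0 k; have h2 := disc9'_gt0 k; have h3 := @no_root9 k.
move: (disc9 k) (disc9' k) h1 h2 h3; cbv zeta.
move: (em (m9 rat k) A9) (em (m9 rat k) B9) (em (m9 rat k) A9') (em (m9 rat k) B9') => a b a' b' h h' h1 h2 h3.
exact: (@not_isogenous2 a b a' b' h h' h1 h2 h3).
Qed.

End TwoTorsionMaps.

(** * Infinitely many j-invariants for n = 7 *)

Module InfiniteSeven.
Import CurveRing Transport ReverseSeven FamilySevenIdentities RationalPowers FamilySeven.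

Import boolp classical_sets cardinality.

(** If the set were finite, the product of p - c q over its first components c would be a nonzero
    polynomial vanishing at every natural number. *)
Lemma infinite_ratio (A : set (rat * rat)) (f : nat -> rat * rat) (p q : {poly rat}) :
  (forall k, A (f k)) -> (forall k, q.[k%:R] != 0) -> (forall k, (f k).1 = p.[k%:R] / q.[k%:R]) ->
  (forall c, p != c *: q) -> infinite_set A.
Proof.
move=> fA q0 fE pq /finite_seqP[L AL].
pose P := \prod_(c <- L) (p - c.1 *: q).
have P0 : P != 0.
  rewrite /P prodf_seq_neq0; apply/allP => c _ /=; by rewrite subr_eq0.
have rt k : P.[k%:R] = 0.
  have fL : f k \in L by have := fA k; rewrite AL.
  rewrite /P horner_prod (big_rem (f k)) //= hornerD hornerN hornerZ fE divfK // subrr mul0r //.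
have := max_poly_roots P0 (rs := [seq k%:R | k <- iota 0 (size P)]).
rewrite size_map size_iota ltnn => h; suff : false by []; apply: h.
  by apply/allP => _ /mapP[k _ ->]; apply/eqP; exact: rt.
by rewrite map_inj_uniq ?iota_uniq // => i j /eqP; rewrite eqr_nat => /eqP.
Qed.

Lemma jinv7_gen (F : numFieldType) (t : F) : t != 0 -> p7d t != 0 -> p7D t != 0 ->
  1728%:R * 4%:R * p7a t ^+ 3 / (- (1728%:R * 108%:R) * (t ^+ 2 * p7d t ^+ 3 * p7D t ^+ 7)) = t * p7K t ^+ 3 / p7D t ^+ 7.
Proof.
rewrite /p7a; move: (p7D t) (p7d t) (p7K t) => x y z t0 y0 x0.
have n1728 : (1728%:R : F) != 0 by rewrite pnatr_eq0.
move: (1728%:R : F) n1728 => c c0; by field; rewrite t0 x0 y0 c0.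
Qed.

Lemma jinv7 k : jinv (ratcurve (disc7 k)) = (t7n k)%:R * p7K (t7n k)%:R ^+ 3 / p7D (t7n k)%:R ^+ 7.
Proof.
transitivity (1728%:R * 4%:R * p7a ((t7n k)%:R : rat) ^+ 3 / (4%:R * p7a ((t7n k)%:R : rat) ^+ 3 + 27%:R * p7b ((t7n k)%:R : rat) ^+ 2)).
  exact: jinv_ratcurve.
rewrite p7_disc; apply: jinv7_gen; last by rewrite D7nE pnatr_eq0 -lt0n D7n_gt0.
  by rewrite pnatr_eq0 -lt0n t7n_gt0.
exact: d70.
Qed.

Theorem infinite7 : infinite_set [set jj : rat * rat | exists E1 E2 : ellcurve,
    [/\ ~ isogenous E1 E2, reverse_congruent 7 E1 E2 & jj = (jinv E1, jinv E2)]]%classic.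
Proof.
pose X : {poly rat} := 4%:R * 'X + 10%:R.
have Xk k : X.[k%:R] = (t7n k)%:R by rewrite /X hornerD hornerM hornerX -!polyC_natr !hornerC /t7n natrD natrM.
have hor (x : rat) (F : forall R : comNzRingType, R -> R) : (forall (R R' : comNzRingType) (g : {rmorphism R -> R'}) t, g (F R t) = F R' (g t)) ->
   (F {poly rat} X).[x] = F rat X.[x].
  by move=> hF; rewrite -![_.[x]]/(horner_eval x _) hF.
pose FD (R : comNzRingType) (t : R) := p7D t ^+ 7.
pose FK (R : comNzRingType) (t : R) := t * p7K t ^+ 3.
have hD (R R' : comNzRingType) (g : {rmorphism R -> R'}) t : g (FD R t) = FD R' (g t) by rewrite /FD rmorphXn f7D.
have hK (R R' : comNzRingType) (g : {rmorphism R -> R'}) t : g (FK R t) = FK R' (g t) by rewrite /FK rmorphM rmorphXn f7K.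
apply: (@infinite_ratio _ (fun k => (jinv (ratcurve (disc7 k)), jinv (ratcurve (disc_twist (disc7 k) (d70 k))))) (FK _ X) (FD _ X)).
- move=> k /=; exists (ratcurve (disc7 k)), (ratcurve (disc_twist (disc7 k) (d70 k))).
  by split; [exact: nonisog7_inst | exact: reverse7_inst |].
- by move=> k; rewrite hor // Xk /FD D7nE expf_neq0 // pnatr_eq0 -lt0n D7n_gt0.
- by move=> k; rewrite !hor // Xk /FK /FD; exact: jinv7.
move=> c; apply/eqP => e.
have ev x : FK rat X.[x] = c * FD rat X.[x] by rewrite -!hor // e hornerZ.
(* At t = -1 the factor t + 1 of [p7K] vanishes and [p7D] does not, so a constant j would be 0; at t
   = 1 it is not. The arguments solve 4 x + 10 = -1 and 4 x + 10 = 1. *)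
have X1 : X.[- 11%:R / 4%:R] = -1 by rewrite /X hornerD hornerM hornerX -!polyC_natr !hornerC; field.
have X2 : X.[- 9%:R / 4%:R] = 1 by rewrite /X hornerD hornerM hornerX -!polyC_natr !hornerC; field.
have := ev (- 11%:R / 4%:R); have := ev (- 9%:R / 4%:R); rewrite X1 X2.
have -> : FK rat 1 = (- 96%:R) ^+ 3 by rewrite /FK /p7K /p7m; ring.
have -> : FK rat (-1) = 0 by rewrite /FK /p7K /p7m; ring.
have -> : FD rat (-1) = (- 7%:R) ^+ 7 by rewrite /FD /p7D; ring.
move=> e1 /esym /eqP; rewrite mulf_eq0 expf_eq0 oppr_eq0 pnatr_eq0 orbF => /eqP c0.
by move/eqP: e1; rewrite c0 mul0r expf_eq0 oppr_eq0 pnatr_eq0.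
Qed.

End InfiniteSeven.

(** * Infinitely many j-invariants for n = 9 *)

Module InfiniteNine.
Import CurveRing PointIdeals CocycleLaw CurveGroup Reciprocity TorsionStructure Transport ConstantCurves AlmostEverywhere Isogenies GaloisAction ThetaGalois ThreeTorsionMap ReverseNine FamilySevenIdentities RationalPowers PolynomialReflection FamilyNineIdentities FamilyNine TwoTorsionMaps FamilySeven InfiniteSeven.

Import boolp classical_sets cardinality.

Local Opaque pc9 A9 B9 A9' B9' q9 q9' al9.

Lemma disc_morph (R S : comNzRingType) (f : {rmorphism R -> S}) t (A B : seq Z) :
  f (4%:R * pe (@evZ R) t A ^+ 3 + 27%:R * pe (@evZ R) t B ^+ 2) = 4%:R * pe (@evZ S) (f t) A ^+ 3 + 27%:R * pe (@evZ S) (f t) B ^+ 2.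
Proof.
rewrite -!(em_morph f); move: (pe _ t A) (pe _ t B) => x y.
by rewrite !(rmorph_nat, rmorphXn, rmorphM, rmorphD).
Qed.
Lemma num_morph (R S : comNzRingType) (f : {rmorphism R -> S}) t (A : seq Z) :
  f (1728%:R * 4%:R * pe (@evZ R) t A ^+ 3) = 1728%:R * 4%:R * pe (@evZ S) (f t) A ^+ 3.
Proof.
rewrite -!(em_morph f); move: (pe _ t A) => x.
by rewrite !(rmorph_nat, rmorphXn, rmorphM).
Qed.

Lemma disc9_at0 (F : comNzRingType) : 4%:R * pe (@evZ F) 0 A9 ^+ 3 + 27%:R * pe (@evZ F) 0 B9 ^+ 2 = 0.
Proof. by rewrite (disc9_eq (0 : F)) [0 ^+ 5]expr0n /= !mul0r mulr0. Qed.

Lemma A9_at0 (F : numDomainType) : pe (@evZ F) 0 A9 != 0.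
Proof.
have ez (l : seq Z) : pe (@evZ F) 0 l = evZ F (head Z0 l) by case: l => [|x l] //=; rewrite mul0r addr0.
have [_ _ M _ _] := zops_ok F.
rewrite ez (_ : head Z0 A9 = cmul zops (Zneg 3) (cmul zops (cmul zops 100 100) 400)); last by vm_compute.
rewrite !M (_ : evZ F (Zneg 3) = - 3%:R) // (_ : evZ F 100 = 100%:R) // (_ : evZ F 400 = 400%:R) //.
by apply: mulf_neq0; [rewrite oppr_eq0 pnatr_eq0 | apply: mulf_neq0; [apply: mulf_neq0|]; rewrite pnatr_eq0].
Qed.

Lemma num9_neq0 (F : numDomainType) : 1728%:R * 4%:R * pe (@evZ F) 0 A9 ^+ 3 != 0.
Proof. by apply: mulf_neq0; [apply: mulf_neq0; rewrite pnatr_eq0 | apply: expf_neq0; exact: A9_at0]. Qed.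

Theorem infinite9 : infinite_set [set jj : rat * rat | exists E1 E2 : ellcurve,
    [/\ ~ isogenous E1 E2, reverse_congruent 9 E1 E2 & jj = (jinv E1, jinv E2)]]%classic.
Proof.
pose X : {poly rat} := - (5%:R * 'X + 4%:R).
have Xk k : X.[k%:R] = m9 rat k.
  by rewrite /X /m9 /m9n hornerN hornerD hornerM hornerX -!polyC_natr !hornerC natrD natrM.
pose Dx (R : comNzRingType) (t : R) := 4%:R * pe (@evZ R) t A9 ^+ 3 + 27%:R * pe (@evZ R) t B9 ^+ 2.
pose Nx (R : comNzRingType) (t : R) := 1728%:R * 4%:R * pe (@evZ R) t A9 ^+ 3.
have hD (x : rat) : (Dx _ X).[x] = Dx _ X.[x] by exact: (disc_morph (horner_eval x : {rmorphism {poly rat} -> rat}) X A9 B9).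
have hN (x : rat) : (Nx _ X).[x] = Nx _ X.[x] by exact: (num_morph (horner_eval x : {rmorphism {poly rat} -> rat}) X A9).
apply: (@infinite_ratio _ (fun k => (jinv (ratcurve (disc9 k)), jinv (ratcurve (disc9' k)))) (Nx _ X) (Dx _ X)).
- move=> k; exists (ratcurve (disc9 k)), (ratcurve (disc9' k)).
  by split; [exact: nonisog9_inst | exact: reverse9_inst | exact: erefl].
- by move=> k; rewrite hD Xk /Dx; exact: (disc9 k).
- by move=> k; rewrite hD hN Xk /Nx /Dx; exact: (jinv_ratcurve (disc9 k)).
(* At m = 0 the denominator vanishes and the numerator does not. *)
move=> c; apply/eqP => e.
have X0 : X.[- 4%:R / 5%:R] = 0 by rewrite /X hornerN hornerD hornerM hornerX -!polyC_natr !hornerC; field.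
have e2 : Nx rat 0 = c * Dx rat 0.
  by have := congr1 (fun p : {poly rat} => p.[- 4%:R / 5%:R]) e; rewrite hornerZ hD hN X0.
have d0 : Dx rat 0 = 0 by exact: disc9_at0.
have n0 : Nx rat 0 != 0 by exact: num9_neq0.
by move: e2 n0 d0; move: (Nx rat 0) (Dx rat 0) => x y -> + y0; rewrite y0 mulr0 eqxx.
Qed.

End InfiniteNine.

From mathcomp Require Import classical_sets cardinality.

Theorem mainTheorem4 (n : nat) (hn : n = 7%N \/ n = 9%N) :
  infinite_set [set jj : rat * rat | exists E1 E2 : ellcurve,
    [/\ ~ isogenous E1 E2, reverse_congruent n E1 E2
      & jj = (jinv E1, jinv E2)]]%classic.
Proof. by case: hn => ->; [exact: InfiniteSeven.infinite7 | exact: InfiniteNine.infinite9]. Qed.
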